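(* The asymptotic values invariant is complete and effective: (1) Consider two Riemann surfaces with a meromorphic connection, each with a pole of the same order $d\ge2$ and the same residue $\mathrm{res}\in\mathbb{C}$, together with a choice of reference repelling axis at each pole. They have the same asymptotic values invariant in $\mathcal{I}_{d,\mathrm{res}}$ if and only if they are isomorphic near the punctures by an isomorphism matching the reference repelling axes. (2) For any $d\ge2$, any residue $\mathrm{res}\in\mathbb{C}$ and any element $\iota\in\mathcal{I}_{d,\mathrm{res}}$, there exists a meromorphic connection on a punctured disk having at the puncture a pole of order $d$, residue $\mathrm{res}$ and asymptotic values invariant $\iota$ (for some choice of reference repelling axis).
   Context: A meromorphic connection $\nabla$ on a Riemann surface is given in each holomorphic chart $R$ (Riemann chart) by a meromorphic function $\Gamma_R$ (Christoffel symbol) with $\Gamma_1=\psi'\cdot(\Gamma_2\circ\psi)+\psi''/\psi'$ for $\psi=R_2\circ R_1^{-1}$. Orders and residues of poles are chart independent; the residue $\mathrm{res}$ of $\nabla$ at a pole is the residue of $-\Gamma$. Outside the poles, the affine charts are the holomorphic charts in which $\Gamma=0$. Two poles are isomorphic near the punctures if there is a biholomorphism between neighborhoods of the poles, sending pole to pole and one connection to the other. Let $p$ be a pole of order $d\ge2$ and residue $\mathrm{res}$; in a Riemann chart sending $p$ to $0$ write $\Gamma(z)=a_{-d}z^{-d}+\cdots$. The repelling axes are the $d-1$ half-lines $[0,+\infty)e^{i\theta}$ with $-a_{-d}e^{-i(d-1)\theta}\in\mathbb{R}_{<0}$ (the paper also calls them divergent axes); they are well defined as half-lines in the tangent space at $p$,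 and an isomorphism matches chosen axes if its differential at the pole sends one to the other. Let $\tilde B$ be a universal covering of $B(0,\epsilon)\setminus\{0\}$ ($\epsilon$ small); the argument has a lift $\tilde B\to\mathbb{R}$. A developing map is a holomorphic map $\tilde\phi:\tilde B\to\mathbb{C}$ with nowhere vanishing derivative satisfying $\tilde\phi''/\tilde\phi'=\Gamma$ (derivatives with respect to the coordinate $z$). Fix a lifted argument $\theta_0\in\mathbb{R}$ of a chosen repelling axis (the reference axis) and set $\theta_n=\theta_0+\frac{2\pi n}{d-1}$, $n\in\mathbb{Z}$. For each $n$, $\tilde\phi$ converges to a complex number $u_n$, depending only on $n$, along every path in $\tilde B$ tending to $0$ with lifted argument tending to $\theta_n$. The family $(u_n)_{n\in\mathbb{Z}}$ is called the asymptotic value family of $\tilde\phi$. $\mathcal{U}_{d,\mathrm{res}}$ is the set of families $u\in\mathbb{C}^{\mathbb{Z}}$ for which there is $b\in\mathbb{C}$ with $u_{k+(d-1)}=e^{-2\pi i\,\mathrm{res}}u_k+b$ for all $k\in\mathbb{Z}$; $\mathcal{I}_{d,\mathrm{res}}$ is its quotient by the relation $u\sim u'$ iff there is an affine bijection $g:z\mapsto\alpha z+\beta$ ($\alpha\neq0$) of $\mathbb{C}$ with $g(u_k)=u'_k$ for all $k$. The asymptotic value family belongs to $\mathcal{U}_{d,\mathrm{res}}$, and its class in $\mathcal{I}_{d,\mathrm{res}}$ depends only on the pole and on the reference axis; this class is the asymptotic values invariant. *)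

(* Defs.v *)
From HB Require Import structures.
From mathcomp Require Import all_boot all_order all_algebra complex.
From mathcomp Require Import all_classical all_reals all_analysis.

Set Implicit Arguments.
Unset Strict Implicit.
Unset Printing Implicit Defensive.

Import Order.TTheory GRing.Theory Num.Theory.
Import numFieldNormedType.Exports.

Local Open Scope classical_set_scope.
Local Open Scope ring_scope.
Local Open Scope complex_scope.

(* [R[i]^o] carries the topology of the complex plane, and [derivable f z 1]
   and [derive1 f] for [f : Cplx R -> Cplx R] are complex differentiability and
   the complex derivative. *)
Notation Cplx R := (R[i]^o).

Section ComplexPlane.
Context {R : realType}.
Local Notation C := (Cplx R).

Definition cexp (z : C) : C :=
  (expR (complex.Re z) * cos (complex.Im z))
    +i* (expR (complex.Re z) * sin (complex.Im z)).

Definition cdisk (r : R) : set C := [set z | `|z| < r%:C].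

Definition half_line (theta : R) : set C :=
  [set t%:C * cexp (0 +i* theta) | t in [set t : R | 0 <= t]].

Definition holomorphic_on (A : set C) (f : C -> C) : Prop :=
  forall z, A z -> derivable f z 1.

Definition holomorphic_at (f : C -> C) (z : C) : Prop :=
  \forall w \near z, derivable f w 1.

(* [a k] is the coefficient of [(w - z) ^- k]. *)
Definition laurent_at (f : C -> C) (z : C) (d : nat) (a : nat -> C) : Prop :=
  exists2 h : C -> C, holomorphic_at h z &
    \forall w \near z^', f w = h w + \sum_(1 <= k < d.+1) a k / (w - z) ^+ k.

Definition pole_order (f : C -> C) (z : C) (d : nat) : Prop :=
  (0 < d)%N /\ exists2 a, laurent_at f z d a & a d != 0.

Definition residue_at (f : C -> C) (z : C) (r : C) : Prop :=
  exists d a, [/\ (0 < d)%N, laurent_at f z d a & a 1%N = r].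

(* Meromorphic functions are represented by total functions whose values at
   the poles are irrelevant. *)
Definition meromorphic_on (A : set C) (f : C -> C) : Prop :=
  forall z, A z -> holomorphic_at f z \/ exists d, pole_order f z d.

(* Equality of meromorphic functions on [A]: equality away from the poles. *)
Definition christoffel_law (A : set C) (psi G1 G2 : C -> C) : Prop :=
  forall z, A z -> holomorphic_at G1 z -> holomorphic_at G2 (psi z) ->
    G1 z = derive1 psi z * G2 (psi z) + derive1 (derive1 psi) z / derive1 psi z.

End ComplexPlane.

(* [chart_inv] is only meaningful on the image [chart_fun @` chart_dom]. *)
Record chart (R : realType) (T : topologicalType) := Chart {
  chart_dom : set T;
  chart_fun :> T -> Cplx R;
  chart_inv : Cplx R -> T;
  chart_dom_open : open chart_dom;
  chart_cod_open : open (chart_fun @` chart_dom);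
  chart_funK : forall x, chart_dom x -> chart_inv (chart_fun x) = x;
  chart_fun_cts : forall x, chart_dom x -> {for x, continuous chart_fun};
  chart_inv_cts :
    forall z, (chart_fun @` chart_dom) z -> {for z, continuous chart_inv} }.

Section Transition.
Context {R : realType} {T : topologicalType}.
Implicit Types c : chart R T.

Definition chart_cod c : set (Cplx R) := c @` chart_dom c.

Definition transition c1 c2 : Cplx R -> Cplx R := c2 \o chart_inv c1.

Definition transition_dom c1 c2 : set (Cplx R) :=
  c1 @` (chart_dom c1 `&` chart_dom c2).

Definition compatible c1 c2 : Prop :=
  holomorphic_on (transition_dom c1 c2) (transition c1 c2) /\
  holomorphic_on (transition_dom c2 c1) (transition c2 c1).

End Transition.

Record riemann_surface (R : realType) := RiemannSurface {
  surface_space :> topologicalType;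
  surface_hausdorff : hausdorff_space surface_space;
  surface_connected : connected [set: surface_space];
  surface_atlas : set (chart R surface_space);
  surface_cover : forall x, exists2 c, surface_atlas c & chart_dom c x;
  surface_compatible : forall c1 c2,
    surface_atlas c1 -> surface_atlas c2 -> compatible c1 c2 }.

(* The charts of the maximal atlas. *)
Definition holomorphic_chart (R : realType) (S : riemann_surface R)
    (c : chart R S) : Prop :=
  forall c', @surface_atlas R S c' -> compatible c c'.

Definition holomorphic_chart_at (R : realType) (S : riemann_surface R)
    (p : S) (c : chart R S) : Prop :=
  holomorphic_chart c /\ chart_dom c p.

Record meromorphic_connection (R : realType) (S : riemann_surface R) :=
  MeromorphicConnection {
  christoffel :> chart R S -> Cplx R -> Cplx R;
  christoffel_meromorphic : forall c,
    holomorphic_chart c -> meromorphic_on (chart_cod c) (christoffel c);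
  christoffel_transition : forall c1 c2,
    holomorphic_chart c1 -> holomorphic_chart c2 ->
    christoffel_law (transition_dom c1 c2) (transition c1 c2)
      (christoffel c1) (christoffel c2) }.

(* A half-line in the tangent space at [p], given by its coordinates in every
   holomorphic chart around [p]; the coordinates change by the differential of
   the transition map. *)
Record tangent_half_line (R : realType) (S : riemann_surface R) (p : S) :=
  TangentHalfLine {
  half_line_coord :> chart R S -> set (Cplx R);
  half_line_coordE : forall c,
    holomorphic_chart_at p c -> exists theta, half_line_coord c = half_line theta;
  half_line_transition : forall c1 c2,
    holomorphic_chart_at p c1 -> holomorphic_chart_at p c2 ->
    half_line_coord c2 =
      [set derive1 (transition c1 c2) (c1 p) * v | v in half_line_coord c1] }.

Section Poles.
Context {R : realType} {S : riemann_surface R}.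
Local Notation C := (Cplx R).
Implicit Types (nabla : meromorphic_connection S) (p : S).

Definition regular_point nabla p : Prop :=
  forall c, holomorphic_chart_at p c -> holomorphic_at (nabla c) (c p).

Definition is_pole nabla p (d : nat) : Prop :=
  forall c, holomorphic_chart_at p c -> pole_order (nabla c) (c p) d.

Definition has_residue nabla p (res : C) : Prop :=
  forall c, holomorphic_chart_at p c ->
    residue_at (fun z => - nabla c z) (c p) res.

(* In [R[i]], [x < 0] says that [x] is a negative real number. *)
Definition repelling_axis nabla p (d : nat) (L : tangent_half_line p) : Prop :=
  forall c, holomorphic_chart_at p c ->
    exists theta a, [/\ L c = half_line theta, laurent_at (nabla c) (c p) d a &
      - a d * cexp (0 +i* (- (d.-1%:R * theta))) < 0].

End Poles.

Section AsymptoticValues.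
Context {R : realType}.
Local Notation C := (Cplx R).

(* The universal covering of [cdisk eps] minus its center is modelled by a left
   half-plane with covering map [cexp]; the lifted argument is [complex.Im]. *)
Definition covering_space (eps : R) : set C := [set w | cdisk eps (cexp w)].

(* Derivative with respect to the coordinate [z = cexp w]. *)
Definition derive_z (f : C -> C) (w : C) : C := derive1 f w / cexp w.

Definition developing_map (Gamma : C -> C) (eps : R) (phi : C -> C) : Prop :=
  forall w, covering_space eps w ->
    [/\ derivable phi w 1, derive_z phi w != 0 &
        derive_z (derive_z phi) w / derive_z phi w = Gamma (cexp w)].

Definition asymptotic_value (eps : R) (phi : C -> C) (theta : R) (u : C) :
    Prop :=
  forall gamma : R -> C,
    {within `[0, +oo[, continuous gamma} ->
    (forall t, 0 <= t -> covering_space eps (gamma t)) ->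
    cexp (gamma t) @[t --> +oo] --> (0 : C) ->
    complex.Im (gamma t) @[t --> +oo] --> theta ->
    phi (gamma t) @[t --> +oo] --> u.

Definition asymptotic_family (d : nat) (eps : R) (phi : C -> C) (theta0 : R)
    (u : int -> C) : Prop :=
  forall n : int,
    asymptotic_value eps phi (theta0 + 2 * pi * n%:~R / d.-1%:R) (u n).

Definition family_space (d : nat) (res : C) : set (int -> C) :=
  [set u | exists b : C, forall k : int,
     u (k + d.-1%:Z) = cexp (- (0 +i* (2 * pi)) * res) * u k + b].

Definition affine_equiv (u u' : int -> C) : Prop :=
  exists alpha beta : C, alpha != 0 /\ forall k, alpha * u k + beta = u' k.

Definition family_class (d : nat) (res : C) (u : int -> C) : set (int -> C) :=
  [set u' | family_space d res u' /\ affine_equiv u u'].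

(* The quotient of [family_space d res] by [affine_equiv], as a set of
   equivalence classes. *)
Definition invariant_space (d : nat) (res : C) : set (set (int -> C)) :=
  family_class d res @` family_space d res.

(* The class does not depend on the chart, the radius, the developing map and the
   lift [theta0] of the axis, so it is read off from any choice of them. *)
Definition asymptotic_invariant (S : riemann_surface R)
    (nabla : meromorphic_connection S) (p : S) (d : nat) (res : C)
    (L : tangent_half_line p) (iota : set (int -> C)) : Prop :=
  exists (c : chart R S) (eps : R) (phi : C -> C) (theta0 : R) (u : int -> C),
    [/\ holomorphic_chart_at p c, c p = 0,
        0 < eps, cdisk eps `<=` chart_cod c &
        forall z, cdisk eps z -> z != 0 -> holomorphic_at (nabla c) z] /\
    [/\ developing_map (nabla c) eps phi, L c = half_line theta0,
        asymptotic_family d eps phi theta0 u & iota = family_class d res u].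

End AsymptoticValues.

Section Isomorphisms.
Context {R : realType} {S1 S2 : riemann_surface R}.

Definition map_in_charts (f : S1 -> S2) (c1 : chart R S1) (c2 : chart R S2) :
    Cplx R -> Cplx R :=
  c2 \o f \o chart_inv c1.

Definition map_in_charts_dom (U : set S1) (f : S1 -> S2)
    (c1 : chart R S1) (c2 : chart R S2) : set (Cplx R) :=
  c1 @` (chart_dom c1 `&` U `&` f @^-1` chart_dom c2).

Definition holomorphic_map (U : set S1) (f : S1 -> S2) : Prop :=
  (forall x, U x -> {for x, continuous f}) /\
  forall c1 c2, holomorphic_chart c1 -> holomorphic_chart c2 ->
    holomorphic_on (map_in_charts_dom U f c1 c2) (map_in_charts f c1 c2).

Definition sends_connection (U : set S1) (f : S1 -> S2)
    (nabla1 : meromorphic_connection S1) (nabla2 : meromorphic_connection S2) :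
    Prop :=
  forall c1 c2, holomorphic_chart c1 -> holomorphic_chart c2 ->
    christoffel_law (map_in_charts_dom U f c1 c2) (map_in_charts f c1 c2)
      (nabla1 c1) (nabla2 c2).

Definition matches_half_lines (f : S1 -> S2) (p1 : S1) (p2 : S2)
    (L1 : tangent_half_line p1) (L2 : tangent_half_line p2) : Prop :=
  forall c1 c2, holomorphic_chart_at p1 c1 -> holomorphic_chart_at p2 c2 ->
    L2 c2 = [set derive1 (map_in_charts f c1 c2) (c1 p1) * v | v in L1 c1].

End Isomorphisms.

Definition biholomorphism (R : realType) (S1 S2 : riemann_surface R)
    (U1 : set S1) (U2 : set S2) (f : S1 -> S2) (g : S2 -> S1) : Prop :=
  [/\ forall x, U1 x -> U2 (f x) /\ g (f x) = x,
      forall y, U2 y -> U1 (g y) /\ f (g y) = y,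
      holomorphic_map U1 f & holomorphic_map U2 g].

Definition isomorphic_near_punctures (R : realType) (S1 S2 : riemann_surface R)
    (nabla1 : meromorphic_connection S1) (nabla2 : meromorphic_connection S2)
    (p1 : S1) (p2 : S2)
    (L1 : tangent_half_line p1) (L2 : tangent_half_line p2) : Prop :=
  exists (U1 : set S1) (U2 : set S2) (f : S1 -> S2) (g : S2 -> S1),
    [/\ open U1 /\ U1 p1, open U2 /\ U2 p2 & biholomorphism U1 U2 f g] /\
    [/\ f p1 = p2, sends_connection U1 f nabla1 nabla2 &
        matches_half_lines f L1 L2].

Section Disk.
Context {R : realType}.
Context (r : R) (r0 : 0 < r).
Local Notation C := (Cplx R).
Local Notation D := (set_type (cdisk r : set C)).

Lemma cdisk0 : (0 : C) \in cdisk r.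
Proof. by rewrite inE /cdisk/= normr0 (_ : 0 = 0%:C)// ltcR. Qed.

Definition disk_center : D := SigSub cdisk0.

Definition disk_inv (z : C) : D := insubd disk_center z.

Lemma cdisk_open : open (cdisk r : set C).
Proof.
rewrite (_ : cdisk r = ball (0 : C) r%:C); first exact: ball_open.
by rewrite predeqE => z; rewrite /cdisk -ball_normE /= sub0r normrN.
Qed.

Lemma disk_cod : (set_val : D -> C) @` setT = cdisk r.
Proof.
rewrite predeqE => z; split => [[x _ <-]|zD]; first exact: set_valP.
by exists (SigSub (mem_set zD)).
Qed.

Lemma disk_invK (x : D) : disk_inv (set_val x) = x.
Proof. exact: valKd. Qed.

Lemma disk_inv_cts (z : C) :
  ((set_val : D -> C) @` setT) z -> {for z, continuous disk_inv}.
Proof.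
rewrite disk_cod => zD U [_ [[W oW <-] Wz WU]] /=.
have vE w : cdisk r w -> set_val (disk_inv w) = w.
  by move=> wD; rewrite set_valE insubdK// inE.
have : nbhs z (W `&` cdisk r).
  apply: open_nbhs_nbhs; split; first exact: openI oW cdisk_open.
  by split=> //; rewrite -(vE _ zD).
by apply: filterS => w [Ww wD]; apply: WU; rewrite /= vE.
Qed.

Lemma disk_cod_open : open ((set_val : D -> C) @` setT).
Proof. rewrite disk_cod; exact: cdisk_open. Qed.

Definition disk_chart : chart R D :=
  @Chart R D setT set_val disk_inv openT disk_cod_open
    (fun x _ => disk_invK x) (fun x _ => @initial_continuous _ _ set_val x)
    disk_inv_cts.

Lemma disk_compatible : compatible disk_chart disk_chart.
Proof.
suff H : holomorphic_on (transition_dom disk_chart disk_chart)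
           (transition disk_chart disk_chart) by [].
move=> z; rewrite /transition_dom setIid.
  have -> : disk_chart @` setT = cdisk r := disk_cod.
  move=> zD.
suff : derivable (id : C -> C) z 1.
  apply: near_eq_derivable.
  have : nbhs z (cdisk r) by apply: open_nbhs_nbhs; split=> //; exact: cdisk_open.
  by apply: filterS => w wD; rewrite /transition/= set_valE insubdK// inE.
exact: derivable_id.
Qed.

Lemma disk_hausdorff : hausdorff_space D.
Proof.
move=> x y xy; apply: val_inj; apply: (@norm_hausdorff _ C) => A B xA yB.
have cD : continuous (set_val : D -> C) by exact: initial_continuous.
have [z [Az Bz]] := xy _ _ (cD x _ xA) (cD y _ yB).
by exists (set_val z).
Qed.

Lemma real_complex_continuous : continuous (fun t : R => t%:C : C).
Proof.
move=> t; apply/cvgrPdist_lt => -[e e']; rewrite ltcE/= => /andP[/eqP -> e0].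
have := @cvg_id _ (nbhs t); move=> /cvgrPdist_lt/(_ _ e0).
by apply: filterS => s /=; rewrite -rmorphB/= normc_def/= expr0n addr0 sqrtr_sqr ltcR.
Qed.

Lemma disk_connected : connected [set: D].
Proof.
pose seg (x : D) (t : R) : D := disk_inv (t%:C * set_val x : C).
have segD (x : D) t : 0 <= t <= 1 -> cdisk r (t%:C * set_val x : C).
  move=> /andP[t0 t1]; rewrite /cdisk/= normrM.
  have := set_valP x; rewrite /cdisk/=; apply: le_lt_trans.
  by rewrite ger0_norm ?lecR// ler_piMl// lecR.
rewrite (_ : setT = \bigcup_(x in setT) (seg x @` `[0, 1])).
  apply: bigcup_connected.
    exists disk_center => x _; exists 0; first by rewrite /= in_itv/= lexx ler01.
    by rewrite /seg mul0r -[RHS]disk_invK.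
  move=> x _; apply: connected_continuous_connected.
    exact: segment_connected.
  apply: continuous_in_subspaceT => t; rewrite inE/= in_itv/= => t01.
  apply: (@continuous_comp _ _ _ (fun t : R => t%:C * set_val x : C)).
    by apply: cvgMl; exact: real_complex_continuous.
  by apply: disk_inv_cts; rewrite disk_cod; exact: segD.
rewrite predeqE => x; split=> // _; exists x => //; exists 1.
  by rewrite /= in_itv/= ler01 lexx.
by rewrite /seg mul1r disk_invK.
Qed.

Definition disk_surface : riemann_surface R :=
  @RiemannSurface R D disk_hausdorff disk_connected [set disk_chart]
    (fun x => ex_intro2 _ _ disk_chart erefl I)
    (fun c1 c2 e1 e2 => ecast c (compatible c _) (esym e1)
       (ecast c (compatible _ c) (esym e2) disk_compatible)).

End Disk.

(* Main.v *)
(* Write [m = d - 1] and pull everything back by [z = cexp w]. In a suitable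
   coordinate the connection is [m / z ^ m.+1 - res / z + E' / E] with [E]
   holomorphic and [E 0 = 1], so that, up to an affine map, a developing map
   satisfies [phi' = exp ((1 - res) w - e ^ (- m w)) E (e ^ w)].
   In the sector of the n-th repelling axis this derivative decays
   superexponentially, hence [phi] tends to [u n] with an explicit rate.

   Two developing maps with the same values differ, on both sides of each
   attracting direction, by an amount negligible with respect to the
   derivative; the equation [phi2 (w + eta w) = phi1 w] is then solved by
   contraction with [eta] small and 2 i pi - periodic, so that it
   descends to a bounded holomorphic function of [z], and the singularity at
   the pole is removable. Conversely an isomorphism transports charts,
   developing maps and axes.

   For the realization, the families form a space spanned modulo constants by
   the values of the [m] maps with derivative [z ^ k exp (...)]. Rotation by
   [2 pi / m] acts on each of them by a scalar, the scalars are distinct, and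
   each map has non-constant values: otherwise a formal power series with
   factorially growing coefficients would converge. A Vandermonde system then
   provides [E]. *)

Require Import Defs.
From HB Require Import structures.
From mathcomp Require Import all_boot all_order all_algebra complex ring lra zify.
From mathcomp Require Import all_classical all_reals all_analysis.

Set Implicit Arguments.
Unset Strict Implicit.
Unset Printing Implicit Defensive.

Import Order.TTheory GRing.Theory Num.Theory.
Import numFieldNormedType.Exports.
Import Normc.

Local Open Scope classical_set_scope.
Local Open Scope ring_scope.
Local Open Scope complex_scope.

(** * Complex derivatives *)

(** The difficulty lies at the attracting directions, where a developing map is unbounded and its
    asymptotic values say nothing directly. The bound [Em] is therefore measured against the
    derivative itself and proved up to the very edge of each sector, so that the closed sectors
    cover a whole half-plane Re w <= s. If two developing maps have the same values and their
    derivatives agree to leading order at the pole, they differ by at most A e^((1 + m) Re w) times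
    the derivative, everywhere, whereas the derivative is nearly constant on disks of radius c e^(m
    Re w). The spare factor e^(Re w) makes the contraction work, but it needs equal leading
    constants; [rescale_lift] arranges this by shifting z^-m by a constant, without moving the
    values. In the realization, one further map with exponent 0 and coefficient 1 provides E 0 = 1,
    and the m correcting exponents start at a large [k0], so that the recurrence for the power
    series never meets a vanishing factor. Families are compared through differences of consecutive
    values, from which integration constants disappear. *)

Section Modulus.
Context {R : realType}.
Local Notation C := (Cplx R).
Implicit Types (z w v : C) (e : R).

Lemma normcE' z : `|z| = (normc z)%:C.
Proof. by case: z => a b; rewrite normc_def. Qed.

Lemma normc_ge0 z : 0 <= normc z.
Proof. by case: z => a b /=; exact: sqrtr_ge0. Qed.

Lemma normc_eq0 z : (normc z == 0) = (z == 0).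
Proof. by apply/eqP/eqP => [/eq0_normc//|->]; exact: normc0. Qed.

Lemma normc_gt0 z : (0 < normc z) = (z != 0).
Proof. by rewrite lt0r normc_ge0 normc_eq0 andbT. Qed.

Lemma normc_real (x : R) : normc (x%:C) = `|x|.
Proof. by rewrite /= expr0n/= addr0 sqrtr_sqr. Qed.

Lemma normcB z w : normc (z - w) = normc (w - z).
Proof. by rewrite -normcN opprB. Qed.

Lemma le_normcB z w : normc (z - w) <= normc z + normc w.
Proof. by rewrite -(normcN w); exact: le_normcD. Qed.

Lemma le_normc_dist z w v : normc (z - v) <= normc (z - w) + normc (w - v).
Proof. by apply: le_trans (le_normcD _ _); rewrite addrA subrK. Qed.

Lemma ge_normcB z w : normc z - normc w <= normc (z - w).
Proof. by rewrite lerBlDr; apply: le_trans (le_normcD _ _); rewrite subrK. Qed.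

Lemma normcX z n : normc (z ^+ n) = normc z ^+ n.
Proof.
elim: n => [|n IH]; first by rewrite !expr0 normc1.
by rewrite !exprS normcM IH.
Qed.

Lemma normc_div z w : normc (z / w) = normc z / normc w.
Proof. by rewrite normcM normcV. Qed.

Lemma Re_le_normc z : `|complex.Re z| <= normc z.
Proof. by have := normc_ge_Re z; rewrite normcE' lecR. Qed.

Lemma Im_le_normc z : `|complex.Im z| <= normc z.
Proof.
case: z => a b /=; rewrite -sqrtr_sqr ler_wsqrtr// lerDr; exact: sqr_ge0.
Qed.

Lemma normc_le_ReIm z : normc z <= `|complex.Re z| + `|complex.Im z|.
Proof.
case: z => a b; rewrite [X in normc X](_ : _ = a%:C + (0 +i* 1) * b%:C); last first.
  by simpc.
apply: le_trans (le_normcD _ _) _; rewrite normcM !normc_real.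
by rewrite /= expr0n add0r expr1n sqrtr1 mul1r.
Qed.

Lemma complex_ext z w :
  complex.Re z = complex.Re w -> complex.Im z = complex.Im w -> z = w.
Proof. by case: z w => [a b] [c d] /= -> ->. Qed.

Lemma cReD z w : complex.Re (z + w) = complex.Re z + complex.Re w.
Proof. by case: z w => [a b] [c d]. Qed.
Lemma cImD z w : complex.Im (z + w) = complex.Im z + complex.Im w.
Proof. by case: z w => [a b] [c d]. Qed.
Lemma cReN z : complex.Re (- z) = - complex.Re z. Proof. by case: z. Qed.
Lemma cImN z : complex.Im (- z) = - complex.Im z. Proof. by case: z. Qed.
Lemma cReM z w :
  complex.Re (z * w) = complex.Re z * complex.Re w - complex.Im z * complex.Im w.
Proof. by case: z w => [a b] [c d]. Qed.
Lemma cImM z w :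
  complex.Im (z * w) = complex.Re z * complex.Im w + complex.Im z * complex.Re w.
Proof. by case: z w => [a b] [c d]. Qed.

Lemma realCD (x y : R) : (x + y)%:C = x%:C + y%:C :> C. Proof. exact: rmorphD. Qed.
Lemma realCB (x y : R) : (x - y)%:C = x%:C - y%:C :> C. Proof. exact: rmorphB. Qed.
Lemma realCN (x : R) : (- x)%:C = - x%:C :> C. Proof. exact: rmorphN. Qed.
Lemma realCM (x y : R) : (x * y)%:C = x%:C * y%:C :> C. Proof. exact: rmorphM. Qed.
Lemma realCV (x : R) : (x^-1)%:C = (x%:C)^-1 :> C. Proof. exact: fmorphV. Qed.
Lemma realC_nat n : (n%:R : R)%:C = n%:R :> C. Proof. exact: rmorph_nat. Qed.
Lemma realC1 : (1 : R)%:C = 1 :> C. Proof. by []. Qed.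
Lemma realC0 : (0 : R)%:C = 0 :> C. Proof. by []. Qed.
Definition realCE := (realCD, realCN, realCM, realCV, realC_nat, realC1, realC0).

(** Rotating an increment onto the positive real axis reduces estimates of moduli to estimates of
    real parts. *)
Lemma unimodular z : exists2 c : C, normc c = 1 & c * z = (normc z)%:C.
Proof.
have [->|z0] := eqVneq z 0.
  by exists 1; rewrite ?normc1// mulr0 normc0.
have n0 : normc z != 0 by rewrite normc_eq0.
have nC : ((normc z)%:C : C) != 0.
  by apply/eqP => /complexI /eqP; rewrite (negbTE n0).
exists ((normc z)%:C / z); last by rewrite mulfVK.
by rewrite normc_div normc_real ger0_norm ?normc_ge0// divff.
Qed.

(** Balls of the complex plane have radii in [R[i]]; here and in [cvgCP] the radii are real, the
    form used in the later estimates. *)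
Lemma nbhsCP z (A : set C) :
  nbhs z A <-> exists2 e, 0 < e & forall w, normc (w - z) < e -> A w.
Proof.
split.
  move=> /nbhs_ballP[[e f]]; rewrite /= ltcE/= => /andP[/eqP ? e0] H; subst f.
  exists e => // w we; apply: H; rewrite -ball_normE /ball_ /= normcE' ltcR.
  by rewrite normcB.
move=> [e e0 H]; apply/nbhs_ballP; exists e%:C; first by rewrite /= ltcR.
move=> w; rewrite -ball_normE /ball_ /= normcE' ltcR => we; apply: H.
by rewrite normcB.
Qed.

Lemma near_normc z e : 0 < e -> \forall w \near z, normc (w - z) < e.
Proof. by move=> e0; apply/nbhsCP; exists e. Qed.

Lemma cvgCP T (F : set_system T) (FF : Filter F) (f : T -> C) z :
  f @ F --> z <-> forall e, 0 < e -> \forall t \near F, normc (f t - z) < e.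
Proof.
split=> [H e e0|H].
  exact: H _ (near_normc z e0).
move=> A /nbhsCP[e e0 eA]; have := H _ e0; apply: filterS => t /=; exact: eA.
Qed.

End Modulus.

Section Calculus.
Context {R : realType}.
Local Notation C := (Cplx R).

(** The little-o form includes [y = x], so the chain rule needs no case for vanishing increments. A
    general field [K] serves both real and complex derivatives. *)
Lemma is_derive1P (K : numFieldType) (f : K -> K) (x v : K) :
  is_derive x (1 : K) f v <->
  forall e : K, 0 < e ->
    \forall y \near x, `|f y - f x - v * (y - x)| <= e * `|y - x|.
Proof.
split.
  move=> [df dv] e e0.
  have : h^-1 *: (f (h *: 1 + x) - f x) @[h --> 0^'] --> v.
    by rewrite -dv; exact: df.
  move=> /cvgrPdist_le/(_ _ e0) H.
  have : \forall y \near x, y - x != 0 ->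
      `|v - (y - x)^-1 *: (f ((y - x) *: 1 + x) - f x)| <= e.
    have /nbhs_ballP[d d0 dH] : \forall h \near (0 : K), h != 0 ->
      `|v - h^-1 *: (f (h *: 1 + x) - f x)| <= e by exact: H.
    apply/nbhs_ballP; exists d => // y; rewrite -ball_normE /= => xy.
    by apply: dH; rewrite -ball_normE /= sub0r opprB.
  apply: filterS => y; have [->|yx] := eqVneq y x.
    by move=> _; rewrite !subrr mulr0 subrr normr0 mulr0.
  rewrite subr_eq0 => /(_ yx); rewrite /GRing.scale/= mulr1 subrK => yP.
  have nz : y - x != 0 by rewrite subr_eq0.
  rewrite -ler_pdivrMr ?normr_gt0// -normfV -normrM.
  rewrite distrC in yP; congr (`|_| <= e) : yP.
  by field.
move=> H.
suff c : h^-1 *: (f (h *: 1 + x) - f x) @[h --> 0^'] --> v.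
  by split; [apply/cvg_ex; exists v|exact/cvg_lim].
apply/cvgrPdist_le => e e0.
suff : \forall h \near (0 : K), h != 0 ->
  `|v - h^-1 *: (f (h *: 1 + x) - f x)| <= e by [].
have /nbhs_ballP[d d0 dH] := H _ e0.
apply/nbhs_ballP; exists d => // h; rewrite -ball_normE /= sub0r normrN => hd h0.
have := dH (h + x); rewrite -ball_normE /= opprD addrCA subrr addr0 normrN.
move=> /(_ hd) hP.
rewrite distrC /GRing.scale/= mulr1.
move: hP; rewrite addrK -ler_pdivrMr ?normr_gt0// -normfV -normrM.
congr (`|_| <= e); field; exact: h0.
Qed.

Definition cder (f : C -> C) (z v : C) := is_derive z (1 : C) f v.

Lemma cderP f z v : cder f z v <-> forall e : R, 0 < e ->
  \forall w \near z, normc (f w - f z - v * (w - z)) <= e * normc (w - z).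
Proof.
split.
  move=> /is_derive1P H e e0; have := H (e%:C); rewrite ltcR => /(_ e0).
  by apply: filterS => w; rewrite !normcE' -rmorphM lecR.
move=> H; apply/is_derive1P => -[e e']; rewrite ltcE/= => /andP[/eqP -> e0].
have := H _ e0; apply: filterS => w; rewrite !normcE'.
by rewrite [X in _ -> _ <= X](_ : _ = (e * normc (w - z))%:C) ?lecR// rmorphM.
Qed.

Lemma cder_derivable f z v : cder f z v -> derivable f z 1.
Proof. by case. Qed.

Lemma cder1 f z v : cder f z v -> derive1 f z = v.
Proof. by move=> [_ <-]; rewrite derive1E. Qed.

Lemma derivable_cder (f : C -> C) z : derivable f z 1 -> cder f z (derive1 f z).
Proof. by move=> /derivableP; rewrite derive1E. Qed.

Lemma cder_unique f z v w : cder f z v -> cder f z w -> v = w.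
Proof. by move=> /cder1 <- /cder1 <-. Qed.

Lemma cder_eq f z v w : cder f z v -> v = w -> cder f z w.
Proof. by move=> ? <-. Qed.

Lemma near_eq_cder f g z v :
  (\forall w \near z, f w = g w) -> cder f z v -> cder g z v.
Proof.
move=> fg /cderP H; apply/cderP => e e0.
have := H _ e0; move: (fg) => /nbhs_singleton fgz; move: fg.
by apply: filterS2 => w <-; rewrite fgz.
Qed.

Lemma cder_cst (c z : C) : cder (fun=> c) z 0.
Proof. exact: is_derive_cst. Qed.
Lemma cder_id (z : C) : cder (fun w => w) z 1.
Proof. exact: is_derive_id. Qed.
Lemma cderD f g z v w :
  cder f z v -> cder g z w -> cder (fun x => f x + g x) z (v + w).
Proof. exact: is_deriveD. Qed.
Lemma cderN f z v : cder f z v -> cder (fun x => - f x) z (- v).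
Proof. exact: is_deriveN. Qed.
Lemma cderB f g z v w :
  cder f z v -> cder g z w -> cder (fun x => f x - g x) z (v - w).
Proof. exact: is_deriveB. Qed.
Lemma cderM f g z v w :
  cder f z v -> cder g z w -> cder (fun x => f x * g x) z (v * g z + f z * w).
Proof.
move=> df dg; apply: (cder_eq (is_deriveM df dg)).
by rewrite /GRing.scale/=; ring.
Qed.
Lemma cderZ c f z v : cder f z v -> cder (fun x => c * f x) z (c * v).
Proof. exact: is_deriveZ. Qed.
Lemma cderX f n z v : cder f z v ->
  cder (fun x => f x ^+ n) z (n%:R * f z ^+ n.-1 * v).
Proof.
move=> df; case: n => [|n].
  by rewrite !mul0r; exact: (cder_cst 1 z).
rewrite (_ : (fun x => _) = f ^+ n.+1); first exact: (is_deriveX n.+1 df).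
by apply/funext => x; rewrite exprfctE.
Qed.
Lemma cderV f z v : f z != 0 -> cder f z v ->
  cder (fun x => (f x)^-1) z (- v / f z ^+ 2).
Proof.
move=> fz df; split; first by apply: derivableV => //; exact: cder_derivable df.
rewrite deriveV//; last exact: cder_derivable df.
by case: df => _ ->; rewrite /GRing.scale/=; ring.
Qed.

Lemma cder_lip f z v : cder f z v ->
  \forall w \near z, normc (f w - f z) <= (normc v + 1) * normc (w - z).
Proof.
move=> /cderP/(_ 1 ltr01); apply: filterS => w; rewrite mul1r => H.
have -> : f w - f z = (f w - f z - v * (w - z)) + v * (w - z) by ring.
apply: le_trans (le_normcD _ _) _.
by rewrite mulrDl mul1r addrC lerD// normcM.
Qed.

Lemma cder_cts f z v : cder f z v -> {for z, continuous f}.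
Proof.
move=> df; apply: differentiable_continuous; apply/derivable1_diffP.
exact: cder_derivable df.
Qed.

Lemma cder_comp f g z v w :
  cder f z v -> cder g (f z) w -> cder (g \o f) z (w * v).
Proof.
move=> df dg; have lf := cder_lip df; have cf := cder_cts df.
apply/cderP => e e0.
pose M := normc v + 1; pose K := normc w + 1.
have M0 : 0 < M by rewrite ltr_wpDl ?normc_ge0.
have K0 : 0 < K by rewrite ltr_wpDl ?normc_ge0.
have e1 : 0 < e / 2 / M by rewrite !divr_gt0.
have e2 : 0 < e / 2 / K by rewrite !divr_gt0.
move/cderP : dg => /(_ _ e1)/cf; rewrite /= near_simpl => dg.
move/cderP : df => /(_ _ e2) df.
near=> x.
have H1 : normc (f x - f z) <= M * normc (x - z) by near: x.
have H2 : normc (g (f x) - g (f z) - w * (f x - f z)) <= e / 2 / M * normc (f x - f z).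
  by near: x.
have H3 : normc (f x - f z - v * (x - z)) <= e / 2 / K * normc (x - z) by near: x.
have -> : (g \o f) x - (g \o f) z - w * v * (x - z) =
  (g (f x) - g (f z) - w * (f x - f z)) + w * (f x - f z - v * (x - z)).
  by rewrite /=; ring.
apply: le_trans (le_normcD _ _) _; rewrite normcM.
have -> : e * normc (x - z) = e / 2 / M * (M * normc (x - z)) + K * (e / 2 / K * normc (x - z)).
  by field; rewrite !gt_eqF.
apply: lerD; first by apply: le_trans H2 _; rewrite ler_wpM2l// ltW.
apply: ler_pM; rewrite ?normc_ge0// /K lerDl//.
Unshelve. all: by end_near. Qed.

(** [R[i]^o] is a module over itself, so a curve with a real parameter gets its own derivative, in
    little-o form. *)
Definition rder (g : R -> C) (t : R) (v : C) := forall e : R, 0 < e ->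
  \forall s \near t, normc (g s - g t - v * (s - t)%:C) <= e * `|s - t|.

Lemma rder_eq g t v w : rder g t v -> v = w -> rder g t w.
Proof. by move=> ? <-. Qed.

Lemma near_eq_rder f g t v :
  (\forall s \near t, f s = g s) -> rder f t v -> rder g t v.
Proof.
move=> fg H e e0.
have := H _ e0; move: (fg) => /nbhs_singleton fgz; move: fg.
by apply: filterS2 => w <-; rewrite fgz.
Qed.

Lemma rder_aff (a b : C) t : rder (fun s => a + b * s%:C) t b.
Proof.
move=> e e0; near=> s; rewrite rmorphB.
rewrite [X in normc X](_ : _ = 0) ?normc0 ?mulr_ge0// ?ltW//.
by ring.
Unshelve. all: by end_near. Qed.

Lemma rderD f g t v w :
  rder f t v -> rder g t w -> rder (fun s => f s + g s) t (v + w).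
Proof.
move=> df dg e e0; have e2 : 0 < e / 2 by rewrite divr_gt0.
move: (df _ e2) (dg _ e2); apply: filterS2 => s H1 H2.
have -> : f s + g s - (f t + g t) - (v + w) * (s - t)%:C =
   (f s - f t - v * (s - t)%:C) + (g s - g t - w * (s - t)%:C) by ring.
apply: le_trans (le_normcD _ _) _; apply: le_trans (lerD H1 H2) _.
by rewrite -mulrDl -splitr.
Qed.

Lemma rderZ c g t v : rder g t v -> rder (fun s => c * g s) t (c * v).
Proof.
move=> dg e e0; have c0 : 0 < normc c + 1 by rewrite ltr_wpDl ?normc_ge0.
have e1 : 0 < e / (normc c + 1) by rewrite divr_gt0.
have := dg _ e1; apply: filterS => s H.
rewrite -mulrA -!mulrBr normcM.
rewrite -[leRHS](@mulfVK _ (normc c + 1)) ?gt_eqF// [leRHS]mulrC.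
by apply: ler_pM; rewrite ?normc_ge0// ?lerDl// mulrAC.
Qed.

Lemma rder_cts g t v : rder g t v -> {for t, continuous g}.
Proof.
move=> dg; apply/cvgCP => e e0.
pose M := normc v + 1; have M0 : 0 < M by rewrite ltr_wpDl ?normc_ge0.
have eM : 0 < e / M by rewrite divr_gt0.
have : \forall s \near t, `|s - t| < e / M.
  by near=> s; rewrite distrC; near: s; exact: cvgr_dist_lt.
move: (dg _ ltr01); apply: filterS2 => s H1 H2.
have -> : g s - g t = (g s - g t - v * (s - t)%:C) + v * (s - t)%:C by ring.
apply: le_lt_trans (le_normcD _ _) _.
rewrite normcM normc_real; apply: le_lt_trans (_ : M * `|s - t| < _).
  by rewrite mulrDl addrC lerD.
by rewrite mulrC -ltr_pdivlMr.
Unshelve. all: by end_near. Qed.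

Lemma rder_comp f (g : R -> C) t v w :
  rder g t v -> cder f (g t) w -> rder (f \o g) t (w * v).
Proof.
move=> dg df; have cg := rder_cts dg.
move=> e e0.
pose M := normc v + 1; pose K := normc w + 1.
have M0 : 0 < M by rewrite ltr_wpDl ?normc_ge0.
have K0 : 0 < K by rewrite ltr_wpDl ?normc_ge0.
have e1 : 0 < e / 2 / M by rewrite !divr_gt0.
have e2 : 0 < e / 2 / K by rewrite !divr_gt0.
have df1 := cg _ ((cderP f (g t) w).1 df _ e1).
near=> x.
have H1 : normc (g x - g t) <= M * `|x - t|.
  have H : normc (g x - g t - v * (x - t)%:C) <= 1 * `|x - t|.
    by near: x; exact: dg.
  have -> : g x - g t = (g x - g t - v * (x - t)%:C) + v * (x - t)%:C by ring.
  apply: le_trans (le_normcD _ _) _.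
  by rewrite normcM normc_real /M mulrDl addrC lerD.
have H2 : normc (f (g x) - f (g t) - w * (g x - g t)) <= e / 2 / M * normc (g x - g t).
  by near: x.
have H3 : normc (g x - g t - v * (x - t)%:C) <= e / 2 / K * `|x - t|.
  by near: x; exact: dg.
have -> : (f \o g) x - (f \o g) t - w * v * (x - t)%:C =
  (f (g x) - f (g t) - w * (g x - g t)) + w * (g x - g t - v * (x - t)%:C).
  by rewrite /=; ring.
apply: le_trans (le_normcD _ _) _; rewrite normcM.
have -> : e * `|x - t| = e / 2 / M * (M * `|x - t|) + K * (e / 2 / K * `|x - t|).
  by field; rewrite !gt_eqF.
apply: lerD; first by apply: le_trans H2 _; rewrite ler_wpM2l// ltW.
apply: ler_pM; rewrite ?normc_ge0// /K lerDl//.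
Unshelve. all: by end_near. Qed.

Lemma rder_Re g t v : rder g t v -> is_derive t (1 : R) (fun s => complex.Re (g s)) (complex.Re v).
Proof.
move=> dg; apply/is_derive1P => e e0; have := dg _ e0; apply: filterS => s.
apply: le_trans; apply: le_trans (Re_le_normc _).
by rewrite !cReD !cReN cReM /= mulr0 subr0.
Qed.

Lemma rder_ReIm g t a b :
  is_derive t (1 : R) (fun s => complex.Re (g s)) a ->
  is_derive t (1 : R) (fun s => complex.Im (g s)) b -> rder g t (a +i* b).
Proof.
move=> /is_derive1P da /is_derive1P db e e0.
have e2 : 0 < e / 2 by rewrite divr_gt0.
move: (da _ e2) (db _ e2); apply: filterS2 => s H1 H2.
apply: le_trans (normc_le_ReIm _) _.
rewrite (splitr e) mulrDl lerD//.
  by apply: le_trans H1; rewrite !cReD !cReN cReM /= mulr0 subr0.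
by apply: le_trans H2; rewrite !cImD !cImN cImM /= mulr0 add0r.
Qed.

(** After the increment of [g] is rotated onto the real axis by [c], the function [B - Re (c g)] has
    a nonnegative derivative. The majorant [B] is variable because the decay estimates bound a
    derivative by an exponentially varying quantity. *)
Lemma rder_majorant (g g' : R -> C) (B B' : R -> R) (a b : R) : a <= b ->
  (forall t, a <= t <= b -> rder g t (g' t)) ->
  (forall t, a <= t <= b -> is_derive t (1 : R) B (B' t)) ->
  (forall t, a <= t <= b -> normc (g' t) <= B' t) ->
  normc (g b - g a) <= B b - B a.
Proof.
move=> ab dg dB le.
have [c c1 cE] := unimodular (g b - g a).
pose h t := B t - complex.Re (c * g t).
pose h' t := B' t - complex.Re (c * g' t).
have dh t : a <= t <= b -> is_derive t (1 : R) h (h' t).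
  move=> tab; apply: is_deriveB; first exact: dB.
  by apply: rder_Re; apply: rderZ; exact: dg.
suff : h a <= h b.
  rewrite /h lerBlDr => H.
  have : complex.Re (c * (g b - g a)) = normc (g b - g a) by rewrite cE.
  rewrite mulrBr cReD cReN => <-; lra.
have [->//|ab'] := eqVneq a b.
have {}ab' : a < b by rewrite lt_neqAle ab'.
rewrite -subr_ge0.
have [||x xab ->] := @MVT_segment R h h' a b ab.
- by move=> x; rewrite in_itv/= => /andP[? ?]; apply: dh; rewrite !ltW.
- apply: derivable_within_continuous => x; rewrite in_itv/= => xab.
  by have [] := dh x xab.
apply: mulr_ge0; last by rewrite subr_ge0.
rewrite /h' subr_ge0.
move: xab; rewrite in_itv/= => xab; apply: le_trans (le _ xab).
apply: le_trans (ler_norm _) _; apply: le_trans (Re_le_normc _) _.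
by rewrite normcM c1 mul1r.
Qed.

End Calculus.

(** * The exponential and integrals along curves *)

Section Exponential.
Context {R : realType}.
Local Notation C := (Cplx R).
Implicit Types z w : C.

Lemma cexpD z w : cexp (z + w) = cexp z * cexp w.
Proof.
case: z w => [a b] [c d]; rewrite /cexp /= expRD cosD sinD.
by simpc; congr (_ +i* _); ring.
Qed.

Lemma cexp0 : cexp 0 = 1 :> C.
Proof. by rewrite /cexp /= expR0 cos0 sin0 mulr1 mulr0. Qed.

Lemma normc_cexp z : normc (cexp z) = expR (complex.Re z).
Proof.
by rewrite /cexp /= !exprMn -mulrDr cos2Dsin2 mulr1 sqrtr_sqr ger0_norm// expR_ge0.
Qed.

Lemma cexp_neq0 z : cexp z != 0.
Proof. by rewrite -normc_gt0 normc_cexp expR_gt0. Qed.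

Lemma cexpN z : cexp (- z) = (cexp z)^-1.
Proof.
apply: (mulfI (cexp_neq0 z)); rewrite -cexpD subrr cexp0 divff//.
exact: cexp_neq0.
Qed.

Lemma cexpB z w : cexp (z - w) = cexp z / cexp w.
Proof. by rewrite cexpD cexpN. Qed.

Lemma cexpMn z n : cexp (n%:R * z) = cexp z ^+ n.
Proof.
elim: n => [|n IH]; first by rewrite mul0r cexp0 expr0.
by rewrite exprS -IH -cexpD -natr1; congr cexp; ring.
Qed.

Lemma cexp_real (x : R) : cexp x%:C = (expR x)%:C.
Proof. by rewrite /cexp /= cos0 sin0 mulr1 mulr0. Qed.

Lemma normc_cexp_im (x : R) : normc (cexp (0 +i* x)) = 1.
Proof. by rewrite normc_cexp /= expR0. Qed.

Lemma cder_cexp z : cder cexp z (cexp z).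
Proof.
suff H0 : cder cexp (0 : C) 1.
  have -> : (cexp : C -> C) = (fun w => cexp z * cexp w) \o (fun w => w - z).
    by apply/funext => w /=; rewrite -cexpD addrC subrK.
  apply: (cder_eq (v := (cexp z * 1) * 1)); last first.
    by rewrite !mulr1 /= subrr cexp0 mulr1.
  apply: cder_comp.
    by apply: (cder_eq (cderB (cder_id z) (cder_cst z z))); rewrite subr0.
  by rewrite subrr; apply: cderZ.
have dE : is_derive (0 : R) 1 expR (expR 0) by exact: is_derive_expR.
have dC : is_derive (0 : R) 1 cos (- sin 0) by exact: is_derive_cos.
have dS : is_derive (0 : R) 1 sin (cos 0) by exact: is_derive_sin.
(* The four error terms below add up to at most 9/16 of [e n]; the caps at 1 bound [expR x] by 3. *)
apply/cderP => e e0; have e8 : 0 < Num.min (e / 16) 1 by rewrite lt_min ltr01 divr_gt0.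
have {}dE := (is_derive1P _ _ _).1 dE _ e8.
have {}dC := (is_derive1P _ _ _).1 dC _ e8.
have {}dS := (is_derive1P _ _ _).1 dS _ e8.
move: dE dC dS => /nbhs_ballP[a a0 dE] /nbhs_ballP[b b0 dC] /nbhs_ballP[c c0 dS].
pose d := Num.min (Num.min a b) (Num.min c (Num.min 1 (e / 16))).
have d0 : 0 < d by rewrite !lt_min a0 b0 c0 ltr01 divr_gt0.
apply/nbhsCP; exists d => // w; rewrite subr0 !lt_min => /andP[/andP[wa wb]].
move=> /andP[wc /andP[w1 we]].
have {}dE := dE (complex.Re w); have {}dC := dC (complex.Im w).
have {}dS := dS (complex.Im w).
have Rew := Re_le_normc w; have Imw := Im_le_normc w.
rewrite cexp0 mul1r.
move: dE dC dS; rewrite -!ball_normE /= !sub0r !normrN !subr0 expR0 cos0 sin0.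
rewrite oppr0 mul0r !mul1r subr0.
move=> /(_ (le_lt_trans Rew wa)) dE /(_ (le_lt_trans Imw wb)) dC.
move=> /(_ (le_lt_trans Imw wc)); rewrite addr0 => dS.
set x := complex.Re w in Rew dE *; set y := complex.Im w in Imw dC dS *.
set n := normc w in wa wb wc w1 we Rew Imw *.
have n0 : 0 <= n by exact: normc_ge0.
set e' := Num.min _ _ in e8 dE dC dS.
have e'1 : e' <= e / 16 by rewrite /e' ge_min lexx.
have e'2 : e' <= 1 by rewrite /e' ge_min lexx orbT.
have B (t : R) : `|t| <= n -> e' * `|t| <= e / 16 * n.
  by move=> tn; apply: ler_pM => //; rewrite ltW.
have B' (t : R) : `|t| <= n -> e' * `|t| <= n.
  by move=> tn; rewrite -[leRHS]mul1r; apply: ler_pM => //; rewrite ltW.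
have EX : `|expR x| <= 3.
  have -> : expR x = (expR x - 1 - x) + 1 + x by ring.
  have := le_trans dE (B' _ Rew); have := ler_normD (expR x - 1 - x + 1) x.
  have := ler_normD (expR x - 1 - x) 1; rewrite normr1; lra.
apply: le_trans (normc_le_ReIm _) _.
have -> : complex.Re (cexp w - 1 - w) = expR x * (cos y - 1) + (expR x - 1 - x).
  by rewrite !cReD !cReN /= -/x -/y; ring.
have -> : complex.Im (cexp w - 1 - w) = expR x * (sin y - y) + (expR x - 1) * y.
  by rewrite !cImD !cImN /= -/x -/y oppr0 addr0; ring.
have H1 : `|expR x * (cos y - 1)| <= 3 * (e / 16 * n).
  by rewrite normrM; apply: ler_pM => //; apply: le_trans dC (B _ Imw).
have H2 : `|expR x * (sin y - y)| <= 3 * (e / 16 * n).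
  by rewrite normrM; apply: ler_pM => //; apply: le_trans dS (B _ Imw).
have en : 0 <= e * n by rewrite mulr_ge0// ltW.
have H3 : `|expR x - 1 - x| <= e / 16 * n by apply: le_trans dE (B _ Rew).
have H4 : `|(expR x - 1) * y| <= 2 * (e / 16 * n).
  have H : `|expR x - 1| <= 2 * n.
    have := ler_normD (expR x - 1 - x) x; rewrite subrK.
    by have := le_trans dE (B' _ Rew); lra.
  rewrite normrM; apply: (@le_trans _ _ (2 * n * n)); first exact: ler_pM.
  by rewrite -mulrA ler_wpM2l// ler_wpM2r// ltW.
have := ler_normD (expR x * (cos y - 1)) (expR x - 1 - x).
have := ler_normD (expR x * (sin y - y)) ((expR x - 1) * y).
lra.
Qed.

Lemma cexp_2pi : cexp (0 +i* (2 * pi)) = 1 :> C.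
Proof. by rewrite /cexp /= expR0 !mul1r mulr_natl cos2pi sin2pi. Qed.

Lemma cexp_2pik (k : int) : cexp (0 +i* (2 * pi * k%:~R)) = 1 :> C.
Proof.
have N n : cexp (0 +i* (2 * pi * n%:R)) = 1 :> C.
  elim: n => [|n IH]; first by rewrite mulr0 cexp0.
  have -> : 0 +i* (2 * pi * n.+1%:R) = (0 +i* (2 * pi * n%:R)) + (0 +i* (2 * pi)) :> C.
    apply: complex_ext; rewrite ?cReD ?cImD /=; first by rewrite addr0.
    by rewrite -[n.+1%:R]natr1 mulrDr mulr1.
  by rewrite cexpD IH cexp_2pi mulr1.
case: k => n; first exact: N.
rewrite NegzE mulrNz mulrN (_ : 0 -i* _ = - (0 +i* (2 * pi * n.+1%:R)) :> C).
  by rewrite cexpN N invr1.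
by simpc.
Qed.

Lemma cexp_surj z : z != 0 -> exists w, cexp w = z.
Proof.
move=> z0; have n0 : 0 < normc z by rewrite normc_gt0.
have [s sE] := expR_total n0.
pose a := complex.Re z / normc z; pose b := complex.Im z / normc z.
have ab : a ^+ 2 + b ^+ 2 = 1.
  rewrite /a /b !exprMn -mulrDl exprVn.
  have -> : complex.Re z ^+ 2 + complex.Im z ^+ 2 = normc z ^+ 2.
    by case: (z) => u v /=; rewrite sqr_sqrtr// addr_ge0// sqr_ge0.
  by rewrite divff// expf_neq0// gt_eqF.
have a1 : -1 <= a <= 1.
  rewrite -ler_norml -(@ler_pXn2r _ 2)// ?nnegrE// expr1n real_normK ?num_real//.
  by rewrite -ab lerDl sqr_ge0.
have ca : cos (acos a) = a by rewrite acosK// in_itv.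
have sa : sin (acos a) = `|b|.
  by rewrite sin_acos// -sqrtr_sqr -ab addrAC subrr add0r.
have [t [ct st]] : exists t, cos t = a /\ sin t = b.
  have [b0|b0] := leP 0 b.
    by exists (acos a); rewrite ca sa ger0_norm.
  by exists (- acos a); rewrite cosN sinN ca sa ltr0_norm// opprK.
exists (s +i* t); rewrite /cexp /= sE ct st /a /b.
case: (z) n0 => u v /= n0; congr (_ +i* _); rewrite mulrC divfK ?gt_eqF//.
Qed.

Lemma cos_eq1 (x : R) : cos x = 1 -> exists k : int, x = 2 * pi * k%:~R.
Proof.
move=> c1; have p0 := pi_gt0 R; have tp0 : 0 < 2 * pi :> R by lra.
pose k := Num.floor (x / (2 * pi)); exists k.
pose y := x - 2 * pi * k%:~R.
have /andP[y0 y1] : 0 <= y < 2 * pi.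
  have /andP[h1 h2] := floor_itv (x / (2 * pi)).
  rewrite -/k in h1 h2; rewrite /y subr_ge0 ltrBlDl -[X in _ < _ + X]mulr1 -mulrDr.
  move: h1 h2; rewrite ler_pdivlMr// ltr_pdivrMr// intrD => h1 h2.
  by rewrite mulrC h1 mulrC.
have cy : cos y = 1.
  have := cexp_2pik (- k); rewrite /cexp /= expR0 !mul1r => -[cc ss].
  rewrite /y -mulrN -mulrNz cosD cc c1 mulr1 ss mulr0 subr0//.
suff : y = 0 by rewrite /y => /eqP; rewrite subr_eq0 => /eqP.
have [yp|yp] := leP y pi.
  apply: cos_inj; rewrite ?in_itv/= ?y0 ?yp ?lexx ?pi_ge0//.
  by rewrite cy cos0.
have : cos (2 * pi - y) = 1.
  by rewrite cosB cy mulr_natl cos2pi sin2pi mul1r mul0r addr0.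
rewrite -[X in _ = X -> _]cos0 => /cos_inj; rewrite !in_itv/= lexx pi_ge0 => H.
have : 2 * pi - y = 0 by apply: H => //; apply/andP; split; lra.
lra.
Qed.

Lemma cexp_eq1 z : cexp z = 1 -> exists k : int, z = 0 +i* (2 * pi * k%:~R).
Proof.
move=> z1; have := normc_cexp z; rewrite z1 normc1 -expR0 => /expR_inj Rz.
move: z1; rewrite /cexp -Rz expR0 !mul1r => -[/cos_eq1[k kE] _].
by exists k; rewrite -kE; case: (z) Rz => a b /= <-.
Qed.

Lemma cexp_eq z w : cexp z = cexp w ->
  exists k : int, z = w + (0 +i* (2 * pi * k%:~R)).
Proof.
move=> zw; have /cexp_eq1[k kE] : cexp (z - w) = 1.
  by rewrite cexpB zw divff// cexp_neq0.
by exists k; rewrite -kE addrC subrK.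
Qed.

End Exponential.

(** * Antiderivatives along segments and curves *)

Section Integral.
Context {R : realType}.
Local Notation C := (Cplx R).

Lemma rder_seg (f : C -> C) (a b v : C) t : cder f (a + t%:C * (b - a)) v ->
  rder (fun s => f (a + s%:C * (b - a))) t ((b - a) * v).
Proof.
move=> df; rewrite mulrC.
apply: (@rder_comp _ f (fun s => a + s%:C * (b - a))) => //.
apply: near_eq_rder (rder_aff a (b - a) t).
by near=> s; rewrite mulrC.
Unshelve. all: by end_near. Qed.

Lemma cder_majorant (f : C -> C) (a b : C) (f' : C -> C) (B B' : R -> R) :
  (forall t : R, 0 <= t <= 1 -> cder f (a + t%:C * (b - a)) (f' (a + t%:C * (b - a)))) ->
  (forall t : R, 0 <= t <= 1 -> is_derive t (1 : R) B (B' t)) ->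
  (forall t : R, 0 <= t <= 1 -> normc ((b - a) * f' (a + t%:C * (b - a))) <= B' t) ->
  normc (f b - f a) <= B 1 - B 0.
Proof.
move=> df dB le.
have := @rder_majorant _ (fun s => f (a + s%:C * (b - a)))
  (fun t => (b - a) * f' (a + t%:C * (b - a))) B B' 0 1 ler01.
rewrite mul0r addr0 mul1r (addrC a) subrK; apply => // t t01.
by apply: rder_seg; exact: df.
Qed.

Lemma cder_mvt (f : C -> C) (a b : C) (f' : C -> C) (M : R) :
  (forall t : R, 0 <= t <= 1 -> cder f (a + t%:C * (b - a)) (f' (a + t%:C * (b - a)))) ->
  (forall t : R, 0 <= t <= 1 -> normc (f' (a + t%:C * (b - a))) <= M) ->
  normc (f b - f a) <= M * normc (b - a).
Proof.
move=> df le.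
have := @cder_majorant f a b f' (fun t => M * normc (b - a) * t)
  (fun=> M * normc (b - a)) df.
rewrite mulr1 mulr0 subr0; apply => [t t01|t t01].
  by apply: is_derive_eq; rewrite [LHS]mulr1.
by rewrite normcM mulrC ler_wpM2r ?normc_ge0// le.
Qed.

Definition convexC (A : set C) := forall a b (t : R),
  A a -> A b -> 0 <= t <= 1 -> A (a + t%:C * (b - a)).

Lemma cder0_cst (A : set C) (f : C -> C) : convexC A ->
  (forall z, A z -> cder f z 0) -> forall a b, A a -> A b -> f a = f b.
Proof.
move=> cA df a b Aa Ab; apply/eqP; rewrite eq_sym -subr_eq0 -normc_eq0.
rewrite eq_le normc_ge0 andbT.
have := @cder_mvt f a b (fun=> 0) 0; rewrite mul0r; apply => t t01.
  by apply: df; exact: cA.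
by rewrite normc0.
Qed.

(** Extends a function from the unit interval to the line, where the real fundamental theorem asks
    for continuity everywhere. *)
Definition clamp (t : R) : R := if t <= 0 then 0 else if t <= 1 then t else 1.

Lemma clamp_id t : 0 <= t <= 1 -> clamp t = t.
Proof.
by move=> /andP[t0 t1]; rewrite /clamp t1; case: leP => // t0'; apply/le_anti/andP.
Qed.

Lemma clamp01 t : 0 <= clamp t <= 1.
Proof.
rewrite /clamp; case: (leP t 0) => [_|/ltW t0]; first by rewrite lexx ler01.
by case: (leP t 1) => t1; rewrite ?t0 ?t1 ?lexx ?ler01.
Qed.

Lemma clamp_lip s t : `|clamp s - clamp t| <= `|s - t|.
Proof.
wlog st : s t / s <= t.
  by move=> H; have [/H//|/ltW/H] := leP s t; rewrite distrC (distrC t).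
rewrite distrC (distrC s) (ger0_norm (x := t - s)) ?subr_ge0//.
rewrite /clamp; case: (leP t 0) => t0; case: (leP s 0) => s0; try lra;
  rewrite ?subrr ?normr0 ?subr_ge0 ?subr0//.
- by case: (leP t 1) => t1; rewrite ger0_norm; lra.
- by case: (leP t 1) => t1; case: (leP s 1) => s1; rewrite ger0_norm; lra.
Qed.

Lemma real_antiderivative (f : R -> R) : continuous f ->
  exists F : R -> R, forall t : R, 0 <= t <= 1 -> is_derive t (1 : R) F (f t).
Proof.
move=> cf.
(* Integrating from -1 puts 0 and 1 in the interior of the interval, so that the derivative at the
   end points is two-sided. *)
pose F (x : R) := (\int[lebesgue_measure]_(t in [set` Interval (BLeft (-1 : R)) (BRight x)]) (f t))%R.
exists F => t /andP[t0 t1].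
have [||||dF FE] := @continuous_FTC1 R f (BLeft (-1)) t 3.
- lra.
- apply: continuous_compact_integrable; first exact: segment_compact.
  by apply: continuous_subspaceT => x; exact: cf.
- by rewrite /Order.lt/=; lra.
- exact: cf.
by split; [exact: dF|rewrite -derive1E FE].
Qed.

Lemma antiderivative (g : R -> C) :
  (forall t : R, 0 <= t <= 1 -> {for t, continuous g}) ->
  exists G : R -> C, forall t : R, 0 <= t <= 1 -> rder G t (g t).
Proof.
move=> cg; pose h t := g (clamp t).
have ch : forall t e, 0 < e -> \forall s \near t, normc (h s - h t) < e.
  move=> t e e0; have /cvgCP/(_ _ e0) := cg _ (clamp01 t).
  move=> /nbhs_ballP[d d0 H]; apply/nbhs_ballP; exists d => // s.
  rewrite -ball_normE/= => ts; apply: H; rewrite -ball_normE/=.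
  exact: le_lt_trans (clamp_lip _ _) ts.
have [F dF] : exists F : R -> R, forall t : R, 0 <= t <= 1 ->
    is_derive t (1 : R) F (complex.Re (h t)).
  apply: (@real_antiderivative (fun t => complex.Re (h t))) => t.
  apply/cvgrPdist_lt => e e0.
  have := ch t e e0; apply: filterS => s; apply: le_lt_trans.
  by apply: le_trans (Re_le_normc _); rewrite distrC cReD cReN.
have [G dG] : exists F : R -> R, forall t : R, 0 <= t <= 1 ->
    is_derive t (1 : R) F (complex.Im (h t)).
  apply: (@real_antiderivative (fun t => complex.Im (h t))) => t.
  apply/cvgrPdist_lt => e e0.
  have := ch t e e0; apply: filterS => s; apply: le_lt_trans.
  by apply: le_trans (Im_le_normc _); rewrite distrC cImD cImN.
exists (fun t => F t +i* G t) => t t01.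
rewrite -[g t](_ : complex.Re (h t) +i* complex.Im (h t) = _); last first.
  by rewrite /h clamp_id//; case: (g t).
apply: rder_ReIm; [exact: dF|exact: dG].
Qed.

(* [cint g] is the integral of [g] over [[0, 1]] (junk if [g] has no
   antiderivative there). *)
Definition cint (g : R -> C) : C :=
  let G := get [set G : R -> C | forall t : R, 0 <= t <= 1 -> rder G t (g t)] in
  G 1 - G 0.

Lemma cintE (g G : R -> C) :
  (forall t : R, 0 <= t <= 1 -> rder G t (g t)) -> cint g = G 1 - G 0.
Proof.
move=> dG; rewrite /cint; set H := get _.
have dH : forall t : R, 0 <= t <= 1 -> rder H t (g t).
  by apply: (@getPex _ [set G : R -> C | forall t : R, 0 <= t <= 1 -> rder G t (g t)]); exists G.
have d0 t : 0 <= t <= 1 -> rder (fun s => H s + (-1) * G s) t 0.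
  move=> t01; apply: rder_eq (rderD (dH t t01) (rderZ (-1) (dG t t01))) _.
  by ring.
have := @rder_majorant _ _ (fun=> 0) (fun=> 0) (fun=> 0) 0 1 ler01 d0.
rewrite subrr => /(_ (fun t _ => is_derive_cst _ _ _)) /(_ _)/wrap[].
  by move=> t _; rewrite normc0.
rewrite le_eqVlt ltNge normc_ge0 orbF normc_eq0 => /eqP H1.
apply/eqP; rewrite -subr_eq0 -H1; apply/eqP; ring.
Qed.

End Integral.

(** * Goursat's lemma and primitives *)

Section Integral.
Context {R : realType}.
Local Notation C := (Cplx R).

Definition ctsI (g : R -> C) := forall t : R, 0 <= t <= 1 -> {for t, continuous g}.

Lemma ctsI_cst c : ctsI (fun=> c).
Proof. by move=> t _; exact: cvg_cst. Qed.

Lemma ctsID f g : ctsI f -> ctsI g -> ctsI (fun t => f t + g t).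
Proof. by move=> cf cg t t01; exact: (continuousD (cf t t01) (cg t t01)). Qed.

Lemma ctsIM f g : ctsI f -> ctsI g -> ctsI (fun t => f t * g t).
Proof. by move=> cf cg t t01; exact: (continuousM (cf t t01) (cg t t01)). Qed.

Lemma eq_cint (f g : R -> C) : ctsI f ->
  (forall t : R, 0 <= t <= 1 -> f t = g t) -> cint f = cint g.
Proof.
move=> /antiderivative[G dG] fg; rewrite !(cintE (G := G))// => t t01.
by rewrite -fg//; exact: dG.
Qed.

Lemma cintD (f g : R -> C) : ctsI f -> ctsI g ->
  cint (fun t => f t + g t) = cint f + cint g.
Proof.
move=> /antiderivative[F dF] /antiderivative[G dG].
rewrite (cintE dF) (cintE dG) (cintE (G := fun t => F t + G t)); first by ring.
by move=> t t01; apply: rderD; [exact: dF|exact: dG].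
Qed.

Lemma cintZ c (f : R -> C) : ctsI f -> cint (fun t => c * f t) = c * cint f.
Proof.
move=> /antiderivative[F dF].
rewrite (cintE dF) (cintE (G := fun t => c * F t)); first by ring.
by move=> t t01; apply: rderZ; exact: dF.
Qed.

Lemma cint_le (f : R -> C) (M : R) : ctsI f ->
  (forall t : R, 0 <= t <= 1 -> normc (f t) <= M) -> normc (cint f) <= M.
Proof.
move=> /antiderivative[F dF] fM; rewrite (cintE dF).
have := @rder_majorant _ F f (fun t => M * t) (fun=> M) 0 1 ler01 dF.
rewrite mulr1 mulr0 subr0; apply => // t t01.
by apply: is_derive_eq; rewrite [LHS]mulr1.
Qed.

Lemma rder_line (a v : C) (t : R) : rder (fun s => a + s%:C * v) t v.
Proof.
apply: near_eq_rder (rder_aff a v t).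
by near=> s; rewrite mulrC.
Unshelve. all: by end_near. Qed.

Lemma ctsI_seg (f : C -> C) (a b : C) :
  (forall t : R, 0 <= t <= 1 -> {for a + t%:C * (b - a), continuous f}) ->
  ctsI (fun t => f (a + t%:C * (b - a))).
Proof.
move=> cf t t01; apply: (@continuous_comp _ _ _ (fun t : R => a + t%:C * (b - a))).
  exact: rder_cts (rder_line _ _ _).
exact: cf.
Qed.

Definition sint (f : C -> C) (a b : C) : C :=
  (b - a) * cint (fun t => f (a + t%:C * (b - a))).

Lemma sint_prim (F f : C -> C) (a b : C) :
  (forall t : R, 0 <= t <= 1 -> cder F (a + t%:C * (b - a)) (f (a + t%:C * (b - a)))) ->
  ctsI (fun t => f (a + t%:C * (b - a))) ->
  sint f a b = F b - F a.
Proof.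
move=> dF cf; rewrite /sint -cintZ//.
rewrite (cintE (G := fun s => F (a + s%:C * (b - a)))).
  by rewrite mul1r mul0r addr0 (addrC a) subrK.
by move=> t t01; apply: rder_seg; exact: dF.
Qed.

Lemma sint_le (f : C -> C) (a b : C) (M : R) :
  ctsI (fun t => f (a + t%:C * (b - a))) ->
  (forall t : R, 0 <= t <= 1 -> normc (f (a + t%:C * (b - a))) <= M) ->
  normc (sint f a b) <= M * normc (b - a).
Proof.
move=> cf fM; rewrite /sint normcM mulrC ler_wpM2r ?normc_ge0//.
exact: cint_le.
Qed.

Lemma rder_reparam (g : R -> C) (al be t : R) v : rder g (al + be * t) v ->
  rder (fun s => g (al + be * s)) t (be%:C * v).
Proof.
move=> dg e e0; have b0 : 0 < `|be| + 1 by rewrite ltr_wpDl.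
have e1 : 0 < e / (`|be| + 1) by rewrite divr_gt0.
have c : {for t, continuous (fun s : R => al + be * s)}.
  apply: differentiable_continuous; apply/derivable1_diffP.
  by apply: derivableD.
have := c _ (dg _ e1); apply: (@filterS _ (nbhs t)) => s /=.
have -> : al + be * s - (al + be * t) = be * (s - t) by ring.
rewrite normrM rmorphM mulrCA mulrA => H; apply: le_trans H _.
have -> : e * `|s - t| = e / (`|be| + 1) * ((`|be| + 1) * `|s - t|).
  by field; rewrite gt_eqF.
apply: ler_wpM2l; first exact: ltW.
by apply: ler_wpM2r => //; rewrite lerDl.
Qed.

Lemma sint_swap (f : C -> C) (a b : C) :
  ctsI (fun t => f (a + t%:C * (b - a))) -> sint f b a = - sint f a b.
Proof.
move=> /antiderivative[G dG]; rewrite /sint (cintE dG).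
rewrite (cintE (G := fun t => (-1) * G (1 + (-1) * t))).
  by rewrite mulr1 mulr0 addr0 subrr; ring.
move=> t t01.
have h : 0 <= 1 + (-1) * t <= 1 by lra.
apply: rder_eq (rderZ (-1) (rder_reparam (dG _ h))) _.
rewrite !realCE mulN1r mulN1r opprK; congr f.
by ring.
Qed.

Lemma sint_mid (f : C -> C) (a b m : C) : a + b = 2 * m ->
  ctsI (fun t => f (a + t%:C * (b - a))) ->
  sint f a b = sint f a m + sint f m b.
Proof.
move=> abm /antiderivative[G dG]; rewrite /sint (cintE dG).
have -> : b = 2 * m - a by rewrite -abm; ring.
rewrite (cintE (G := fun t => 2 * G (0 + 2^-1 * t))); last first.
  move=> t t01; have h : 0 <= 0 + 2^-1 * t <= 1 by lra.
  apply: rder_eq (rderZ 2 (rder_reparam (dG _ h))) _.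
  rewrite mulrA (_ : 2 * (2^-1)%:C = 1 :> C) ?mul1r; last first.
    by rewrite !realCE mulfV// pnatr_eq0.
  congr f; rewrite add0r !realCE.
  have -> : b = 2 * m - a by rewrite -abm; ring.
  by field.
rewrite (cintE (G := fun t => 2 * G (2^-1 + 2^-1 * t))); last first.
  move=> t t01; have h : 0 <= 2^-1 + 2^-1 * t <= 1 by lra.
  apply: rder_eq (rderZ 2 (rder_reparam (dG _ h))) _.
  rewrite mulrA (_ : 2 * (2^-1)%:C = 1 :> C) ?mul1r; last first.
    by rewrite !realCE mulfV// pnatr_eq0.
  congr f; rewrite !realCE.
  have -> : b = 2 * m - a by rewrite -abm; ring.
  by field.
rewrite !mulr1 !mulr0 !addr0 add0r.
have -> : (2^-1 + 2^-1 : R) = 1 by field.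
by ring.
Qed.

Definition tri (f : C -> C) (a b c : C) := sint f a b + sint f b c + sint f c a.

(** The intervals of radius c / 2^n around [x n] are nested, and the limit is the supremum of their
    left ends. This yields an explicit rate together with the limit. *)
Lemma halving_limit (x : R^nat) (c : R) : 0 <= c ->
  (forall n, `|x n.+1 - x n| <= c / 2 ^+ n.+1) ->
  exists l, forall n, `|x n - l| <= c / 2 ^+ n.
Proof.
move=> c0 H.
have pw n : c / 2 ^+ n = c / 2 ^+ n.+1 + c / 2 ^+ n.+1.
  by rewrite exprS; field; rewrite expf_neq0.
pose lo n := x n - c / 2 ^+ n; pose hi n := x n + c / 2 ^+ n.
have loS n : lo n <= lo n.+1.
  by rewrite /lo; have := H n; rewrite (pw n) ler_norml; lra.
have hiS n : hi n.+1 <= hi n.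
  by rewrite /hi; have := H n; rewrite (pw n) ler_norml; lra.
have lom n k : lo n <= lo (n + k)%N.
  by elim: k => [|k IH]; rewrite ?addn0// addnS; apply: le_trans IH (loS _).
have him n k : hi (n + k)%N <= hi n.
  by elim: k => [|k IH]; rewrite ?addn0// addnS; apply: le_trans (hiS _) IH.
have lohi n k : lo n <= hi k.
  apply: le_trans (lom n k) _; rewrite addnC; apply: le_trans (him k n).
  by rewrite /lo /hi; apply: (@le_trans _ _ (x (k + n)%N));
    rewrite ?gerBl ?lerDl divr_ge0// exprn_ge0.
have hs : has_sup (range lo).
  split; first by exists (lo 0%N), 0%N.
  by exists (hi 0%N) => _ [n _ <-].
exists (sup (range lo)) => n.
have h1 : lo n <= sup (range lo) by apply: sup_upper_bound => //; exists n.
have h2 : sup (range lo) <= hi n.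
  by apply: ge_sup; [exists (lo 0%N), 0%N|move=> _ [k _ <-]].
by move: h1 h2; rewrite /lo /hi ler_norml; lra.
Qed.

Lemma half_pow_small (c e : R) : 0 <= c -> 0 < e -> exists n, c / 2 ^+ n < e.
Proof.
move=> c0 e0; exists (Num.bound (c / e)).
rewrite ltr_pdivrMr ?exprn_gt0// -ltr_pdivrMl// mulrC.
exact: upper_nthrootP.
Qed.

Lemma convex_normc_ball (z : C) (r : R) : convexC [set w | normc (w - z) <= r].
Proof.
move=> a b t /= ar br /andP[t0 t1].
have -> : a + t%:C * (b - a) - z = (1 - t)%:C * (a - z) + t%:C * (b - z).
  by rewrite realCB realC1; ring.
apply: le_trans (le_normcD _ _) _; rewrite !normcM !normc_real !ger0_norm ?subr_ge0//.
have -> : r = (1 - t) * r + t * r by ring.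
by apply: lerD; rewrite ler_wpM2l// subr_ge0.
Qed.

Lemma hol_ctsI (A : set C) (f : C -> C) (a b : C) : convexC A -> holomorphic_on A f ->
  A a -> A b -> ctsI (fun t => f (a + t%:C * (b - a))).
Proof.
move=> cA hf Aa Ab; apply: ctsI_seg => t t01.
exact: cder_cts (derivable_cder (hf _ (cA _ _ _ Aa Ab t01))).
Qed.

Lemma tri_split (A : set C) (f : C -> C) (a b c x y z : C) :
  convexC A -> holomorphic_on A f -> A a -> A b -> A c -> A x -> A y -> A z ->
  b + c = 2 * x -> a + c = 2 * y -> a + b = 2 * z ->
  tri f a b c = tri f a z y + tri f z b x + tri f y x c + tri f x y z.
Proof.
move=> cA hf Aa Ab Ac Ax Ay Az xE yE zE.
have I p q : A p -> A q -> ctsI (fun t => f (p + t%:C * (q - p))).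
  by move=> Ap Aq; exact: hol_ctsI hf Ap Aq.
have yE' : c + a = 2 * y by rewrite addrC.
rewrite /tri (sint_mid zE (I _ _ Aa Ab)) (sint_mid xE (I _ _ Ab Ac)).
rewrite (sint_mid yE' (I _ _ Ac Aa)).
rewrite (sint_swap (I _ _ Az Ay)) (sint_swap (I _ _ Az Ax)) (sint_swap (I _ _ Ay Ax)).
by ring.
Qed.

(** The affine part of [f] at [z] is integrated exactly by a polynomial, whose increments cancel
    around a triangle. The remainder is at most [e r] on a segment of length at most 2 r. *)
Lemma sint_cder_le (f : C -> C) (z v p q : C) (e r : R) : 0 <= e ->
  ctsI (fun t => f (p + t%:C * (q - p))) ->
  normc (p - z) <= r -> normc (q - z) <= r ->
  (forall w : C, normc (w - z) <= r -> normc (f w - f z - v * (w - z)) <= e * normc (w - z)) ->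
  normc (sint f p q - (f z * (q - p) + v / 2 * ((q - z) ^+ 2 - (p - z) ^+ 2)))
    <= 2 * e * r ^+ 2.
Proof.
move=> e0 cf pz qz H.
have r0 : 0 <= r by apply: le_trans pz; exact: normc_ge0.
pose g (w : C) : C := f z + v * (w - z); pose G (w : C) : C := f z * w + v / 2 * (w - z) ^+ 2.
have dG w : cder G w (g w).
  rewrite /G /g; apply: (cder_eq (cderD (cderZ (f z) (cder_id w))
    (cderZ (v / 2) (cderX 2 (cderB (cder_id w) (cder_cst z w)))))).
  by rewrite /= expr1; field.
have cg : ctsI (fun t => g (p + t%:C * (q - p))).
  apply: ctsI_seg => t t01; rewrite /g; apply: cder_cts.
  exact: cderD (cder_cst _ _) (cderZ v (cderB (cder_id _) (cder_cst z _))).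
have cNg : ctsI (fun t => (-1) * g (p + t%:C * (q - p))).
  exact: (@ctsIM (fun=> -1) (fun t => g (p + t%:C * (q - p)))) (@ctsI_cst (-1)) cg.
have -> : f z * (q - p) + v / 2 * ((q - z) ^+ 2 - (p - z) ^+ 2) = sint g p q.
  rewrite (sint_prim (F := G) _ cg); first by rewrite /G; ring.
  by move=> t _; exact: dG.
have -> : sint f p q - sint g p q = sint (fun w => f w + (-1) * g w) p q.
  rewrite /sint (@cintD (fun t => f (p + t%:C * (q - p)))
    (fun t => (-1) * g (p + t%:C * (q - p))))// cintZ//; ring.
apply: le_trans (sint_le (M := e * r) _ _) _.
- exact: (ctsID cf cNg).
- move=> t t01; have H1 := convex_normc_ball pz qz t01.
  rewrite /= in H1; have := H _ H1; rewrite mulN1r /g.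
  rewrite -addrA -opprD => /le_trans; apply.
  by rewrite ler_wpM2l.
have -> : 2 * e * r ^+ 2 = e * r * (r + r) by ring.
rewrite ler_wpM2l ?mulr_ge0//.
have -> : q - p = (q - z) - (p - z) by ring.
by apply: le_trans (le_normcB _ _) _; apply: lerD.
Qed.

Lemma tri_cder_le (f : C -> C) (z v a b c : C) (e r : R) : 0 <= e ->
  ctsI (fun t => f (a + t%:C * (b - a))) -> ctsI (fun t => f (b + t%:C * (c - b))) ->
  ctsI (fun t => f (c + t%:C * (a - c))) ->
  normc (a - z) <= r -> normc (b - z) <= r -> normc (c - z) <= r ->
  (forall w : C, normc (w - z) <= r -> normc (f w - f z - v * (w - z)) <= e * normc (w - z)) ->
  normc (tri f a b c) <= 6 * e * r ^+ 2.
Proof.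
move=> e0 cab cbc cca ar br cr H.
have h1 := sint_cder_le e0 cab ar br H.
have h2 := sint_cder_le e0 cbc br cr H.
have h3 := sint_cder_le e0 cca cr ar H.
rewrite /tri; set s1 := sint f a b in h1 *; set s2 := sint f b c in h2 *.
set s3 := sint f c a in h3 *.
set g1 := _ - (_ + _) in h1; set g2 := _ - (_ + _) in h2; set g3 := _ - (_ + _) in h3.
have -> : s1 + s2 + s3 = g1 + g2 + g3 by rewrite /g1 /g2 /g3; ring.
have := le_normcD (g1 + g2) g3; have := le_normcD g1 g2; lra.
Qed.

Lemma ge0_half_pow (c l : R) : 0 <= c -> (forall n, 0 <= l + c / 2 ^+ n) -> 0 <= l.
Proof.
move=> c0 H; rewrite leNgt; apply/negP => l0.
have [|n nP] := @half_pow_small c (- l) c0; first by rewrite oppr_gt0.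
have := H n; lra.
Qed.

Lemma convex_tri (A : set C) (a b c : C) (x y : R) : convexC A -> A a -> A b -> A c ->
  0 <= x -> 0 <= y -> x + y <= 1 -> A (a + x%:C * (b - a) + y%:C * (c - a)).
Proof.
move=> cA Aa Ab Ac x0 y0 xy.
have [s0|s0] := eqVneq (x + y) 0.
  have -> : x = 0 by lra.
  have -> : y = 0 by lra.
  by rewrite !realC0 !mul0r !addr0.
have s_gt0 : 0 < x + y by rewrite lt_neqAle eq_sym s0 addr_ge0.
have t01 : 0 <= y / (x + y) <= 1.
  by rewrite divr_ge0 ?(ltW s_gt0)//= ler_pdivrMr// mul1r lerDr.
have s01 : 0 <= x + y <= 1 by rewrite xy ltW.
have := cA _ _ _ Aa (cA _ _ _ Ab Ac t01) s01.
congr A; rewrite !realCE; field.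
by rewrite -realCD; apply: contra s0 => /eqP/complexI ->.
Qed.

Lemma quarter_lt (e a b c d : R) : e <= a + b + c + d ->
  a < e / 4 -> b < e / 4 -> c < e / 4 -> d < e / 4 -> False.
Proof. lra. Qed.

Lemma goursat (A : set C) (f : C -> C) (a b c : C) :
  convexC A -> holomorphic_on A f -> A a -> A b -> A c -> tri f a b c = 0.
Proof.
move=> cA hf Aa Ab Ac.
have I p q : A p -> A q -> ctsI (fun t => f (p + t%:C * (q - p))).
  by move=> Ap Aq; exact: hol_ctsI hf Ap Aq.
pose P (x y : R) : C := a + x%:C * (b - a) + y%:C * (c - a).
have AP x y : 0 <= x -> 0 <= y -> x + y <= 1 -> A (P x y) by exact: convex_tri.
(* A triangle similar to the given one is encoded by the affine coordinates of a corner and a signed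
   ratio. The middle triangle of a subdivision is reversed, hence the negative ratio in [q4]. *)
pose T (q : R * R * R) :=
  tri f (P q.1.1 q.1.2) (P (q.1.1 + q.2) q.1.2) (P q.1.1 (q.1.2 + q.2)).
pose Inv (q : R * R * R) := [/\ 0 <= q.1.1, 0 <= q.1.2, q.1.1 + q.1.2 <= 1 &
  [/\ 0 <= q.1.1 + q.2, 0 <= q.1.2 + q.2 & q.1.1 + q.1.2 + q.2 <= 1]].
have stepP q : exists q', Inv q -> [/\ Inv q', `|q'.2| = `|q.2| / 2,
    `|q'.1.1 - q.1.1| <= `|q.2| / 2, `|q'.1.2 - q.1.2| <= `|q.2| / 2 &
    normc (T q) / 4 <= normc (T q')].
  case: q => [[x y] s].
  have [[]|nI] := pselect (Inv (x, y, s)); last by exists (x, y, s).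
  rewrite /= => x0 y0 xy [xs ys xys].
  pose q1 := (x, y, s / 2); pose q2 := (x + s / 2, y, s / 2).
  pose q3 := (x, y + s / 2, s / 2); pose q4 := (x + s / 2, y + s / 2, - (s / 2)).
  have TE : T (x, y, s) = T q1 + T q2 + T q3 + T q4.
    rewrite /T /= (@tri_split A f _ _ _ (P (x + s / 2) (y + s / 2))
      (P x (y + s / 2)) (P (x + s / 2) y))//; try (by apply: AP; clear -x0 y0 xy xs ys xys; lra).
    - have e1 (t : R) : t + s / 2 + s / 2 = t + s by field.
      have e2 (t : R) : t + s / 2 - s / 2 = t by field.
      by rewrite !e1 !e2.
    - by rewrite /P !realCE; field.
    - by rewrite /P !realCE; field.
    - by rewrite /P !realCE; field.
  have nT : normc (T (x, y, s)) <= normc (T q1) + normc (T q2) + normc (T q3) + normc (T q4).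
    rewrite TE; do 3 (apply: le_trans (le_normcD _ _) _; rewrite lerD2r//).
  have s2 : `|s / 2| = `|s| / 2 by rewrite normrM [`|2^-1|]ger0_norm.
  have z2 : `|0 : R| <= `|s| / 2 by rewrite normr0 divr_ge0.
  have d2 t : `|t + s / 2 - t| <= `|s| / 2 by rewrite (addrC t) addrK s2.
  have i1 : Inv q1 by clear -x0 y0 xy xs ys xys; rewrite /Inv /=; do 2?split; lra.
  have i2 : Inv q2 by clear -x0 y0 xy xs ys xys; rewrite /Inv /=; do 2?split; lra.
  have i3 : Inv q3 by clear -x0 y0 xy xs ys xys; rewrite /Inv /=; do 2?split; lra.
  have i4 : Inv q4 by clear -x0 y0 xy xs ys xys; rewrite /Inv /=; do 2?split; lra.
  have [h1|h1] := leP (normc (T (x, y, s)) / 4) (normc (T q1)).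
    by exists q1 => _; split => //=; rewrite ?subrr ?normrN.
  have [h2|h2] := leP (normc (T (x, y, s)) / 4) (normc (T q2)).
    by exists q2 => _; split => //=; rewrite ?subrr ?normrN.
  have [h3|h3] := leP (normc (T (x, y, s)) / 4) (normc (T q3)).
    by exists q3 => _; split => //=; rewrite ?subrr ?normrN.
  have [h4|h4] := leP (normc (T (x, y, s)) / 4) (normc (T q4)).
    by exists q4 => _; split => //=; rewrite ?subrr ?normrN.
  by case: (quarter_lt nT h1 h2 h3 h4).
have [step st] := boolp.choice stepP.
pose q n := iter n step (0, 0, 1).
have qI n : Inv (q n).
  elim: n => [|n IH]; first by split=> //=; try split; lra.
  by have [] := st _ IH.
have qs n : `|(q n).2| = 1 / 2 ^+ n.
  elim: n => [|n IH]; first by rewrite /= normr1 expr0 divr1.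
  have [_ -> _ _ _] := st _ (qI n); rewrite IH exprS; field.
  by rewrite expf_neq0.
have [X XP] : exists l, forall n, `|(q n).1.1 - l| <= 1 / 2 ^+ n.
  apply: halving_limit => // n; have [_ _ h _ _] := st _ (qI n).
  apply: le_trans h _; rewrite qs exprS.
  by rewrite invfM !mul1r mulrC.
have [Y YP] : exists l, forall n, `|(q n).1.2 - l| <= 1 / 2 ^+ n.
  apply: halving_limit => // n; have [_ _ _ h _] := st _ (qI n).
  apply: le_trans h _; rewrite qs exprS.
  by rewrite invfM !mul1r mulrC.
have X0 : 0 <= X.
  apply: (@ge0_half_pow 1) => // n; have [h _ _ _] := qI n.
  by have := XP n; rewrite ler_norml; lra.
have Y0 : 0 <= Y.
  apply: (@ge0_half_pow 1) => // n; have [_ h _ _] := qI n.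
  by have := YP n; rewrite ler_norml; lra.
have XY : X + Y <= 1.
  rewrite -subr_ge0; apply: (@ge0_half_pow 2) => // n; have [_ _ h _] := qI n.
  by have := YP n; have := XP n; rewrite !ler_norml; lra.
have /derivable_cder/cderP dz := hf _ (AP _ _ X0 Y0 XY).
set z := P X Y in dz; set v := derive1 f z in dz.
pose L := normc (b - a) + normc (c - a).
have L0 : 0 <= L by rewrite addr_ge0// normc_ge0.
(* The corners at step n are within 2 L / 2^n of the limit point; adding 1 keeps [M] positive for a
   degenerate triangle. *)
pose M := 2 * L + 1.
have nTn n : normc (T (q 0%N)) / 4 ^+ n <= normc (T (q n)).
  elim: n => [|n IH]; first by rewrite expr0 divr1.
  have [_ _ _ _ h] := st _ (qI n); apply: le_trans h.
  by rewrite exprS invfM mulrCA mulrC ler_pM2r.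
have T0 : T (q 0%N) = tri f a b c.
  by rewrite /T /P /= !add0r !realC0 !realC1 !mul0r !addr0 !mul1r !(addrC a) !subrK.
apply/eqP; rewrite -T0 -normc_eq0; apply/negPn/negP => Tn0.
have Tp : 0 < normc (T (q 0%N)) by rewrite lt_neqAle eq_sym Tn0 normc_ge0.
set eta := normc _ in Tp.
have M0 : 0 < M by rewrite /M; lra.
(* Chosen so that the bound 6 e (M / 2^n)^2 on the n-th triangle, multiplied by 4^n, is [eta / 2],
   against the lower bound [eta]. *)
pose e := eta / (12 * M ^+ 2).
have e0 : 0 < e by rewrite divr_gt0// mulr_gt0// exprn_gt0.
have /nbhsCP[d d0 dP] := dz _ e0.
have [n nP] := half_pow_small (ltW M0) d0.
have [i1 i2 i3 [i4 i5 i6]] := qI n.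
have Pz x y : `|x - X| <= 2 / 2 ^+ n -> `|y - Y| <= 2 / 2 ^+ n ->
    normc (P x y - z) <= M / 2 ^+ n.
  move=> hx hy.
  have -> : P x y - z = (x - X)%:C * (b - a) + (y - Y)%:C * (c - a).
    by rewrite /z /P !realCB; ring.
  apply: le_trans (le_normcD _ _) _; rewrite !normcM !normc_real.
  apply: (@le_trans _ _ (2 / 2 ^+ n * normc (b - a) + 2 / 2 ^+ n * normc (c - a))).
    by apply: lerD; rewrite ler_wpM2r ?normc_ge0.
  rewrite -mulrDr mulrAC -/L ler_wpM2r ?invr_ge0 ?exprn_ge0//.
  by rewrite /M; lra.
have two : 2 / 2 ^+ n = 1 / 2 ^+ n + 1 / 2 ^+ n :> R by lra.
have p0 : 0 <= 1 / 2 ^+ n :> R by rewrite divr_ge0// exprn_ge0.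
have := XP n; have := YP n; have := qs n.
set x := (q n).1.1; set y := (q n).1.2; set s := (q n).2 => sE hy hx.
have bd : normc (T (q n)) <= 6 * e * (M / 2 ^+ n) ^+ 2.
  have hX : `|x - X| <= 2 / 2 ^+ n by lra.
  have hY : `|y - Y| <= 2 / 2 ^+ n by lra.
  have hXs : `|x + s - X| <= 2 / 2 ^+ n.
    by rewrite addrAC two; apply: le_trans (ler_normD _ _) _; rewrite lerD// sE.
  have hYs : `|y + s - Y| <= 2 / 2 ^+ n.
    by rewrite addrAC two; apply: le_trans (ler_normD _ _) _; rewrite lerD// sE.
  apply: (@tri_cder_le f z v) (ltW e0) _ _ _ (Pz _ _ hX hY) (Pz _ _ hXs hY) (Pz _ _ hX hYs) _.
  - by apply: I; apply: AP; rewrite // /x /y /s; clear -i1 i2 i3 i4 i5 i6; lra.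
  - by apply: I; apply: AP; rewrite // /x /y /s; clear -i1 i2 i3 i4 i5 i6; lra.
  - by apply: I; apply: AP; rewrite // /x /y /s; clear -i1 i2 i3 i4 i5 i6; lra.
  by move=> w hw; apply: dP; exact: le_lt_trans hw nP.
have := le_trans (nTn n) bd; rewrite -/eta ler_pdivrMr ?exprn_gt0//.
have -> : 6 * e * (M / 2 ^+ n) ^+ 2 * 4 ^+ n = eta / 2.
  rewrite /e exprMn exprVn -exprM mulnC exprM (_ : 2 ^+ 2 = 4 :> R); last by ring.
  by field; rewrite expf_neq0//= gt_eqF.
lra.
Qed.

(** Integrate from a base point: by [goursat] the difference of two such integrals is the integral
    over the segment that joins the end points. *)
Lemma primitive (A : set C) (f : C -> C) : convexC A -> open A -> holomorphic_on A f ->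
  exists F : C -> C, forall z, A z -> cder F z (f z).
Proof.
move=> cA oA hf; have [[z0 Az0]|nA] := pselect (exists z, A z); last first.
  by exists f => z Az; case: nA; exists z.
have I p q : A p -> A q -> ctsI (fun t => f (p + t%:C * (q - p))).
  by move=> Ap Aq; exact: hol_ctsI hf Ap Aq.
exists (sint f z0) => z Az; apply/cderP => e e0.
have /nbhsCP[r r0 rA] : nbhs z A by apply: open_nbhs_nbhs.
have /cvgCP/(_ _ e0)/nbhsCP[d d0 dP] := cder_cts (derivable_cder (hf _ Az)).
apply/nbhsCP; exists (Num.min r d); first by rewrite lt_min r0.
move=> w; rewrite lt_min => /andP[wr wd]; have Aw := rA _ wr.
have := goursat cA hf Az0 Az Aw; rewrite /tri (sint_swap (I _ _ Az0 Aw)) => H.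
have -> : sint f z0 w - sint f z0 z = sint f z w.
  by apply/eqP; rewrite subr_eq addrC -subr_eq0 -oppr_eq0 opprB H.
have -> : sint f z w - f z * (w - z) = sint (fun x => f x + (-1) * f z) z w.
  rewrite /sint (cintD (I _ _ Az Aw) (@ctsI_cst ((-1) * f z))).
  rewrite (@cintE _ (fun=> (-1) * f z) (fun t => 0 + (-1) * f z * t%:C)).
    by rewrite realC0 realC1; ring.
  by move=> t _; exact: rder_aff.
apply: sint_le.
  exact: (ctsID (I _ _ Az Aw) (@ctsI_cst ((-1) * f z))).
move=> t t01; rewrite mulN1r ltW//; apply: dP.
rewrite addrC addKr normcM normc_real ger0_norm; last by case/andP: t01.
apply: le_lt_trans wd; rewrite ler_piMl ?normc_ge0//; by case/andP: t01.
Qed.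

End Integral.

(** * Cauchy's formula and removable singularities *)

Arguments normc : simpl never.

Section Cauchy.
Context {R : realType}.
Local Notation C := (Cplx R).
Implicit Types (z w : C) (r s t e l : R) (f : C -> C) (g : R -> C).

Definition disk (r : R) : set C := [set z | normc z < r].

Lemma cdiskE r : cdisk r = disk r.
Proof. by apply/funext => z; apply/propext; rewrite /cdisk /disk/= normcE' ltcR. Qed.

Lemma disk_convex r : convexC (disk r).
Proof.
move=> a b t /= ar br /andP[t0 t1].
have -> : a + t%:C * (b - a) = (1 - t)%:C * a + t%:C * b.
  by rewrite realCB realC1; ring.
apply: le_lt_trans (le_normcD _ _) _; rewrite !normcM !normc_real !ger0_norm ?subr_ge0//.
have [->|tn0] := eqVneq t 0; first by rewrite subr0 mul1r mul0r addr0.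
have -> : r = (1 - t) * r + t * r by ring.
apply: ler_ltD; first by rewrite ler_wpM2l ?subr_ge0// ltW.
by rewrite ltr_pM2l// lt_neqAle eq_sym tn0.
Qed.

Lemma nbhs_disk r z : disk r z -> nbhs z (disk r).
Proof.
move=> zr; apply/nbhsCP; exists (r - normc z); first by rewrite subr_gt0.
move=> w wz; rewrite /disk/= -(subrK z w); apply: le_lt_trans (le_normcD _ _) _.
by rewrite -ltrBrDr.
Qed.

Lemma disk_open r : open (disk r).
Proof. by rewrite openE => z; exact: nbhs_disk. Qed.

(** Differentiation under the integral sign: a quadratic remainder, uniform in [t], takes the place
    of dominated convergence. *)
Lemma cint_param (k : C -> R -> C) (k' : R -> C) (z : C) (M d : R) :
  0 < d -> 0 <= M ->
  (forall w, normc (w - z) < d -> ctsI (k w)) -> ctsI k' ->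
  (forall w (t : R), normc (w - z) < d -> 0 <= t <= 1 ->
     normc (k w t - k z t - k' t * (w - z)) <= M * normc (w - z) ^+ 2) ->
  cder (fun w => cint (k w)) z (cint k').
Proof.
move=> d0 M0 ck ck' H; apply/cderP => e e0.
have M1 : 0 < M + 1 by rewrite ltr_wpDl.
apply/nbhsCP; exists (Num.min d (e / (M + 1))); first by rewrite lt_min d0 divr_gt0.
move=> w; rewrite lt_min => /andP[wd we].
have cz : ctsI (k z) by apply: ck; rewrite subrr normc0.
have cw := ck _ wd.
have c1 : ctsI (fun t => (-1) * k z t) by exact: ctsIM (@ctsI_cst _ (-1)) cz.
have c2 : ctsI (fun t => - (w - z) * k' t) by exact: ctsIM (@ctsI_cst _ (- (w - z))) ck'.
have -> : cint (k w) - cint (k z) - cint k' * (w - z) =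
    cint (fun t => k w t + (-1) * k z t + - (w - z) * k' t).
  rewrite (cintD (ctsID cw c1) c2) (cintD cw c1) !cintZ//; ring.
apply: le_trans (cint_le (M := M * normc (w - z) ^+ 2) (ctsID (ctsID cw c1) c2) _) _.
  move=> t t01; have := H _ _ wd t01; congr (normc _ <= _); ring.
rewrite expr2 mulrA; apply: ler_wpM2r; first exact: normc_ge0.
move: we; rewrite ltr_pdivlMr// => we; apply: le_trans (ltW we).
by rewrite mulrC; apply: ler_wpM2l; rewrite ?normc_ge0// lerDl.
Qed.

Definition circ (r t : R) : C := r%:C * cexp (t%:C * (0 +i* (2 * pi))).

Lemma Re_circ_arg t : complex.Re (t%:C * (0 +i* (2 * pi)) : C) = 0.
Proof. by rewrite /= mulr0 mul0r subr0. Qed.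

Lemma normc_circ r t : 0 <= r -> normc (circ r t) = r.
Proof.
by move=> r0; rewrite normcM normc_real ger0_norm// normc_cexp Re_circ_arg expR0 mulr1.
Qed.

Lemma circ01 r : circ r 1 = circ r 0.
Proof. by rewrite /circ realC1 mul1r realC0 mul0r cexp_2pi cexp0. Qed.

Definition tpi : C := 0 +i* (2 * pi).

Lemma tpi_neq0 : tpi != 0.
Proof. by rewrite eq_complex /= negb_and mulf_neq0 ?orbT// gt_eqF// pi_gt0. Qed.

Lemma rder_circ r t : rder (circ r) t (tpi * circ r t).
Proof.
have d := rder_comp (rder_line 0 tpi t) (cderZ r%:C (cder_cexp (0 + t%:C * tpi))).
apply: near_eq_rder (rder_eq d _); last by rewrite /circ add0r /tpi; ring.
by near=> s; rewrite /= add0r.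
Unshelve. all: by end_near. Qed.

Lemma ctsI_rder (g g' : R -> C) : (forall t, rder g t (g' t)) -> ctsI g.
Proof. by move=> dg t _; exact: rder_cts (dg t). Qed.

Lemma ctsI_circ r : ctsI (circ r).
Proof. exact: ctsI_rder (rder_circ r). Qed.

Lemma segment_near (P : R -> R -> Prop) (F : set_system R) : Filter F ->
  (forall t : R, 0 <= t <= 1 -> \forall s \near t & e \near F, P e s) ->
  \forall e \near F, forall t : R, 0 <= t <= 1 -> P e t.
Proof.
move=> FF H; have /compact_near_coveringP K := @segment_compact R 0 1.
have := K R F P FF; rewrite /subset => /(_ _)/wrap[t|].
  by rewrite /= in_itv/=; exact: H.
by apply: filterS => e he t t01; apply: he; rewrite /= in_itv.
Qed.

Lemma ctsI_bounded g : ctsI g ->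
  exists B : R, 0 <= B /\ forall t, 0 <= t <= 1 -> normc (g t) <= B.
Proof.
move=> cg.
have : \forall B \near +oo, forall t : R, 0 <= t <= 1 -> normc (g t) <= B.
  apply: (@segment_near (fun B t => normc (g t) <= B)) => t t01.
  have /cvgCP/(_ 1 ltr01) h := cg t t01.
  exists ([set s | normc (g s - g t) < 1], [set B | normc (g t) + 1 <= B]).
    by split => //=; apply: nbhs_pinfty_ge; rewrite num_real.
  move=> [s B] /= [h1 h2]; apply: le_trans h2.
  rewrite -(subrK (g t) (g s)) addrC; apply: le_trans (le_normcD _ _) _.
  by rewrite lerD2l ltW.
move=> h; have [B [B0 BP]] : exists B : R, 0 <= B /\ (forall t : R, 0 <= t <= 1 -> normc (g t) <= B).
  near (+oo : set_system R) => B; exists B; split; last by near: B.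
  by near: B; apply: nbhs_pinfty_ge; rewrite num_real.
by exists B.
Unshelve. all: by end_near. Qed.

Lemma ctsI_unif g f e : ctsI g -> 0 < e ->
  (forall t : R, 0 <= t <= 1 -> {for g t, continuous f}) ->
  exists2 d : R, 0 < d & forall t w, 0 <= t <= 1 -> normc (w - g t) < d ->
    normc (f w - f (g t)) < e.
Proof.
move=> cg e0 cf; have e2 : 0 < e / 2 by rewrite divr_gt0.
have h : \forall d \near (0 : R)^'+, forall t : R, 0 <= t <= 1 ->
    forall w, normc (w - g t) < d -> normc (f w - f (g t)) < e.
  apply: (@segment_near (fun d t => forall w, normc (w - g t) < d ->
    normc (f w - f (g t)) < e)) => t t01.
  have /cvgCP/(_ _ e2)/nbhsCP[d d0 dP] := cf t t01.
  have d2 : 0 < d / 2 by rewrite divr_gt0.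
  have /cvgCP/(_ _ d2) h := cg t t01.
  exists ([set s | normc (g s - g t) < d / 2], [set x | x < d / 2]).
    by split => //=; exact: nbhs_right_lt.
  move=> [s x] /= [h1 h2] w wx.
  have w1 : normc (f (g s) - f (g t)) < e / 2 by apply: dP; lra.
  have w2 : normc (f w - f (g t)) < e / 2.
    by apply: dP; have := le_normc_dist w (g s) (g t); lra.
  by have := le_normc_dist (f w) (f (g t)) (f (g s)); rewrite (normcB (f (g t))); lra.
near (0 : R)^'+ => d; exists d; first by near: d; exact: nbhs_right_gt.
move=> t w t01; move: w; move: t t01; near: d; exact: h.
Unshelve. all: by end_near. Qed.

Lemma ctsI_comp (f : C -> C) (g : R -> C) : ctsI g ->
  (forall t : R, 0 <= t <= 1 -> {for g t, continuous f}) -> ctsI (fun t => f (g t)).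
Proof. by move=> cg cf t t01; apply: continuous_comp; [exact: cg|exact: cf]. Qed.

Lemma ctsIV (g : R -> C) : ctsI g -> (forall t : R, 0 <= t <= 1 -> g t != 0) ->
  ctsI (fun t => (g t)^-1).
Proof. by move=> cg g0 t t01; apply: cvgV; [exact: g0|exact: cg]. Qed.

Lemma ctsIX (g : R -> C) n : ctsI g -> ctsI (fun t => g t ^+ n).
Proof.
move=> cg; elim: n => [|n IH].
  have -> : (fun t => g t ^+ 0) = fun=> 1 by apply/funext => t; rewrite expr0.
  exact: ctsI_cst.
have -> : (fun t => g t ^+ n.+1) = fun t => g t * g t ^+ n.
  by apply/funext => t; rewrite exprS.
exact: ctsIM.
Qed.

Lemma circ_sub_ge (r s t : R) (z : C) : 0 <= r -> normc z <= s ->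
  r - s <= normc (circ r t - z).
Proof.
move=> r0 zs; apply: le_trans (ge_normcB _ _); rewrite normc_circ//.
by rewrite lerB.
Qed.

Lemma circ_sub_neq0 (r t : R) (z : C) : normc z < r -> circ r t - z != 0.
Proof.
move=> zr; rewrite -normc_gt0.
have r0 : 0 <= r by apply: le_trans (ltW zr); exact: normc_ge0.
by apply: lt_le_trans (circ_sub_ge t r0 (lexx _)); rewrite subr_gt0.
Qed.

(** A Cauchy integral against dt. Since d zeta = 2 i pi zeta dt on the circle, the density
    [f (circ r t) * circ r t] with [n = 1] is the usual Cauchy integral of [f], prefactor
    included. *)
Definition ker (r : R) (n : nat) (g : R -> C) (z : C) : C :=
  cint (fun t => g t * (circ r t - z)^-1 ^+ n).

Lemma ctsI_ker r n g z : normc z < r -> ctsI g ->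
  ctsI (fun t => g t * (circ r t - z)^-1 ^+ n).
Proof.
move=> zr cg; apply: (ctsIM cg); apply: ctsIX; apply: ctsIV.
  exact: ctsID (@ctsI_circ r) (@ctsI_cst _ (- z)).
by move=> t _; exact: circ_sub_neq0.
Qed.

(** The mean value inequality is applied twice: to the derivative, then to the function minus its
    linear part. *)
Lemma inv_pow_taylor (a h : C) (n : nat) (s : R) : 0 < s ->
  (forall t : R, 0 <= t <= 1 -> s <= normc (a - t%:C * h)) ->
  normc ((a - h)^-1 ^+ n - a^-1 ^+ n - n%:R * a^-1 ^+ n.+1 * h) <=
    (n * n.+1)%:R * s^-1 ^+ n.+2 * normc h ^+ 2.
Proof.
move=> s0 H.
have nz (w : C) : s <= normc w -> w != 0.
  by move=> sw; rewrite -normc_gt0; exact: lt_le_trans sw.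
have du k (w : C) : s <= normc (a - w) ->
    cder (fun w : C => (a - w)^-1 ^+ k) w (k%:R * (a - w)^-1 ^+ k.+1).
  move=> sw; apply: (cder_eq (cderX k (cderV (f := fun w => a - w) (nz _ sw)
    (cderB (cder_cst a w) (cder_id w))))).
  case: k => [|k]; first by rewrite !mul0r.
  rewrite /= sub0r opprK -!mulrA !exprVn; congr (_ * _).
  have := nz _ sw; move: (a - w) => x x0.
  by rewrite !exprSr; field; rewrite x0 expf_neq0.
have seg (t : R) : 0 <= t <= 1 -> s <= normc (a - (0 + t%:C * (h - 0))).
  by move=> t01; rewrite add0r subr0; exact: H.
pose u' (w : C) : C := n%:R * (a - w)^-1 ^+ n.+1.
pose M := (n * n.+1)%:R * s^-1 ^+ n.+2 : R.
have M0 : 0 <= M by rewrite mulr_ge0// exprn_ge0// invr_ge0 ltW.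
have L t : 0 <= t <= 1 -> normc (u' (t%:C * h) - u' 0) <= M * normc h.
  move=> t01; have := @cder_mvt _ u' 0 (t%:C * h)
    (fun w => n%:R * (n.+1%:R * (a - w)^-1 ^+ n.+2)) M.
  have sg (x : R) : 0 <= x <= 1 -> s <= normc (a - (0 + x%:C * (t%:C * h - 0))).
    move=> x01; rewrite add0r subr0 mulrA -realCM; apply: H.
    case/andP: x01 => ? ?; case/andP: t01 => ? ?.
    by rewrite mulr_ge0//= mulr_ile1.
  move=> /(_ _ _)/wrap[x x01|x x01|].
  - by apply: cderZ; apply: du; exact: sg.
  - rewrite mulrA -natrM normcM normcX normcV.
    rewrite -realC_nat normc_real ger0_norm// ler_wpM2l//.
    rewrite lerXn2r ?nnegrE ?invr_ge0 ?normc_ge0 ?(ltW s0)//.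
    by rewrite lef_pV2 ?posrE ?(lt_le_trans s0)// sg.
  rewrite subr0 normcM normc_real => /le_trans; apply.
  case/andP: t01 => t0 t1; rewrite ger0_norm// ler_wpM2l//.
  by rewrite ler_piMl// normc_ge0.
have := @cder_mvt _ (fun w : C => (a - w)^-1 ^+ n - u' 0 * w) 0 h
  (fun w => u' w - u' 0) (M * normc h).
move=> /(_ _ _)/wrap[x x01|x x01|].
- apply: (cder_eq (cderB (du n _ (seg _ x01)) (cderZ (u' 0) (cder_id _)))).
  by rewrite mulr1.
- by rewrite add0r subr0; exact: L.
rewrite subr0 -/M expr2 mulrA subr0; congr (normc _ <= _).
by rewrite /u' subr0 mulr0 subr0; ring.
Qed.

Lemma cder_ker r n g z : normc z < r -> ctsI g ->
  cder (ker r n g) z (n%:R * ker r n.+1 g z).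
Proof.
move=> zr cg; have r0 : 0 <= r by apply: le_trans (ltW zr); exact: normc_ge0.
pose s := (r - normc z) / 2; have s0 : 0 < s by rewrite divr_gt0// subr_gt0.
have [B0 [B B0p]] : exists B, (0 <= B) /\ forall t : R, 0 <= t <= 1 -> normc (g t) <= B.
  exact: ctsI_bounded.
have ball w : normc (w - z) < s -> normc w <= normc z + s.
  move=> wz; rewrite -(subrK z w) addrC; apply: le_trans (le_normcD _ _) _.
  by rewrite lerD2l ltW.
have zs : normc z + s < r by rewrite /s; lra.
rewrite /ker -cintZ; last exact: ctsI_ker.
apply: (@cint_param (fun w t => g t * (circ r t - w)^-1 ^+ n)
  (fun t => n%:R * (g t * (circ r t - z)^-1 ^+ n.+1)) z (B0 * ((n * n.+1)%:R * s^-1 ^+ n.+2)) s s0).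
- by rewrite mulr_ge0// mulr_ge0// exprn_ge0// invr_ge0 ltW.
- by move=> w wz; apply: ctsI_ker => //; apply: le_lt_trans zs; exact: ball.
- exact: (ctsIM (@ctsI_cst _ n%:R) (@ctsI_ker _ n.+1 _ _ zr cg)).
move=> w t wz t01.
have := @inv_pow_taylor (circ r t - z) (w - z) n s s0.
move=> /(_ _)/wrap[x x01|H].
  have -> : circ r t - z - x%:C * (w - z) = circ r t - (z + x%:C * (w - z)) by ring.
  have -> : s = r - (normc z + s) by rewrite /s; field.
  apply: circ_sub_ge => //; apply: ball.
  rewrite addrC addKr normcM normc_real.
  case/andP: x01 => x0 x1; rewrite ger0_norm//; apply: le_lt_trans wz.
  by rewrite ler_piMl// normc_ge0.
have -> : circ r t - w = circ r t - z - (w - z) by ring.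
rewrite [X in normc X](_ : _ = g t * ((circ r t - z - (w - z))^-1 ^+ n -
  (circ r t - z)^-1 ^+ n - n%:R * (circ r t - z)^-1 ^+ n.+1 * (w - z))); last by ring.
rewrite normcM -[leRHS]mulrA; apply: ler_pM => //; rewrite ?normc_ge0//.
exact: B0p.
Qed.

Lemma cint_circ_period (g g' : R -> C) : (forall t : R, 0 <= t <= 1 -> rder g t (g' t)) ->
  g 1 = g 0 -> cint g' = 0.
Proof. by move=> dg g01; rewrite (cintE dg) g01 subrr. Qed.

(** The derivative in [z] vanishes, because its integrand is the [t]-derivative of a function with
    equal values at both ends; at the centre the integrand is 1. *)
Lemma winding r z : normc z < r -> ker r 1 (circ r) z = 1.
Proof.
move=> zr; have r0 : 0 < r by apply: le_lt_trans zr; exact: normc_ge0.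
have d0 w : disk r w -> cder (ker r 1 (circ r)) w 0.
  move=> wr; apply: (cder_eq (cder_ker 1 wr (@ctsI_circ r))).
  rewrite mul1r /ker; apply: (@cint_circ_period
    (fun t => (- tpi^-1) * (circ r t - w)^-1)); last by rewrite circ01.
  move=> t t01; have nz := @circ_sub_neq0 r t w wr.
  have dV : cder (fun x => (x - w)^-1) (circ r t) (- (1 - 0) / (circ r t - w) ^+ 2).
    exact: (cderV (f := fun x => x - w) nz (cderB (cder_id _) (cder_cst w _))).
  apply: (rder_eq (rderZ (- tpi^-1) (rder_comp (rder_circ r t) dV))).
  by field; rewrite nz tpi_neq0.
have z0 : disk r 0 by rewrite /disk/= normc0.
rewrite (cder0_cst (@disk_convex r) d0 (b := 0) zr z0) /ker.
have E t : 0 <= t <= 1 -> (1 : C) = circ r t * (circ r t - 0)^-1 ^+ 1.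
  move=> _; rewrite subr0 expr1 divff//.
  by rewrite -normc_gt0 normc_circ// ltW.
rewrite -(@eq_cint _ (fun=> 1) _ (@ctsI_cst _ 1) E).
rewrite (cintE (G := fun t => 0 + 1 * t%:C)); first by rewrite realC1 realC0; ring.
by move=> t _; exact: rder_aff.
Qed.

(** The circle is contracted to [z] along [pt l]. The [l]-derivative of the integral is the integral
    of a [t]-derivative of a periodic function, hence 0; at l = 0 the integral is [F z] times the
    winding number. Continuity of the derivative [f] justifies differentiating under the
    integral. *)
Lemma cauchy_C1 (F f : C -> C) rho r z : r < rho -> normc z < r ->
  (forall w, disk rho w -> cder F w (f w)) ->
  (forall w, disk rho w -> {for w, continuous f}) ->
  F z = ker r 1 (fun t => F (circ r t) * circ r t) z.
Proof.
move=> rrho zr dF cf; have r0 : 0 < r by apply: le_lt_trans zr; exact: normc_ge0.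
pose pt (l : R) t := z + l%:C * (circ r t - z).
pose k t := circ r t * (circ r t - z)^-1.
have ck : ctsI k.
  apply: (ctsIM (@ctsI_circ r)); apply: ctsIV.
    exact: ctsID (@ctsI_circ r) (@ctsI_cst _ (- z)).
  by move=> t _; exact: circ_sub_neq0.
have cpt l : ctsI (pt l).
  apply: (ctsID (@ctsI_cst _ z)); apply: (ctsIM (@ctsI_cst _ l%:C)).
  exact: ctsID (@ctsI_circ r) (@ctsI_cst _ (- z)).
have npt l t : 0 <= l <= 1 -> normc (pt l t) <= r.
  move=> l01; have := @convex_normc_ball R 0 r z (circ r t) l.
  by rewrite /= !subr0 normc_circ ?(ltW r0)//; apply => //; exact: ltW.
have dpt l t : 0 <= l <= 1 -> disk rho (pt l t).
  by move=> l01; apply: le_lt_trans rrho; exact: npt.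
pose Phi l := cint (fun t => F (pt l t) * k t).
have dPhi l : 0 <= l <= 1 -> rder Phi l 0.
  move=> l01.
  have zero : cint (fun t => f (pt l t) * circ r t) = 0.
    (* The general antiderivative divides by [l]; at l = 0 the integrand is a constant multiple of
       [circ r]. *)
    have [l0|l0] := eqVneq l 0.
      apply: (@cint_circ_period (fun t => (f z / tpi) * circ r t)); last by rewrite circ01.
      move=> t t01; apply: (rder_eq (rderZ (f z / tpi) (rder_circ r t))).
      by rewrite /pt l0 realC0 mul0r addr0; field; exact: tpi_neq0.
    have lC : l%:C != 0 :> C by apply/eqP => /complexI/eqP; rewrite (negbTE l0).
    apply: (@cint_circ_period (fun t => (tpi * l%:C)^-1 * F (pt l t))); last first.
      by rewrite /pt circ01.
    move=> t t01.
    have dp : rder (pt l) t (l%:C * (tpi * circ r t)).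
      have d1 : rder (fun t => circ r t + (- z + 0 * t%:C)) t (tpi * circ r t + 0).
        exact: rderD (rder_circ r t) (rder_aff (- z) 0 t).
      have d2 := rderD (rder_aff z 0 t) (rderZ l%:C d1).
      apply: near_eq_rder (rder_eq d2 _); last by ring.
      by near=> x; rewrite /pt; ring.
    apply: (rder_eq (rderZ (tpi * l%:C)^-1 (rder_comp dp (dF _ (dpt l t l01))))).
    by field; rewrite lC tpi_neq0.
  move=> e e0; have e1 : 0 < e / r by rewrite divr_gt0.
  have [d d0 dP] := ctsI_unif (cpt l) e1 (fun t t01 => cf _ (dpt l t l01)).
  have m0 : 0 < Num.min d (rho - r) / (2 * r).
    by rewrite divr_gt0 ?mulr_gt0// lt_min d0 subr_gt0.
  near=> s.
  have sl : `|s - l| < Num.min d (rho - r) / (2 * r).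
    by rewrite distrC; near: s; apply: cvgr_dist_lt.
  have pE t : pt s t - pt l t = (s - l)%:C * (circ r t - z).
    by rewrite /pt realCB; ring.
  have nz t : normc (circ r t - z) <= 2 * r.
    apply: le_trans (le_normcB _ _) _; rewrite normc_circ; last exact: ltW.
    by rewrite mulr_natl mulr2n lerD2l ltW.
  have pB t : normc (pt s t - pt l t) < Num.min d (rho - r).
    rewrite pE normcM normc_real; move: sl; rewrite ltr_pdivlMr ?mulr_gt0//.
    by apply: le_lt_trans; rewrite ler_wpM2l.
  have seg t (x : R) : 0 <= x <= 1 ->
      normc (pt l t + x%:C * (pt s t - pt l t) - pt l t) < Num.min d (rho - r).
    case/andP => x0 x1; rewrite addrC addKr normcM normc_real ger0_norm//.
    by apply: le_lt_trans (pB t); rewrite ler_piMl// normc_ge0.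
  have seg2 t (x : R) : 0 <= x <= 1 -> disk rho (pt l t + x%:C * (pt s t - pt l t)).
    move=> x01; have := seg t x x01; rewrite lt_min => /andP[_ h].
    rewrite -[X in disk rho X](subrK (pt l t)).
    apply: le_lt_trans (le_normcD _ _) _.
    by have := npt l t l01; move: h; lra.
  have dps t : disk rho (pt s t).
    have := seg2 t 1; rewrite realC1 mul1r addrC subrK; apply.
    by rewrite ler01 lexx.
  have cFs : ctsI (fun t => F (pt s t) * k t).
    apply: (ctsIM _ ck); apply: (ctsI_comp (cpt s)) => t t01.
    exact: cder_cts (dF _ (dps t)).
  have cFl : ctsI (fun t => F (pt l t) * k t).
    apply: (ctsIM _ ck); apply: (ctsI_comp (cpt l)) => t t01.
    exact: cder_cts (dF _ (dpt l t l01)).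
  have cfl : ctsI (fun t => f (pt l t) * circ r t).
    apply: (ctsIM _ (@ctsI_circ r)); apply: (ctsI_comp (cpt l)) => t t01.
    exact: cf _ (dpt l t l01).
  have c1 := ctsIM (@ctsI_cst _ (-1)) cFl.
  have c2 := ctsIM (@ctsI_cst _ (- (s - l)%:C)) cfl.
  have -> : Phi s - Phi l - 0 * (s - l)%:C =
      cint (fun t => F (pt s t) * k t + (-1) * (F (pt l t) * k t) +
        (- (s - l)%:C) * (f (pt l t) * circ r t)).
    rewrite (cintD (ctsID cFs c1) c2) (cintD cFs c1) !cintZ// zero /Phi; ring.
  apply: (cint_le (ctsID (ctsID cFs c1) c2)) => t t01.
  have kE : (circ r t - z) * k t = circ r t.
    by rewrite /k mulrC divfK// circ_sub_neq0.
  have -> : F (pt s t) * k t + (-1) * (F (pt l t) * k t) +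
     (- (s - l)%:C) * (f (pt l t) * circ r t) =
     (F (pt s t) - F (pt l t) - f (pt l t) * (pt s t - pt l t)) * k t.
    by rewrite pE -[in LHS]kE; ring.
  have H : normc (F (pt s t) - F (pt l t) - f (pt l t) * (pt s t - pt l t)) <=
      e / r * normc (pt s t - pt l t).
    have := @cder_mvt _ (fun w => F w - f (pt l t) * w) (pt l t) (pt s t)
      (fun w => f w - f (pt l t)) (e / r).
    move=> /(_ _ _)/wrap[x x01|x x01|].
    - apply: (cder_eq (cderB (dF _ (seg2 t x x01)) (cderZ (f (pt l t)) (cder_id _)))).
      by rewrite mulr1.
    - apply: ltW; apply: dP => //.
      by have := seg t x x01; rewrite lt_min => /andP[].
    by congr (normc _ <= _); ring.
  rewrite normcM; apply: le_trans (ler_wpM2r (normc_ge0 _) H) _.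
  rewrite -[leLHS]mulrA -normcM pE -(mulrA (s - l)%:C) kE normcM normc_circ ?normc_real; last exact: ltW.
  have -> : e / r * (`|s - l| * r) = e * `|s - l| by field; rewrite gt_eqF.
  exact: lexx.
have := @rder_majorant _ Phi (fun=> 0) (fun=> 0) (fun=> 0) 0 1 ler01 dPhi.
rewrite subrr => /(_ (fun t _ => is_derive_cst _ _ _)) /(_ _)/wrap[].
  by move=> t _; rewrite normc0.
rewrite le_eqVlt ltNge normc_ge0 orbF normc_eq0 subr_eq0 => /eqP H1.
have -> : ker r 1 (fun t => F (circ r t) * circ r t) z = Phi 1.
  rewrite /ker /Phi; congr cint; apply/funext => t.
  rewrite /pt realC1 mul1r (addrC z) subrK /k expr1.
  by rewrite mulrA.
rewrite H1 /Phi -[LHS]mulr1 -(winding zr) /ker.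
rewrite -(cintZ (F z) (@ctsI_ker r 1 _ _ zr (@ctsI_circ r))).
by congr cint; apply/funext => t; rewrite /pt realC0 mul0r addr0 expr1.
Unshelve. all: by end_near. Qed.

Lemma between_gt0 (a b : R) : 0 <= a -> a < b -> exists c, [/\ 0 < c, a < c & c < b].
Proof. by move=> a0 ab; exists ((a + b) / 2); split; lra. Qed.

(** A primitive [F] of [f] has the continuous derivative [f], so [cauchy_C1] applies to it. Then
    [F], [f] and the derivative of [f] are Cauchy integrals, and these are differentiable. *)
Lemma hol_deriv (rho : R) f :
  holomorphic_on (disk rho) f -> holomorphic_on (disk rho) (derive1 f).
Proof.
move=> hf; have [F dF] := primitive (@disk_convex rho) (@disk_open rho) hf.
move=> z zrho; have [r [r0 zr rrho]] := between_gt0 (normc_ge0 z) zrho.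
pose G t := F (circ r t) * circ r t.
have cG : ctsI G.
  apply: (ctsIM _ (@ctsI_circ r)); apply: (ctsI_comp (@ctsI_circ r)) => t _.
  by apply: (cder_cts (dF _ _)); rewrite /disk/= normc_circ// ltW.
have cf w : disk rho w -> {for w, continuous f}.
  by move=> wr; exact: cder_cts (derivable_cder (hf _ wr)).
have FE w : disk r w -> F w = ker r 1 G w by move=> wr; exact: cauchy_C1 dF cf.
have fE w : disk r w -> f w = ker r 2 G w.
  move=> wr; apply: (cder_unique (dF w (lt_trans wr rrho))).
  apply: (near_eq_cder _ (cder_eq (cder_ker 1 wr cG) (mul1r _))).
  by apply: filterS (nbhs_disk wr) => x xr; rewrite FE.
have dfE w : disk r w -> derive1 f w = 2 * ker r 3 G w.
  move=> wr; apply: cder1; apply: (near_eq_cder _ (cder_ker 2 wr cG)).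
  by apply: filterS (nbhs_disk wr) => x xr; rewrite fE.
apply: cder_derivable (near_eq_cder _ (cderZ 2 (cder_ker 3 zr cG))).
by apply: filterS (nbhs_disk (zr : disk r z)) => x xr; rewrite dfE.
Qed.

Lemma cauchy (rho r : R) f z : holomorphic_on (disk rho) f -> r < rho -> normc z < r ->
  f z = ker r 1 (fun t => f (circ r t) * circ r t) z.
Proof.
move=> hf rrho zr; apply: (cauchy_C1 (f := derive1 f) rrho zr) => w wr.
  exact: derivable_cder (hf _ wr).
exact: cder_cts (derivable_cder (hol_deriv hf wr)).
Qed.

(** Without the factor [circ r t], this is the Cauchy integral of f(zeta) / zeta; by [divzE] it
    extends (f z - f 0) / z across 0. *)
Definition divz r f z := ker r 1 (fun t => f (circ r t)) z.

Lemma ctsI_hol_circ (rho r : R) f : 0 <= r -> r < rho -> holomorphic_on (disk rho) f ->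
  ctsI (fun t => f (circ r t)).
Proof.
move=> r0 rrho hf; apply: (ctsI_comp (@ctsI_circ r)) => t _.
by apply: (cder_cts (derivable_cder (hf _ _))); rewrite /disk/= normc_circ.
Qed.

Lemma divz_hol (rho r : R) f : 0 <= r -> r < rho -> holomorphic_on (disk rho) f ->
  holomorphic_on (disk r) (divz r f).
Proof.
move=> r0 rrho hf z zr; exact: cder_derivable (cder_ker 1 zr (ctsI_hol_circ r0 rrho hf)).
Qed.

Lemma divzE (rho r : R) f z : 0 < r -> r < rho -> holomorphic_on (disk rho) f ->
  normc z < r -> f z = f 0 + z * divz r f z.
Proof.
move=> r0 rrho hf zr; have z0 : normc (0 : C) < r by rewrite normc0.
rewrite [LHS](cauchy hf rrho zr) (cauchy hf rrho z0) /divz /ker.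
have cf := ctsI_hol_circ (ltW r0) rrho hf.
have c0 := @ctsI_ker _ 1 _ _ z0 (ctsIM cf (@ctsI_circ r)).
have c1 := @ctsI_ker _ 1 _ _ zr cf.
rewrite -(cintZ z c1) -(cintD c0 (ctsIM (@ctsI_cst _ z) c1)).
congr cint; apply/funext => t; rewrite !expr1 subr0; field.
by rewrite circ_sub_neq0// -normc_gt0 normc_circ// ltW.
Qed.

(** The function [z ^+ 2 * f z], extended by 0, is holomorphic and vanishes to second order at 0. It
    is divided by [z] twice, and each division costs a little of the radius. *)
Lemma removable_disk (rho M : R) f : 0 < rho ->
  (forall z, disk rho z -> z != 0 -> derivable f z 1) ->
  (forall z, disk rho z -> z != 0 -> normc (f z) <= M) ->
  forall r, 0 < r -> r < rho -> exists2 g : C -> C, holomorphic_on (disk r) g &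
    forall z, disk r z -> z != 0 -> f z = g z.
Proof.
move=> rho0 df fM r r0 rrho.
pose h z := if z == 0 then 0 else z ^+ 2 * f z.
have hE z : z != 0 -> h z = z ^+ 2 * f z by rewrite /h => /negbTE ->.
have h0 : cder h 0 0.
  have M1 : 0 < `|M| + 1 by rewrite ltr_wpDl.
  apply/cderP => e e0; apply/nbhsCP.
  exists (Num.min rho (e / (`|M| + 1))); first by rewrite lt_min rho0 divr_gt0.
  move=> w; rewrite !subr0 mul0r subr0 lt_min => /andP[wrho we].
  have [->|w0] := eqVneq w 0.
    by rewrite subrr normc0 mulr_ge0// ?ltW// normc_ge0.
  rewrite hE// [h 0](_ : _ = 0) ?subr0; last by rewrite /h eqxx.
  rewrite normcM normcX expr2 -mulrA mulrC.
  apply: ler_wpM2r; first exact: normc_ge0.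
  have := fM w wrho w0; move: we; rewrite ltr_pdivlMr// => we fw.
  apply: le_trans (ltW we); apply: ler_wpM2l; first exact: normc_ge0.
  by apply: le_trans fw _; have := ler_norm M; lra.
have hh : holomorphic_on (disk rho) h.
  move=> z zr; have [->|z0] := eqVneq z 0; first exact: cder_derivable h0.
  have d := cderM (cderX 2 (cder_id z)) (derivable_cder (df z zr z0)).
  apply: (cder_derivable (near_eq_cder _ d)).
  have n0 : 0 < normc z by rewrite normc_gt0.
  near=> w; rewrite hE// -normc_gt0.
  have : normc (w - z) < normc z by near: w; exact: near_normc.
  by have := ge_normcB z w; rewrite normcB; lra.
have [r1 [r10 rr1 r1rho]] := between_gt0 (ltW r0) rrho.
have [r2 [r20 rr2 r2rho]] := between_gt0 (ltW r10) r1rho.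
have h1 := divz_hol (ltW r20) r2rho hh.
have z1 : normc (0 : C) < r2 by rewrite normc0.
have h00 : h 0 = 0 by rewrite /h eqxx.
have d0 : divz r2 h 0 = 0.
  have c : cder (fun w : C => h 0 + w * divz r2 h w) 0 (divz r2 h 0).
    have := cderD (cder_cst (h 0) 0) (cderM (cder_id (0 : C)) (derivable_cder (h1 _ z1))).
    by move=> /cder_eq; apply; ring.
  apply: (cder_unique c); apply: near_eq_cder h0.
  by apply: filterS (nbhs_disk z1) => w; exact: (divzE r20 r2rho hh).
exists (divz r1 (divz r2 h)) => [z zr|z zr z0].
  by apply: (divz_hol (ltW r10) rr2 h1); exact: lt_trans rr1.
have zr1 := lt_trans zr rr1; have zr2 := lt_trans zr1 rr2.
have := divzE r20 r2rho hh zr2; rewrite (divzE r10 rr2 h1 zr1) d0 h00 hE//.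
rewrite !add0r mulrA -expr2 => /mulfI; apply.
by rewrite expf_neq0.
Unshelve. all: by end_near. Qed.

End Cauchy.

(** * Local inverses and the calculus of holomorphic germs *)

(* [lra] is slow on atoms that are moduli. *)
Ltac nlra := repeat (match goal with
  | |- context [normc ?x] => let n := fresh "n" in set (n := normc x) in *; clearbody n
  | H : context [normc ?x] |- _ => let n := fresh "n" in set (n := normc x) in *; clearbody n
  end); lra.

Section LocalInverse.
Context {R : realType}.
Local Notation C := (Cplx R).
Implicit Types (z w v y : C) (r s t e l : R) (f : C -> C) (g : C -> C).

Lemma nearCW z (P : C -> Prop) : (forall w, P w) -> \forall w \near z, P w.
Proof. by move=> H; apply/nbhsCP; exists 1. Qed.

Fact cd_key : unit. Proof. by []. Qed.

(* Locked, since conversion would otherwise unfold the limit defining [derive1]. *)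
Definition cd : (C -> C) -> C -> C := locked_with cd_key (@derive1 C C).

Lemma cdE : cd = @derive1 C C.
Proof. exact: unlock. Qed.

Lemma cder_cd f z v : cder f z v -> cd f z = v.
Proof. by rewrite cdE; exact: cder1. Qed.

Lemma derivable_cd f z : derivable f z 1 -> cder f z (cd f z).
Proof. by rewrite cdE; exact: derivable_cder. Qed.

Lemma hol_cd r f : holomorphic_on (disk r) f -> holomorphic_on (disk r) (cd f).
Proof. by rewrite cdE; exact: hol_deriv. Qed.

Lemma continuousCP g z : {for z, continuous g} <->
  forall e, 0 < e -> \forall w \near z, normc (g w - g z) < e.
Proof. exact: (@cvgCP R C (nbhs z) _ g (g z)). Qed.

Lemma convex_open_ball z r : convexC [set w : C | normc (w - z) < r].
Proof.
move=> a b t /= ar br t01.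
have := @disk_convex R r (a - z) (b - z) t ar br t01.
by congr (normc _ < _); ring.
Qed.

Lemma half_pow_eq0 (c x : R) : 0 <= c -> 0 <= x -> (forall n, x <= c / 2 ^+ n) -> x = 0.
Proof.
move=> c0 x0 H; apply: le_anti; rewrite x0 andbT -oppr_ge0.
by apply: (@ge0_half_pow R c) => // n; rewrite addrC subr_ge0.
Qed.

Lemma halving_limitC (x : nat -> C) (c : R) : 0 <= c ->
  (forall n, normc (x n.+1 - x n) <= c / 2 ^+ n.+1) ->
  exists l : C, forall n, normc (x n - l) <= 2 * c / 2 ^+ n.
Proof.
move=> c0 H.
have [a aP] : exists l, forall n, `|complex.Re (x n) - l| <= c / 2 ^+ n.
  apply: halving_limit => // n; apply: le_trans (H n).
  by apply: le_trans (Re_le_normc _); rewrite cReD cReN.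
have [b bP] : exists l, forall n, `|complex.Im (x n) - l| <= c / 2 ^+ n.
  apply: halving_limit => // n; apply: le_trans (H n).
  by apply: le_trans (Im_le_normc _); rewrite cImD cImN.
exists (a +i* b) => n; apply: le_trans (normc_le_ReIm _) _.
rewrite cReD cReN cImD cImN /= -mulrA mulr_natl mulr2n.
exact: lerD (aP n) (bP n).
Qed.

(** [f] minus its linear model is Lipschitz with constant |a| / 2. This gives both the injectivity
    of [f] and the contraction that constructs its inverse. *)
Lemma expand_lower f (f' : C -> C) z0 (a : C) (rho : R) :
  (forall w, normc (w - z0) < rho -> cder f w (f' w)) ->
  (forall w, normc (w - z0) < rho -> normc (f' w - a) <= normc a / 2) ->
  forall w1 w2, normc (w1 - z0) < rho -> normc (w2 - z0) < rho ->
  normc (f w2 - f w1 - a * (w2 - w1)) <= normc a / 2 * normc (w2 - w1).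
Proof.
move=> df fa w1 w2 h1 h2.
have sg t : 0 <= t <= 1 -> normc (w1 + t%:C * (w2 - w1) - z0) < rho.
  exact: (@convex_open_ball z0 rho w1 w2 t h1 h2).
have := @cder_mvt _ (fun w => f w - a * w) w1 w2 (fun w => f' w - a) (normc a / 2).
move=> /(_ _ _)/wrap[t t01|t t01|].
- apply: (cder_eq (cderB (df _ (sg t t01)) (cderZ a (cder_id _)))).
  by rewrite mulr1.
- exact: fa (sg t t01).
by congr (normc _ <= _); ring.
Qed.

Lemma lower_lipschitz f (f' : C -> C) z0 (a : C) (rho : R) :
  (forall w, normc (w - z0) < rho -> cder f w (f' w)) ->
  (forall w, normc (w - z0) < rho -> normc (f' w - a) <= normc a / 2) ->
  forall w1 w2, normc (w1 - z0) < rho -> normc (w2 - z0) < rho ->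
  normc a / 2 * normc (w2 - w1) <= normc (f w2 - f w1).
Proof.
move=> df fa w1 w2 h1 h2; have := expand_lower df fa h1 h2.
have := ge_normcB (a * (w2 - w1)) (a * (w2 - w1) - (f w2 - f w1)).
rewrite subKr normcM (normcB (a * _)); lra.
Qed.

(* The inverse is the fixed point of the half-contraction [w - (f w - y) / a]. *)
Lemma inverse_exists f (f' : C -> C) z0 (a : C) (rho : R) : a != 0 ->
  (forall w, normc (w - z0) < rho -> cder f w (f' w)) ->
  (forall w, normc (w - z0) < rho -> normc (f' w - a) <= normc a / 2) ->
  forall y, 2 * normc (y - f z0) < normc a * rho ->
  exists2 w, normc (w - z0) <= 2 * normc (y - f z0) / normc a & f w = y.
Proof.
move=> a0 df fa y yr; have na : 0 < normc a by rewrite normc_gt0.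
pose c : R := 2 * normc (y - f z0) / normc a; rewrite -/c.
have c0 : 0 <= c by rewrite divr_ge0 ?mulr_ge0 ?normc_ge0.
have crho : c < rho by rewrite /c ltr_pdivrMr// mulrC (mulrC rho) // mulrC.
pose T w := w - (f w - y) / a.
have TL w1 w2 : normc (w1 - z0) < rho -> normc (w2 - z0) < rho ->
    normc (T w2 - T w1) <= normc (w2 - w1) / 2.
  move=> h1 h2; have := expand_lower df fa h1 h2.
  have -> : T w2 - T w1 = - ((f w2 - f w1 - a * (w2 - w1)) / a).
    by rewrite /T; field.
  by rewrite normcN normc_div ler_pdivrMr// => /le_trans; apply; rewrite mulrC mulrA mulrAC.
pose x n := iter n T z0.
have T0 : normc (T z0 - z0) = c / 2.
  rewrite /T addrC addKr normcN normc_div normcB /c; field; exact: lt0r_neq0.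
clearbody c.
have z0in : normc (z0 - z0) < rho by rewrite subrr normc0; exact: le_lt_trans crho.
have xin n : normc (x n - z0) <= c.
  elim: n => [|n IH]; first by rewrite /x /= subrr normc0.
  apply: le_trans (le_normc_dist _ (T z0) _) _; rewrite T0.
  have := TL z0 (x n) z0in (le_lt_trans IH crho).
  by rewrite -/(x n.+1) /x iterS -/(x n); lra.
have xin' n : normc (x n - z0) < rho := le_lt_trans (xin n) crho.
have xS n : normc (x n.+1 - x n) <= c / 2 ^+ n.+1.
  elim: n => [|n IH]; first by rewrite /x /= T0 expr1.
  apply: le_trans (TL _ _ (xin' n) (xin' n.+1)) _.
  rewrite ler_pdivrMr//; apply: le_trans IH _; rewrite [2 ^+ n.+2]exprSr.
  by rewrite invfM mulrA divfK.
have [L LP] := halving_limitC c0 xS.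
have Lc : normc (L - z0) <= c.
  rewrite -subr_ge0; apply: (@ge0_half_pow R (2 * c)) => [|n]; first by rewrite mulr_ge0.
  have := le_normc_dist L (x n) z0; have := LP n; have := xin n.
  by rewrite (normcB L (x n)); lra.
exists L => //; apply/eqP; rewrite -subr_eq0 -normc_eq0; apply/eqP.
(* The error is at most 2 |a| times the distance to the limit, that is 4 |a| c / 2^n, plus a last
   step of |a| c / 2^(n + 1). *)
apply: (@half_pow_eq0 (5 * normc a * c)); rewrite ?mulr_ge0 ?normc_ge0// => n.
have h1 : normc (f L - f (x n)) <= 2 * normc a * normc (L - x n).
  have := expand_lower df fa (xin' n) (le_lt_trans Lc crho).
  have := le_normcD (f L - f (x n) - a * (L - x n)) (a * (L - x n)).
  rewrite subrK normcM => H1 H2.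
  have : 0 <= normc a * normc (L - x n) by rewrite mulr_ge0 ?normc_ge0.
  lra.
have h2 : normc (f (x n) - y) = normc a * normc (x n.+1 - x n).
  rewrite -normcM -normcN; congr normc; rewrite /x iterS -/(x n) /T.
  by field.
apply: le_trans (le_normc_dist _ (f (x n)) _) _; rewrite h2.
have := LP n; rewrite normcB => h3.
have h4 := xS n.
have h5 : normc a * normc (x n.+1 - x n) <= normc a * (c / 2 ^+ n.+1) by rewrite ler_wpM2l ?normc_ge0.
have h6 : 2 * normc a * normc (L - x n) <= 2 * normc a * (2 * c / 2 ^+ n).
  by rewrite ler_wpM2l ?mulr_ge0 ?normc_ge0.
pose q : R := c / 2 ^+ n.+1.
have qE : c / 2 ^+ n = 2 * q by rewrite /q exprS; field; rewrite expf_neq0.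
move: h5 h6 h1; rewrite -!(mulrA _ c) -mulrA -(mulrA 5) -mulrA qE -/q.
have q0 : 0 <= normc a * q by rewrite mulr_ge0 ?normc_ge0// divr_ge0// exprn_ge0.
move: (normc (f L - _)) (normc (L - _)) (normc (x _.+1 - _)) => A B D h5 h6 h1.
have -> : normc a * (2 * q) = 2 * (normc a * q) by ring.
lra.
Qed.

(** Continuity of [g] keeps [g y] where the expansion of [f] at [z0] is valid. The expansion makes
    [g] Lipschitz at [y0] and can then be solved for its increment. *)
Lemma cder_inverse f g z0 y0 v : f z0 = y0 -> g y0 = z0 -> v != 0 ->
  cder f z0 v -> {for y0, continuous g} -> (\forall y \near y0, f (g y) = y) ->
  cder g y0 v^-1.
Proof.
move=> fz gy v0 df cg fg; have nv : 0 < normc v by rewrite normc_gt0.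
apply/cderP => e e0.
pose e' := Num.min (normc v / 2) (e * normc v ^+ 2 / 2).
have e'0 : 0 < e' by rewrite lt_min !divr_gt0// mulr_gt0// exprn_gt0.
have e'1 : e' <= normc v / 2 by rewrite ge_min lexx.
have e'2 : e' <= e * normc v ^+ 2 / 2 by rewrite ge_min lexx orbT.
move/cderP : df => /(_ _ e'0); rewrite -gy => df.
near=> y.
have h : normc (f (g y) - f (g y0) - v * (g y - g y0)) <= e' * normc (g y - g y0).
  by near: y; exact: cg _ df.
have fgy : f (g y) = y by near: y.
rewrite fgy gy fz -gy in h.
have lip : normc (g y - g y0) <= 2 / normc v * normc (y - y0).
  have := ge_normcB (v * (g y - g y0)) (v * (g y - g y0) - (y - y0)).
  rewrite subKr normcM (normcB (v * _)) => h1.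
  have h2 : e' * normc (g y - g y0) <= normc v / 2 * normc (g y - g y0).
    by rewrite ler_wpM2r ?normc_ge0.
  rewrite mulrAC ler_pdivlMr// [_ * normc v]mulrC; lra.
have -> : g y - g y0 - v^-1 * (y - y0) = - (v^-1 * (y - y0 - v * (g y - g y0))).
  by field.
rewrite normcN normcM normcV mulrC ler_pdivrMr//; apply: le_trans h _.
apply: (@le_trans _ _ (e * normc v ^+ 2 / 2 * (2 / normc v * normc (y - y0)))).
  by apply: ler_pM; rewrite ?normc_ge0// ltW.
rewrite le_eqVlt; apply/orP; left; apply/eqP; field; exact: lt0r_neq0.
Unshelve. all: by end_near. Qed.

Lemma holomorphic_atP f z :
  holomorphic_at f z <-> exists2 r, 0 < r & forall w, normc (w - z) < r -> derivable f w 1.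
Proof. exact: nbhsCP. Qed.

Lemma holomorphic_at_derivable f z : holomorphic_at f z -> derivable f z 1.
Proof. exact: nbhs_singleton. Qed.

Lemma holomorphic_at_cder f z : holomorphic_at f z -> cder f z (cd f z).
Proof. by move=> /holomorphic_at_derivable/derivable_cd. Qed.

Lemma near_holomorphic_at f z : holomorphic_at f z -> \forall w \near z, holomorphic_at f w.
Proof. exact: nbhs_interior. Qed.

Lemma near_eq_holomorphic_at f g z : (\forall w \near z, f w = g w) ->
  holomorphic_at f z -> holomorphic_at g z.
Proof.
move=> /nbhs_interior fg hf; rewrite /holomorphic_at; move: fg hf.
apply: filterS2 => w fg /derivable_cd df.
exact: cder_derivable (near_eq_cder fg df).
Qed.

Lemma near_cder_holomorphic_at f (f' : C -> C) z :
  (\forall w \near z, cder f w (f' w)) -> holomorphic_at f z.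
Proof. by apply: filterS => w; exact: cder_derivable. Qed.

Lemma holomorphic_at_disk f z : holomorphic_at f z ->
  exists2 r, 0 < r & holomorphic_on (disk r) (fun w => f (z + w)).
Proof.
move=> /holomorphic_atP[r r0 H]; exists r => // w wr.
have h : derivable f (z + w) 1 by apply: H; rewrite addrC addKr.
have d := cderD (cder_cst z w) (cder_id w).
exact: cder_derivable (cder_comp d (derivable_cd h)).
Qed.

Lemma cder_shift f z w v : cder (fun x => f (z + x)) w v -> cder f (z + w) v.
Proof.
move=> df; have d := cderB (cder_id (z + w)) (cder_cst z (z + w)).
have e : z + w - z = w by rewrite addrC addKr.
have := @cder_comp _ (fun x => x - z) (fun x => f (z + x)) (z + w) _ v d.
rewrite e => /(_ df); rewrite subr0 mulr1; apply: near_eq_cder.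
by apply: nearCW => x /=; rewrite addrC subrK.
Qed.

Lemma holomorphic_at_shift f z : holomorphic_at (fun x => f (z + x)) 0 -> holomorphic_at f z.
Proof.
move=> /holomorphic_atP[r r0 H]; apply/holomorphic_atP; exists r => // w wr.
have -> : w = z + (w - z) by rewrite addrC subrK.
by apply: cder_derivable (cder_shift (derivable_cd (H _ _))); rewrite subr0.
Qed.

Lemma cd_shift f z w : derivable f (z + w) 1 ->
  cd (fun x => f (z + x)) w = cd f (z + w).
Proof.
move=> df; apply: cder_cd; have d := cderD (cder_cst z w) (cder_id w).
apply: (cder_eq (cder_comp d (derivable_cd df))); by rewrite add0r mulr1.
Qed.

Lemma holomorphic_at_cd f z : holomorphic_at f z -> holomorphic_at (cd f) z.
Proof.
move=> hf; have [r r0 hr] := holomorphic_at_disk hf.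
apply: holomorphic_at_shift; apply: (near_eq_holomorphic_at (f := cd (fun w => f (z + w)))).
  have /holomorphic_atP[s s0 hs] := hf.
  apply/nbhsCP; exists s; first exact: s0.
  move=> w; rewrite subr0 => ws.
  have h : derivable f (z + w) 1 by apply: hs; rewrite addrC addKr.
  exact: (cd_shift h).
apply/holomorphic_atP; exists r => // w; rewrite subr0 => wr.
exact: (hol_cd hr wr).
Qed.

Lemma holomorphic_at_cst (c z : C) : holomorphic_at (fun=> c) z.
Proof. by apply: (@near_cder_holomorphic_at _ (fun=> 0)); apply: nearCW => w; exact: cder_cst. Qed.

Lemma holomorphic_at_id z : holomorphic_at (fun w => w) z.
Proof. by apply: (@near_cder_holomorphic_at _ (fun=> 1)); apply: nearCW => w; exact: cder_id. Qed.

Lemma holomorphic_atD f g z : holomorphic_at f z -> holomorphic_at g z ->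
  holomorphic_at (fun w => f w + g w) z.
Proof.
apply: filterS2 => w /derivable_cd df /derivable_cd dg.
exact: cder_derivable (cderD df dg).
Qed.

Lemma holomorphic_atN f z : holomorphic_at f z -> holomorphic_at (fun w => - f w) z.
Proof.
by apply: filterS => w /derivable_cd df; exact: cder_derivable (cderN df).
Qed.

Lemma holomorphic_atM f g z : holomorphic_at f z -> holomorphic_at g z ->
  holomorphic_at (fun w => f w * g w) z.
Proof.
apply: filterS2 => w /derivable_cd df /derivable_cd dg.
exact: cder_derivable (cderM df dg).
Qed.

Lemma holomorphic_atX f n z : holomorphic_at f z -> holomorphic_at (fun w => f w ^+ n) z.
Proof.
by apply: filterS => w /derivable_cd df; exact: cder_derivable (cderX n df).
Qed.

Lemma near_neq0 f z : {for z, continuous f} -> f z != 0 -> \forall w \near z, f w != 0.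
Proof.
move=> cf fz; have /cvgCP/(_ (normc (f z))) := cf; rewrite normc_gt0 => /(_ fz).
apply: filterS => w; rewrite -normc_gt0 normcB; have := ge_normcB (f z) (f w); lra.
Qed.

Lemma holomorphic_atV f z : holomorphic_at f z -> f z != 0 ->
  holomorphic_at (fun w => (f w)^-1) z.
Proof.
move=> hf fz; have := near_neq0 (cder_cts (holomorphic_at_cder hf)) fz.
rewrite /holomorphic_at; move: hf; apply: filterS2 => w /derivable_cd df fw.
exact: cder_derivable (cderV fw df).
Qed.

Lemma holomorphic_at_comp f g z : holomorphic_at f z -> holomorphic_at g (f z) ->
  holomorphic_at (g \o f) z.
Proof.
move=> hf hg; move/holomorphic_atP : hg => [r r0 H].
have /cvgCP/(_ _ r0) h := cder_cts (holomorphic_at_cder hf).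
move: hf h; apply: filterS2 => w /derivable_cd df /H /derivable_cd dg.
exact: cder_derivable (cder_comp df dg).
Qed.

Lemma holomorphic_at_cexp z : holomorphic_at cexp z.
Proof. by apply: near_cder_holomorphic_at; apply: nearCW => w; exact: cder_cexp. Qed.

Lemma holomorphic_at_sum n (F : nat -> C -> C) z :
  (forall k, holomorphic_at (F k) z) -> holomorphic_at (fun w => \sum_(k < n) F k w) z.
Proof.
move=> hF; elim: n => [|n IH].
  have -> : (fun w => \sum_(k < 0) F k w) = fun=> 0.
    by apply/funext => w; rewrite big_ord0.
  exact: holomorphic_at_cst.
have -> : (fun w => \sum_(k < n.+1) F k w) = fun w => \sum_(k < n) F k w + F n w.
  by apply/funext => w; rewrite big_ord_recr.
exact: (holomorphic_atD IH (hF n)).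
Qed.

Lemma holomorphic_at_primitive f z : holomorphic_at f z ->
  exists F : C -> C, \forall w \near z, cder F w (f w).
Proof.
move=> /holomorphic_at_disk[r r0 hr].
have [F dF] := primitive (@disk_convex R r) (@disk_open R r) hr.
exists (fun w => F (w - z)); apply/nbhsCP; exists r => // w wr.
have d := cderB (cder_id w) (cder_cst z w).
apply: (cder_eq (cder_comp d (dF (w - z) wr))).
by rewrite subr0 mulr1 addrC subrK.
Qed.

(* [cexp (- L) * p] has zero derivative when [L' = p' / p]. *)
Lemma holomorphic_at_log (p : C -> C) z (l0 : C) : holomorphic_at p z -> p z = cexp l0 ->
  exists L : C -> C, [/\ holomorphic_at L z, L z = l0 & \forall w \near z, cexp (L w) = p w].
Proof.
move=> hp pz; have p0 : p z != 0 by rewrite pz cexp_neq0.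
have hq : holomorphic_at (fun w => cd p w * (p w)^-1) z.
  by apply: holomorphic_atM; [exact: holomorphic_at_cd|exact: holomorphic_atV].
have [L0 dL0] := holomorphic_at_primitive hq.
pose L w : C := L0 w - L0 z + l0.
have dL : \forall w \near z, cder L w (cd p w * (p w)^-1).
  apply: filterS dL0 => w dw.
  by apply: (cder_eq (cderD (cderB dw (cder_cst (L0 z) w)) (cder_cst l0 w))); ring.
have Lz : L z = l0 by rewrite /L subrr add0r.
exists L; split; [exact: (@near_cder_holomorphic_at L _ z dL)|exact: Lz|].
have pn := near_neq0 (cder_cts (holomorphic_at_cder hp)) p0.
have /nbhsCP[r r0 H] : \forall w \near z, [/\ cder L w (cd p w * (p w)^-1), p w != 0 & derivable p w 1].
  move: dL pn hp; rewrite /holomorphic_at; apply: filterS3 => w h1 h2 h3.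
  by split; [exact: h1|exact: h2|exact: h3].
apply/nbhsCP; exists r => // w wr.
have d0 x : normc (x - z) < r -> cder (fun x => cexp (- L x) * p x) x 0.
  move=> xr; have [h1 h2 /derivable_cd h3] := H x xr.
  apply: (cder_eq (cderM (cder_comp (cderN h1) (cder_cexp _)) h3)).
  by rewrite /=; field.
have zr : normc (z - z) < r by rewrite subrr normc0.
have := cder0_cst (@convex_open_ball z r) d0 wr zr.
rewrite Lz pz (cexpN l0) mulVf ?cexp_neq0// cexpN => h.
by rewrite -[RHS](mulVKf (cexp_neq0 (L w))) h mulr1.
Unshelve. all: by end_near. Qed.

Lemma holomorphic_at_div f z : holomorphic_at f z ->
  exists2 g : C -> C, holomorphic_at g z & \forall w \near z, f w = f z + (w - z) * g w.
Proof.
move=> /holomorphic_at_disk[r r0 hr].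
have r2 : 0 < r / 2 by rewrite divr_gt0.
have r2r : r / 2 < r by lra.
exists (fun w => divz (r / 2) (fun w => f (z + w)) (w - z)).
  have h := divz_hol (ltW r2) r2r hr.
  apply/holomorphic_atP; exists (r / 2) => // w wr.
  have d := cderB (cder_id w) (cder_cst z w).
  exact: cder_derivable (cder_comp d (derivable_cd (h _ wr))).
apply/nbhsCP; exists (r / 2) => // w wr.
by have := divzE r2 r2r hr wr; rewrite addrC subrK addr0 => ->.
Qed.

Lemma holomorphic_at_taylor f z n : holomorphic_at f z ->
  exists (t : nat -> C) (g : C -> C), [/\ holomorphic_at g z, (0 < n)%N -> t 0%N = f z &
    \forall w \near z, f w = \sum_(j < n) t j * (w - z) ^+ j + (w - z) ^+ n * g w].
Proof.
elim: n f => [|n IH] f hf.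
  exists (fun=> 0), f; split => //; apply: nearCW => w.
  by rewrite big_ord0 add0r expr0 mul1r.
have [g hg fE] := holomorphic_at_div hf.
have [t [k [hk _ gE]]] := IH g hg.
exists (fun j => if j is j'.+1 then t j' else f z), k; split => //.
move: fE gE; apply: filterS2 => w -> ->.
rewrite big_ord_recl /= expr0 mulr1 -addrA; congr (_ + _).
rewrite mulrDr mulrA -exprS; congr (_ + _); rewrite mulr_sumr.
by apply: eq_bigr => i _; rewrite /= exprS; ring.
Qed.

(** The cap [rho0] lets a caller keep the inverse inside a prescribed disk, as is needed to compare
    it with another solution. *)
Lemma local_inverse f z (rho0 : R) : holomorphic_at f z -> cd f z != 0 -> 0 < rho0 ->
  exists rho s (g : C -> C), [/\ 0 < rho <= rho0, 0 < s,
    forall w, normc (w - z) < rho -> derivable f w 1 /\ cd f w != 0,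
    forall w1 w2, normc (w1 - z) < rho -> normc (w2 - z) < rho -> f w1 = f w2 -> w1 = w2 &
    forall y, normc (y - f z) < s -> [/\ normc (g y - z) < rho, f (g y) = y &
      cder g y (cd f (g y))^-1]].
Proof.
move=> hf a0 rho0_gt0; set a := cd f z in a0.
have na : 0 < normc a by rewrite normc_gt0.
have na2 : 0 < normc a / 2 by rewrite divr_gt0.
have /cvgCP/(_ _ na2) := cder_cts (holomorphic_at_cder (holomorphic_at_cd hf)).
rewrite -/a => h1; have /nbhsCP[r r0 H] : \forall w \near z,
    derivable f w 1 /\ normc (cd f w - a) < normc a / 2.
  by move: hf h1; apply: filterS2.
pose rho := Num.min r rho0.
have rho_gt0 : 0 < rho by rewrite lt_min r0.
have wr w : normc (w - z) < rho -> normc (w - z) < r by rewrite lt_min => /andP[].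
have df w : normc (w - z) < rho -> cder f w (cd f w).
  by move=> /wr/H[/derivable_cd].
have fa w : normc (w - z) < rho -> normc (cd f w - a) <= normc a / 2.
  by move=> /wr/H[_ /ltW].
have d0 w : normc (w - z) < rho -> cd f w != 0.
  move=> /fa h; rewrite -normc_gt0; have := ge_normcB a (a - cd f w).
  by rewrite subKr (normcB a (cd f w)); nlra.
pose s := normc a * rho / 2.
have s0 : 0 < s by rewrite divr_gt0// mulr_gt0.
have lip := lower_lipschitz df fa.
have inj w1 w2 : normc (w1 - z) < rho -> normc (w2 - z) < rho -> f w1 = f w2 -> w1 = w2.
  move=> h1' h2' fE; have := lip _ _ h1' h2'; rewrite fE subrr normc0.
  rewrite pmulr_rle0// => h; apply/eqP; rewrite eq_sym -subr_eq0 -normc_eq0.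
  by rewrite eq_le h normc_ge0.
have ex y : exists w, normc (y - f z) < s -> normc (w - z) < rho /\ f w = y.
  have [ys|ys] := ltP (normc (y - f z)) s; last by exists 0.
  have ys2 : 2 * normc (y - f z) < normc a * rho by move: ys; rewrite /s; lra.
  have [w w1 w2] := inverse_exists a0 df fa ys2.
  exists w => _; split => //; apply: le_lt_trans w1 _.
  by rewrite ltr_pdivrMr// mulrC (mulrC rho) mulrC.
have [g gP] := boolp.choice ex.
exists rho, s, g; split; [|exact: s0| |exact: inj|].
- by rewrite rho_gt0 ge_min lexx orbT.
- by move=> w h; split; [exact: cder_derivable (df w h)|exact: d0].
move=> y ys; have [h1' h2'] := gP y ys; split => //.
have nys : \forall x \near y, normc (x - f z) < s.
  apply/nbhsCP; exists (s - normc (y - f z)); first by rewrite subr_gt0.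
  by move=> x xy; have := le_normc_dist x y (f z); lra.
apply: (cder_inverse h2' erefl (d0 _ h1') (df _ h1')).
  apply/continuousCP => e e0; near=> x.
  have xs : normc (x - f z) < s by near: x.
  have [k1 k2] := gP x xs.
  have := lip _ _ h1' k1; rewrite h2' k2 => l1.
  rewrite -(ltr_pM2l na2); apply: le_lt_trans l1 _.
  by near: x; apply: near_normc; rewrite mulr_gt0.
by apply: filterS nys => x xs; have [] := gP x xs.
Unshelve. all: by end_near. Qed.

End LocalInverse.

(** * Decay in the sectors *)

Section Decay.
Context {R : realType}.
Local Notation C := (Cplx R).
Implicit Types (z w v y : C) (r s t e l a K : R) (f : C -> C) (g : C -> C).

(** With z = e^w, [Xm] is z^-m and [Pm] is z^(1 - res) exp (- z^-m). The exponent is 1 - res rather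
    than - res because derivatives are taken in w and dz = z dw. *)
Definition Xm m w : C := cexp (- (m%:R * w)).
Definition Qm m (res : C) w : C := (1 - res) * w - Xm m w.
Definition Pm m (res : C) w : C := cexp (Qm m res w).
(* Dominates, in a sector of decay, a primitive of a function of size
   [e ^ (a w) * Pm m res w]: integrating [exp (- e ^ (- m w))] gains a factor
   [e ^ (m w)]. *)
Definition Em m (res : C) a w : R :=
  expR (complex.Re (Qm m res w) + (a + m%:R) * complex.Re w).

Lemma normc_nat n : normc (n%:R : C) = n%:R.
Proof. by rewrite -realC_nat normc_real ger0_norm. Qed.

Lemma RenM n w : complex.Re (n%:R * w) = n%:R * complex.Re w.
Proof. by rewrite -realC_nat cReM /= mul0r subr0. Qed.

Lemma ImnM n w : complex.Im (n%:R * w) = n%:R * complex.Im w.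
Proof. by rewrite -realC_nat cImM /= mul0r addr0. Qed.

Lemma cder_Xm m w : cder (Xm m) w (- (m%:R * Xm m w)).
Proof.
have d := cder_comp (cderN (cderZ m%:R (cder_id w))) (cder_cexp _).
by apply: (cder_eq d); rewrite /Xm; ring.
Qed.

Lemma cder_Qm m res w : cder (Qm m res) w ((1 - res) + m%:R * Xm m w).
Proof.
by apply: (cder_eq (cderB (cderZ (1 - res) (cder_id w)) (cder_Xm m w))); ring.
Qed.

Lemma cder_Pm m res w : cder (Pm m res) w (((1 - res) + m%:R * Xm m w) * Pm m res w).
Proof.
by apply: (cder_eq (cder_comp (cder_Qm m res w) (cder_cexp _))); rewrite /Pm mulrC.
Qed.

Lemma Pm_neq0 m res w : Pm m res w != 0. Proof. exact: cexp_neq0. Qed.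

Lemma normc_Xm m w : normc (Xm m w) = expR (- (m%:R * complex.Re w)).
Proof. by rewrite normc_cexp cReN RenM. Qed.

Lemma EmE m res a w :
  Em m res a w = normc (Pm m res w) * expR ((a + m%:R) * complex.Re w).
Proof. by rewrite /Em /Pm expRD normc_cexp. Qed.

Lemma Em_gt0 m res a w : 0 < Em m res a w. Proof. exact: expR_gt0. Qed.

Lemma is_derive_expR_comp (h : R -> R) (t dh : R) : is_derive t (1 : R) h dh ->
  is_derive t (1 : R) (fun x => expR (h x)) (dh * expR (h t)).
Proof.
move=> d; have dE := @is_derive_expR R (h t).
by apply: (is_derive_eq (is_derive1_comp dE d)); rewrite mulrC.
Qed.

(** To the left of [s], half of the term m |Xm| in the derivative of the exponent dominates all the
    others. The inner factor 2 accounts for segments of length up to 2 sg. *)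
Definition steep m (res : C) a s := 2 * (2 * normc (1 - res) + a + m%:R) <= m%:R * expR (- (m%:R * s)).

Lemma steep_le m res a s s' : s' <= s -> steep m res a s -> steep m res a s'.
Proof.
move=> ss; rewrite /steep => /le_trans; apply; rewrite ler_wpM2l// ler_expR.
by rewrite lerN2 ler_wpM2l.
Qed.

(** The majorant along the segment is - 4 K [Em]. The logarithmic derivative of [Em] is at most - sg
    (m / 2) |Xm|, and |Xm| cancels the factor e^(m Re w) inside [Em]. What is left is at least 2 sg
    K |Pm| e^(a Re w), which bounds the derivative of [G] along the segment. *)
Lemma seg_decay m (res : C) a K (G G' : C -> C) (w0 w1 : C) s (sg : R) :
  (0 < m)%N -> 0 <= a -> 0 <= K -> 0 <= sg ->
  normc (w1 - w0) <= 2 * sg -> `|complex.Re (w1 - w0)| <= sg -> steep m res a s ->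
  (forall t, 0 <= t <= 1 -> let w := w0 + t%:C * (w1 - w0) in
    [/\ complex.Re w <= s, cder G w (G' w),
        normc (G' w) <= K * normc (Pm m res w) * expR (a * complex.Re w) &
        complex.Re (Xm m w * (w1 - w0)) <= - sg * normc (Xm m w)]) ->
  normc (G w1 - G w0) <= 4 * K * (Em m res a w0 - Em m res a w1).
Proof.
move=> m0 a0 K0 sg0 V2 VR st H.
pose H0 w : C := Qm m res w + (a + m%:R)%:C * w.
have H0E w : expR (complex.Re (H0 w)) = Em m res a w.
  by rewrite /Em /H0 cReD [in X in _ + X]cReM /= mul0r subr0.
pose V := w1 - w0; pose w (t : R) : C := w0 + t%:C * V.
pose B (t : R) : R := - (4 * K) * expR (complex.Re (H0 (w t))).
pose B' (t : R) : R := - (4 * K) * (complex.Re (V * ((1 - res) + m%:R * Xm m (w t) + (a + m%:R)%:C))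
   * expR (complex.Re (H0 (w t)))).
have dB t : is_derive t (1 : R) B (B' t).
  apply: is_deriveZ; apply: is_derive_expR_comp.
  have dH : cder H0 (w t) ((1 - res) + m%:R * Xm m (w t) + (a + m%:R)%:C).
    apply: (cder_eq (cderD (cder_Qm m res (w t)) (cderZ _ (cder_id _)))).
    by rewrite mulr1.
  exact: rder_Re (rder_seg dH).
have := @cder_majorant _ G w0 w1 G' B B'.
rewrite /B /w /V realC1 mul1r realC0 mul0r addr0 (addrC w0) subrK !H0E => cm.
have -> : 4 * K * (Em m res a w0 - Em m res a w1) =
  - (4 * K) * Em m res a w1 - - (4 * K) * Em m res a w0 by ring.
apply: cm => [t t01|t t01]; first by have [] := H t t01.
have [h1 h2 h3 h4] := H t t01; rewrite -/V -/(w t) in h1 h3 h4 *.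
rewrite normcM; have h5 := steep_le h1 st.
set x := complex.Re (w t) in h1 h3 h5 *.
have XE : normc (Xm m (w t)) = expR (- (m%:R * x)) by rewrite normc_Xm.
rewrite XE in h4; rewrite /B' H0E EmE -/x (mulrDl a m%:R x) expRD.
set X := expR (- (m%:R * x)) in h4 h5 XE; set ea := expR (a * x) in h3 *.
have -> : expR (m%:R * x) = X^-1 by rewrite /X expRN invrK.
have X0 : 0 < X by exact: expR_gt0.
have ea0 : 0 < ea by exact: expR_gt0.
have m1 : 1 <= m%:R :> R by rewrite ler1n.
have hV : complex.Re (V * ((1 - res) + m%:R * Xm m (w t) + (a + m%:R)%:C)) <= - sg * (m%:R / 2 * X).
  have -> : V * ((1 - res) + m%:R * Xm m (w t) + (a + m%:R)%:C) =
     V * (1 - res) + m%:R * (Xm m (w t) * V) + (a + m%:R)%:C * V by ring.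
  rewrite !cReD RenM [X in _ + X]cReM /= mul0r subr0.
  have k1 : complex.Re (V * (1 - res)) <= 2 * sg * normc (1 - res).
    apply: le_trans (ler_norm _) _; apply: le_trans (Re_le_normc _) _.
    by rewrite normcM ler_wpM2r ?normc_ge0.
  have k2 : (a + m%:R) * complex.Re V <= (a + m%:R) * sg.
    by rewrite ler_wpM2l ?addr_ge0//; apply: le_trans (ler_norm _) VR.
  have k3 : m%:R * complex.Re (Xm m (w t) * V) <= m%:R * (- sg * X) by rewrite ler_wpM2l.
  have k4 : sg * (2 * (2 * normc (1 - res) + a + m%:R)) <= sg * (m%:R * X) by rewrite ler_wpM2l.
  move: k1 k2 k3 k4; clear; move: (normc (1 - res)) (complex.Re _) (complex.Re _) (complex.Re _) => *.
  lra.
have N0 := normc_ge0 (Pm m res (w t)); have NV := normc_ge0 V.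
set N := normc (Pm _ _ _) in N0 h3 *.
apply: (@le_trans _ _ (2 * sg * (K * N * ea))).
  by apply: ler_pM; rewrite ?normc_ge0//.
have -> : 2 * sg * (K * N * ea) = - (4 * K) * (- sg * (1 / 2 * X) * (N * (ea / X))).
  by field; rewrite gt_eqF.
rewrite [leLHS]mulNr [leRHS]mulNr lerN2 ler_wpM2l ?mulr_ge0//.
apply: ler_wpM2r; first by rewrite mulr_ge0// divr_ge0// ltW.
apply: le_trans hV _; rewrite !mulNr lerN2 ler_wpM2l// ler_wpM2r ?(ltW X0)//.
lra.
Qed.

(* Since the derivative of [Qm] is [1 - res + m * Xm], along such a segment
   [Pm] decays at the rate [m * sg * normc (Xm m w)], up to lower order terms. *)
Definition seg_ok m (res : C) a (s : R) (w0 w1 : C) := exists sg : R,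
  [/\ 0 <= sg, normc (w1 - w0) <= 2 * sg, `|complex.Re (w1 - w0)| <= sg &
   forall t, 0 <= t <= 1 -> let w := w0 + t%:C * (w1 - w0) in
     complex.Re w <= s /\ complex.Re (Xm m w * (w1 - w0)) <= - sg * normc (Xm m w)].

Lemma Xm_polar m w (n : int) : (0 < m)%N -> let y := m%:R * complex.Im w - 2 * pi * n%:~R in
  Xm m w = (normc (Xm m w))%:C * (cos y -i* sin y).
Proof.
move=> m0 y; rewrite normc_Xm /Xm /cexp cReN cImN RenM ImnM cosN sinN.
have -> : m%:R * complex.Im w = y + 2 * pi * n%:~R by rewrite /y subrK.
clearbody y.
have := @cexp_2pik R n; rewrite /cexp /= expR0 !mul1r => -[cE sE].
rewrite cosD sinD cE sE.
by apply: complex_ext; rewrite ?cReM ?cImM /=; ring.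
Qed.

(** One unit to the left multiplies |Xm| by e^m >= 1 + m, and [steep] makes this growth in the
    exponent absorb every other change. The halving gives a geometric sequence along the axis. *)
Lemma Em_axis m (res : C) a s (n : int) (p : R) : (0 < m)%N -> 0 <= a -> steep m res a s ->
  p <= s -> Em m res a ((p - 1) +i* (2 * pi * n%:~R / m%:R)) <=
    Em m res a (p +i* (2 * pi * n%:~R / m%:R)) / 2.
Proof.
move=> m0 a0 st ps; set th := 2 * pi * n%:~R / m%:R.
have m1 : 1 <= m%:R :> R by rewrite ler1n.
have mn : m%:R != 0 :> R by rewrite gt_eqF// ltr0n.
have X q : complex.Re (Xm m (q +i* th)) = expR (- (m%:R * q)).
  rewrite (Xm_polar _ n m0) cReM normc_Xm /= mul0r subr0.
  have -> : m%:R * th - 2 * pi * n%:~R = 0 by rewrite /th mulrC divfK// subrr.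
  by rewrite cos0 mulr1.
have Q q : complex.Re (Qm m res (q +i* th)) =
    complex.Re (1 - res) * q - complex.Im (1 - res) * th - expR (- (m%:R * q)).
  by rewrite /Qm cReD cReN X cReM.
rewrite /Em !Q /=.
have e2 : expR (-1) <= 2^-1 :> R.
  rewrite expRN lef_pV2 ?posrE ?expR_gt0//.
  by apply: le_trans (expR_ge1Dx 1); lra.
rewrite [leRHS]mulrC; apply: (le_trans _ (ler_wpM2r (expR_ge0 _) e2)).
rewrite -expRD ler_expR.
have h : (1 + m%:R) * expR (- (m%:R * p)) <= expR (- (m%:R * (p - 1))).
  have -> : - (m%:R * (p - 1)) = m%:R + - (m%:R * p) by ring.
  by rewrite expRD ler_wpM2r ?expR_ge0// expR_ge1Dx.
have := steep_le ps st; rewrite /steep => hs.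
have Rr : `|complex.Re (1 - res)| <= normc (1 - res) by exact: Re_le_normc.
move: h hs Rr m1 a0; move: (expR _) (expR _) (complex.Re _) (complex.Im _) (normc _) => X1 X2 c1 c2 N h hs.
rewrite ler_norml => /andP[r1 r2] m1 a0.
have hh : m%:R * X2 <= X1 - X2 by move: h; rewrite mulrDl mul1r; lra.
have -> : c1 * (p - 1) = c1 * p - c1 by ring.
have -> : (a + m%:R) * (p - 1) = (a + m%:R) * p - (a + m%:R) by ring.
lra.
Qed.

(** Since [Xm] is |Xm| e^(- i y), the condition on [cos y] and [sin y] says that moving in the
    direction c1 + i c2 makes the real part of [Xm] times the step at most - |Xm|. *)
Lemma seg_ok_dir m (res : C) a s (w0 : C) (n : int) (sg c1 c2 : R) : (0 < m)%N ->
  0 <= sg -> `|c1| <= 1 -> `|c2| <= 1 ->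
  (forall t, 0 <= t <= 1 -> complex.Re w0 + t * (sg * c1) <= s) ->
  (forall t, 0 <= t <= 1 ->
     let y := m%:R * (complex.Im w0 + t * (sg * c2)) - 2 * pi * n%:~R in
     cos y * c1 + sin y * c2 <= -1) ->
  seg_ok m res a s w0 (w0 + sg%:C * (c1 +i* c2)).
Proof.
move=> m0 sg0 h1 h2 hs hy; exists sg; rewrite (addrC w0) addrK; split => //.
- apply: le_trans (normc_le_ReIm _) _; rewrite cReM cImM /= !mul0r subr0 addr0 !normrM.
  by rewrite (ger0_norm sg0) -mulrDr mulrC ler_wpM2r// lerD.
- by rewrite cReM /= mul0r subr0 normrM (ger0_norm sg0) ler_piMr.
move=> t t01 w.
have Rw : complex.Re w = complex.Re w0 + t * (sg * c1).
  by rewrite /w cReD cReM cReM cImM /= !mul0r !subr0.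
have Iw : complex.Im w = complex.Im w0 + t * (sg * c2).
  by rewrite /w cImD cImM cReM cImM /= !mul0r !addr0.
split; first by rewrite Rw hs.
rewrite {1}(Xm_polar w n m0) Iw; have := hy t t01.
set y := _ - _; have X0 := normc_ge0 (Xm m w); set X := normc _ in X0 *.
move=> H; rewrite cReM !cReM !cImM /= !mul0r !subr0 !addr0.
have -> : X * cos y * (sg * c1) - X * - sin y * (sg * c2) = sg * X * (cos y * c1 + sin y * c2) by ring.
have -> : - sg * X = sg * X * -1 by ring.
by rewrite ler_wpM2l// mulr_ge0.
Qed.

Lemma sin_cos_ge1 (y : R) : 0 <= y <= pi / 2 -> 1 <= cos y + sin y.
Proof.
move=> /andP[y0 y1]; have p0 := pi_gt0 R.
have c0 : 0 <= cos y by apply: cos_ge0_pihalf; apply/andP; split; lra.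
have s0 : 0 <= sin y by apply: sin_ge0_pi; apply/andP; split; lra.
rewrite -(@ler_pXn2r _ 2)// ?nnegrE ?addr_ge0// expr1n sqrrD.
by have := cos2Dsin2 y; have := mulr_ge0 c0 s0; rewrite mulr2n; lra.
Qed.

Lemma seg_ok_refl m (res : C) a s w : complex.Re w <= s -> seg_ok m res a s w w.
Proof.
move=> ws; exists 0; rewrite subrr normc0 normr0 mulr0; split => // t t01 v.
by rewrite /v mulr0 addr0 mulr0 oppr0 mul0r.
Qed.

Lemma sinM_sign (e y : R) : e = 1 \/ e = -1 -> sin (e * y) = e * sin y.
Proof. by case=> ->; rewrite ?mul1r// !mulN1r sinN. Qed.

Lemma cosM_sign (e y : R) : e = 1 \/ e = -1 -> cos (e * y) = cos y.
Proof. by case=> ->; rewrite ?mul1r// !mulN1r cosN. Qed.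

(** In the inner half of a sector the diagonal direction, leftwards and towards the axis, decays
    fast enough because cos + sin >= 1 on the first quadrant. *)
Lemma seg_ok_inner m (res : C) a s (n : int) w (e y : R) : (0 < m)%N ->
  e = 1 \/ e = -1 -> 0 <= y <= pi / 2 -> m%:R * complex.Im w - 2 * pi * n%:~R = e * y ->
  complex.Re w <= s ->
  seg_ok m res a s w ((complex.Re w - y / m%:R) +i* (2 * pi * n%:~R / m%:R)).
Proof.
move=> m0 e1 /andP[y0 y1] yE ws; have mp : 0 < m%:R :> R by rewrite ltr0n.
have mn : m%:R != 0 :> R by rewrite gt_eqF.
have ym : 0 <= y / m%:R by rewrite divr_ge0// ltW.
have -> : (complex.Re w - y / m%:R) +i* (2 * pi * n%:~R / m%:R) =
    w + (y / m%:R)%:C * ((-1) +i* (- e)).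
  apply: complex_ext; rewrite ?cReD ?cImD ?cReM ?cImM /= !mul0r; first by ring.
  have -> : complex.Im w = (2 * pi * n%:~R + e * y) / m%:R by rewrite -yE; field.
  by field.
apply: (@seg_ok_dir _ _ _ _ _ n) => //.
- by rewrite normrN normr1.
- by case: e1 => ->; rewrite ?opprK ?normrN normr1.
- move=> t /andP[t0 t1]; apply: le_trans ws.
  by rewrite mulrN1 mulrN gerDl oppr_le0 mulr_ge0.
move=> t /andP[t0 t1] /=.
have -> : m%:R * (complex.Im w + t * (y / m%:R * - e)) - 2 * pi * n%:~R = e * (y * (1 - t)).
  have -> : complex.Im w = (2 * pi * n%:~R + e * y) / m%:R by rewrite -yE; field.
  by field.
rewrite cosM_sign// sinM_sign//.
have := @sin_cos_ge1 (y * (1 - t)); have ee : e * e = 1 by case: e1 => ->; ring.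
move=> /(_ _)/wrap[|h].
  rewrite mulr_ge0 ?subr_ge0//=; apply: le_trans y1; rewrite ler_piMr//; lra.
have -> : e * sin (y * (1 - t)) * - e = - sin (y * (1 - t)) * (e * e) by ring.
rewrite ee; lra.
Qed.

(** In the outer half the cosine is negative and [Pm] grows to the left, so the path moves to the
    right and towards the axis until the scaled angle is pi / 2. The excursion is at most pi / 2 <
    2, whence the margin 2 in the later statements. *)
Lemma seg_ok_outer m (res : C) a s (n : int) w (e y : R) : (0 < m)%N ->
  e = 1 \/ e = -1 -> pi / 2 <= y <= pi -> m%:R * complex.Im w - 2 * pi * n%:~R = e * y ->
  complex.Re w + 2 <= s ->
  exists w1 : C, [/\ seg_ok m res a s w w1, complex.Re w <= complex.Re w1 <= complex.Re w + 2 &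
    m%:R * complex.Im w1 - 2 * pi * n%:~R = e * (pi / 2)].
Proof.
move=> m0 e1 /andP[y0 y1] yE ws; have mp : 0 < m%:R :> R by rewrite ltr0n.
have mn : m%:R != 0 :> R by rewrite gt_eqF.
have p2 := @pihalf_lt2 R; have p0 := pi_gt0 R.
pose sg := (y - pi / 2) / m%:R.
have sg0 : 0 <= sg by rewrite divr_ge0 ?(ltW mp)// subr_ge0.
have sg2 : sg <= 2.
  rewrite ler_pdivrMr//; apply: (@le_trans _ _ (2 * 1)); first lra.
  by rewrite ler_wpM2l// ler1n.
have Iw : complex.Im w = (2 * pi * n%:~R + e * y) / m%:R by rewrite -yE; field.
exists (w + sg%:C * (1 +i* (- e))); split; last 2 first.
- by rewrite cReD cReM /= mul0r subr0 mulr1 lerDl sg0 lerD2l.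
- rewrite cImD cImM /= mul0r addr0 Iw /sg; field; exact: mn.
apply: (@seg_ok_dir _ _ _ _ _ n) => //.
- by rewrite normr1.
- by case: e1 => ->; rewrite ?opprK ?normrN normr1.
- move=> t /andP[t0 t1]; apply: le_trans ws.
  by rewrite mulr1 lerD2l; apply: le_trans sg2; rewrite ler_piMl.
move=> t /andP[t0 t1] /=.
have -> : m%:R * (complex.Im w + t * (sg * - e)) - 2 * pi * n%:~R =
    e * ((y - pi / 2) * (1 - t) + pi / 2).
  by rewrite Iw /sg; field.
rewrite cosM_sign// sinM_sign// cosDpihalf sinDpihalf.
have := @sin_cos_ge1 ((y - pi / 2) * (1 - t)); have ee : e * e = 1 by case: e1 => ->; ring.
move=> /(_ _)/wrap[|h].
  rewrite mulr_ge0 ?subr_ge0//=; apply: (@le_trans _ _ (y - pi / 2)); last lra.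
  by rewrite ler_piMr ?subr_ge0//; lra.
set q := _ * (1 - t) in h *.
have -> : e * cos q * - e = - cos q * (e * e) by ring.
rewrite ee; lra.
Qed.

Lemma path_to_axis m (res : C) a s (n : int) w : (0 < m)%N ->
  `|m%:R * complex.Im w - 2 * pi * n%:~R| <= pi -> complex.Re w + 2 <= s ->
  exists (w1 : C) (p : R), [/\ seg_ok m res a s w w1,
    seg_ok m res a s w1 (p +i* (2 * pi * n%:~R / m%:R)) & p <= s].
Proof.
move=> m0; set y := _ - _ => yp ws.
have mp : 0 < m%:R :> R by rewrite ltr0n.
have [e [e1 yE]] : exists e : R, (e = 1 \/ e = -1) /\ y = e * `|y|.
  have [h|h] := leP 0 y; first by exists 1; split; [left|rewrite ger0_norm ?mul1r].
  by exists (-1); split; [right|rewrite ltr0_norm// mulN1r opprK].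
have ws' : complex.Re w <= s by lra.
have [h|h] := leP `|y| (pi / 2).
  exists w, (complex.Re w - `|y| / m%:R); split; first exact: seg_ok_refl.
    by apply: (@seg_ok_inner _ _ _ _ _ _ e `|y|) => //; rewrite normr_ge0.
  by apply: le_trans ws'; rewrite gerBl divr_ge0// ltW.
have hy : pi / 2 <= `|y| <= pi by rewrite (ltW h).
have [w1 [h1 /andP[h2 h3] h4]] := @seg_ok_outer m res a s n w e `|y| m0 e1 hy yE ws.
have p0 := pi_gt0 R.
exists w1, (complex.Re w1 - (pi / 2) / m%:R); split; first exact: h1.
  apply: (@seg_ok_inner _ _ _ _ _ _ e (pi / 2)) => //; last exact: le_trans ws.
  by rewrite lexx andbT divr_ge0// ltW.
apply: le_trans ws; apply: le_trans h3; rewrite gerBl divr_ge0 ?divr_ge0// ltW//.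
Qed.

Lemma seg_ok_axis m (res : C) a s (n : int) (p q : R) : (0 < m)%N -> q <= p -> p <= s ->
  seg_ok m res a s (p +i* (2 * pi * n%:~R / m%:R)) (q +i* (2 * pi * n%:~R / m%:R)).
Proof.
move=> m0 qp ps; have mn : m%:R != 0 :> R by rewrite gt_eqF// ltr0n.
have -> : q +i* (2 * pi * n%:~R / m%:R) =
    (p +i* (2 * pi * n%:~R / m%:R)) + (p - q)%:C * ((-1) +i* 0) :> C.
  by apply: complex_ext; rewrite ?cReD ?cImD ?cReM ?cImM /=; ring.
apply: (@seg_ok_dir _ _ _ _ _ n); rewrite ?subr_ge0// ?normrN ?normr1 ?normr0//.
- move=> t /andP[t0 t1] /=; apply: le_trans ps.
  by rewrite mulrN1 mulrN gerDl oppr_le0 mulr_ge0 ?subr_ge0.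
move=> t _ /=; have -> : m%:R * (2 * pi * n%:~R / m%:R + t * ((p - q) * 0)) - 2 * pi * n%:~R = 0.
  by field.
rewrite cos0 sin0; lra.
Qed.

Lemma seg_ok_decay m (res : C) a K (G G' : C -> C) (w0 w1 : C) s :
  (0 < m)%N -> 0 <= a -> 0 <= K -> steep m res a s ->
  (forall w, complex.Re w <= s -> cder G w (G' w) /\
     normc (G' w) <= K * normc (Pm m res w) * expR (a * complex.Re w)) ->
  seg_ok m res a s w0 w1 ->
  normc (G w1 - G w0) <= 4 * K * (Em m res a w0 - Em m res a w1).
Proof.
move=> m0 a0 K0 st H [sg [h1 h2 h3 h4]].
apply: (@seg_decay _ _ _ _ _ G' _ _ s sg) => // t t01 w.
by have [k1 k2] := h4 t t01; have [k3 k4] := H _ k1; split.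
Qed.

(** The limit exists along the axis by geometric decay. Any other point is joined to a far point of
    the axis by three admissible segments, whose bounds are differences of values of [Em] and
    telescope, leaving the value at the starting point. *)
Lemma sector_limit m (res : C) a K (G G' : C -> C) s (n : int) :
  (0 < m)%N -> 0 <= a -> 0 <= K -> steep m res a s ->
  (forall w, complex.Re w <= s -> cder G w (G' w) /\
     normc (G' w) <= K * normc (Pm m res w) * expR (a * complex.Re w)) ->
  exists u : C, forall w, `|m%:R * complex.Im w - 2 * pi * n%:~R| <= pi ->
    complex.Re w + 2 <= s -> normc (G w - u) <= 4 * K * Em m res a w.
Proof.
move=> m0 a0 K0 st H; pose th : R := 2 * pi * n%:~R / m%:R.
have D w0 w1 := @seg_ok_decay m res a K G G' w0 w1 s m0 a0 K0 st H.
pose E k := Em m res a ((s - k%:R) +i* th).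
have E_ge0 k : 0 <= E k by rewrite ltW// Em_gt0.
have sk k : s - k%:R <= s by rewrite gerBl.
have EH k : E k <= E 0%N / 2 ^+ k.
  elim: k => [|k IH]; first by rewrite expr0 divr1.
  apply: le_trans (_ : E k / 2 <= _).
    have := @Em_axis m res a s n _ m0 a0 st (sk k).
    by rewrite -/th /E -[k.+1%:R]natr1 opprD addrA.
  by rewrite exprS invfM mulrA mulrAC ler_wpM2r// invr_ge0.
pose x k := G ((s - k%:R) +i* th).
have K4 : 0 <= 4 * K by rewrite mulr_ge0.
have xS k : normc (x k.+1 - x k) <= 8 * K * E 0%N / 2 ^+ k.+1.
  have ok : seg_ok m res a s ((s - k%:R) +i* th) ((s - k.+1%:R) +i* th).
    by apply: seg_ok_axis => //; rewrite lerD2l lerN2 ler_nat.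
  apply: le_trans (D _ _ ok) _.
  apply: (@le_trans _ _ (4 * K * (E 0%N / 2 ^+ k))).
    rewrite ler_wpM2l//; apply: le_trans (EH k).
    by rewrite gerBl ltW// Em_gt0.
  by rewrite exprS le_eqVlt; apply/orP; left; apply/eqP; field; rewrite expf_neq0.
have c0 : 0 <= 8 * K * E 0%N by rewrite mulr_ge0// mulr_ge0.
have [u uP] := halving_limitC c0 xS.
exists u => w hw ws.
have [w1 [p [h1 h2 ps]]] := @path_to_axis m res a s n w m0 hw ws.
rewrite -subr_ge0; apply: (@ge0_half_pow R (2 * (8 * K * E 0%N))) => [|k].
  by rewrite mulr_ge0.
(* Large enough for the axis point to lie to the left of [p], where the path reaches the axis, and
   at least [k], so that the error tends to 0 with [k]. *)
pose k0 := (Num.bound (s - p) + k)%N.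
have kp : s - k0%:R <= p.
  rewrite lerBlDr -lerBlDl; apply: ltW; apply: le_lt_trans (ler_norm _) _.
  apply: lt_le_trans (_ : (Num.bound (s - p))%:R <= _); last by rewrite ler_nat leq_addr.
  by have := archi_boundP (normr_ge0 (s - p)); rewrite /Num.bound /= normr_id.
have h3 := @seg_ok_axis m res a s n p (s - k0%:R) m0 kp ps.
have d1 := D _ _ h1; have d2 := D _ _ h2; have d3 := D _ _ h3.
rewrite -/th in d2 d3.
have d4 := uP k0; rewrite /x in d4.
have d5 : 2 * (8 * K * E 0%N) / 2 ^+ k0 <= 2 * (8 * K * E 0%N) / 2 ^+ k.
  rewrite ler_wpM2l ?mulr_ge0// lef_pV2 ?posrE ?exprn_gt0//.
  by rewrite ler_eXn2l ?leq_addl// ltr1n.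
have d6 := E_ge0 k0; rewrite /E in d6.
move: d1 d2 d3 d4 d5 d6.
set A := G w; set B := G w1; set Cc := G _; set F := G _.
have t1 := le_normc_dist A B u; have t2 := le_normc_dist B Cc u.
have t3 := le_normc_dist Cc F u.
rewrite (normcB B A) (normcB Cc B) (normcB F Cc) !mulrBr.
move: (Em m res a w) (Em m res a w1) (Em _ _ _ _) (Em _ _ _ _) => E1 E2 E3 E4.
move=> d1 d2 d3 d4 d5 d6; have := mulr_ge0 K4 d6.
move: t1 t2 t3 d1 d2 d3 d4 d5.
move: (2 * _ / 2 ^+ k0) (2 * _ / 2 ^+ k) => f1 f2.
move: (normc (A - B)) (normc (B - Cc)) (normc (Cc - F)) (normc (A - u)) (normc (B - u)) (normc (Cc - u)) (normc (F - u)).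
move: (4 * K * E1) (4 * K * E2) (4 * K * E3) (4 * K * E4); clear => *.
lra.
Qed.

End Decay.

(** * Asymptotic values *)

Section Values.
Context {R : realType}.
Local Notation C := (Cplx R).
Implicit Types (z w v y : C) (r s t e l a K : R) (f : C -> C) (g : C -> C) (phi : C -> C) (u : int -> C).

Lemma steep_exists m (res : C) a s0 : (0 < m)%N -> 0 <= a ->
  exists2 s, s <= s0 & steep m res a s.
Proof.
move=> m0 a0; have m1 : 1 <= m%:R :> R by rewrite ler1n.
pose B := 2 * (2 * normc (1 - res) + a + m%:R).
have B0 : 0 <= B by rewrite mulr_ge0// !addr_ge0// mulr_ge0// normc_ge0.
exists (Num.min s0 (- B)); first by rewrite ge_min lexx.
apply: (@steep_le _ _ _ _ (- B)); first by rewrite ge_min lexx orbT.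
rewrite /steep -/B mulrN opprK.
have e1 := expR_ge1Dx (m%:R * B).
have h : B <= m%:R * B by rewrite ler_peMl.
have h2 : expR (m%:R * B) <= m%:R * expR (m%:R * B) by rewrite ler_peMl// expR_ge0.
move: e1 h h2; clear; move: (m%:R * B) => Y; move: (expR Y) => X *; lra.
Qed.

Lemma cos_ge_cos1 (y : R) : `|y| <= 1 -> cos 1 <= cos y.
Proof.
have p4 := @pihalf_ge1 R; have p0 := pi_gt0 R.
move=> h; have -> : cos y = cos `|y|.
  by have [g|g] := leP 0 y; [rewrite ger0_norm|rewrite ltr0_norm// cosN].
rewrite leNgt ltr_cos ?in_itv /= ?normr_ge0/= -?leNgt// ?ler01 /=.
  lra.
lra.
Qed.

Lemma quad_dominates (N B c : R) : 0 < c -> 0 <= N -> 0 <= B ->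
  exists2 q0 : R, 0 <= q0 & forall q : R, q0 <= q -> N * q + B <= c * (expR q).
Proof.
move=> c0 N0 B0; exists (4 * (N + B) / c + 1).
  by rewrite addr_ge0// divr_ge0 ?(ltW c0)// mulr_ge0// addr_ge0.
move=> q hq; have q1 : 1 <= q.
  by apply: le_trans hq; rewrite lerDr divr_ge0 ?(ltW c0)// mulr_ge0// addr_ge0.
have h1 : 4 * (N + B) <= c * q.
  rewrite [c * q]mulrC -ler_pdivrMr//; apply: le_trans hq; lra.
have e1 : (1 + q / 2) ^+ 2 <= expR q.
  have -> : expR q = expR (q / 2) ^+ 2 by rewrite expr2 -expRD; congr expR; field.
  by rewrite lerXn2r ?nnegrE ?expR_ge0 ?expR_ge1Dx//; lra.
have h2 : c * (q ^+ 2 / 4) <= c * expR q.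
  rewrite ler_wpM2l ?(ltW c0)//; apply: le_trans e1.
  have -> : (1 + q / 2) ^+ 2 = q ^+ 2 / 4 + (1 + q) by field.
  by rewrite lerDl; lra.
have h3 : 4 * (N + B) * q <= c * q * q by rewrite ler_wpM2r//; lra.
have h4 : B <= B * q by rewrite ler_peMr.
have h5 : c * (q ^+ 2 / 4) = c * q * q / 4 by rewrite expr2; ring.
have h6 : 4 * (N + B) * q = 4 * (N * q) + 4 * (B * q) by ring.
move: h2 h3 h4; rewrite h5 h6; clear; move: (c * expR q) (c * q * q) (N * q) (B * q) => *; lra.
Qed.

(** Within scaled angle 1 of the axis the cosine is at least cos 1 > 0, so [Em] decays doubly
    exponentially. No such uniform smallness holds up to the edge of the sector. *)
Lemma Em_small m (res : C) a (n : int) e : (0 < m)%N -> 0 <= a -> 0 < e ->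
  exists s, forall w, complex.Re w <= s -> `|m%:R * complex.Im w - 2 * pi * n%:~R| <= 1 ->
    Em m res a w < e.
Proof.
move=> m0 a0 e0; have m1 : 1 <= m%:R :> R by rewrite ler1n.
have p0 := pi_gt0 R; have c0 := cos1_gt0 R.
pose N : R := normc (1 - res); pose Y := 1 + 2 * pi * `|n%:~R : R|.
have N0 : 0 <= N by exact: normc_ge0.
have Y0 : 0 <= Y by rewrite addr_ge0// mulr_ge0// mulr_ge0// ltW.
have B0 : 0 <= N * Y + `|ln e| + 1 by rewrite !addr_ge0// mulr_ge0.
have [q0 q00 H] := quad_dominates c0 N0 B0.
exists (- q0) => w ws hw.
pose q := - complex.Re w; have qq : q0 <= q by rewrite /q; lra.
have q0' : 0 <= q := le_trans q00 qq.
have hI : `|complex.Im w| <= Y.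
  have : `|m%:R * complex.Im w| <= Y.
    have -> : m%:R * complex.Im w = (m%:R * complex.Im w - 2 * pi * n%:~R) + 2 * pi * n%:~R by rewrite subrK.
    apply: le_trans (ler_normD _ _) _; rewrite lerD// normrM ler_wpM2r//.
    by rewrite normrM !ger0_norm// ltW.
  by apply: le_trans; rewrite normrM ger0_norm// ler_peMl.
rewrite -[X in _ < X](lnK e0) /Em ltr_expR.
have -> : complex.Re (Qm m res w) = complex.Re (1 - res) * complex.Re w
   - complex.Im (1 - res) * complex.Im w - complex.Re (Xm m w).
  by rewrite /Qm cReD cReN [X in X - _]cReM.
have hX : cos 1 * expR q <= complex.Re (Xm m w).
  rewrite (Xm_polar w n m0) cReM /= mul0r subr0 normc_Xm mulrC.
  apply: ler_pM; rewrite ?expR_ge0 ?(ltW c0) ?cos_ge_cos1//.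
  by rewrite ler_expR -mulrN -/q ler_peMl.
have hR : complex.Re (1 - res) * complex.Re w <= N * q.
  have -> : complex.Re (1 - res) * complex.Re w = - complex.Re (1 - res) * q by rewrite /q; ring.
  by rewrite ler_wpM2r//; apply: le_trans (ler_norm _) _; rewrite normrN; exact: Re_le_normc.
have hJ : - (complex.Im (1 - res) * complex.Im w) <= N * Y.
  apply: le_trans (ler_norm _) _; rewrite normrN normrM.
  by apply: ler_pM => //; exact: Im_le_normc.
have ha : (a + m%:R) * complex.Re w <= 0.
  have -> : complex.Re w = - q by rewrite /q opprK.
  by rewrite mulrN oppr_le0 mulr_ge0// addr_ge0.
have hl : - `|ln e| <= ln e by have := ler_norm (- ln e); rewrite normrN; lra.
have := H _ qq; move: hX hR hJ ha hl; clear.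
move: (cos 1 * _) (N * q) (N * Y) `|ln e| (ln e) (complex.Re (Xm m w)) => *.
lra.
Qed.

Definition axis m (n : int) (x : R) : C := x +i* (2 * pi * n%:~R / m%:R).

Lemma axis_sector m n (x : R) : (0 < m)%N -> m%:R * complex.Im (axis m n x) - 2 * pi * n%:~R = 0.
Proof. by move=> m0 /=; field; rewrite gt_eqF// ltr0n. Qed.

(** Identifies constants: a number dominated by [Em] along a single axis is 0. *)
Lemma axis_limit0 m (res : C) a K (n : int) (A : C) s : (0 < m)%N -> 0 <= a -> 0 <= K ->
  (forall x, x <= s -> normc A <= K * Em m res a (axis m n x)) -> A = 0.
Proof.
move=> m0 a0 K0 H; apply/eqP; rewrite -normc_eq0 eq_le normc_ge0 andbT leNgt.
apply/negP => A0; have K1 : 0 < K + 1 by lra.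
have [s1 h1] := @Em_small m res a n (normc A / (K + 1)) m0 a0 (divr_gt0 A0 K1).
have := H (Num.min s s1); rewrite ge_min lexx => /(_ isT).
have := h1 (axis m n (Num.min s s1)); rewrite axis_sector// normr0 /= ge_min lexx orbT ler01.
move=> /(_ isT isT); set x := Em _ _ _ _ => h2 h3.
have : K * x <= (K + 1) * x by rewrite ler_wpM2r ?ltW ?Em_gt0//; lra.
rewrite ltr_pdivlMr// mulrC in h2; lra.
Qed.

(* The n-th sector extends up to the two neighbouring attracting directions:
   the bound is small around the axis but large near the boundary, where [Pm]
   grows. *)
Definition has_values m (res : C) s phi u := exists2 K : R, 0 <= K & forall n w,
  `|m%:R * complex.Im w - 2 * pi * n%:~R| <= pi -> complex.Re w <= s ->
  normc (phi w - u n) <= K * Em m res 0 w.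

Lemma has_values_le m (res : C) s s' phi u : s' <= s ->
  has_values m res s phi u -> has_values m res s' phi u.
Proof. by move=> ss [K K0 H]; exists K => // n w h1 h2; apply: H => //; exact: le_trans ss. Qed.

Lemma has_values_affine m (res : C) s phi u (al be : C) :
  has_values m res s phi u -> has_values m res s (fun w => al * phi w + be) (fun n => al * u n + be).
Proof.
move=> [K K0 H]; exists (normc al * K); first by rewrite mulr_ge0// normc_ge0.
move=> n w h1 h2; have -> : al * phi w + be - (al * u n + be) = al * (phi w - u n) by ring.
by rewrite normcM -mulrA ler_wpM2l ?normc_ge0// H.
Qed.

Lemma has_values_exists m (res : C) s phi (phi' : C -> C) K : (0 < m)%N -> 0 <= K ->
  (forall w, complex.Re w <= s -> cder phi w (phi' w) /\ normc (phi' w) <= K * normc (Pm m res w)) ->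
  exists s' u, s' <= s /\ has_values m res s' phi u.
Proof.
move=> m0 K0 H; have [s1 s1s st] := @steep_exists m res 0 s m0 (lexx 0).
have /choice [u uP] : forall n : int, exists u : C, forall w,
    `|m%:R * complex.Im w - 2 * pi * n%:~R| <= pi -> complex.Re w + 2 <= s1 ->
    normc (phi w - u) <= 4 * K * Em m res 0 w.
  move=> n; apply: (@sector_limit R m res 0 K phi phi' s1 n) => // w ws.
  by rewrite mul0r expR0 mulr1; apply: H; exact: le_trans s1s.
exists (s1 - 2), u; split; first lra.
exists (4 * K); first by rewrite mulr_ge0.
by move=> n w h1 h2; apply: uP => //; lra.
Qed.

Lemma Re_near_ninfty (gamma : R -> C) s : cexp (gamma t) @[t --> +oo] --> (0 : C) ->
  \forall t \near +oo, complex.Re (gamma t) <= s.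
Proof.
move=> /cvgCP /(_ _ (expR_gt0 s)); apply: filterS => t.
by rewrite subr0 normc_cexp ltr_expR => /ltW.
Qed.

(** A curve whose argument tends to the axis eventually stays within scaled angle 1 of it, where
    [Em_small] applies. The reference angle is 0 because normal coordinates put the reference axis
    there. *)
Lemma has_values_family m (res : C) s phi u eps : (0 < m)%N ->
  has_values m res s phi u -> asymptotic_family m.+1 eps phi 0 u.
Proof.
move=> m0 [K K0 H] n gamma _ _ g0 gI; apply/cvgCP => e e0.
have mp : 0 < m%:R :> R by rewrite ltr0n.
have K1 : 0 < K + 1 by lra.
have [s1 h1] := @Em_small m res 0 n (e / (K + 1)) m0 (lexx 0) (divr_gt0 e0 K1).
have n1 := Re_near_ninfty s g0; have n2 := Re_near_ninfty s1 g0.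
have n3 : \forall t \near +oo, `|m%:R * complex.Im (gamma t) - 2 * pi * n%:~R| <= 1.
  move/cvgrPdist_lt : gI => /(_ m%:R^-1); rewrite invr_gt0 => /(_ mp); apply: filterS => t.
  rewrite add0r distrC => /ltW h.
  have -> : m%:R * complex.Im (gamma t) - 2 * pi * n%:~R =
     m%:R * (complex.Im (gamma t) - 2 * pi * n%:~R / m%:R) by field; rewrite gt_eqF.
  by rewrite normrM (ger0_norm (ltW mp)) mulrC -ler_pdivlMr// div1r.
near=> t.
have k1 : complex.Re (gamma t) <= s by near: t.
have k2 : complex.Re (gamma t) <= s1 by near: t.
have k3 : `|m%:R * complex.Im (gamma t) - 2 * pi * n%:~R| <= 1 by near: t.
have k4 : `|m%:R * complex.Im (gamma t) - 2 * pi * n%:~R| <= pi.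
  by apply: le_trans k3 _; have := @pihalf_ge1 R; have := pi_gt0 R; lra.
apply: le_lt_trans (H _ _ k4 k1) _.
have := h1 _ k2 k3; rewrite ltr_pdivlMr// mulrC; apply: le_lt_trans.
by rewrite ler_wpM2r ?ltW ?Em_gt0//; lra.
Unshelve. all: by end_near.
Qed.

End Values.

(** * Developing maps *)

Section Developing.
Context {R : realType}.
Local Notation C := (Cplx R).
Implicit Types (z w v y : C) (r s t e l a K : R) (f : C -> C) (G E : C -> C) (phi kap : C -> C) (u : int -> C).

(** Under [cexp] this half-plane covers the punctured disk of radius e^s. *)
Definition hp s : set C := [set w | complex.Re w < s].

Lemma hp_convex s : convexC (hp s).
Proof.
move=> a b t; rewrite /hp /= => ha hb /andP[t0 t1].
rewrite cReD cReM /= mul0r subr0 cReD cReN.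
have [->|tn] := eqVneq t 0; first lra.
have h1 : t * complex.Re b < t * s by rewrite ltr_pM2l// lt_neqAle eq_sym tn.
have h2 : (1 - t) * complex.Re a <= (1 - t) * s by rewrite ler_wpM2l ?subr_ge0// ltW.
lra.
Qed.

Lemma nbhs_hp s w : hp s w -> nbhs w (hp s).
Proof.
rewrite /hp /= => h; apply/nbhsCP; exists (s - complex.Re w); first by rewrite subr_gt0.
move=> v hv; rewrite /hp /=; have := Re_le_normc (v - w); rewrite cReD cReN.
by move=> /(le_trans (ler_norm _)); lra.
Qed.

Lemma hp_open s : open (hp s).
Proof. by rewrite openE => w; exact: nbhs_hp. Qed.

Lemma hp_expR s w : hp s w <-> normc (cexp w) < expR s.
Proof. by rewrite normc_cexp ltr_expR. Qed.

Lemma covering_spaceE eps : covering_space eps = [set w : C | normc (cexp w) < eps].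
Proof. by rewrite /covering_space cdiskE. Qed.

Lemma hp_covering s eps w : expR s <= eps -> hp s w -> covering_space eps w.
Proof. by rewrite covering_spaceE /= => h /hp_expR h1; exact: lt_le_trans h. Qed.

Lemma covering_hp eps w : 0 < eps -> covering_space eps w -> hp (ln eps) w.
Proof. by move=> e0; rewrite covering_spaceE /hp /= normc_cexp -{1}(lnK e0) ltr_expR. Qed.

Lemma nbhs_covering eps w : covering_space eps w -> nbhs w (covering_space eps).
Proof.
rewrite covering_spaceE /= => h; have e0 : 0 < eps by apply: le_lt_trans h; exact: normc_ge0.
have : hp (ln eps) w by apply: covering_hp; rewrite ?covering_spaceE.
by move/nbhs_hp; apply: filterS => v /hp_expR; rewrite lnK.
Qed.

(** Both functions solve the linear equation q' = g q, so their quotient has zero derivative. *)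
Lemma proportional (A : set C) (q1 q2 g : C -> C) : convexC A ->
  (forall w, A w -> cder q1 w (g w * q1 w)) ->
  (forall w, A w -> cder q2 w (g w * q2 w)) ->
  (forall w, A w -> q2 w != 0) ->
  exists K : C, forall w, A w -> q1 w = K * q2 w.
Proof.
move=> cA h1 h2 h3; have [[w0 Aw0]|A0] := pselect (exists w, A w); last first.
  by exists 0 => w Aw; case: A0; exists w.
exists (q1 w0 / q2 w0) => w Aw.
  have H : forall z, A z -> cder (fun x => q1 x * (q2 x)^-1) z 0.
    move=> z Az; apply: (cder_eq (cderM (h1 _ Az) (cderV (h3 _ Az) (h2 _ Az)))).
    by have := h3 _ Az; move: (q1 z) (q2 z) => x1 x2 ?; field.
  have := cder0_cst cA H Aw Aw0 => /(congr1 (fun x => x * q2 w)).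
  by rewrite divfK ?h3.
Qed.

(** The Christoffel symbol of the pulled-back connection, that is, the right-hand side of
    [christoffel_law]. *)
Definition pull (f G : C -> C) z : C := cd f z * G (f z) + cd (cd f) z / cd f z.

Lemma cder_developing_z G eps phi w : developing_map G eps phi -> covering_space eps w ->
  [/\ cder phi w (cexp w * derive_z phi w),
      cder (derive_z phi) w (cexp w * G (cexp w) * derive_z phi w) &
      derive_z phi w != 0].
Proof.
move=> dev cw; have nw := nbhs_covering cw.
have [d0 n0 dE] := dev _ cw; split; last exact: n0.
  by apply: (cder_eq (derivable_cder d0)); rewrite /derive_z mulrC divfK ?cexp_neq0.
have hphi : holomorphic_at phi w by apply: filterS nw => v /dev [].
have hq : cder (derive_z phi) w (cd (derive_z phi) w).
  apply: holomorphic_at_cder; apply: holomorphic_atM; first by rewrite -cdE; exact: holomorphic_at_cd.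
  by apply: holomorphic_atV; [exact: holomorphic_at_cexp|exact: cexp_neq0].
have dE' : cd (derive_z phi) w / cexp w / derive_z phi w = G (cexp w) by rewrite cdE.
apply: (cder_eq hq); rewrite -dE'; have := cexp_neq0 (R := R) w; move: n0.
move: (derive_z phi w) (cd _ w) (cexp w) => x1 x2 x3 n1 n2.
by field; apply/andP.
Qed.

Lemma cder_developing (G phi q : C -> C) eps :
  (forall w, covering_space eps w -> cder phi w (cexp w * q w)) ->
  (forall w, covering_space eps w -> q w != 0) ->
  (forall w, covering_space eps w -> cder q w (cexp w * G (cexp w) * q w)) ->
  developing_map G eps phi.
Proof.
move=> h1 h2 h3 w cw.
have E v : covering_space eps v -> derive_z phi v = q v.
  by move=> cv; rewrite /derive_z (cder1 (h1 _ cv)) mulrC mulKf// cexp_neq0.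
split; first exact: cder_derivable (h1 _ cw).
  by rewrite E// h2.
rewrite {1}/derive_z E//.
have -> : derive1 (derive_z phi) w = cexp w * G (cexp w) * q w.
  apply: cder1; apply: near_eq_cder (h3 _ cw).
  by apply: filterS (nbhs_covering cw) => v /E.
have := cexp_neq0 w; have := h2 _ cw.
by move: (cexp w) (q w) (G _) => x1 x2 x3 ? ?; field; apply/andP.
Qed.

Lemma developing_affine G eps phi (al be : C) : al != 0 ->
  developing_map G eps phi -> developing_map G eps (fun w => al * phi w + be).
Proof.
move=> a0 dev.
apply: (@cder_developing _ _ (fun w => al * derive_z phi w)) => w cw.
- have [h _ _] := cder_developing_z dev cw; apply: (cder_eq (cderD (cderZ al h) (cder_cst be _))); ring.
- by rewrite mulf_neq0//; have [] := dev _ cw.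
by have [_ h _] := cder_developing_z dev cw; apply: (cder_eq (cderZ al h)); ring.
Qed.

(** A coordinate change fixing 0 is written z e^(kap z), because this form comes with a lift to the
    covering: Im (kap 0) records by which angle arguments are turned, as a real number and not
    modulo 2 pi. *)
Definition lift kap w : C := w + kap (cexp w).
Definition unlift kap z : C := z * cexp (kap z).

Lemma cexp_lift kap w : cexp (lift kap w) = unlift kap (cexp w).
Proof. by rewrite /lift /unlift cexpD. Qed.

Lemma cder_lift kap w : derivable kap (cexp w) 1 ->
  cder (lift kap) w (1 + cd kap (cexp w) * cexp w).
Proof.
move=> d; apply: (cderD (cder_id w)).
exact: (cder_comp (cder_cexp w) (derivable_cd d)).
Qed.

Lemma cder_unlift kap z : derivable kap z 1 ->
  cder (unlift kap) z (cexp (kap z) * (1 + z * cd kap z)).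
Proof.
move=> d; apply: (cder_eq (cderM (cder_id z) (cder_comp (derivable_cd d) (cder_cexp _)))).
by rewrite /comp; ring.
Qed.

Lemma developing_pull G eps phi kap r : holomorphic_on (disk r) kap ->
  (forall z, disk r z -> z != 0 -> disk eps (unlift kap z)) ->
  (forall z, disk r z -> z != 0 -> cd (unlift kap) z != 0) ->
  developing_map G eps phi ->
  developing_map (pull (unlift kap) G) r (phi \o lift kap).
Proof.
move=> hk he hd dev; pose psi := unlift kap.
have inr w : covering_space r w -> disk r (cexp w) by rewrite /covering_space cdiskE.
apply: (@cder_developing _ _ (fun w => cd psi (cexp w) * derive_z phi (lift kap w))) => w cw.
all: have dw := inr _ cw; have cl : covering_space eps (lift kap w)
  by rewrite /covering_space /= cdiskE cexp_lift; apply: he => //; exact: cexp_neq0.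
all: have [p1 p2 p3] := cder_developing_z dev cl.
all: have dk := hk _ dw; have dl := cder_lift dk.
all: have dpsi : cd psi (cexp w) = cexp (kap (cexp w)) * (1 + cexp w * cd kap (cexp w))
  by apply: cder_cd; exact: cder_unlift.
- apply: (cder_eq (cder_comp dl p1)); rewrite dpsi cexp_lift /unlift; ring.
- by rewrite mulf_neq0// hd// cexp_neq0.
have hpsi : cder (cd psi) (cexp w) (cd (cd psi) (cexp w)).
  have hpsi0 : holomorphic_on (disk r) psi.
    by move=> z dz; exact: cder_derivable (cder_unlift (hk _ dz)).
  exact: derivable_cd (hol_cd hpsi0 dw).
have h1 := cder_comp (cder_cexp w) hpsi.
have h2 := cder_comp dl p2.
apply: (cder_eq (cderM h1 h2)); rewrite /comp /pull -/psi.
have n0 : cd psi (cexp w) != 0 by apply: hd => //; exact: cexp_neq0.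
have e0 := cexp_neq0 (R := R) w.
rewrite cexp_lift -/psi.
have eP : psi (cexp w) = cexp w * cexp (kap (cexp w)) by [].
(* Both sides are the derivative of [psi] after [cexp], which is also [cexp] after the lift. *)
have k1 : psi (cexp w) * (1 + cd kap (cexp w) * cexp w) = cexp w * cd psi (cexp w).
  by rewrite eP dpsi; ring.
move: (derive_z phi _) (G _) (cd (cd psi) _) => x1 x2 x3.
move: (1 + cd kap _ * _) k1 => y3; clear -n0; move: (cd psi _) n0 (psi _) => y1 n0 y2; move: (cexp w) => y4 k1.
have -> : y2 * x2 * x1 * y3 = y2 * y3 * x2 * x1 by ring.
by rewrite k1; field.
Qed.

Lemma developing_unique G1 G2 r phi1 phi2 z :
  developing_map G1 r phi1 -> developing_map G2 r phi2 ->
  (forall w, covering_space r w -> phi1 w = phi2 w) ->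
  disk r z -> z != 0 -> G1 z = G2 z.
Proof.
move=> d1 d2 e dz z0; have [w wz] := cexp_surj z0.
have cw : covering_space r w by rewrite /covering_space /= wz cdiskE.
have E v : covering_space r v -> derive_z phi1 v = derive_z phi2 v.
  move=> cv; have [p1 _ _] := cder_developing_z d1 cv; have [p2 _ _] := cder_developing_z d2 cv.
  have p3 : cder phi2 v (cexp v * derive_z phi1 v).
    by apply: near_eq_cder p1; apply: filterS (nbhs_covering cv) => y /e.
  by have /(mulfI (cexp_neq0 _)) := cder_unique p3 p2.
have [_ q1 n1] := cder_developing_z d1 cw; have [_ q2 n2] := cder_developing_z d2 cw.
have q3 : cder (derive_z phi2) w (cexp w * G1 (cexp w) * derive_z phi1 w).
  by apply: near_eq_cder q1; apply: filterS (nbhs_covering cw) => y /E.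
have := cder_unique q3 q2; rewrite (E _ cw) => /(mulIf n2) /(mulfI (cexp_neq0 _)).
by rewrite wz.
Qed.

(** With leading coefficient [m] the repelling axes are the arguments 2 pi n / m. The holomorphic
    remainder is written as a logarithmic derivative so that the derivative of a developing map is
    explicit. *)
Definition normal_form m (res : C) r E G := [/\ holomorphic_on (disk r) E, E 0 = 1,
  forall z, disk r z -> E z != 0 &
  forall z, disk r z -> z != 0 -> G z = m%:R / z ^+ m.+1 - res / z + cd E z / E z].

Definition dev_der m (res : C) E w : C := Pm m res w * E (cexp w).

Lemma cexp_Xm m w : Xm m w = (cexp w ^+ m)^-1.
Proof. by rewrite /Xm cexpN cexpMn. Qed.

Lemma cder_dev_der m (res : C) r E G w : normal_form m res r E G ->
  covering_space r w ->
  cder (fun v => dev_der m res E v / cexp v) w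
    (cexp w * G (cexp w) * (dev_der m res E w / cexp w)).
Proof.
move=> [hE _ En GE] cw; have dw : disk r (cexp w) by move: cw; rewrite /covering_space cdiskE.
have e0 := cexp_neq0 (R := R) w.
have d1 := cder_comp (cder_cexp w) (derivable_cd (hE _ dw)).
apply: (cder_eq (cderM (cderM (cder_Pm m res w) d1) (cderV e0 (cder_cexp w)))).
rewrite /dev_der GE// /comp cexp_Xm [cexp w ^+ m.+1]exprS; have := En _ dw.
have em : cexp w ^+ m != 0 by rewrite expf_neq0.
move: em e0; move: (cexp w ^+ m) => y; move: (E (cexp w)) (cd E (cexp w)) (Pm _ _ _) => x1 x2 x3; move: (cexp w) => x4 y0 x40 x10.
by field; apply/and3P.
Qed.

Lemma dev_der_neq0 m (res : C) r E G w : normal_form m res r E G ->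
  covering_space r w -> dev_der m res E w != 0.
Proof.
move=> [_ _ En _]; rewrite /covering_space cdiskE => cw.
by rewrite mulf_neq0 ?Pm_neq0// En.
Qed.

Lemma developing_normal m (res : C) r E G eps phi s : normal_form m res r E G ->
  developing_map G eps phi -> expR s <= eps -> expR s <= r ->
  exists2 K : C, K != 0 & forall w, hp s w -> cder phi w (K * dev_der m res E w).
Proof.
move=> nf dev se sr.
have [K KP] : exists K : C, forall w, hp s w -> derive_z phi w = K * (dev_der m res E w / cexp w).
  apply: (@proportional _ _ _ (fun w => cexp w * G (cexp w))) => [|w hw|w hw|w hw].
  - exact: hp_convex.
  - by have [] := cder_developing_z dev (hp_covering se hw).
  - exact: cder_dev_der nf (hp_covering sr hw).
  by rewrite mulf_neq0 ?invr_eq0 ?cexp_neq0// (dev_der_neq0 nf)//; exact: hp_covering hw.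
have hw0 : hp s (s - 1)%:C by rewrite /hp /=; lra.
exists K.
  have [_ _] := cder_developing_z dev (hp_covering se hw0); rewrite KP//.
  by apply: contra => /eqP ->; rewrite mul0r.
move=> w hw; have [h _ _] := cder_developing_z dev (hp_covering se hw).
by apply: (cder_eq h); rewrite KP// mulrCA [cexp w * _]mulrC divfK// cexp_neq0.
Qed.

Lemma dev_der_hol m (res : C) r E G s : normal_form m res r E G -> expR s <= r ->
  holomorphic_on (hp s) (dev_der m res E).
Proof.
move=> [hE _ _ _] sr w hw; have := hp_covering sr hw; rewrite /covering_space cdiskE => dw.
exact: cder_derivable (cderM (cder_Pm m res w) (cder_comp (cder_cexp w) (derivable_cd (hE _ dw)))).
Qed.

Lemma developing_exists m (res : C) r E G : 0 < r -> normal_form m res r E G ->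
  exists phi, (forall w, hp (ln r) w -> cder phi w (dev_der m res E w)) /\ developing_map G r phi.
Proof.
move=> r0 nf.
have [|phi H] := @primitive R (hp (ln r)) (dev_der m res E) (@hp_convex (ln r)) (@hp_open (ln r)).
  by apply: dev_der_hol nf _; rewrite lnK.
exists phi; split => //; apply: (@cder_developing _ _ (fun w => dev_der m res E w / cexp w)) => w cw.
- by apply: (cder_eq (H _ (covering_hp r0 cw))); rewrite mulrC divfK// cexp_neq0.
- by rewrite mulf_neq0 ?invr_eq0 ?cexp_neq0// (dev_der_neq0 nf).
exact: cder_dev_der nf cw.
Qed.

End Developing.

(** * Monodromy *)

Section Monodromy.
Context {R : realType}.
Local Notation C := (Cplx R).
Implicit Types (z w v y : C) (r s t e l a K : R) (f : C -> C) (G E : C -> C) (phi kap : C -> C) (u : int -> C).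

Definition mono (res : C) : C := cexp (- (0 +i* (2 * pi)) * res).

Lemma Xm_tpi m w : Xm m (w + tpi) = Xm m w.
Proof. by rewrite !cexp_Xm cexpD /tpi cexp_2pi mulr1. Qed.

Lemma Pm_tpi m (res : C) w : Pm m res (w + tpi) = mono res * Pm m res w.
Proof.
rewrite /Pm /Qm Xm_tpi /mono -cexpD.
have -> : (1 - res) * (w + tpi) - Xm m w =
  (- (0 +i* (2 * pi)) * res + ((1 - res) * w - Xm m w)) + tpi by rewrite /tpi; ring.
by rewrite [LHS]cexpD /tpi cexp_2pi mulr1.
Qed.

Lemma dev_der_tpi m (res : C) E w : dev_der m res E (w + tpi) = mono res * dev_der m res E w.
Proof. by rewrite /dev_der Pm_tpi cexpD /tpi cexp_2pi mulr1 mulrA. Qed.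

Lemma hp_tpi s w : hp s w -> hp s (w + tpi).
Proof. by rewrite /hp /= cReD /= addr0. Qed.

Lemma dev_period m (res : C) E phi (K : C) s :
  (forall w, hp s w -> cder phi w (K * dev_der m res E w)) ->
  exists b, forall w, hp s w -> phi (w + tpi) = mono res * phi w + b.
Proof.
move=> H; have hs0 : hp s (s - 1)%:C by rewrite /hp /=; lra.
exists (phi ((s - 1)%:C + tpi) - mono res * phi (s - 1)%:C) => w hw.
have d0 z : hp s z -> cder (fun v => phi (v + tpi) - mono res * phi v) z 0.
  move=> hz; have d1 := cderD (cder_id z) (cder_cst tpi z).
  have d2 := cder_comp d1 (H _ (hp_tpi hz)).
  apply: (cder_eq (cderB d2 (cderZ (mono res) (H _ hz)))).
  by rewrite dev_der_tpi; ring.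
have := cder0_cst (@hp_convex R s) d0 hw hs0 => /= <-.
by rewrite subrKC.
Qed.

Lemma axisD m n (x : R) : (0 < m)%N -> axis m (n + m%:Z) x = axis m n x + tpi.
Proof.
move=> m0; rewrite /axis; apply: complex_ext; rewrite ?cReD ?cImD /= ?addr0//.
by rewrite intrD -pmulrn; field; rewrite gt_eqF// ltr0n.
Qed.

Lemma Em_tpi m (res : C) a w : Em m res a (w + tpi) = normc (mono res) * Em m res a w.
Proof. by rewrite !EmE Pm_tpi normcM cReD /= addr0 mulrA. Qed.

Lemma hp_axis m n s (x : R) : x <= s - 1 -> hp s (axis m n x).
Proof. by rewrite /hp /= => h; lra. Qed.

Lemma values_period m (res : C) phi u (b : C) s : (0 < m)%N ->
  has_values m res s phi u ->
  (forall w, hp s w -> phi (w + tpi) = mono res * phi w + b) ->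
  forall k, u (k + m%:Z) = mono res * u k + b.
Proof.
move=> m0 [K K0 H] per k; apply/eqP; rewrite -subr_eq0; apply/eqP.
apply: (@axis_limit0 R m res 0 (2 * (normc (mono res) * K)) k _ (s - 1)) => //.
  by rewrite !mulr_ge0// normc_ge0.
move=> x xs; have sec n : `|m%:R * complex.Im (axis m n x) - 2 * pi * n%:~R| <= pi.
  by rewrite axis_sector// normr0 pi_ge0.
have xs' : complex.Re (axis m k x) <= s by rewrite /=; lra.
have h1 := H _ _ (sec k) xs'; have := H _ _ (sec (k + m%:Z)) xs'.
rewrite axisD// per ?Em_tpi; last exact: hp_axis.
have := le_normc_dist (u (k + m%:Z)) (mono res * phi (axis m k x) + b) (mono res * u k + b).
have -> : mono res * phi (axis m k x) + b - (mono res * u k + b) =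
  mono res * (phi (axis m k x) - u k) by ring.
rewrite (normcB (u (k + m%:Z)) (mono res * phi _ + b)) normcM.
have h2 : normc (mono res) * normc (phi (axis m k x) - u k) <= normc (mono res) * (K * Em m res 0 (axis m k x)).
  by rewrite ler_wpM2l ?normc_ge0.
have -> : u (k + m%:Z) - (mono res * u k + b) = u (k + m%:Z) - mono res * u k - b by ring.
move: h2; rewrite -!mulrA; move: (Em _ _ _ _) => Em0.
move: (normc (mono res)) => N; rewrite [N * (K * Em0)]mulrCA.
move: (K * (N * Em0)) (normc _) (normc _) (N * normc _); clear => *; lra.
Qed.

Lemma values_family_space m (res : C) E phi u (K : C) s : (0 < m)%N ->
  has_values m res s phi u ->
  (forall w, hp s w -> cder phi w (K * dev_der m res E w)) ->
  family_space m.+1 res u.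
Proof.
move=> m0 hv /dev_period [b bP]; exists b => k.
exact: (values_period m0 hv bP).
Qed.

Lemma near_Re_limit (gamma : R -> C) (T : R) : (forall t, complex.Re (gamma t) = - T - t) ->
  cexp (gamma t) @[t --> +oo] --> (0 : C).
Proof.
move=> H; apply/cvgCP => e e0; exists (- T - ln e); split; first exact: num_real.
by move=> t ht; rewrite subr0 normc_cexp H -{1}(lnK e0) ltr_expR; lra.
Qed.

(** Both families are limits along the same curves: rays on the axes of the new coordinate, and
    their images under [lift kap], whose arguments tend to the axes of the old coordinate because Im
    (kap 0) = theta0. *)
Lemma family_transfer m (res : C) kap r eps phi (theta0 : R) u u' s : (0 < m)%N -> 0 < r ->
  holomorphic_on (disk r) kap -> complex.Im (kap 0) = theta0 ->
  (forall z, disk r z -> z != 0 -> disk eps (unlift kap z)) ->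
  asymptotic_family m.+1 eps phi theta0 u ->
  has_values m res s (phi \o lift kap) u' -> u = u'.
Proof.
move=> m0 r0 hk hI he fam hv; apply/funext => n.
pose T := Num.max (1 - ln r) (- s).
have [T1 T2] : 1 - ln r <= T /\ - s <= T by rewrite !le_max !lexx orbT.
pose g0 (t : R) : C := axis m n (- T) + (-1) * t%:C.
have g0R t : complex.Re (g0 t) = - T - t by rewrite cReD cReM /= oppr0 mul0r subr0 mulN1r.
have g0I t : complex.Im (g0 t) = 2 * pi * n%:~R / m%:R.
  by rewrite cImD cImM /= oppr0 mul0r mulr0 !addr0.
have dg0 t : 0 <= t -> disk r (cexp (g0 t)).
  by move=> t0; rewrite /disk /= normc_cexp g0R -{1}(lnK r0) ltr_expR; lra.
pose gam (t : R) : C := lift kap (g0 t).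
have rg0 t : rder g0 t (-1) by exact: rder_aff.
have gam_cts t : 0 <= t -> {for t, continuous gam}.
  move=> t0; exact: rder_cts (rder_comp (rg0 t) (cder_lift (hk _ (dg0 t t0)))).
have lim0 := near_Re_limit g0R.
have d0 : disk r 0 by rewrite /disk /= normc0.
have kc := cder_cts (derivable_cd (hk _ d0)).
have A1 : phi (gam t) @[t --> +oo] --> u n.
  apply: fam.
  - apply: continuous_in_subspaceT => t; rewrite inE /= in_itv /= andbT; exact: gam_cts.
  - move=> t t0; rewrite /covering_space cdiskE /= cexp_lift; apply: he; first exact: dg0.
    exact: cexp_neq0.
  - have uc := cder_cts (cder_unlift (hk _ d0)).
    have u0 : unlift kap 0 = 0 by rewrite /unlift mul0r.
    rewrite -[X in _ --> X]u0.
    rewrite (_ : (fun t => cexp (gam t)) = unlift kap \o (fun t => cexp (g0 t))); last first.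
      by apply/funext => t; rewrite /= cexp_lift.
    exact: (continuous_cvg _ uc lim0).
  have kl : (kap (cexp (g0 t)) : C) @[t --> +oo] --> kap 0 by exact: (continuous_cvg _ kc lim0).
  rewrite -hI addrC; apply/cvgrPdist_lt => e e0.
  move/cvgCP : kl => /(_ _ e0); apply: filterS => t h.
  apply: le_lt_trans h; apply: le_trans _ (Im_le_normc _).
  rewrite /gam /lift [X in _ - X]cImD g0I cImD cImN /= distrC.
  by rewrite le_eqVlt; apply/orP; left; apply/eqP; congr `|_|; ring.
have A2 : phi (gam t) @[t --> +oo] --> u' n.
  have := @has_values_family R m res s (phi \o lift kap) u' r m0 hv n g0.
  apply.
  - apply: continuous_in_subspaceT => t _; exact: rder_cts (rg0 t).
  - by move=> t t0; rewrite /covering_space cdiskE /=; exact: dg0.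
  - exact: lim0.
  rewrite add0r; apply/cvgrPdist_lt => e e0; near=> t.
  by rewrite g0I /= subrr normr0.
exact: (cvg_unique (@norm_hausdorff _ C) A1 A2).
Unshelve. all: by end_near.
Qed.

End Monodromy.

(** * Matching two developing maps *)

Section Matching.
Context {R : realType}.
Local Notation C := (Cplx R).
Implicit Types (z w v y : C) (r s t e l a K M : R) (f : C -> C) (G E : C -> C) (phi kap b : C -> C) (u : int -> C).

(** Rounding to the nearest integer. That closed sectors leave no gap turns sectorial bounds into
    bounds on a half-plane. *)
Lemma sector_exists m w : exists n : int, `|m%:R * complex.Im w - 2 * pi * n%:~R| <= pi.
Proof.
have p0 := pi_gt0 R; set x := m%:R * complex.Im w.
exists (Num.floor (x / (2 * pi) + 2^-1)).
have /andP[h1 h2] := floor_itv (x / (2 * pi) + 2^-1).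
rewrite intrD in h2; set k : R := _%:~R in h1 h2 *.
have xE : 2 * pi * (x / (2 * pi) + 2^-1) = x + pi.
  have p1 : pi != 0 :> R by rewrite gt_eqF.
  rewrite mulrDr [X in X + _]mulrC divfK ?mulf_neq0//; congr (_ + _).
  by rewrite mulrAC divff// mul1r.
have g1 : 2 * pi * k <= 2 * pi * (x / (2 * pi) + 2^-1) by rewrite ler_wpM2l// mulr_ge0// ltW.
have g2 : 2 * pi * (x / (2 * pi) + 2^-1) <= 2 * pi * (k + 1) by rewrite ler_wpM2l ?(ltW h2)// mulr_ge0// ltW.
rewrite ler_norml; move: g1 g2; rewrite xE (mulrDr _ k 1) mulr1.
move: (2 * pi * k) => P *; apply/andP; split; lra.
Qed.

Lemma holomorphic_at_bounded f : holomorphic_at f 0 ->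
  exists r M, [/\ 0 < r, 0 <= M & forall z, disk r z -> derivable f z 1 /\ normc (f z) <= M].
Proof.
move=> hf; have [r r0 H] := (holomorphic_atP f 0).1 hf.
have /continuousCP/(_ 1 ltr01)/nbhsCP[r1 r10 H1] := cder_cts (holomorphic_at_cder hf).
exists (Num.min r r1), (normc (f 0) + 1); split.
- by rewrite lt_min r0.
- by rewrite addr_ge0// normc_ge0.
move=> z; rewrite /disk /= lt_min => /andP[z0 z1].
split; first by apply: H; rewrite subr0.
have h2 := H1 z; rewrite subr0 in h2; have := h2 z1; have := ge_normcB (f z) (f 0); nlra.
Qed.

Lemma holomorphic_at_vanish f : holomorphic_at f 0 -> f 0 = 0 ->
  exists r M, [/\ 0 < r, 0 <= M & forall z, disk r z -> normc (f z) <= M * normc z].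
Proof.
move=> hf f0; have [g hg fg] := holomorphic_at_div hf.
have [r [M [r0 M0 H]]] := holomorphic_at_bounded hg.
have /nbhsCP[r1 r10 H1] := fg.
exists (Num.min r r1), M; split => //; first by rewrite lt_min r0.
move=> z; rewrite /disk /= lt_min => /andP[z0 z1].
rewrite H1 ?subr0// f0 add0r normcM mulrC ler_wpM2r ?normc_ge0//.
by have [] := H z z0.
Qed.

Lemma cexp_near1 z : normc z <= 4^-1 -> normc (cexp z - 1) <= 2 * normc z.
Proof.
move=> hz; rewrite -(cexp0 (R := R)).
have := @cder_mvt R cexp 0 z cexp 2; rewrite subr0; apply => t /andP[t0 t1].
  exact: cder_cexp.
rewrite add0r normc_cexp cReM /= mul0r subr0.
have h1 : t * complex.Re z <= 4^-1.
  apply: le_trans (_ : t * 4^-1 <= _); last by rewrite ler_piMl.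
  rewrite ler_wpM2l//; apply: le_trans (ler_norm _) _; apply: le_trans (Re_le_normc _) hz.
apply: le_trans (_ : expR (4^-1) <= 2); first by rewrite ler_expR.
have e1 := expR_ge1Dx (- (4^-1) : R).
have e0 := expR_gt0 (4^-1 : R).
have : expR (4^-1 : R) * expR (- 4^-1) = 1 by rewrite -expRD subrr expR0.
have : expR (4^-1 : R) * (1 - 4^-1) <= expR (4^-1 : R) * expR (- 4^-1) by rewrite ler_wpM2l// ltW.
move: (expR _ * expR _) => P; lra.
Qed.

(** Here [b] stands for a logarithm of the multiplicative constant times [E], so that the derivative
    of a developing map is [cexp] of a single exponent. *)
Definition expo m (res : C) b w : C := Qm m res w + b (cexp w).

Lemma cder_expo m (res : C) b w : derivable b (cexp w) 1 ->
  cder (expo m res b) w (1 - res + m%:R * Xm m w + cd b (cexp w) * cexp w).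
Proof.
move=> db; apply: (cderD (cder_Qm m res w)).
exact: (cder_comp (cder_cexp w) (derivable_cd db)).
Qed.

Lemma expo_Pm m (res : C) b w : cexp (expo m res b w) = Pm m res w * cexp (b (cexp w)).
Proof. by rewrite cexpD. Qed.

(* [cexp (expo m res b)] varies by a factor at most 1/2 on a disk of radius
   [c * |cexp w| ^ m]. *)
Lemma expo_ball m (res : C) b : (0 < m)%N -> holomorphic_at b 0 ->
  exists c s : R, [/\ 0 < c, c <= 1 & forall w v, complex.Re w <= s ->
    normc (v - w) < c * expR (m%:R * complex.Re w) ->
    [/\ complex.Re v <= complex.Re w + 1, derivable b (cexp v) 1 &
     normc (cexp (expo m res b v) - cexp (expo m res b w)) <= normc (cexp (expo m res b w)) / 2]].
Proof.
move=> m0 hb; have m1 : 1 <= m%:R :> R by rewrite ler1n.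
have [r [M [r0 M0 H]]] := holomorphic_at_bounded (holomorphic_at_cd hb).
have [r1 [M1 [r10 M10 H1]]] := holomorphic_at_bounded hb.
pose L : R := normc (1 - res) + m%:R + M; have L1 : 1 <= L.
  by rewrite /L; have := normc_ge0 (1 - res); nlra.
have L0 : 0 < L by lra.
have em := expR_gt0 (m%:R : R).
(* On the disk the exponent has derivative at most L e^m e^(- m x), so over a distance c e^(m x) it
   changes by at most 1/4; [cexp_near1] turns this into the factor 1/2. *)
pose c : R := (4 * L * expR m%:R)^-1.
have c0 : 0 < c by rewrite invr_gt0 !mulr_gt0.
have e1 : 1 <= expR m%:R :> R by rewrite -expR0 ler_expR.
have c1 : c <= 1.
  rewrite invf_le1 ?mulr_gt0//; apply: le_trans L1 _.
  have : L * 1 <= L * expR m%:R by rewrite ler_wpM2l// ltW.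
  by rewrite mulr1 -mulrA; move: (L * expR _) => P; lra.
(* The disk around [w] has radius at most 1: the first bound keeps its image in the domains of [b]
   and its derivative, the second gives |cexp y| <= 1. *)
pose s : R := Num.min (ln (Num.min r r1) - 2) (- 2).
have rr : 0 < Num.min r r1 by rewrite lt_min r0.
have [s1 s2] : s <= ln (Num.min r r1) - 2 /\ s <= - 2 by rewrite !ge_min !lexx orbT.
exists c, s; split => //; move=> w v ws hv.
set x := complex.Re w in ws hv.
have mx : m%:R * x <= x by rewrite ler_neMl//; lra.
have ex1 : expR (m%:R * x) <= 1 by rewrite -[leRHS]expR0 ler_expR; lra.
have xneg : x <= -2 by exact: le_trans ws s2.
have cx1 : c * expR (m%:R * x) <= 1 by rewrite mulr_ile1 ?expR_ge0// ltW.
have in_ball y : normc (y - w) < c * expR (m%:R * x) ->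
   [/\ complex.Re y <= x + 1, x - 1 <= complex.Re y & disk (Num.min r r1) (cexp y)].
  move=> hy; have := Re_le_normc (y - w); rewrite cReD cReN => hRe.
  have : `|complex.Re y - complex.Re w| <= 1 by lra.
  rewrite ler_norml -/x => /andP[y1 y2].
  split; [lra|lra|]; rewrite /disk /= normc_cexp.
  by rewrite -[ltRHS](lnK rr) ltr_expR; lra.
have in_r y : disk (Num.min r r1) y -> disk r y /\ disk r1 y.
  by rewrite /disk /= lt_min => /andP[].
have dexpo y : normc (y - w) < c * expR (m%:R * x) ->
  cder (expo m res b) y (1 - res + m%:R * Xm m y + cd b (cexp y) * cexp y).
  move=> hy; have [_ _ /in_r[_ d1]] := in_ball y hy.
  by apply: cder_expo; have [] := H1 _ d1.
have [v1 v2 v4] := in_ball v hv; split => //.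
  by have [_ d1] := in_r _ v4; have [] := H1 _ d1.
have -> : cexp (expo m res b v) - cexp (expo m res b w) =
   cexp (expo m res b w) * (cexp (expo m res b v - expo m res b w) - 1).
  by rewrite cexpB mulrBr mulr1 mulrC divfK ?cexp_neq0.
rewrite normcM ler_wpM2l ?normc_ge0//.
suff h : normc (expo m res b v - expo m res b w) <= 4^-1.
  by apply: le_trans (cexp_near1 h) _; lra.
have seg (t : R) : 0 <= t <= 1 -> normc (w + t%:C * (v - w) - w) < c * expR (m%:R * x).
  move=> /andP[t0 t1]; rewrite addrC addKr normcM normc_real ger0_norm//.
  by apply: le_lt_trans hv; rewrite ler_piMl// normc_ge0.
apply: le_trans (_ : L * expR m%:R * expR (- (m%:R * x)) * normc (v - w) <= _).
  apply: (cder_mvt (f' := fun y => 1 - res + m%:R * Xm m y + cd b (cexp y) * cexp y)).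
    by move=> t t01; apply: dexpo; exact: seg.
  move=> t t01; set y : C := w + _; have [y1 y2 /in_r[y4 _]] := in_ball y (seg t t01).
  have [_ hM] := H _ y4.
  have X1 : normc (Xm m y) <= expR m%:R * expR (- (m%:R * x)).
    by rewrite normc_Xm -expRD ler_expR -subr_ge0 (_ : _ - _ = m%:R * (1 + (complex.Re y - x))); [rewrite mulr_ge0//; lra|ring].
  have X2 : 1 <= expR m%:R * expR (- (m%:R * x)).
    have : 1 <= expR (- (m%:R * x)) by rewrite -[leLHS]expR0 ler_expR; lra.
    by move=> h; rewrite -[leLHS](mul1r 1) ler_pM.
  have X3 : normc (cexp y) <= 1 by rewrite normc_cexp -[leRHS]expR0 ler_expR; lra.
  have X4 : normc (cd b (cexp y) * cexp y) <= M.
    by rewrite normcM -(mulr1 M) ler_pM ?normc_ge0.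
  apply: le_trans (le_normcD _ _) _; apply: le_trans (lerD (le_normcD _ _) (lexx _)) _.
  rewrite normcM normc_nat -[leRHS]mulrA; set P := expR _ * _ in X1 X2 *.
  rewrite /L !mulrDl; apply: lerD; first apply: lerD.
  - by rewrite ler_peMr ?normc_ge0.
  - by rewrite ler_wpM2l.
  by apply: le_trans X4 _; rewrite ler_peMr.
have ex0 := expR_gt0 (- (m%:R * x) : R).
apply: le_trans (_ : L * expR m%:R * expR (- (m%:R * x)) * (c * expR (m%:R * x)) <= _).
  by rewrite ler_wpM2l ?(ltW hv)// !mulr_ge0 ?expR_ge0// ltW.
rewrite expRN /c; have := expR_gt0 (m%:R * x : R); move: em L0.
move: (expR (m%:R * x)) => p2; move: (expR m%:R) => p1 p10 L0 p20.
rewrite le_eqVlt; apply/orP; left; apply/eqP; field.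
by rewrite !gt_eqF.
Qed.

(** A derivative smaller by e^(a Re w) improves the rate from [Em] with exponent 0 to [Em] with
    exponent [a]. The limit found by [sector_limit] is the prescribed one, since both are approached
    along the axis. *)
Lemma values_decay m (res : C) a K s0 phi (phi' : C -> C) u : (0 < m)%N -> 0 <= a -> 0 <= K ->
  (forall w, complex.Re w <= s0 -> cder phi w (phi' w) /\
     normc (phi' w) <= K * normc (Pm m res w) * expR (a * complex.Re w)) ->
  has_values m res s0 phi u ->
  exists2 s, s <= s0 & forall n w, `|m%:R * complex.Im w - 2 * pi * n%:~R| <= pi ->
    complex.Re w <= s -> normc (phi w - u n) <= 4 * K * Em m res a w.
Proof.
move=> m0 a0 K0 H [K1 K10 hv].
have [s1 s1s st] := @steep_exists R m res a (Num.min s0 0) m0 a0.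
move: s1s; rewrite le_min => /andP[s10 s1n].
exists (s1 - 2); first by lra.
move=> n w hn ws.
have H1 x : complex.Re x <= s1 -> cder phi x (phi' x) /\
    normc (phi' x) <= K * normc (Pm m res x) * expR (a * complex.Re x).
  by move=> xs; apply: H; exact: le_trans s10.
have [nu hnu] := @sector_limit R m res a K phi phi' s1 n m0 a0 K0 st H1.
suff n0 : nu - u n = 0.
  have -> : u n = nu by apply/eqP; rewrite eq_sym -subr_eq0 n0.
  by apply: hnu => //; lra.
apply: (@axis_limit0 R m res 0 (K1 + 4 * K) n _ (s1 - 2)) => //.
  by rewrite addr_ge0// mulr_ge0.
move=> x xs; have sec : `|m%:R * complex.Im (axis m n x) - 2 * pi * n%:~R| <= pi.
  by rewrite axis_sector// normr0 pi_ge0.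
have k1 : complex.Re (axis m n x) <= s0 by rewrite /=; lra.
have k2 : complex.Re (axis m n x) + 2 <= s1 by rewrite /=; lra.
have k0 : x <= 0 by lra.
have := hv _ _ sec k1; have := hnu _ sec k2.
have E01 : Em m res a (axis m n x) <= Em m res 0 (axis m n x).
  by rewrite /Em ler_expR lerD2l /= ler_wnM2r// lerD2r.
have : 4 * K * Em m res a (axis m n x) <= 4 * K * Em m res 0 (axis m n x) by rewrite ler_wpM2l ?mulr_ge0.
rewrite (mulrDl K1 (4 * K)); set y := axis m n x.
have := le_normc_dist nu (phi y) (u n); rewrite (normcB nu (phi y)).
move: (Em _ _ 0 _) (Em _ _ a _) => E0 E1.
move: (4 * K * E1) (4 * K * E0) (K1 * E0).
move: (normc (phi y - nu)) (normc (phi y - u n)) (normc _); clear => *; lra.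
Qed.

Lemma has_valuesD m (res : C) s phi1 phi2 u1 u2 : has_values m res s phi1 u1 ->
  has_values m res s phi2 u2 -> has_values m res s (fun w => phi1 w + phi2 w) (fun n => u1 n + u2 n).
Proof.
move=> [K1 K10 H1] [K2 K20 H2]; exists (K1 + K2); first exact: addr_ge0.
move=> n w h1 h2; rewrite opprD addrACA mulrDl.
apply: le_trans (le_normcD _ _) _; exact: lerD (H1 _ _ h1 h2) (H2 _ _ h1 h2).
Qed.

(** Equality of [b1 0] and [b2 0] makes the difference of the derivatives of size |z| |Pm|, which is
    the case a = 1 of [values_decay]. Equal values make its limit 0 in every sector, and the sectors
    cover the half-plane. *)
Lemma match_bound m (res : C) b1 b2 u (phi1 phi2 : C -> C) s0 : (0 < m)%N ->
  holomorphic_at b1 0 -> holomorphic_at b2 0 -> b1 0 = b2 0 ->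
  (forall w, hp s0 w -> cder phi1 w (cexp (expo m res b1 w))) ->
  (forall w, hp s0 w -> cder phi2 w (cexp (expo m res b2 w))) ->
  has_values m res s0 phi1 u -> has_values m res s0 phi2 u ->
  exists A s : R, 0 <= A /\ forall w, complex.Re w <= s ->
    normc (phi1 w - phi2 w) <= A * Em m res 1 w.
Proof.
move=> m0 h1 h2 b0 d1 d2 v1 v2.
pose B z : C := cexp (b1 z) - cexp (b2 z).
have hB : holomorphic_at B 0.
  apply: holomorphic_atD; first exact: (holomorphic_at_comp h1 (holomorphic_at_cexp _)).
  by apply: holomorphic_atN; exact: (holomorphic_at_comp h2 (holomorphic_at_cexp _)).
have B0 : B 0 = 0 by rewrite /B b0 subrr.
have [r [M [r0 M0 HB]]] := holomorphic_at_vanish hB B0.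
pose s1 : R := Num.min (s0 - 1) (ln r - 1).
have [s10 s1r] : s1 <= s0 - 1 /\ s1 <= ln r - 1 by rewrite !ge_min !lexx orbT.
pose D w : C := phi1 w + (-1 * phi2 w + 0).
pose D' w : C := cexp (expo m res b1 w) - cexp (expo m res b2 w).
have HD w : complex.Re w <= s1 -> cder D w (D' w) /\ normc (D' w) <= M * normc (Pm m res w) * expR (1 * complex.Re w).
  move=> ws; have hw : hp s0 w by rewrite /hp /=; lra.
  split.
    apply: (cder_eq (cderD (d1 _ hw) (cderD (cderZ (-1) (d2 _ hw)) (cder_cst 0 w)))).
    by rewrite mulN1r addr0.
  have -> : D' w = Pm m res w * B (cexp w) by rewrite /D' !expo_Pm -mulrBr.
  have dw : disk r (cexp w) by rewrite /disk /= normc_cexp -[ltRHS](lnK r0) ltr_expR; lra.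
  have := HB _ dw; rewrite normcM normc_cexp mul1r => h.
  by rewrite [M * _]mulrC -mulrA ler_wpM2l ?normc_ge0.
have s1s : s1 <= s0 by lra.
have vD := has_valuesD (has_values_le s1s v1) (has_values_affine (-1) 0 (has_values_le s1s v2)).
have [s ss hs] := values_decay m0 ler01 M0 HD vD.
exists (4 * M), s; split; first by rewrite mulr_ge0.
move=> w ws; have [n hn] := sector_exists m w.
have := hs n w hn ws; rewrite mulN1r addr0 subrr subr0.
by rewrite /D mulN1r addr0.
Qed.

(** The displacement needed is about |phi1 - phi2| divided by the derivative of [phi2], of order
    e^((1 + m) Re w). Far to the left it is well inside the disk of radius c e^(m Re w), on which
    [phi2] is nearly affine, hence injective. *)
Lemma match_solve m (res : C) b1 b2 u (phi1 phi2 : C -> C) s0 : (0 < m)%N ->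
  holomorphic_at b1 0 -> holomorphic_at b2 0 -> b1 0 = b2 0 ->
  (forall w, hp s0 w -> cder phi1 w (cexp (expo m res b1 w))) ->
  (forall w, hp s0 w -> cder phi2 w (cexp (expo m res b2 w))) ->
  has_values m res s0 phi1 u -> has_values m res s0 phi2 u ->
  exists A c s : R, [/\ 0 <= A, 0 < c <= 1, s <= s0 - 2, s <= 0 & forall w, complex.Re w <= s ->
    [/\ A * expR ((1 + m%:R) * complex.Re w) <= c / 4 * expR (m%:R * complex.Re w),
      exists2 v, normc (v - w) <= A * expR ((1 + m%:R) * complex.Re w) & phi2 v = phi1 w &
      forall v1 v2, normc (v1 - w) < c * expR (m%:R * complex.Re w) ->
        normc (v2 - w) < c * expR (m%:R * complex.Re w) -> phi2 v1 = phi2 v2 -> v1 = v2]].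
Proof.
move=> m0 h1 h2 b0 d1 d2 v1 v2; have m1 : 1 <= m%:R :> R by rewrite ler1n.
have [A [s1 [A0 HA]]] := match_bound m0 h1 h2 b0 d1 d2 v1 v2.
have [c [s2 [c0 c1 Hc]]] := expo_ball res m0 h2.
have [r [M [r0 M0 Hr]]] := holomorphic_at_bounded h2.
(* The 2 is the loss in [inverse_exists], and e^M compares |Pm| with the derivative of [phi2]. The
   last entry of [s] below makes A' e^(Re w) at most c / 4. *)
pose A' : R := 2 * A * expR M; have A'0 : 0 <= A' by rewrite !mulr_ge0// expR_ge0.
have A'1 : 0 < A' + 1 by lra.
pose s : R := Num.min (Num.min (Num.min s1 s2) (ln r - 1)) (Num.min (Num.min (s0 - 2) 0) (ln (c / 4 / (A' + 1)))).
have [s3 s4 s5] : [/\ s <= s1, s <= s2 & s <= ln r - 1] by rewrite !ge_min !lexx !orbT.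
have [s6 s7 s8] : [/\ s <= s0 - 2, s <= 0 & s <= ln (c / 4 / (A' + 1))] by rewrite !ge_min !lexx !orbT.
exists A', c, s; split => //; first by rewrite c0.
move=> w ws; set x := complex.Re w in ws *.
have exc : A' * expR x <= c / 4.
  have c4 : 0 < c / 4 / (A' + 1) by rewrite !divr_gt0.
  have : expR x <= c / 4 / (A' + 1) by rewrite -[leRHS](lnK c4) ler_expR (le_trans ws).
  rewrite ler_pdivlMr// mulrC => h; apply: le_trans h.
  by rewrite ler_wpM2r ?expR_ge0//; lra.
have ea0 := expR_gt0 (m%:R * x); set em := expR (m%:R * x) in ea0 *.
have e1 : expR ((1 + m%:R) * x) = expR x * em by rewrite mulrDl mul1r expRD.
have cl1 : A' * expR ((1 + m%:R) * x) <= c / 4 * em by rewrite e1 mulrA ler_wpM2r// ltW.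
pose a : C := cexp (expo m res b2 w).
have a0 : a != 0 by exact: cexp_neq0.
have Hd v : normc (v - w) < c * em -> cder phi2 v (cexp (expo m res b2 v)).
  move=> hv; have [g1 _ _] := Hc w v (le_trans ws s4) hv.
  by apply: d2; rewrite /hp /=; lra.
have Hn v : normc (v - w) < c * em -> normc (cexp (expo m res b2 v) - a) <= normc a / 2.
  by move=> hv; have [] := Hc w v (le_trans ws s4) hv.
split => //; last first.
  move=> y1 y2 k1 k2 e12; apply/eqP; rewrite eq_sym -subr_eq0 -normc_eq0 eq_le normc_ge0 andbT.
  have := lower_lipschitz Hd Hn k1 k2; rewrite e12 subrr normc0.
  by rewrite pmulr_rle0// divr_gt0// normc_gt0.
have D2 : 2 * normc (phi1 w - phi2 w) <= normc a * (A' * expR ((1 + m%:R) * x)).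
  have dw : disk r (cexp w) by rewrite /disk /= normc_cexp -[ltRHS](lnK r0) ltr_expR -/x; lra.
  have [_ hM] := Hr _ dw.
  have ge : normc (Pm m res w) <= normc a * expR M.
    rewrite /a expo_Pm normcM -mulrA ler_peMr ?normc_ge0// normc_cexp -expRD -[leLHS]expR0 ler_expR.
    have := Re_le_normc (b2 (cexp w)); rewrite ler_norml => /andP[q1 _].
    by move: q1 hM; clear; nlra.
  have := HA w (le_trans ws s3); rewrite EmE -/x => hD.
  apply: le_trans (_ : 2 * (A * (normc (Pm m res w) * expR ((1 + m%:R) * x))) <= _); first by rewrite ler_wpM2l.
  have -> : normc a * (A' * expR ((1 + m%:R) * x)) = 2 * (A * (normc a * expR M * expR ((1 + m%:R) * x))).
    by rewrite /A'; ring.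
  by rewrite ler_wpM2l// ler_wpM2l// ler_wpM2r// expR_ge0.
have [|v hv ve] := @inverse_exists R phi2 _ w a (c * em) a0 Hd Hn (phi1 w).
  apply: le_lt_trans D2 _; rewrite ltr_pM2l ?normc_gt0//; apply: le_lt_trans cl1 _.
  by rewrite ltr_pM2r//; lra.
exists v => //; apply: le_trans hv _.
by rewrite ler_pdivrMr ?normc_gt0// [leRHS]mulrC.
Qed.

End Matching.

(** * Isomorphism of germs *)

Section Isomorphism.
Context {R : realType}.
Local Notation C := (Cplx R).
Implicit Types (z w v y : C) (r s t e l a K M : R) (f : C -> C) (G E : C -> C) (phi kap b : C -> C) (u : int -> C).

(** An arbitrary choice of logarithm. It is composed only with functions of period 2 i pi, whose
    values do not depend on the branch. *)
Definition clog z : C := get [set w : C | cexp w = z].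

Lemma clogK z : z != 0 -> cexp (clog z) = z.
Proof. by move=> /cexp_surj [w wz]; exact: (@getI _ [set w : C | cexp w = z] w). Qed.

Lemma periodic_cexp s (h : C -> C) : (forall w, hp s w -> h (w + tpi) = h w) ->
  forall w v, hp s w -> cexp v = cexp w -> h v = h w.
Proof.
move=> per.
have hpn w n : hp s w -> hp s (w + n%:R * tpi).
  by rewrite /hp /= cReD RenM /= mulr0 addr0.
have pern w n : hp s w -> h (w + n%:R * tpi) = h w.
  move=> hw; elim: n => [|n IH]; first by rewrite mul0r addr0.
  by rewrite -IH -(per _ (hpn _ n hw)); congr h; rewrite -natr1; ring.
move=> w v hw /cexp_eq [k ->]; have kE n : 0 +i* (2 * pi * n%:R) = n%:R * tpi :> C.
  by apply: complex_ext; rewrite ?RenM ?ImnM /=; ring.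
case: k => n; first by rewrite -pmulrn kE pern.
rewrite NegzE rmorphN /= -pmulrn mulrN.
have -> : 0 +i* (- (2 * pi * n.+1%:R)) = - (n.+1%:R * tpi) :> C.
  by rewrite -kE; apply: complex_ext; rewrite ?cReN ?cImN /= ?oppr0.
rewrite -[in RHS](subrK (n.+1%:R * tpi) w) pern //.
by move: hw; rewrite /hp /= cReD cReN RenM /= mulr0 oppr0 addr0.
Qed.

(** A periodic function factors through [cexp]; local inverses of [cexp] show that the factor is
    holomorphic on the punctured disk, and boundedness removes the singularity. *)
Lemma descend_bounded s A (h : C -> C) :
  (forall w, hp s w -> derivable h w 1) ->
  (forall w, hp s w -> h (w + tpi) = h w) ->
  (forall w, hp s w -> normc (h w) <= A) ->
  forall r, 0 < r -> r < expR s -> exists2 g : C -> C,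
    holomorphic_on (disk r) g & forall w, hp (ln r) w -> g (cexp w) = h w.
Proof.
move=> dh per hb r r0 rs.
have pc := periodic_cexp per.
pose k z : C := h (clog z).
have kE w : hp s w -> k (cexp w) = h w.
  by move=> hw; apply: pc => //; rewrite clogK// cexp_neq0.
have es := expR_gt0 s.
have hd z : disk (expR s) z -> z != 0 -> derivable k z 1.
  move=> dz z0; have [w0 w0z] := cexp_surj z0.
  have hw0 : hp s w0 by apply/hp_expR; rewrite w0z.
  have c0 : cd cexp w0 != 0 by rewrite (cder_cd (cder_cexp w0)) cexp_neq0.
  have [rho [s' [g [/andP[rho0 _] s'0 _ inj gP]]]] := local_inverse (holomorphic_at_cexp w0) c0 ltr01.
  rewrite w0z in gP; have gz : g z = w0.
    have [q1 q2 _] := gP z ltac:(by rewrite subrr normc0).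
    by apply: inj => //; rewrite ?subrr ?normc0// w0z.
  have [_ _ dg] := gP z ltac:(by rewrite subrr normc0).
  have dk : cder h (g z) (cd h w0) by rewrite gz; exact: derivable_cd (dh _ hw0).
  apply: cder_derivable; apply: near_eq_cder (cder_comp dg dk).
  have n1 : \forall y \near z, normc (y - z) < s' by exact: near_normc.
  have n2 : \forall y \near z, hp s (g y).
    by have := cder_cts dg; apply; rewrite gz; exact: nbhs_hp.
  apply: filterS2 n1 n2 => y y1 y2; have [_ gy _] := gP y y1.
  by rewrite /= -kE// gy.
have hbd z : disk (expR s) z -> z != 0 -> normc (k z) <= A.
  move=> dz z0; have [w0 w0z] := cexp_surj z0.
  have hw0 : hp s w0 by apply/hp_expR; rewrite w0z.
  by rewrite -w0z kE//; exact: hb.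
have [g hg gk] := removable_disk es hd hbd r0 rs.
exists g => // w hw.
have hw' : hp s w by apply/hp_expR; apply: lt_trans rs; rewrite -[ltRHS](lnK r0); apply/hp_expR.
by rewrite -kE// -gk ?cexp_neq0//; move/hp_expR: hw; rewrite lnK.
Qed.

(** The decay says |g z| <= A |z| away from 0, which is incompatible by continuity with a nonzero
    value at 0. *)
Lemma descend_periodic s A (h : C -> C) : 0 <= A ->
  (forall w, hp s w -> derivable h w 1) ->
  (forall w, hp s w -> h (w + tpi) = h w) ->
  (forall w, hp s w -> normc (h w) <= A * expR (complex.Re w)) ->
  forall r, 0 < r -> r < expR s -> exists g : C -> C,
    [/\ holomorphic_on (disk r) g, g 0 = 0 & forall w, hp (ln r) w -> g (cexp w) = h w].
Proof.
move=> A0 dh per hb r r0 rs.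
have hb' w : hp s w -> normc (h w) <= A * expR s.
  by move=> hw; apply: le_trans (hb w hw) _; rewrite ler_wpM2l// ler_expR ltW.
have [g hg gh] := descend_bounded dh per hb' r0 rs.
have d0 : disk r 0 by rewrite /disk /= normc0.
exists g; split => //.
apply/eqP; rewrite -normc_eq0 eq_le normc_ge0 andbT leNgt; apply/negP => g0.
have n1 : 0 < normc (g 0) / 2 by rewrite divr_gt0.
have /continuousCP/(_ _ n1)/nbhsCP[d d0' Hd] := cder_cts (derivable_cd (hg _ d0)).
have A1 : 0 < A + 1 by lra.
pose t := Num.min (Num.min (d / 2) (r / 2)) (normc (g 0) / 2 / (A + 1)).
have t0 : 0 < t by rewrite !lt_min !divr_gt0.
have [t1 t2 t3] : [/\ t <= d / 2, t <= r / 2 & t <= normc (g 0) / 2 / (A + 1)].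
  by rewrite !ge_min !lexx !orbT.
have nt : normc (t%:C : C) = t by rewrite normc_real ger0_norm// ltW.
have tn0 : t%:C != 0 :> C by rewrite -normc_gt0 nt.
have dt : disk r t%:C by rewrite /disk /= nt; lra.
have h1 := Hd t%:C; rewrite subr0 nt in h1.
have h2 : t < d by lra.
have h3 : normc (g t%:C) <= A * t.
  have [w wt] := cexp_surj tn0; rewrite -wt gh; last by apply/hp_expR; rewrite lnK// wt.
  rewrite -[X in A * X]nt -wt normc_cexp; apply: hb; apply/hp_expR; rewrite wt nt.
  by apply: lt_trans rs; lra.
have h4 : t * (A + 1) <= normc (g 0) / 2 by rewrite -ler_pdivlMr.
have := h1 h2; have := ge_normcB (g 0) (g t%:C); rewrite (normcB (g 0)).
move: h3 h4; rewrite mulrDr mulr1 [t * A]mulrC; move: (A * t) => At; nlra.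
Qed.

(** The solution [V w] is first chosen point by point. Its uniqueness in the disk of radius [rho w]
    then does the rest: [V] must agree with a holomorphic local inverse of [phi2], and it must
    commute with the translation by 2 i pi. *)
Lemma match_normal m (res : C) b1 b2 u (phi1 phi2 : C -> C) s0 : (0 < m)%N ->
  holomorphic_at b1 0 -> holomorphic_at b2 0 -> b1 0 = b2 0 ->
  (forall w, hp s0 w -> cder phi1 w (cexp (expo m res b1 w))) ->
  (forall w, hp s0 w -> cder phi2 w (cexp (expo m res b2 w))) ->
  has_values m res s0 phi1 u -> has_values m res s0 phi2 u ->
  exists r (eta : C -> C), [/\ 0 < r, holomorphic_on (disk r) eta, eta 0 = 0 &
    forall w, hp (ln r) w -> phi2 (lift eta w) = phi1 w].
Proof.
move=> m0 hb1 hb2 b0 d1 d2 v1 v2.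
have [A [c [s [A0 /andP[c0 c1] ss0 sn H]]]] := match_solve m0 hb1 hb2 b0 d1 d2 v1 v2.
pose rho w : R := c * expR (m%:R * complex.Re w).
have /choice [V VP] : forall w, exists v, complex.Re w <= s ->
    normc (v - w) <= A * expR ((1 + m%:R) * complex.Re w) /\ phi2 v = phi1 w.
  move=> w; have [ws|ws] := leP (complex.Re w) s; last by exists 0.
  by have [_ [v q1 q2] _] := H w ws; exists v.
have rho0 w : 0 < rho w by rewrite mulr_gt0// expR_gt0.
have rho1 w : complex.Re w <= s -> rho w <= 1.
  move=> ws; apply: mulr_ile1; rewrite ?expR_ge0 ?(ltW c0)// -[leRHS]expR0 ler_expR.
  by rewrite mulr_ge0_le0//; lra.
have V4 w : complex.Re w <= s -> normc (V w - w) <= rho w / 4.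
  move=> ws; have [q1 _ _] := H w ws; apply: le_trans (proj1 (VP w ws)) _.
  by rewrite /rho mulrAC.
have ReV w v : complex.Re w <= s -> normc (v - w) <= 1 -> hp s0 v.
  move=> ws hv; have := Re_le_normc (v - w); rewrite cReD cReN ler_norml => /andP[_ q].
  rewrite /hp /=; lra.
have Vhp w : complex.Re w <= s -> hp s0 (V w).
  move=> ws; apply: (ReV w) => //; have := V4 w ws; have := rho1 w ws; have := rho0 w; nlra.
have V0 w : complex.Re w <= s -> normc (V w - w) < rho w.
  by move=> ws; apply: le_lt_trans (V4 w ws) _; have := rho0 w; lra.
have inj w : complex.Re w <= s -> forall y1 y2, normc (y1 - w) < rho w ->
    normc (y2 - w) < rho w -> phi2 y1 = phi2 y2 -> y1 = y2.
  by move=> ws; have [_ _] := H w ws.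
have dV w : hp s w -> derivable V w 1.
  move=> hw; have ws : complex.Re w <= s by exact: ltW.
  have hv := Vhp w ws; have d2V := d2 _ hv.
  have hol2 : holomorphic_at phi2 (V w).
    apply: (@near_cder_holomorphic_at R phi2 (fun v => cexp (expo m res b2 v))).
    by apply: filterS (nbhs_hp hv) => v /d2.
  have c2 : cd phi2 (V w) != 0 by rewrite (cder_cd d2V) cexp_neq0.
  have r4 : 0 < rho w / 4 by rewrite divr_gt0.
  have [rh [s' [g [/andP[rh0 rh1] s'0 _ inj2 gP]]]] := local_inverse hol2 c2 r4.
  have [_ VE] := VP w ws.
  have d1w := d1 w ltac:(rewrite /hp /=; lra).
  have [_ _ dg] : [/\ normc (g (phi1 w) - V w) < rh, phi2 (g (phi1 w)) = phi1 w &
       cder g (phi1 w) (cd phi2 (g (phi1 w)))^-1].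
    by apply: gP; rewrite VE subrr normc0.
  apply: cder_derivable; apply: near_eq_cder (cder_comp d1w dg).
  have n1 := near_normc w r4.
  have n2 := nbhs_hp hw.
  have n3 : \forall x \near w, normc (phi1 x - phi1 w) < s' by have /continuousCP := cder_cts d1w; exact.
  (* The radius depends on the point. Up to a factor 2 it does not grow nearby, so [V x], which is
     close to [x], lies in the disk of uniqueness of [w]. *)
  have n4 : \forall x \near w, rho x <= 2 * rho w.
    have dm := cder_comp (cderZ m%:R (cder_id w)) (cder_cexp _).
    have /continuousCP/(_ _ (expR_gt0 (m%:R * complex.Re w))) := cder_cts dm.
    apply: filterS => x; rewrite /= => hx.
    have := ge_normcB (cexp (m%:R * x)) (cexp (m%:R * w)); rewrite !normc_cexp !RenM => h2.
    rewrite /rho mulrCA ler_wpM2l ?(ltW c0)//.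
    by move: hx h2; clear; nlra.
  near=> x.
  have x1 : normc (x - w) < rho w / 4 by near: x.
  have x2 : hp s x by near: x; exact: n2.
  have x3 : normc (phi1 x - phi1 w) < s' by near: x.
  have x4 : rho x <= 2 * rho w by near: x.
  have xs : complex.Re x <= s by exact: ltW.
  have [g1 g2 _] := gP (phi1 x) ltac:(by rewrite VE).
  apply: (inj w ws).
  - have := V4 w ws; have := le_normc_dist (g (phi1 x)) (V w) w.
    by rewrite /=; move: g1 rh1 (rho0 w); clear; nlra.
  - have := V4 x xs; have := le_normc_dist (V x) x w.
    by move: x1 x4 (rho0 w); clear; nlra.
  by rewrite /= g2 (proj2 (VP x xs)).
have per : forall w, hp s w -> V (w + tpi) = V w + tpi.
  move=> w hw; have ws : complex.Re w <= s by exact: ltW.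
  have Dd phi b : (forall w, hp s0 w -> cder phi w (cexp (expo m res b w))) ->
     forall w, hp s0 w -> cder phi w (1 * dev_der m res (cexp \o b) w).
    by move=> h x hx; apply: (cder_eq (h x hx)); rewrite expo_Pm mul1r.
  have [be1 B1] := dev_period (Dd _ _ d1); have [be2 B2] := dev_period (Dd _ _ d2).
  have e1 := values_period m0 v1 B1 0; have e2 := values_period m0 v2 B2 0.
  (* The additive constant of the monodromy is determined by the values, which are common to both
     maps. *)
  have be : be1 = be2 by apply: (addrI (mono res * u 0)); rewrite -e1 -e2.
  have Rt : complex.Re (w + tpi) = complex.Re w by rewrite cReD /= addr0.
  have rt : rho (w + tpi) = rho w by rewrite /rho Rt.
  have ws' : complex.Re (w + tpi) <= s by rewrite Rt.
  apply: (inj (w + tpi) ws'); first exact: V0.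
    by rewrite rt opprD addrACA subrr addr0; exact: V0.
  rewrite (proj2 (VP _ ws')) B2; last exact: Vhp.
  by rewrite (proj2 (VP w ws)) B1 ?be// /hp /=; lra.
pose h w : C := V w - w.
have h1 : forall w, hp s w -> derivable h w 1.
  by move=> w hw; exact: cder_derivable (cderB (derivable_cd (dV w hw)) (cder_id w)).
have h2 : forall w, hp s w -> h (w + tpi) = h w.
  by move=> w hw; rewrite /h per//; ring.
have h3 : forall w, hp s w -> normc (h w) <= A * expR (complex.Re w).
  move=> w hw; have ws : complex.Re w <= s by exact: ltW.
  apply: le_trans (proj1 (VP w ws)) _; rewrite ler_wpM2l// ler_expR mulrDl mul1r gerDl.
  by rewrite mulr_ge0_le0//; lra.
have es := expR_gt0 s.
have [g [g1 g2 g3]] := descend_periodic A0 h1 h2 h3 (r := expR s / 2) ltac:(lra) ltac:(lra).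
exists (expR s / 2), g; split => //; first by rewrite divr_gt0 ?expR_gt0.
move=> w hw; have ws : complex.Re w <= s.
  apply: ltW; apply: lt_trans hw _; rewrite -[X in _ < X]expRK ltr_ln ?posrE ?divr_gt0 ?expR_gt0//.
  by have := expR_gt0 s; lra.
by rewrite /lift g3// /h addrC subrK; exact: (proj2 (VP w ws)).
Unshelve. all: by end_near.
Qed.

Lemma near_disk (P : C -> Prop) : (\forall z \near (0 : C), P z) ->
  exists2 r : R, 0 < r & forall z, disk r z -> P z.
Proof. by move=> /nbhsCP[r r0 H]; exists r => // z hz; apply: H; rewrite subr0. Qed.

Lemma unlift0 kap : unlift kap 0 = 0. Proof. by rewrite /unlift mul0r. Qed.

Lemma unlift_cts kap e : holomorphic_at kap 0 -> 0 < e ->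
  \forall z \near (0 : C), disk e (unlift kap z).
Proof.
move=> hk e0; have := cder_cts (cder_unlift (holomorphic_at_derivable hk)).
by move=> /continuousCP/(_ _ e0); apply: filterS => z; rewrite unlift0 subr0.
Qed.

Lemma holomorphic_atZ c f z : holomorphic_at f z -> holomorphic_at (fun w => c * f w) z.
Proof. by move=> hf; exact: (holomorphic_atM (holomorphic_at_cst c z) hf). Qed.

Lemma holomorphic_at_unlift kap z : holomorphic_at kap z -> holomorphic_at (unlift kap) z.
Proof.
move=> hk; apply: holomorphic_atM; first exact: holomorphic_at_id.
exact: (holomorphic_at_comp hk (holomorphic_at_cexp _)).
Qed.

Lemma near_cd_unlift_neq0 kap : holomorphic_at kap 0 -> \forall z \near (0 : C), cd (unlift kap) z != 0.
Proof.
move=> hk; apply: near_neq0.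
  exact: cder_cts (holomorphic_at_cder (holomorphic_at_cd (holomorphic_at_unlift hk))).
by rewrite (cder_cd (cder_unlift (holomorphic_at_derivable hk))) mul0r addr0 mulr1 cexp_neq0.
Qed.

Lemma hp_disk r s w : 0 < r -> s <= ln r -> hp s w -> disk r (cexp w).
Proof.
by move=> r0 sr /hp_expR h; apply: lt_le_trans h _; rewrite -[leRHS](lnK r0) ler_expR.
Qed.

(* Shifting [zeta ^- m] by a constant rescales [exp (- zeta ^- m)]. *)
Lemma rescale_lift m (res : C) b s0 (c : C) phi : (0 < m)%N -> holomorphic_at b 0 ->
  (forall w, hp s0 w -> cder phi w (cexp (expo m res b w))) ->
  exists kap b' s, [/\ holomorphic_at kap 0, kap 0 = 0, holomorphic_at b' 0, b' 0 = b 0 - c &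
    forall w, hp s w -> cder (phi \o lift kap) w (cexp (expo m res b' w))].
Proof.
move=> m0 hb dphi; have mn : m%:R != 0 :> C by rewrite pnatr_eq0 -lt0n.
have hp0 : holomorphic_at (fun z => 1 + c * z ^+ m) 0.
  apply: holomorphic_atD; first exact: holomorphic_at_cst.
  apply: holomorphic_atM; first exact: holomorphic_at_cst.
  by apply: holomorphic_atX; exact: holomorphic_at_id.
have [|L [hL L0 LE]] := holomorphic_at_log (l0 := 0) hp0.
  by rewrite cexp0 expr0n gtn_eqF// mulr0 addr0.
(* With 1 + c z^m = e^L this choice gives [Xm m (lift kap w) = Xm m w + c]. *)
pose kap z : C := - m%:R^-1 * L z.
have hk : holomorphic_at kap 0 by exact: holomorphic_atZ hL.
have k0 : kap 0 = 0 by rewrite /kap L0 mulr0.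
have hq : holomorphic_at (fun z => 1 + z * cd kap z) 0.
  apply: holomorphic_atD; first exact: holomorphic_at_cst.
  by apply: holomorphic_atM; [exact: holomorphic_at_id|exact: holomorphic_at_cd].
have [|l [hl l0 lE]] := holomorphic_at_log (l0 := 0) hq.
  by rewrite cexp0 mul0r addr0.
have hu := holomorphic_at_unlift hk.
(* The shift of the linear term, the constant - c coming from [Xm], the old [b] at the new point,
   and the logarithm [l] of the derivative of the lift. *)
pose b' z : C := ((1 - res) * kap z + - c) + (b (unlift kap z) + l z).
have [r1 r10 H1] : exists2 r : R, 0 < r & forall z, disk r z ->
    [/\ cexp (L z) = 1 + c * z ^+ m, cexp (l z) = 1 + z * cd kap z,
        derivable kap z 1 & disk (expR s0) (unlift kap z)].
  apply: near_disk; have n4 := unlift_cts hk (expR_gt0 s0).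
  have n3 : \forall z \near (0 : C), derivable kap z 1 := hk.
  apply: filterS2 (filterI LE lE) (filterI n3 n4) => z [z1 z2] [z3 z4]; split.
  - exact: z1.
  - exact: z2.
  - exact: z3.
  exact: z4.
exists kap, b', (ln r1); split; [exact: hk|exact: k0| | |].
- apply: holomorphic_atD.
    apply: holomorphic_atD; last exact: holomorphic_at_cst.
    exact: holomorphic_atZ hk.
  apply: holomorphic_atD; last exact: hl.
  apply: (holomorphic_at_comp hu).
  by rewrite unlift0.
- by rewrite /b' unlift0 k0 l0; ring.
move=> w hw; have dw := hp_disk r10 (lexx _) hw.
have [z1 z2 z3 z4] := H1 _ dw.
have hl' : hp s0 (lift kap w) by apply/hp_expR; rewrite cexp_lift.
apply: (cder_eq (cder_comp (cder_lift z3) (dphi _ hl'))).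
have -> : 1 + cd kap (cexp w) * cexp w = cexp (l (cexp w)) by rewrite z2 [_ * cexp w]mulrC.
rewrite -cexpD; congr cexp; rewrite /expo /Qm cexp_lift.
have -> : Xm m (lift kap w) = Xm m w + c.
  rewrite /Xm /lift mulrDr opprD cexpD.
  have -> : - (m%:R * kap (cexp w)) = L (cexp w) by rewrite /kap; field.
  rewrite z1 -/(Xm m w) mulrDr mulr1 cexp_Xm mulrCA mulVf ?mulr1//.
  by rewrite expf_neq0// cexp_neq0.
by rewrite /b' /lift; ring.
Qed.

Lemma expo_values m (res : C) b phi s0 : (0 < m)%N -> holomorphic_at b 0 ->
  (forall w, hp s0 w -> cder phi w (cexp (expo m res b w))) ->
  exists s u, s <= s0 /\ has_values m res s phi u.
Proof.
move=> m0 hb dphi; have [r [M [r0 M0 H]]] := holomorphic_at_bounded hb.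
pose s1 : R := Num.min (s0 - 1) (ln r - 1).
have [s10 s1r] : s1 <= s0 - 1 /\ s1 <= ln r - 1 by rewrite !ge_min !lexx orbT.
have [|w ws|s [u [ss hv]]] := @has_values_exists R m res s1 phi (fun w => cexp (expo m res b w)) (expR M) m0.
- exact: expR_ge0.
- split; first by apply: dphi; rewrite /hp /=; lra.
  have dw : disk r (cexp w) by apply: (@hp_disk r (ln r)) => //; rewrite /hp /=; lra.
  have [_ hM] := H _ dw; rewrite expo_Pm normcM mulrC ler_wpM2r ?normc_ge0//.
  by rewrite normc_cexp ler_expR; apply: le_trans (ler_norm _) _; apply: le_trans (Re_le_normc _) hM.
by exists s, u; split => //; lra.
Qed.

(** The factors [K1], [K2] enter the logarithms [b1], [b2], whose values at 0 need not agree.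
    [rescale_lift] corrects [b2]; being tangent to the identity, this change leaves the asymptotic
    values as they are. *)
Lemma match_values m (res : C) E1 E2 (K1 K2 : C) u (phi1 phi2 : C -> C) s0 : (0 < m)%N ->
  holomorphic_at E1 0 -> holomorphic_at E2 0 -> E1 0 = 1 -> E2 0 = 1 -> K1 != 0 -> K2 != 0 ->
  (forall w, hp s0 w -> cder phi1 w (K1 * dev_der m res E1 w)) ->
  (forall w, hp s0 w -> cder phi2 w (K2 * dev_der m res E2 w)) ->
  has_values m res s0 phi1 u -> has_values m res s0 phi2 u ->
  exists r (eta : C -> C), [/\ 0 < r, holomorphic_on (disk r) eta, eta 0 = 0 &
    forall w, hp (ln r) w -> phi2 (lift eta w) = phi1 w].
Proof.
move=> m0 h1 h2 E10 E20 K10 K20 d1 d2 v1 v2.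
have logE E (K : C) phi : holomorphic_at E 0 -> E 0 = 1 -> K != 0 ->
   (forall w, hp s0 w -> cder phi w (K * dev_der m res E w)) ->
   exists b s, [/\ holomorphic_at b 0, s <= s0 &
     forall w, hp s w -> cder phi w (cexp (expo m res b w))].
  move=> hE E0 Kn dphi; have [k kK] := cexp_surj Kn.
  have hKE : holomorphic_at (fun z => K * E z) 0 by exact: holomorphic_atZ hE.
  have [|b [hb _ bE]] := holomorphic_at_log (l0 := k) hKE; first by rewrite E0 mulr1.
  have [r r0 Hr] := near_disk bE.
  exists b, (Num.min s0 (ln r)); split => //; first by rewrite ge_min lexx.
  move=> w; rewrite /hp /= lt_min => /andP[w1 w2]; apply: (cder_eq (dphi _ w1)).
  by rewrite expo_Pm (Hr _ (hp_disk r0 (lexx _) w2)) /dev_der; ring.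
have [b1 [s1 [hb1 ss1 g1]]] := logE E1 K1 phi1 h1 E10 K10 d1.
have [b2 [s2 [hb2 ss2 g2]]] := logE E2 K2 phi2 h2 E20 K20 d2.
have [kap [b3 [s3 [hk k0 hb3 b30 g3]]]] := rescale_lift (b2 0 - b1 0) m0 hb2 g2.
have [s4 [u' [s43 v3]]] := expo_values m0 hb3 g3.
have [eps eps0 He] := near_disk (near_holomorphic_at hk).
have [r r0 Hr] := near_disk (unlift_cts hk eps0).
pose r' := Num.min eps r; have r'0 : 0 < r' by rewrite lt_min eps0.
have uu : u = u'.
  apply: (@family_transfer R m res kap r' eps phi2 0 u u' s4 m0 r'0) => //.
  - move=> z; rewrite /disk /= lt_min => /andP[z1 _].
    exact: holomorphic_at_derivable (He _ z1).
  - by rewrite k0.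
  - by move=> z; rewrite /disk /= lt_min => /andP[_ z1] _; exact: Hr.
  exact: (@has_values_family R m res s0 phi2 u eps m0 v2).
pose s5 : R := Num.min (Num.min s1 s0) s4.
have [s51 s50 s54] : [/\ s5 <= s1, s5 <= s0 & s5 <= s4] by rewrite !ge_min !lexx !orbT.
have b13 : b1 0 = b3 0 by rewrite b30; ring.
have [||||ra [eta [ra0 heta eta0 etaE]]] := @match_normal m res b1 b3 u phi1 (phi2 \o lift kap) s5 m0 hb1 hb3 b13.
- by move=> w hw; apply: g1; exact: lt_le_trans s51.
- by move=> w hw; apply: g3; apply: lt_le_trans hw _; exact: le_trans s43.
- exact: has_values_le v1.
- by apply: has_values_le s54 _; rewrite uu.
(* The composition of [lift eta] followed by [lift kap] is again a lift, namely that of [et]. *)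
pose et z : C := eta z + kap (unlift eta z).
have het : holomorphic_at et 0.
  have hea : holomorphic_at eta 0.
    by apply/holomorphic_atP; exists ra => // z; rewrite subr0 => /heta.
  apply: holomorphic_atD; first exact: hea.
  apply: (holomorphic_at_comp (holomorphic_at_unlift hea)).
  by rewrite unlift0.
have [rb rb0 Hb] := near_disk (het : \forall z \near (0 : C), derivable et z 1).
exists (Num.min ra rb), et; split.
- by rewrite lt_min ra0.
- by move=> z; rewrite /disk /= lt_min => /andP[_ z1]; exact: Hb.
- by rewrite /et unlift0 eta0 k0 addr0.
move=> w hw; rewrite -etaE; last first.
  apply: lt_le_trans hw _; rewrite ler_ln ?posrE ?lt_min ?ra0//.
  by rewrite ge_min lexx.
by rewrite /= /lift /et cexpD -/(unlift eta (cexp w)) addrA.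
Qed.

Lemma developing_le G eps r phi : r <= eps -> developing_map G eps phi -> developing_map G r phi.
Proof.
move=> re dev w; rewrite covering_spaceE /= => hw; apply: dev.
by rewrite covering_spaceE /=; exact: lt_le_trans re.
Qed.

(** The affine map is absorbed into the first developing map, which then equals the second one after
    [lift eta]; a developing map determines its Christoffel symbol. *)
Lemma iso_germ m (res : C) r E1 E2 G1 G2 eps1 eps2 phi1 phi2 s u1 u2 : (0 < m)%N ->
  0 < r -> 0 < eps1 -> 0 < eps2 -> normal_form m res r E1 G1 -> normal_form m res r E2 G2 ->
  developing_map G1 eps1 phi1 -> developing_map G2 eps2 phi2 ->
  has_values m res s phi1 u1 -> has_values m res s phi2 u2 -> affine_equiv u1 u2 ->
  exists r' eta, [/\ 0 < r', r' <= r, holomorphic_on (disk r') eta, eta 0 = 0 &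
    forall z, disk r' z -> [/\ disk r (unlift eta z), cd (unlift eta) z != 0 &
      z != 0 -> G1 z = pull (unlift eta) G2 z]].
Proof.
move=> m0 r0 e10 e20 nf1 nf2 dev1 dev2 v1 v2 [al [be [al0 uE]]].
pose eps : R := Num.min (Num.min eps1 eps2) r.
have [ee1 ee2 er] : [/\ eps <= eps1, eps <= eps2 & eps <= r] by rewrite !ge_min !lexx !orbT.
have eps0 : 0 < eps by rewrite !lt_min e10 e20.
pose s0 : R := Num.min (ln eps) s.
have [s0e s0s] : s0 <= ln eps /\ s0 <= s by rewrite !ge_min !lexx orbT.
have es0 : expR s0 <= eps by rewrite -[leRHS](lnK eps0) ler_expR.
have [K1 K10 d1] := developing_normal nf1 dev1 (le_trans es0 ee1) (le_trans es0 er).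
have [K2 K20 d2] := developing_normal nf2 dev2 (le_trans es0 ee2) (le_trans es0 er).
have hol E G : normal_form m res r E G -> holomorphic_at E 0.
  by move=> [hE _ _ _]; apply/holomorphic_atP; exists r => // z; rewrite subr0 => /hE.
have E0 E G : normal_form m res r E G -> E 0 = 1 by case.
have v1' := has_values_le s0s (has_values_affine al be v1).
have uE' : (fun n => al * u1 n + be) = u2 by apply/funext => n; rewrite uE.
rewrite uE' in v1'.
have [|ra [eta [ra0 heta eta0 etaE]]] := @match_values m res E1 E2 (al * K1) K2 u2
    (fun w => al * phi1 w + be) phi2 s0 m0 (hol _ _ nf1) (hol _ _ nf2) (E0 _ _ nf1) (E0 _ _ nf2)
    (mulf_neq0 al0 K10) K20 _ d2 v1' (has_values_le s0s v2).
  by move=> w hw; apply: (cder_eq (cderD (cderZ al (d1 w hw)) (cder_cst be w))); ring.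
have hea : holomorphic_at eta 0.
  by apply/holomorphic_atP; exists ra => // z; rewrite subr0 => /heta.
clearbody eps; have [rb rb0 Hb] := near_disk (unlift_cts hea eps0).
have [rc rc0 Hc] := near_disk (near_cd_unlift_neq0 hea).
pose r' : R := Num.min (Num.min ra rb) (Num.min rc eps).
have [p1 p2 p3 p4] : [/\ r' <= ra, r' <= rb, r' <= rc & r' <= eps] by rewrite !ge_min !lexx !orbT.
have r'0 : 0 < r' by rewrite !lt_min ra0 rb0 rc0.
have dle (a b : R) z : a <= b -> disk a z -> disk b z by rewrite /disk /= => h1 h2; exact: lt_le_trans h1.
exists r', eta; split => //; first exact: le_trans er.
  by move=> z /(dle _ _ _ p1) /heta.
move=> z dz; split; first by apply: (dle _ _ _ er); apply: Hb; exact: (dle _ _ _ p2).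
  by apply: Hc; exact: (dle _ _ _ p3).
move=> z0; have D1 := developing_affine be al0 (developing_le (le_trans p4 ee1) dev1).
have D2 : developing_map (pull (unlift eta) G2) r' (phi2 \o lift eta).
  apply: (@developing_pull R G2 eps) => [y /(dle _ _ _ p1) /heta//|y|y|].
  - by move=> /(dle _ _ _ p2) /Hb.
  - by move=> /(dle _ _ _ p3) /Hc.
  exact: developing_le dev2.
apply: (developing_unique D1 D2) => // w cw; symmetry; apply: etaE.
by apply: covering_hp => //; move: cw; rewrite !covering_spaceE /= => h; exact: lt_le_trans p1.
Qed.

End Isomorphism.

(** * Laurent expansions and the normal form *)

Section NormalForm.
Context {R : realType}.
Local Notation C := (Cplx R).
Implicit Types (z w v y : C) (r s t e l K M : R) (f h : C -> C) (G E : C -> C) (phi kap b : C -> C) (a : nat -> C).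

Lemma near_cts f z y (P : C -> Prop) : {for z, continuous f} -> f z = y ->
  (\forall x \near y, P x) -> \forall x \near z, P (f x).
Proof. by move=> cf <- H; exact: (cf _ H). Qed.

Lemma dnbhsCP z (P : C -> Prop) : (\forall w \near z^', P w) <->
  exists2 e : R, 0 < e & forall w, w != z -> normc (w - z) < e -> P w.
Proof.
split; first by move=> /nbhsCP[e e0 H]; exists e => // w wz we; exact: H.
by move=> [e e0 H]; apply/nbhsCP; exists e => // w we wz; exact: H.
Qed.

Lemma punctured_point z (P : C -> Prop) e : (\forall w \near z^', P w) -> 0 < e ->
  exists w, [/\ w != z, normc (w - z) < e & P w].
Proof.
move=> /dnbhsCP[d d0 H] e0; pose t : R := Num.min (d / 2) (e / 2).
have t0 : 0 < t by rewrite lt_min !divr_gt0.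
have [t1 t2] : t <= d / 2 /\ t <= e / 2 by rewrite !ge_min !lexx orbT.
have nt : normc ((z + t%:C) - z) = t by rewrite addrC addKr normc_real gtr0_norm.
have zt : z + t%:C != z by rewrite -subr_eq0 -normc_gt0 nt.
exists (z + t%:C); split; rewrite ?nt//; first lra.
by apply: H; rewrite ?nt//; lra.
Qed.

Lemma punctured_eq f h z : {for z, continuous f} -> {for z, continuous h} ->
  (\forall w \near z^', f w = h w) -> f z = h z.
Proof.
move=> cf ch fh; apply/eqP; rewrite -subr_eq0 -normc_eq0 eq_le normc_ge0 andbT leNgt.
apply/negP => n0; have n2 : 0 < normc (f z - h z) / 2 by lra.
have /continuousCP/(_ _ n2)/nbhsCP[d1 d10 H1] := cf.
have /continuousCP/(_ _ n2)/nbhsCP[d2 d20 H2] := ch.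
have d0 : 0 < Num.min d1 d2 by rewrite lt_min d10.
have [w [wz]] := punctured_point fh d0; rewrite lt_min => /andP[w1 w2] e.
have := H1 w w1; have := H2 w w2; rewrite e.
have := le_normc_dist (f z) (h w) (h z); rewrite (normcB (f z) (h w)).
move: n0; nlra.
Qed.

(** Multiplying by the highest power and letting w tend to z isolates the top coefficient; the
    others follow by induction. *)
Lemma laurent_zero a h z n : holomorphic_at h z ->
  (\forall w \near z^', h w + \sum_(1 <= k < n.+1) a k / (w - z) ^+ k = 0) ->
  forall k, (1 <= k <= n)%N -> a k = 0.
Proof.
elim: n => [|n IH] hh H k; first by case: k => [|[]].
suff an : a n.+1 = 0.
  move=> /andP[k1]; rewrite leq_eqVlt => /orP[/eqP->//|kn]; apply: IH => //; last by rewrite k1.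
  apply: filterS H => w /=; rewrite big_nat_recr //= an mul0r addr0 => h1; exact: h1.
pose f w : C := h w * (w - z) ^+ n.+1 + (\sum_(i < n) a i.+1 * (w - z) ^+ (n - i) + a n.+1).
have hf : holomorphic_at f z.
  have hX j : holomorphic_at (fun w : C => (w - z) ^+ j) z.
    by apply: holomorphic_atX; apply: holomorphic_atD; [exact: holomorphic_at_id|exact: holomorphic_at_cst].
  have hS := @holomorphic_at_sum R n (fun i w => a i.+1 * (w - z) ^+ (n - i)) z
    (fun i => holomorphic_atZ (a i.+1) (hX (n - i)%N)).
  exact: (holomorphic_atD (holomorphic_atM hh (hX n.+1)) (holomorphic_atD hS (holomorphic_at_cst (a n.+1) z))).
have fz : f z = a n.+1.
  rewrite /f subrr expr0n mulr0 add0r big1 ?add0r// => i _.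
  by rewrite expr0n subn_eq0 leqNgt ltn_ord mulr0.
rewrite -fz; apply: (@punctured_eq f (fun=> 0) z).
- exact: cder_cts (holomorphic_at_cder hf).
- exact: cder_cts (cder_cst 0 z).
move: H => /dnbhsCP[e e0 H]; apply/dnbhsCP; exists e => // w wz we.
have w0 : w - z != 0 by rewrite subr_eq0.
have := H w wz we => /(congr1 (fun x => x * (w - z) ^+ n.+1)); rewrite mul0r => <-.
rewrite mulrDl /f; congr (_ + _); rewrite big_add1 /= big_mkord big_ord_recr /= mulrDl.
rewrite divfK ?expf_neq0//; congr (_ + _); rewrite big_distrl; apply: eq_bigr => i _ /=.
rewrite -mulrA; congr (_ * _).
have -> : (n.+1 = (n - i) + i.+1)%N by rewrite addnS subnK// ltnW.
by rewrite exprD mulrC mulfK// expf_neq0.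
Qed.

Lemma big_nat_pad a (n N : nat) (F : nat -> C) : (n <= N)%N ->
  \sum_(1 <= k < n.+1) a k * F k = \sum_(1 <= k < N.+1) (if (k <= n)%N then a k else 0) * F k.
Proof.
move=> nN; rewrite [RHS](big_cat_nat _ (n := n.+1))//= [X in _ = _ + X]big_nat_cond [X in _ = _ + X]big1 ?addr0.
  by apply: eq_big_nat => k /andP[_]; rewrite ltnS => ->.
by move=> k; rewrite andbT => /andP[nk _]; rewrite leqNgt nk mul0r.
Qed.

(** The conditionals pad both expansions with zeros, so that expansions of different nominal order
    can be compared. *)
Lemma laurent_unique f z n a n' a' : laurent_at f z n a -> laurent_at f z n' a' ->
  forall k, (0 < k)%N -> (if (k <= n)%N then a k else 0) = (if (k <= n')%N then a' k else 0).
Proof.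
move=> [h hh fh] [h' hh' fh'] k k0; pose N := maxn (maxn n n') k.
have [nN n'N kN] : [/\ n <= N, n' <= N & k <= N]%N by rewrite /N !leq_max !leqnn !orbT.
apply/eqP; rewrite -subr_eq0; apply/eqP.
pose b i : C := (if (i <= n)%N then a i else 0) - (if (i <= n')%N then a' i else 0).
apply: (@laurent_zero b (fun w => h w - h' w) z N _ _ k); last by rewrite k0.
  exact: holomorphic_atD hh (holomorphic_atN hh').
apply: filterS2 fh fh' => w e1 e2.
rewrite (big_nat_pad a (fun k => ((w - z) ^+ k)^-1) nN) in e1.
rewrite (big_nat_pad a' (fun k => ((w - z) ^+ k)^-1) n'N) in e2.
rewrite (eq_bigr (fun i => (if (i <= n)%N then a i else 0) / (w - z) ^+ i - (if (i <= n')%N then a' i else 0) / (w - z) ^+ i)); last first.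
  by move=> i _; rewrite -mulrBl.
by rewrite sumrB addrACA -e1 -opprD -e2 subrr.
Qed.

Lemma laurentN f z n a : laurent_at f z n a -> laurent_at (fun w => - f w) z n (fun k => - a k).
Proof.
move=> [h hh fh]; exists (fun w => - h w); first exact: holomorphic_atN.
apply: filterS fh => w ->; rewrite opprD -sumrN; congr (_ + _).
by apply: eq_bigr => i _; rewrite mulNr.
Qed.

Lemma laurent_residue f z n a (res : C) : (0 < n)%N -> laurent_at f z n a ->
  residue_at (fun w => - f w) z res -> a 1%N = - res.
Proof.
move=> n0 /laurentN la [d [b [d0 lb <-]]].
by have := laurent_unique la lb (ltn0Sn 0); rewrite n0 d0 => <-; rewrite opprK.
Qed.

Lemma cder_sum n (F F' : nat -> C -> C) z : (forall i, cder (F i) z (F' i z)) ->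
  cder (fun w => \sum_(i < n) F i w) z (\sum_(i < n) F' i z).
Proof.
move=> H; elim: n => [|n IH].
  rewrite big_ord0; apply: near_eq_cder (cder_cst 0 z).
  by apply: nearCW => w; rewrite big_ord0.
rewrite big_ord_recr /=; apply: near_eq_cder (cderD IH (H n)).
by apply: nearCW => w; rewrite big_ord_recr.
Qed.

Lemma cder_negX n z : z != 0 ->
  cder (fun w : C => w^-1 ^+ n.+1) z (- (n.+1%:R / z ^+ n.+2)).
Proof.
move=> z0; apply: (cder_eq (cderX n.+1 (cderV z0 (cder_id z)))).
by rewrite /= exprVn !exprS; field; rewrite z0 expf_neq0.
Qed.

(** The sign condition makes a (m + 1) / m a positive number times e^(i m theta0), so it has an m-th
    root of lifted argument exactly [theta0]. *)
Lemma neg_polar a m (theta0 : R) : (0 < m)%N ->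
  - a m.+1 * cexp (0 +i* (- (m%:R * theta0))) < 0 ->
  exists k0 : C, complex.Im k0 = theta0 /\ cexp (m%:R * k0) = a m.+1 / m%:R.
Proof.
move=> m0; set x := - a m.+1 * _ => x0.
have mp : 0 < m%:R :> R by rewrite ltr0n.
have mn : m%:R != 0 :> R by rewrite gt_eqF.
have [xr xn] : x = (complex.Re x)%:C /\ complex.Re x < 0.
  move: x0; rewrite ltcE /= => /andP[/eqP h1 h2]; split => //.
  by apply: complex_ext => //=; rewrite -h1.
pose rho : R := - complex.Re x / m%:R.
have rho0 : 0 < rho by rewrite divr_gt0// oppr_gt0.
exists ((ln rho / m%:R) +i* theta0); split => //.
have -> : m%:R * ((ln rho / m%:R) +i* theta0) = (ln rho)%:C + (0 +i* (m%:R * theta0)) :> C.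
  by apply: complex_ext; rewrite ?RenM ?ImnM /=; [field|rewrite add0r].
rewrite cexpD cexp_real lnK ?posrE// /rho.
have aE : a m.+1 = - (complex.Re x)%:C * cexp (0 +i* (m%:R * theta0)).
  rewrite mulNr -xr /x -mulrA -cexpD.
  have -> : 0 +i* - (m%:R * theta0) + 0 +i* (m%:R * theta0) = 0 :> C.
    by apply: complex_ext; rewrite ?cReD ?cImD /= ?addNr ?addr0.
  by rewrite cexp0 mulr1 opprK.
by rewrite aE !realCE; ring.
Qed.

(* [p0 (z) / z ^ m] is minus a primitive of the terms of order at least 2. *)
Lemma normal_coordinate m a (theta0 : R) : (0 < m)%N ->
  - a m.+1 * cexp (0 +i* (- (m%:R * theta0))) < 0 ->
  exists kap : C -> C, [/\ holomorphic_at kap 0, complex.Im (kap 0) = theta0 &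
    \forall z \near (0 : C), \sum_(i < m) a i.+2 / i.+1%:R * unlift kap z ^+ (m.-1 - i) = cexp (m%:R * kap z)].
Proof.
move=> m0 ha; have mn : m%:R != 0 :> C by rewrite pnatr_eq0 -lt0n.
have [k0 [k0I k0E]] := neg_polar m0 ha.
pose p0 z : C := \sum_(i < m) a i.+2 / i.+1%:R * z ^+ (m.-1 - i).
have hp0 : holomorphic_at p0 0.
  apply: (@holomorphic_at_sum R m (fun i z => a i.+2 / i.+1%:R * z ^+ (m.-1 - i))) => i.
  exact: (holomorphic_atZ _ (holomorphic_atX _ (holomorphic_at_id 0))).
have p00 : p0 0 = cexp (m%:R * k0).
  rewrite k0E /p0; case: (m) m0 => // n _; rewrite big_ord_recr /= subnn expr0 mulr1 big1 ?add0r// => i _.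
  by rewrite expr0n subn_eq0 leqNgt ltn_ord mulr0.
have [l [hl l0 lE]] := holomorphic_at_log hp0 p00.
pose lam z : C := m%:R^-1 * l z.
have hlam : holomorphic_at lam 0 by exact: holomorphic_atZ hl.
have lam0 : lam 0 = k0 by rewrite /lam l0 mulKf.
(* The unknown u = [unlift kap z] must satisfy u^m = z^m p0(u). Solved for z this reads z = u e^(-
   lam u) with e^(m lam) = p0, so u is the local inverse [g] of [chi]. *)
pose chi := unlift (fun z => - lam z).
have hchi : holomorphic_at chi 0 := holomorphic_at_unlift (holomorphic_atN hlam).
have cchi : cd chi 0 != 0.
  rewrite (cder_cd (cder_unlift (holomorphic_at_derivable (holomorphic_atN hlam)))).
  by rewrite mul0r addr0 mulr1 cexp_neq0.
have [rho [s [g [_ s0 _ _ gP]]]] := local_inverse hchi cchi ltr01.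
have chi0 : chi 0 = 0 by rewrite /chi unlift0.
rewrite chi0 in gP.
have [_ _ dg0] := gP 0 ltac:(by rewrite subrr normc0).
have hg : holomorphic_at g 0.
  apply: (@near_cder_holomorphic_at R g (fun y => (cd chi (g y))^-1)).
  by apply: filterS (near_normc 0 s0) => y ys; have [] := gP y ys.
have g0 : g 0 = 0.
  have [_ h1 _] := gP 0 ltac:(by rewrite subrr normc0).
  move: h1; rewrite /chi /unlift => /eqP; rewrite mulf_eq0 (negbTE (cexp_neq0 _)) orbF.
  by move=> /eqP.
pose kap z : C := lam (g z).
exists kap; split.
- by apply: (holomorphic_at_comp hg); rewrite g0.
- by rewrite /kap g0 lam0.
have n1 : \forall y \near (0 : C), p0 (g y) = cexp (l (g y)).
  by have := near_cts (cder_cts dg0) g0 lE; apply: filterS => y /= ->.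
apply: filterS2 n1 (near_normc 0 s0) => y y1 y2.
have [_ gy _] := gP y y2.
have uy : unlift kap y = g y.
  rewrite /unlift -{1}gy /chi /unlift /kap -mulrA -cexpD addNr cexp0 mulr1 //.
rewrite -/(p0 _) uy y1 /kap /lam; congr cexp.
by rewrite mulrA divff// mul1r.
Qed.

(** Differentiate the identity P(unlift kap z) = z^-m, where [P] is minus a primitive of the terms
    of order at least 2. *)
Lemma pull_polar m a kap z : derivable kap z 1 -> z != 0 ->
  (\forall y \near z, \sum_(i < m) a i.+2 / i.+1%:R * unlift kap y ^+ (m.-1 - i) = cexp (m%:R * kap y)) ->
  cd (unlift kap) z * (\sum_(i < m) a i.+2 / unlift kap z ^+ i.+2) = m%:R / z ^+ m.+1.
Proof.
move=> dk z0 H; pose P y : C := \sum_(i < m) a i.+2 / i.+1%:R * y^-1 ^+ i.+1.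
have u0 y : y != 0 -> unlift kap y != 0 by move=> y0; rewrite mulf_neq0 ?cexp_neq0.
have dP : cder P (unlift kap z) (- \sum_(i < m) a i.+2 / unlift kap z ^+ i.+2).
  have dF i : cder (fun y => a i.+2 / i.+1%:R * y^-1 ^+ i.+1) (unlift kap z) (- (a i.+2 / unlift kap z ^+ i.+2)).
    apply: (cder_eq (cderZ (a i.+2 / i.+1%:R) (cder_negX i (u0 z z0)))).
    by rewrite mulrN mulrA divfK// pnatr_eq0.
  by apply: (cder_eq (@cder_sum m (fun i y => a i.+2 / i.+1%:R * y^-1 ^+ i.+1) (fun i y => - (a i.+2 / y ^+ i.+2)) _ dF)); rewrite sumrN.
have PE y : y != 0 -> \sum_(i < m) a i.+2 / i.+1%:R * unlift kap y ^+ (m.-1 - i) = cexp (m%:R * kap y) ->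
    P (unlift kap y) = y^-1 ^+ m.
  move=> y0 h; have uy := u0 y y0.
  have -> : P (unlift kap y) = (\sum_(i < m) a i.+2 / i.+1%:R * unlift kap y ^+ (m.-1 - i)) / unlift kap y ^+ m.
    rewrite big_distrl; apply: eq_bigr => i _ /=; rewrite -[RHS]mulrA; congr (_ * _).
    have mi : (m = (m.-1 - i) + i.+1)%N by have := ltn_ord i; lia.
    have -> : unlift kap y ^+ m = unlift kap y ^+ (m.-1 - i) * unlift kap y ^+ i.+1 by rewrite -exprD -mi.
    by move: uy; move: (unlift kap y) => x x0; rewrite invfM mulrA divff ?expf_neq0// mul1r exprVn.
  rewrite h cexpMn /unlift exprMn; move: (cexp_neq0 (kap y)); move: (cexp (kap y)) => x x0.
  by rewrite invfM mulrCA divff ?expf_neq0// mulr1 exprVn.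
have dPu := cder_comp (derivable_cd (cder_derivable (cder_unlift dk))) dP.
case: m @P H dP PE dPu => [|n] P H dP PE dPu; first by rewrite !big_ord0 mulr0 mul0r.
have d2 := cder_negX n z0.
have n0 : \forall y \near z, y != 0 by exact: (@near_neq0 R (fun y => y) z (cder_cts (cder_id z)) z0).
have d3 : cder (P \o unlift kap) z (- (n.+1%:R / z ^+ n.+2)).
  by apply: near_eq_cder d2; apply: filterS2 H n0 => y h y0; rewrite /= PE.
have := cder_unique dPu d3; rewrite mulNr => /oppr_inj <-.
by rewrite mulrC.
Qed.

(** The algebraic core of [normal_form_exists], with derivatives replaced by variables; the second
    hypothesis eliminates the derivative [k] of [kap]. *)
Lemma log_der_field (U1 U z k U2 hz S M e X res : C) : U1 * S = M -> U1 * z = U * (1 + z * k) ->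
  z != 0 -> U1 != 0 -> U != 0 -> e != 0 -> X != 0 ->
  U1 * (hz + (- res / U + S)) + U2 / U1 =
    M - res / z + e^-1 * (U2 * X + U1 * (X * (- res * k + hz * U1))) / (e^-1 * (U1 * X)).
Proof.
move=> <- k1 z0 U10 U0 e0 X0.
have -> : k = (U1 * z / U - 1) / z by rewrite k1; field; rewrite ?z0 ?U0.
by field; rewrite ?z0 ?U0 ?U10 ?e0 ?X0.
Qed.

Lemma normal_form_exists m (res : C) G a (theta0 : R) : (0 < m)%N ->
  laurent_at G 0 m.+1 a -> a 1%N = - res ->
  - a m.+1 * cexp (0 +i* (- (m%:R * theta0))) < 0 -> forall e, 0 < e ->
  exists r kap E, [/\ 0 < r, holomorphic_on (disk r) kap, complex.Im (kap 0) = theta0,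
    normal_form m res r E (pull (unlift kap) G) &
    forall z, disk r z -> cd (unlift kap) z != 0 /\ disk e (unlift kap z)].
Proof.
move=> m0 [h hh GE] a1 ha e e0.
have [kap [hk kI kE]] := normal_coordinate m0 ha.
have hu := holomorphic_at_unlift hk.
have [H HH] := holomorphic_at_primitive hh.
(* The logarithmic derivative of [E0] collects what the polar terms of order at least 2 leave: psi''
   / psi', the holomorphic part through its primitive [H], and the excess - res kap' of - res psi' /
   psi over - res / z, for psi = [unlift kap]. Dividing by [E0 0] normalizes [E 0] to 1. *)
pose B z : C := - res * kap z + H (unlift kap z).
pose E0 z : C := cd (unlift kap) z * cexp (B z).
pose E z : C := (E0 0)^-1 * E0 z.
have hH : holomorphic_at H 0 := near_cder_holomorphic_at HH.
have hB : holomorphic_at B 0.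
  apply: (holomorphic_atD (holomorphic_atZ (- res) hk)).
  by apply: (holomorphic_at_comp hu); rewrite unlift0.
have hE0 : holomorphic_at E0 0.
  exact: (holomorphic_atM (holomorphic_at_cd hu) (holomorphic_at_comp hB (holomorphic_at_cexp _))).
have hE : holomorphic_at E 0 := holomorphic_atZ _ hE0.
have ncd := near_cd_unlift_neq0 hk.
have uc := cder_cts (holomorphic_at_cder hu).
have nH := near_cts uc (unlift0 kap) HH.
have nG : \forall z \near (0 : C), unlift kap z != 0 ->
    G (unlift kap z) = h (unlift kap z) + \sum_(1 <= k < m.+2) a k / (unlift kap z - 0) ^+ k := near_cts uc (unlift0 kap) GE.
have [r r0 Hr] : exists2 r : R, 0 < r & forall z, disk r z ->
   [/\ cd (unlift kap) z != 0, disk e (unlift kap z), derivable E z 1,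
      holomorphic_at kap z & [/\ (unlift kap z != 0 -> G (unlift kap z) = h (unlift kap z) + \sum_(1 <= k < m.+2) a k / (unlift kap z - 0) ^+ k),
       cder H (unlift kap z) (h (unlift kap z)) &
       \forall y \near z, \sum_(i < m) a i.+2 / i.+1%:R * unlift kap y ^+ (m.-1 - i) = cexp (m%:R * kap y)]].
  apply: near_disk.
  have n1 := unlift_cts hk e0.
  have n2 : \forall z \near (0 : C), derivable E z 1 := hE.
  have n3 := near_holomorphic_at hk.
  have n4 := near_join kE.
  near=> z; split; last split.
  - by near: z.
  - by near: z.
  - by near: z.
  - by near: z.
  - by near: z.
  - by near: z; exact: nH.
  by near: z.
have d0 : disk r 0 by rewrite /disk /= normc0.
exists r, kap, E; split; [exact: r0| |exact: kI| |].
- by move=> z /Hr [_ _ _ /holomorphic_at_derivable].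
- have E00 : E0 0 != 0 by rewrite mulf_neq0 ?cexp_neq0//; have [] := Hr 0 d0.
  split.
  + by move=> z /Hr [].
  + by rewrite /E mulVf.
  + move=> z /Hr [c0 _ _ _ _]; rewrite /E mulf_neq0 ?invr_eq0// mulf_neq0 ?cexp_neq0//.
  move=> z dz z0; have [c0 _ _ hkz [GEz dH n]] := Hr z dz.
  have dk := holomorphic_at_derivable hkz.
  have u0 : unlift kap z != 0 by rewrite mulf_neq0 ?cexp_neq0.
  rewrite /pull (GEz u0) subr0.
  have du : cder (unlift kap) z (cd (unlift kap) z) := derivable_cd (cder_derivable (cder_unlift dk)).
  have dcu := holomorphic_at_cder (holomorphic_at_cd (holomorphic_at_unlift hkz)).
  have dB := cderD (cderZ (- res) (derivable_cd dk)) (cder_comp du dH).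
  have dE := cderZ (E0 0)^-1 (cderM dcu (cder_comp dB (cder_cexp _))).
  rewrite (cder_cd dE) /E /E0 /comp -/(B z).
  rewrite big_add1 /= big_mkord big_ord_recl /= a1 expr1.
  have -> : \sum_(i < m) a (bump 0 i).+1 / unlift kap z ^+ (bump 0 i).+1 =
     \sum_(i < m) a i.+2 / unlift kap z ^+ i.+2 by apply: eq_bigr.
  have S := pull_polar dk z0 n.
  have k1 : cd (unlift kap) z * z = unlift kap z * (1 + z * cd kap z).
    by rewrite (cder_cd (cder_unlift dk)) /unlift; ring.
  have L := log_der_field (cd (cd (unlift kap)) z) (h (unlift kap z)) res S k1 z0 c0 u0 E00 (cexp_neq0 (B z)).
  clear -L; exact: L.
by move=> z /Hr [q1 q2 _ _ _]; split; [exact: q1|exact: q2].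
Unshelve. all: by end_near.
Qed.

End NormalForm.

(** * Charts *)

Section Charts.
Context {R : realType}.
Local Notation C := (Cplx R).

Section Topological.
Context {T : topologicalType}.
Implicit Types (c : chart R T) (z w : C) (x : T).

Lemma chart_invP c z : chart_cod c z -> chart_dom c (chart_inv c z) /\ c (chart_inv c z) = z.
Proof. by move=> [x dx <-]; rewrite chart_funK. Qed.

Lemma chart_codP c x : chart_dom c x -> chart_cod c (c x). Proof. by exists x. Qed.

Lemma nbhs_chart_cod c z : chart_cod c z -> nbhs z (chart_cod c).
Proof. by move=> h; apply: open_nbhs_nbhs; split => //; exact: chart_cod_open. Qed.

Lemma nbhs_chart_dom c x : chart_dom c x -> nbhs x (chart_dom c).
Proof. by move=> h; apply: open_nbhs_nbhs; split => //; exact: chart_dom_open. Qed.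

Lemma near_chart_inv c z (A : set T) : chart_cod c z -> nbhs (chart_inv c z) A ->
  \forall w \near z, A (chart_inv c w).
Proof. by move=> hz hA; exact: (chart_inv_cts hz hA). Qed.

Lemma near_chart_fun c x (A : set C) : chart_dom c x -> nbhs (c x) A ->
  \forall y \near x, A (c y).
Proof. by move=> hx hA; exact: (chart_fun_cts hx hA). Qed.

Lemma transition_domP c1 c2 z :
  transition_dom c1 c2 z <-> chart_cod c1 z /\ chart_dom c2 (chart_inv c1 z).
Proof.
split; first by move=> [x [h1 h2] <-]; split; [exists x|rewrite chart_funK].
by move=> [/chart_invP [h1 h2] h3]; exists (chart_inv c1 z).
Qed.

Lemma transition_domI c1 c2 x : chart_dom c1 x -> chart_dom c2 x -> transition_dom c1 c2 (c1 x).
Proof. by exists x. Qed.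

Lemma nbhs_transition_dom c1 c2 z : transition_dom c1 c2 z -> nbhs z (transition_dom c1 c2).
Proof.
move=> /transition_domP [h1 h2].
apply: filterS2 (nbhs_chart_cod h1) (near_chart_inv h1 (nbhs_chart_dom h2)) => w w1 w2.
by apply/transition_domP.
Qed.

Lemma transitionK c1 c2 z : transition_dom c1 c2 z -> transition c2 c1 (transition c1 c2 z) = z.
Proof. by move=> [x [h1 h2] <-]; rewrite /transition /= !chart_funK. Qed.

Lemma transition_swap c1 c2 z : transition_dom c1 c2 z -> transition_dom c2 c1 (transition c1 c2 z).
Proof. by move=> [x [h1 h2] <-]; rewrite /transition /= chart_funK//; exists x. Qed.

End Topological.

Section Surface.
Context {S : riemann_surface R}.
Implicit Types (c : chart R S) (z w : C) (p x : S).

(** Charts of the maximal atlas are compatible with the given atlas by definition; two of them are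
    compared through an atlas chart at the point. *)
Lemma transition_derivable c1 c2 z : holomorphic_chart c1 -> holomorphic_chart c2 ->
  transition_dom c1 c2 z -> derivable (transition c1 c2) z 1.
Proof.
move=> h1 h2 /[dup] hz [x [x1 x2] xz].
have [c' a' x'] := surface_cover x.
have [t1 _] := h1 _ a'; have [_ t2] := h2 _ a'.
have d1 := t1 z (ex_intro2 _ _ x (conj x1 x') xz).
have Ez : transition c1 c' z = c' x by rewrite -xz /transition /= chart_funK.
have d2 : derivable (transition c' c2) (transition c1 c' z) 1.
  by rewrite Ez; apply: t2; exists x.
apply: cder_derivable; apply: near_eq_cder (cder_comp (derivable_cd d1) (derivable_cd d2)).
have hz' : transition_dom c1 c' z by exists x.
apply: filterS (nbhs_transition_dom hz') => w [y [y1 y2] <-].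
by rewrite /transition /= !chart_funK.
Qed.

Lemma transition_holomorphic c1 c2 z : holomorphic_chart c1 -> holomorphic_chart c2 ->
  transition_dom c1 c2 z -> holomorphic_at (transition c1 c2) z.
Proof.
move=> h1 h2 hz; apply: filterS (nbhs_transition_dom hz) => w; exact: transition_derivable.
Qed.

Lemma transition_cd_mul c1 c2 z : holomorphic_chart c1 -> holomorphic_chart c2 ->
  transition_dom c1 c2 z ->
  cd (transition c2 c1) (transition c1 c2 z) * cd (transition c1 c2) z = 1.
Proof.
move=> h1 h2 hz; have d1 := derivable_cd (transition_derivable h1 h2 hz).
have d2 := derivable_cd (transition_derivable h2 h1 (transition_swap hz)).
apply: (cder_unique (cder_comp d1 d2)).
by apply: near_eq_cder (cder_id z); apply: filterS (nbhs_transition_dom hz) => w /transitionK.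
Qed.

Lemma transition_cd_neq0 c1 c2 z : holomorphic_chart c1 -> holomorphic_chart c2 ->
  transition_dom c1 c2 z -> cd (transition c1 c2) z != 0.
Proof.
move=> h1 h2 hz; apply/eqP => h0; have := transition_cd_mul h1 h2 hz.
by rewrite h0 mulr0 => /eqP; rewrite eq_sym oner_eq0.
Qed.

Lemma atlas_holomorphic c : @surface_atlas R S c -> holomorphic_chart c.
Proof. by move=> a c' a'; exact: surface_compatible. Qed.

Section Precompose.
Context (c : chart R S) (U : set S) (oU : open U).
Context (f g : C -> C) (f0 : C) (rho s : R).
Context (df : forall w, normc w < rho -> derivable f w 1).
Context (inj : forall w1 w2, normc w1 < rho -> normc w2 < rho -> f w1 = f w2 -> w1 = w2).
Context (gP : forall y, normc (y - f0) < s ->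
  [/\ normc (g y) < rho, f (g y) = y & derivable g y 1]).

Let dom : set S := [set x | [/\ chart_dom c x, normc (c x - f0) < s & U x]].

Let nbhs_dom x : dom x -> nbhs x dom.
Proof.
move=> [x1 x2 x3].
have n1 := nbhs_chart_dom x1; have n3 : nbhs x U by apply: open_nbhs_nbhs; split.
have n2 : \forall y \near x, normc (c y - f0) < s.
  apply: (@near_chart_fun _ c x [set w : C | normc (w - f0) < s] x1); apply/nbhsCP; exists (s - normc (c x - f0)); first lra.
  by move=> w; rewrite /= => ws; have := le_normc_dist w (c x) f0; move: x2 ws; nlra.
by apply: filterS2 (filterI n1 n2) n3 => y [y1 y2] y3; split.
Qed.

Let dom_open : open dom. Proof. by rewrite openE => x; exact: nbhs_dom. Qed.

Let fgc x : dom x -> f (g (c x)) = c x. Proof. by move=> [_ h _]; have [] := gP h. Qed.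

Let inv_cts z : ((g \o c) @` dom) z -> {for z, continuous (chart_inv c \o f)}.
Proof.
move=> [x dx <-]; have [x1 x2 x3] := dx; have [g1 g2 g3] := gP x2.
apply: continuous_comp; first exact: cder_cts (derivable_cd (df g1)).
by rewrite /= g2; apply: chart_inv_cts; exact: chart_codP.
Qed.

Let cod_open : open ((g \o c) @` dom).
Proof.
rewrite openE => z hz; have ct := inv_cts hz; case: hz => x dx xz.
have [x1 x2 x3] := dx; have [g1 g2 g3] := gP x2.
have Ef : f z = c x by rewrite -xz /= g2.
have zr : normc z < rho by rewrite -xz.
have n1 := nbhs_disk zr.
have n2 : \forall w \near z, dom (chart_inv c (f w)).
  by apply: ct; rewrite /= Ef chart_funK//; exact: nbhs_dom.
have n3 : \forall w \near z, chart_cod c (f w).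
  have := cder_cts (derivable_cd (df zr)); apply; rewrite Ef.
  by apply: nbhs_chart_cod; exact: chart_codP.
apply: filterS2 (filterI n1 n2) n3 => w [w1 w2] w3.
exists (chart_inv c (f w)) => //=; have [_ E] := chart_invP w3; rewrite E.
have [_ w4 _] := w2; rewrite E in w4; have [k1 k2 k3] := gP w4.
exact: inj.
Qed.

Let fun_cts x : dom x -> {for x, continuous (g \o c)}.
Proof.
move=> [x1 x2 x3]; have [g1 g2 g3] := gP x2.
apply: continuous_comp; first exact: chart_fun_cts.
exact: cder_cts (derivable_cd g3).
Qed.

Let funK x : dom x -> (chart_inv c \o f) ((g \o c) x) = x.
Proof. by move=> dx; rewrite /= fgc// chart_funK//; case: dx. Qed.

Definition precompose : chart R S := Chart dom_open cod_open funK fun_cts inv_cts.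

Lemma precompose_holomorphic : holomorphic_chart c -> holomorphic_chart precompose.
Proof.
move=> hc c' a'; have [t1 t2] := hc _ a'; split => z [x [x1 x2] xz].
  rewrite -xz; have [y1 y2 y3] := x1; have [g1 g2 g3] := gP y2.
  have d2 : derivable (transition c c') (f (g (c x))) 1.
    by rewrite g2; apply: t1; exists x.
  exact: cder_derivable (cder_comp (derivable_cd (df g1)) (derivable_cd d2)).
rewrite -xz; have [y1 y2 y3] := x2; have [g1 g2 g3] := gP y2.
have E : transition c' c (c' x) = c x by rewrite /transition /= chart_funK.
have d1 : derivable (transition c' c) (c' x) 1 by apply: t2; exists x.
have d2 : derivable g (transition c' c (c' x)) 1 by rewrite E.
exact: cder_derivable (cder_comp (derivable_cd d1) (derivable_cd d2)).
Qed.

End Precompose.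

(** Connections and axes are read in charts, so a new coordinate has to be realized as an actual
    chart. Its domain is confined to [U], for instance to the domain of an isomorphism. *)
Lemma precompose_exists c p (U : set S) (f : C -> C) : holomorphic_chart_at p c ->
  open U -> U p -> holomorphic_at f 0 -> f 0 = c p -> cd f 0 != 0 ->
  exists c', [/\ holomorphic_chart_at p c', c' p = 0, chart_dom c' `<=` U &
    forall z, chart_cod c' z -> chart_cod c (f z) /\ chart_inv c' z = chart_inv c (f z)].
Proof.
move=> [hc dp] oU Up hf f0 cf.
have [rho [s [g [/andP[rho0 _] s0 H1 H2 H3]]]] := local_inverse hf cf ltr01.
have df w : normc w < rho -> derivable f w 1.
  by move=> hw; have [] := H1 w ltac:(by rewrite subr0).
have inj w1 w2 : normc w1 < rho -> normc w2 < rho -> f w1 = f w2 -> w1 = w2.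
  by move=> h1 h2; apply: H2; rewrite subr0.
have gP y : normc (y - f 0) < s -> [/\ normc (g y) < rho, f (g y) = y & derivable g y 1].
  by move=> /H3 [g1 g2 g3]; rewrite subr0 in g1; split => //; exact: cder_derivable g3.
have g0 : g (c p) = 0.
  have [g1 g2 _] := gP (c p) ltac:(by rewrite f0 subrr normc0).
  by apply: inj => //; rewrite ?normc0// f0 g2.
exists (precompose c oU df inj gP); split.
- split; first exact: precompose_holomorphic.
  by split => //; rewrite f0 subrr normc0.
- by rewrite /= g0.
- by move=> x [].
move=> z [x [x1 x2 x3] <-] /=; have [_ -> _] := gP _ x2.
by split => //; exact: chart_codP.
Qed.

End Surface.
End Charts.

(** * Charts in which the connection is in normal form *)

Section NormalCharts.
Context {R : realType}.
Local Notation C := (Cplx R).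
Implicit Types (z w v : C) (f h : C -> C) (G E : C -> C) (r s t : R).

Lemma half_line_scale (k : C) t :
  [set cexp k * v | v in half_line t] = half_line (t + complex.Im k).
Proof.
have E : cexp k = (expR (complex.Re k))%:C * cexp (0 +i* complex.Im k).
  rewrite -cexp_real -cexpD; congr cexp.
  by apply: complex_ext; rewrite ?cReD ?cImD /= ?addr0 ?add0r.
have F (x y : R) : cexp (0 +i* x) * cexp (0 +i* y) = cexp (0 +i* (x + y)) :> C.
  by rewrite -cexpD; congr cexp; apply: complex_ext; rewrite ?cReD ?cImD /= ?addr0.
have e0 := expR_gt0 (complex.Re k).
apply/seteqP; split => v.
  move=> [_ [x x0 <-] <-]; exists (expR (complex.Re k) * x); first by rewrite /= mulr_ge0// ltW.
  by rewrite E -F realCM; ring.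
move=> [x x0 <-]; exists ((x / expR (complex.Re k))%:C * cexp (0 +i* t)).
  by exists (x / expR (complex.Re k)) => //=; rewrite divr_ge0// ltW.
rewrite E -F realCM realCV; field.
by rewrite fmorph_eq0 gt_eqF.
Qed.

Lemma half_line_eq t1 t2 : half_line t1 = half_line t2 :> set C ->
  cexp (0 +i* t1) = cexp (0 +i* t2) :> C.
Proof.
move=> h; have : half_line t1 (cexp (0 +i* t1) : C) by exists 1 => //=; rewrite realC1 mul1r.
rewrite h => -[x x0 xE]; have /(congr1 (@normc R)) := xE.
rewrite normcM normc_real !normc_cexp_im mulr1 ger0_norm// => x1.
by rewrite -xE x1 realC1 mul1r.
Qed.

Lemma neg_axis m (a : C) t1 t2 : cexp (0 +i* t1) = cexp (0 +i* t2) :> C ->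
  - a * cexp (0 +i* (- (m%:R * t1))) < 0 -> - a * cexp (0 +i* (- (m%:R * t2))) < 0.
Proof.
have E t : cexp (0 +i* (- (m%:R * t))) = (cexp (0 +i* t) ^+ m)^-1 :> C.
  rewrite -cexpMn -cexpN; congr cexp; apply: complex_ext; rewrite ?cReN ?cImN ?RenM ?ImnM /= ?mulr0 ?oppr0//.
by move=> h; rewrite !E h.
Qed.

Lemma holomorphic_laurent f z : holomorphic_at f z -> laurent_at f z 0 (fun=> 0).
Proof.
move=> hf; exists f => //; apply/dnbhsCP; exists 1 => // w _ _.
by rewrite big_geq ?addr0.
Qed.

Lemma pole_not_holomorphic f z n : pole_order f z n -> ~ holomorphic_at f z.
Proof.
move=> [n0 [a la an]] /holomorphic_laurent la0.
have := laurent_unique la la0 n0; rewrite leqnn leqNgt n0 /= => h.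
by rewrite h eqxx in an.
Qed.

Lemma laurent_holomorphic f z n a : laurent_at f z n a -> \forall w \near z^', holomorphic_at f w.
Proof.
move=> [h hh /dnbhsCP[e e0 H]]; have /nbhsCP[e1 e10 H1] := near_holomorphic_at hh.
apply/dnbhsCP; exists (Num.min e e1); first by rewrite lt_min e0.
move=> w wz; rewrite lt_min => /andP[w1 w2].
have wz0 : w - z != 0 by rewrite subr_eq0.
pose F (v : C) : C := h v + \sum_(i < n) a i.+1 * ((v - z) ^+ i.+1)^-1.
have hF : holomorphic_at F w.
  apply: (holomorphic_atD (H1 w w2)).
  apply: (@holomorphic_at_sum R n (fun i v => a i.+1 * ((v - z) ^+ i.+1)^-1)) => i.
  apply: holomorphic_atZ.
  have hX : holomorphic_at (fun v : C => (v - z) ^+ i.+1) w.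
    exact: (holomorphic_atX _ (holomorphic_atD (holomorphic_at_id w) (holomorphic_at_cst (- z) w))).
  by apply: (holomorphic_atV hX); rewrite expf_neq0.
apply: near_eq_holomorphic_at hF.
have e2 : 0 < Num.min (e - normc (w - z)) (normc (w - z)).
  by rewrite lt_min subr_gt0 w1 normc_gt0.
apply/nbhsCP; exists (Num.min (e - normc (w - z)) (normc (w - z))) => // v.
rewrite lt_min => /andP[v1 v2]; rewrite H; last first.
- by have := le_normc_dist v w z; nlra.
- apply/eqP => vz; move: v2; rewrite vz normcB ltxx //.
by rewrite /F big_add1 big_mkord.
Qed.

Lemma normal_form_le m (res : C) r r' E G : r' <= r -> normal_form m res r E G -> normal_form m res r' E G.
Proof.
move=> rr [h1 h2 h3 h4].
have dle z : disk r' z -> disk r z by rewrite /disk /= => h; exact: lt_le_trans rr.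
by split => // z dz; [apply: h1|apply: h3|apply: h4] => //; exact: dle.
Qed.

Lemma normal_form_eq m (res : C) r E G1 G2 : (forall z, disk r z -> z != 0 -> G1 z = G2 z) ->
  normal_form m res r E G1 -> normal_form m res r E G2.
Proof. by move=> e [h1 h2 h3 h4]; split => // z dz z0; rewrite -e// h4. Qed.

Lemma developing_eq G1 G2 r phi : (forall z, disk r z -> z != 0 -> G1 z = G2 z) ->
  developing_map G1 r phi -> developing_map G2 r phi.
Proof.
move=> e dev w cw; have [h1 h2 h3] := dev w cw; split => //.
rewrite h3 e ?cexp_neq0//.
by move: cw; rewrite covering_spaceE.
Qed.

Lemma normal_form_holomorphic m (res : C) r E G z : normal_form m res r E G ->
  disk r z -> z != 0 -> holomorphic_at G z.
Proof.
move=> [h1 h2 h3 h4] dz z0.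
have hE : holomorphic_at E z by apply: filterS (nbhs_disk dz) => w /h1.
pose F (v : C) : C := m%:R / v ^+ m.+1 - res / v + cd E v / E v.
have hV n : holomorphic_at (fun v : C => (v ^+ n)^-1) z.
  by apply: (holomorphic_atV (holomorphic_atX n (holomorphic_at_id z))); rewrite expf_neq0.
have hF : holomorphic_at F z.
  apply: holomorphic_atD.
    apply: holomorphic_atD; first exact: holomorphic_atZ (hV _).
    apply: holomorphic_atN; apply: holomorphic_atZ; exact: (hV 1%N).
  exact: (holomorphic_atM (holomorphic_at_cd hE) (holomorphic_atV hE (h3 _ dz))).
have n0 := @near_neq0 R (fun y => y) z (cder_cts (cder_id z)) z0.
apply: near_eq_holomorphic_at hF; apply: filterS2 (nbhs_disk dz) n0 => v v1 v2.
by rewrite h4.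
Qed.

Section Surface.
Context {S : riemann_surface R}.
Implicit Types (c : chart R S) (p x : S) (nabla : meromorphic_connection S).

Lemma nabla_pull nabla c1 c2 z : holomorphic_chart c1 -> holomorphic_chart c2 ->
  transition_dom c1 c2 z -> holomorphic_at (nabla c1) z ->
  holomorphic_at (nabla c2) (transition c1 c2 z) ->
  nabla c1 z = pull (transition c1 c2) (nabla c2) z.
Proof.
move=> h1 h2 hz g1 g2; rewrite (christoffel_transition h1 h2 hz g1 g2).
by rewrite /pull !cdE.
Qed.

Lemma near_pole_holomorphic nabla p (L : tangent_half_line p) d c : repelling_axis nabla d L ->
  holomorphic_chart_at p c -> \forall w \near (c p)^', holomorphic_at (nabla c) w.
Proof. by move=> ax hc; have [t [a [_ la _]]] := ax c hc; exact: laurent_holomorphic la. Qed.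

Lemma near_eq_cd f h z : (\forall w \near z, f w = h w) -> holomorphic_at f z -> cd f z = cd h z.
Proof.
move=> e hf; symmetry; apply: cder_cd; apply: near_eq_cder e _; exact: holomorphic_at_cder.
Qed.

Lemma near_eq_pull f h G z : (\forall w \near z, f w = h w) -> holomorphic_at f z ->
  pull f G z = pull h G z.
Proof.
move=> e hf; have e0 : f z = h z := nbhs_singleton e.
have e1 : cd (cd f) z = cd (cd h) z.
  apply: near_eq_cd; last exact: holomorphic_at_cd.
  by apply: filterS2 (near_join e) (near_holomorphic_at hf) => w w1 w2; exact: near_eq_cd.
have e2 : cd f z = cd h z := near_eq_cd e hf.
exact: (f_equal3 (fun x y t : C => y * G x + t / y) e0 e2 e1).
Qed.

(** The transition from the new chart to [c] is [unlift kap], with derivative e^(kap 0) at 0. Its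
    argument is [theta0], so the axis at angle [theta0] becomes the half-line of angle 0. *)
Lemma normal_chart m (res : C) nabla p (L : tangent_half_line p) c theta0 (U : set S) e :
  (0 < m)%N -> holomorphic_chart_at p c -> c p = 0 -> L c = half_line theta0 ->
  has_residue nabla p res -> repelling_axis nabla m.+1 L -> open U -> U p -> 0 < e ->
  exists c' r kap E, [/\ holomorphic_chart_at p c' /\ c' p = 0, chart_dom c' `<=` U,
     0 < r /\ disk r `<=` chart_cod c', L c' = half_line 0 &
   [/\ holomorphic_on (disk r) kap, complex.Im (kap 0) = theta0,
     normal_form m res r E (nabla c'),
     forall z, disk r z -> cd (unlift kap) z != 0 /\ disk e (unlift kap z) &
     forall z, disk r z -> z != 0 -> nabla c' z = pull (unlift kap) (nabla c) z]].
Proof.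
move=> m0 hc cp Lc hres hax oU Up e0.
have [t [a [Lt la ha]]] := hax c hc; rewrite cp in la.
have a1 : a 1%N = - res by apply: (laurent_residue _ la); rewrite // -cp; exact: hres.
(* The angle [t] supplied by the axis equals [theta0] only modulo 2 pi; the sign condition depends
   only on e^(i t). *)
have ht : cexp (0 +i* t) = cexp (0 +i* theta0) :> C by apply: half_line_eq; rewrite -Lt.
have ha' := neg_axis ht ha.
have [r0 [kap [E [r00 hk kI nf nk]]]] := normal_form_exists m0 la a1 ha' e0.
have d00 : disk r0 0 by rewrite /disk /= normc0.
have hk0 : holomorphic_at kap 0 by apply: filterS (nbhs_disk d00) => z /hk.
have hu := holomorphic_at_unlift hk0.
have [cu _] := nk 0 d00.
have [c' [hc' c'p sU inv']] := precompose_exists hc oU Up hu (etrans (unlift0 kap) (esym cp)) cu.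
have cod0 : chart_cod c' 0 by rewrite -c'p; apply: chart_codP; case: hc'.
have n1 := near_pole_holomorphic hax hc; rewrite cp in n1.
have n2 := near_pole_holomorphic hax hc'; rewrite c'p in n2.
have n3 : \forall z \near (0 : C), unlift kap z != 0 -> holomorphic_at (nabla c) (unlift kap z).
  exact: (near_cts (cder_cts (holomorphic_at_cder hu)) (unlift0 kap) n1).
have [r [r1 rr H]] : exists r : R, [/\ 0 < r, r <= r0 & forall z, disk r z ->
   [/\ chart_cod c' z, z != 0 -> holomorphic_at (nabla c') z &
    unlift kap z != 0 -> holomorphic_at (nabla c) (unlift kap z)]].
  have [r r1 H] : exists2 r : R, 0 < r & forall z, disk r z ->
   [/\ chart_cod c' z, z != 0 -> holomorphic_at (nabla c') z &
    unlift kap z != 0 -> holomorphic_at (nabla c) (unlift kap z)].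
    apply: near_disk; apply: filterS2 (filterI (nbhs_chart_cod cod0) n2) n3 => z [z1 z2] z3.
    by split.
  exists (Num.min r r0); split; first by rewrite lt_min r1.
    by rewrite ge_min lexx orbT.
  by move=> z; rewrite /disk /= lt_min => /andP[z1 _]; exact: H.
have dle z : disk r z -> disk r0 z by rewrite /disk /= => h; exact: lt_le_trans rr.
have [hcc dcp] := hc; have [hcc' dcp'] := hc'.
have tE z : chart_cod c' z -> transition_dom c' c z /\ transition c' c z = unlift kap z.
  move=> hz; have [k1 k2] := inv' z hz; have [k3 k4] := chart_invP k1.
  split; first by apply/transition_domP; rewrite k2.
  by rewrite /transition /= k2.
have ntE z : chart_cod c' z -> \forall w \near z, transition c' c w = unlift kap w.
  by move=> hz; apply: filterS (nbhs_chart_cod hz) => w /tE [].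
have eqN z : disk r z -> z != 0 -> nabla c' z = pull (unlift kap) (nabla c) z.
  move=> dz z0; have [k1 k2 k3] := H z dz; have [k4 k5] := tE z k1.
  rewrite (nabla_pull hcc' hcc k4 (k2 z0)); last first.
    by rewrite k5; apply: k3; rewrite mulf_neq0 ?cexp_neq0.
  apply: near_eq_pull (ntE z k1) _; exact: transition_holomorphic.
exists c', r, kap, E; split; [by split|exact: sU|split; [exact: r1|by move=> z /H []]| |].
  rewrite (half_line_transition L hc hc') Lc cp -cdE.
  have t0 : transition_dom c' c 0 by have [] := tE 0 cod0.
  have h0 : transition c' c 0 = 0 by have [_ ->] := tE 0 cod0; rewrite unlift0.
  have := transition_cd_mul hcc' hcc t0; rewrite h0.
  rewrite (near_eq_cd (ntE 0 cod0) (transition_holomorphic hcc' hcc t0)).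
  rewrite (cder_cd (cder_unlift (hk _ d00))) mul0r addr0 mulr1 => h.
  have -> : cd (transition c c') 0 = cexp (- kap 0).
    by rewrite cexpN; apply: (mulIf (cexp_neq0 (kap 0))); rewrite h mulVf// cexp_neq0.
  by rewrite half_line_scale cImN kI subrr.
split; [|exact: kI| | |exact: eqN].
- by move=> z /dle /hk.
- apply: (@normal_form_eq m res r E (pull (unlift kap) (nabla c))).
    by move=> z dz z0; rewrite eqN.
  exact: normal_form_le nf.
by move=> z /dle /nk.
Qed.

End Surface.
End NormalCharts.

(** * Gluing germs *)

Section Gluing.
Context {R : realType}.
Local Notation C := (Cplx R).
Implicit Types (z w v : C) (f g F : C -> C) (G E H : C -> C) (r s t : R).

Lemma pull_eq_at f G1 G2 z : G1 (f z) = G2 (f z) -> pull f G1 z = pull f G2 z.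
Proof. by move=> e; rewrite /pull e. Qed.

(** The transformation law is a cocycle, which makes pull-backs through several charts
    consistent. *)
Lemma pull_comp f g G z : holomorphic_at f z -> holomorphic_at g (f z) ->
  cd f z != 0 -> cd g (f z) != 0 ->
  pull (g \o f) G z = pull f (pull g G) z.
Proof.
move=> hf hg f0 g0; have df := holomorphic_at_cder hf; have dg := holomorphic_at_cder hg.
have d1 : cd (g \o f) z = cd g (f z) * cd f z := cder_cd (cder_comp df dg).
have n1 : \forall w \near z, cd g (f w) * cd f w = cd (g \o f) w.
  have n2 := near_cts (cder_cts df) erefl (near_holomorphic_at hg).
  apply: filterS2 (near_holomorphic_at hf) n2 => w w1 w2.
  exact: esym (cder_cd (cder_comp (holomorphic_at_cder w1) (holomorphic_at_cder w2))).
have dcf := holomorphic_at_cder (holomorphic_at_cd hf).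
have dcg := holomorphic_at_cder (holomorphic_at_cd hg).
have d2 : cd (cd (g \o f)) z = cd (cd g) (f z) * cd f z * cd f z + cd g (f z) * cd (cd f) z.
  exact: cder_cd (near_eq_cder n1 (cderM (cder_comp df dcg) dcf)).
have := @f_equal3 C C C C (fun x y q : C => x * y + q / x) (cd (g \o f) z) (cd g (f z) * cd f z)
  (G (g (f z))) _ (cd (cd (g \o f)) z) _ d1 erefl d2.
rewrite -[LHS]/(pull (g \o f) G z) => ->; rewrite /pull.
move: f0 g0; move: (cd (cd g) (f z)) (cd g (f z)) (G (g (f z))) => x1 x2 x3.
move: (cd (cd f) z) (cd f z) => x4 x5 h1 h2.
by field; rewrite ?h1 ?h2.
Qed.

Lemma cd_comp_neq0 f g z : holomorphic_at f z -> holomorphic_at g (f z) ->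
  cd f z != 0 -> cd g (f z) != 0 -> cd (g \o f) z != 0.
Proof.
move=> hf hg f0 g0; have -> : cd (g \o f) z = cd g (f z) * cd f z.
  exact: cder_cd (cder_comp (holomorphic_at_cder hf) (holomorphic_at_cder hg)).
exact: mulf_neq0.
Qed.

Section Glue.
Context {S1 S2 : riemann_surface R}.
Context (nabla1 : meromorphic_connection S1) (nabla2 : meromorphic_connection S2).
Context (p1 : S1) (p2 : S2) (L1 : tangent_half_line p1) (L2 : tangent_half_line p2).

(** A germ [F] between normal charts becomes an isomorphism of surfaces after the domains are cut
    down to where [F] is injective and both charts are defined. The condition [cd F 0 = 1] makes
    equal half-lines in [k1] and [k2] correspond. *)
Lemma glue d k1 k2 r r' F :
  holomorphic_chart_at p1 k1 -> holomorphic_chart_at p2 k2 -> k1 p1 = 0 -> k2 p2 = 0 ->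
  is_pole nabla1 p1 d -> L1 k1 = L2 k2 ->
  0 < r' -> r' <= r -> disk r `<=` chart_cod k1 -> disk r `<=` chart_cod k2 ->
  (forall z, disk r z -> z != 0 -> holomorphic_at (nabla1 k1) z) ->
  (forall z, disk r z -> z != 0 -> holomorphic_at (nabla2 k2) z) ->
  holomorphic_on (disk r') F -> F 0 = 0 -> cd F 0 = 1 ->
  (forall z, disk r' z -> [/\ disk r (F z), cd F z != 0 &
     z != 0 -> nabla1 k1 z = pull F (nabla2 k2) z]) ->
  isomorphic_near_punctures nabla1 nabla2 L1 L2.
Proof.
move=> hk1 hk2 k1p k2p pol LL r'0 rr cod1 cod2 hol1 hol2 hF F0 cF HF.
have [h1 dp1] := hk1; have [h2 dp2] := hk2.
have d0 : disk r' 0 by rewrite /disk /= normc0.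
have holF z : disk r' z -> holomorphic_at F z by move=> dz; apply: filterS (nbhs_disk dz) => w /hF.
have cF0 : cd F 0 != 0 by rewrite cF oner_neq0.
have [rho [s0 [g [/andP[rho0 rho1] s00 _ inj gP]]]] := local_inverse (holF _ d0) cF0 r'0.
rewrite F0 in gP.
pose s : R := Num.min s0 r.
have s1 : 0 < s by rewrite lt_min s00; exact: lt_le_trans rr.
have dle z : disk rho z -> disk r' z by rewrite /disk /= => h; exact: lt_le_trans rho1.
have dle' z : disk r' z -> disk r z by rewrite /disk /= => h; exact: lt_le_trans rr.
have ss0 z : disk s z -> disk s0 z by rewrite /disk /= lt_min => /andP[].
have ssr z : disk s z -> disk r z by rewrite /disk /= lt_min => /andP[].
(* [F] is injective on the disk of radius [rho]; the last condition keeps its values where the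
   inverse [g] and the chart [k2] are available. *)
pose U1 : set S1 := [set x | [/\ chart_dom k1 x, disk rho (k1 x) & disk s (F (k1 x))]].
pose U2 : set S2 := [set y | chart_dom k2 y /\ disk s (k2 y)].
pose f : S1 -> S2 := chart_inv k2 \o F \o k1.
pose h : S2 -> S1 := chart_inv k1 \o g \o k2.
have fP x : U1 x -> [/\ chart_dom k2 (f x), k2 (f x) = F (k1 x) & chart_cod k2 (F (k1 x))].
  by move=> [x1 x2 x3]; have [q1 q2] := chart_invP (cod2 _ (ssr _ x3)); split => //; exact: cod2 (ssr _ x3).
have gP' y : disk s y -> [/\ disk rho (g y), F (g y) = y & derivable g y 1].
  move=> /ss0 y1; have [q1 q2 q3] := gP y ltac:(by rewrite subr0).
  by rewrite subr0 in q1; split => //; exact: cder_derivable q3.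
have inj0 z w : disk rho z -> disk rho w -> F z = F w -> z = w.
  by move=> z1 z2; apply: inj; rewrite subr0.
have hP y : U2 y -> [/\ chart_dom k1 (h y), k1 (h y) = g (k2 y), disk rho (g (k2 y)) & F (g (k2 y)) = k2 y].
  move=> [y1 y2]; have [q1 q2 q3] := gP' _ y2.
  by have [q4 q5] := chart_invP (cod1 _ (dle' _ (dle _ q1))); split.
have pU1 : U1 p1 by split => //; rewrite k1p ?F0 /disk /= normc0.
have pU2 : U2 p2 by split => //; rewrite k2p /disk /= normc0.
have oU1 : open U1.
  rewrite openE => x [x1 x2 x3].
  have n1 := nbhs_chart_dom x1.
  have n2 := near_chart_fun x1 (nbhs_disk x2).
  have n3 := near_chart_fun x1 (near_cts (cder_cts (derivable_cd (hF _ (dle _ x2)))) erefl (nbhs_disk x3)).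
  by apply: filterS2 (filterI n1 n2) n3 => y [y1 y2] y3; split.
have oU2 : open U2.
  rewrite openE => x [x1 x2].
  by apply: filterS2 (nbhs_chart_dom x1) (near_chart_fun x1 (nbhs_disk x2)) => y y1 y2; split.
have UV x : U1 x -> U2 (f x) /\ h (f x) = x.
  move=> ux; have [f1 f2 f3] := fP x ux; have [x1 x2 x3] := ux.
  split; first by split => //; rewrite f2.
  have [q1 q2 q3] := gP' _ x3.
  by rewrite /h /= -/(f x) f2 (inj0 _ _ q1 x2 q2) chart_funK.
have VU y : U2 y -> U1 (h y) /\ f (h y) = y.
  move=> uy; have [q1 q2 q3 q4] := hP y uy; have [y1 y2] := uy.
  split; first by split; rewrite ?q2 ?q4.
  by rewrite /f /= -/(h y) q2 q4 chart_funK.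
have fcts x : U1 x -> {for x, continuous f}.
  move=> ux; have [f1 f2 f3] := fP x ux; have [x1 x2 x3] := ux.
  apply: (@continuous_comp _ _ _ k1 (chart_inv k2 \o F)); first exact: chart_fun_cts.
  apply: (@continuous_comp _ _ _ F (chart_inv k2)); last exact: chart_inv_cts.
  exact: cder_cts (derivable_cd (hF _ (dle _ x2))).
have hcts y : U2 y -> {for y, continuous h}.
  move=> uy; have [q1 q2 q3 q4] := hP y uy; have [y1 y2] := uy.
  apply: (@continuous_comp _ _ _ k2 (chart_inv k1 \o g)); first exact: chart_fun_cts.
  apply: (@continuous_comp _ _ _ g (chart_inv k1)).
    by have [_ _ dg] := gP' _ y2; exact: cder_cts (derivable_cd dg).
  by apply: chart_inv_cts; apply: cod1; exact: (dle' _ (dle _ q3)).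
have fhol c1 c2 z : holomorphic_chart c1 -> holomorphic_chart c2 -> map_in_charts_dom U1 f c1 c2 z ->
  exists x, [/\ z = c1 x /\ chart_dom c1 x, U1 x, transition_dom c1 k1 z, transition c1 k1 z = k1 x & transition_dom k2 c2 (F (k1 x))].
  move=> hc1 hc2 [x [[x1 ux] x2] <-]; have [f1 f2 f3] := fP x ux; have [x3 x4 x5] := ux.
  exists x; split => //.
  - by exists x.
  - by rewrite /transition /= chart_funK.
  by apply/transition_domP.
exists U1, U2, f, h; split; first split; [by split|by split| |].
  split => //.
    split => // c1 c2 hc1 hc2 z hz; have [x [[zx xd] ux t1 t2 t3]] := fhol c1 c2 z hc1 hc2 hz.
    have e1 := derivable_cd (transition_derivable hc1 h1 t1).
    have e2 := derivable_cd (hF (transition c1 k1 z) ltac:(by rewrite t2; apply: dle; case: ux)).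
    have e3 := derivable_cd (transition_derivable h2 hc2 t3).
    by rewrite -t2 in e3; exact: cder_derivable (cder_comp e1 (cder_comp e2 e3)).
  split => // c2 c1 hc2 hc1 z [y [[y1 uy] y2] <-]; have [q1 q2 q3 q4] := hP y uy; have [y3 y4] := uy.
  have t1 : transition_dom c2 k2 (c2 y) by exists y.
  have t2 : transition c2 k2 (c2 y) = k2 y by rewrite /transition /= chart_funK.
  have t3 : transition_dom k1 c1 (g (k2 y)).
    by apply/transition_domP; split; [exact: cod1 (dle' _ (dle _ q3))|exact: y2].
  have [_ _ dg] := gP' _ y4.
  have e1 := derivable_cd (transition_derivable hc2 h2 t1).
  have e2 := derivable_cd dg; rewrite -t2 in e2.
  have e3 := derivable_cd (transition_derivable h1 hc1 t3); rewrite -t2 in e3.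
  exact: cder_derivable (cder_comp e1 (cder_comp e2 e3)).
split.
- by rewrite /f /= k1p F0 -k2p chart_funK.
- move=> c1 c2 hc1 hc2 z hz g1 g2; have [x [[zx xd] ux t1 t2 t3]] := fhol c1 c2 z hc1 hc2 hz.
  have [x1 x2 x3] := ux.
  (* The law is demanded only where the symbols are holomorphic, which excludes the pole. *)
  have xp : k1 x != 0.
    apply/eqP => x0; have xp1 : x = p1 by rewrite -(chart_funK x1) x0 -k1p chart_funK.
    apply: (@pole_not_holomorphic R (nabla1 c1) z d) => //.
    by rewrite zx xp1; apply: pol; split => //; rewrite -xp1.
  have Fx0 : F (k1 x) != 0.
    apply/eqP => Fx; have : k1 x = 0 by apply: inj0; rewrite ?Fx ?F0// /disk /= normc0.
    by move/eqP; rewrite (negbTE xp).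
  have [_ cFx FE] := HF _ (dle _ x2).
  have g3 : holomorphic_at (nabla2 k2) (F (k1 x)) := hol2 _ (ssr _ x3) Fx0.
  have g4 : holomorphic_at (nabla1 k1) (transition c1 k1 z).
    by rewrite t2; apply: hol1 => //; exact: dle' (dle _ x2).
  have psiE : map_in_charts f c1 c2 = transition k2 c2 \o (F \o transition c1 k1) by [].
  have g5 : holomorphic_at (nabla2 c2) (transition k2 c2 (F (k1 x))).
    by move: g2; rewrite psiE /= t2.
  rewrite -cdE -[RHS]/(pull (map_in_charts f c1 c2) (nabla2 c2) z) psiE.
  have hT1 := transition_holomorphic hc1 h1 t1.
  have hT2 := transition_holomorphic h2 hc2 t3.
  have hFx := holF _ (dle _ x2).
  have cT1 := transition_cd_neq0 hc1 h1 t1.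
  have cT2 := transition_cd_neq0 h2 hc2 t3.
  have hTF : holomorphic_at (transition k2 c2 \o F) (k1 x) := holomorphic_at_comp hFx hT2.
  have cTF : cd (transition k2 c2 \o F) (k1 x) != 0.
    exact: cd_comp_neq0.
  rewrite (nabla_pull hc1 h1 t1 g1 g4).
  rewrite -[RHS]/(pull ((transition k2 c2 \o F) \o transition c1 k1) (nabla2 c2) z).
  rewrite (@pull_comp (transition c1 k1) (transition k2 c2 \o F)) ?t2//.
  apply: pull_eq_at; rewrite t2 (FE xp) (@pull_comp F (transition k2 c2))//.
  by apply: pull_eq_at; exact: nabla_pull.
move=> c1 c2 hc1 hc2; have [hh1 dq1] := hc1; have [hh2 dq2] := hc2.
have t1 : transition_dom c1 k1 (c1 p1) by exists p1.
have t2 : transition c1 k1 (c1 p1) = 0 by rewrite /transition /= chart_funK.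
have t3 : transition_dom k2 c2 0 by rewrite -k2p; exists p2.
have dT1 := derivable_cd (transition_derivable hh1 h1 t1).
have dT2 := derivable_cd (transition_derivable h2 hh2 t3).
have dF0 : cder F (transition c1 k1 (c1 p1)) 1 by rewrite t2 -cF; exact: derivable_cd (hF _ d0).
have dT2' : cder (transition k2 c2) (F (transition c1 k1 (c1 p1))) (cd (transition k2 c2) 0) by rewrite t2 F0.
have dpsi := cder_comp dT1 (cder_comp dF0 dT2').
rewrite -cdE (cder_cd (f := map_in_charts f c1 c2) dpsi).
rewrite (half_line_transition L2 hk2 hc2) -LL (half_line_transition L1 hc1 hk1) k2p -!cdE.
by rewrite image_comp; apply: eq_imagel => v _ /=; rewrite mulr1 mulrA.
Qed.

End Glue.
End Gluing.

(** * Completeness of the invariant *)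

Section Complete.
Context {R : realType}.
Local Notation C := (Cplx R).
Implicit Types (z w v : C) (f g F : C -> C) (G E H phi : C -> C) (r s t : R) (u : int -> C).

Lemma dev_values m (res : C) E phi (K : C) s : (0 < m)%N -> holomorphic_at E 0 ->
  (forall w, hp s w -> cder phi w (K * dev_der m res E w)) ->
  exists s' u, s' <= s /\ has_values m res s' phi u.
Proof.
move=> m0 hE dphi; have [r [M [r0 M0 H]]] := holomorphic_at_bounded hE.
pose s1 : R := Num.min (s - 1) (ln r - 1).
have [s10 s1r] : s1 <= s - 1 /\ s1 <= ln r - 1 by rewrite !ge_min !lexx orbT.
have [|w ws|s' [u [ss hv]]] := @has_values_exists R m res s1 phi (fun w => K * dev_der m res E w) (normc K * M) m0.
- by rewrite mulr_ge0// normc_ge0.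
- split; first by apply: dphi; rewrite /hp /=; lra.
  have dw : disk r (cexp w) by apply: (@hp_disk R r (ln r)) => //; rewrite /hp /=; lra.
  have [_ hM] := H _ dw; rewrite normcM -mulrA ler_wpM2l ?normc_ge0//.
  by rewrite normcM mulrC ler_wpM2r ?normc_ge0.
by exists s', u; split => //; lra.
Qed.

Lemma normal_form_hol0 m (res : C) r E G : 0 < r -> normal_form m res r E G -> holomorphic_at E 0.
Proof.
move=> r0 [hE _ _ _]; have d0 : disk r 0 by rewrite /disk /= normc0.
by apply: filterS (nbhs_disk d0) => z /hE.
Qed.

Lemma affine_equiv_refl u : affine_equiv u u.
Proof. by exists 1, 0; split => [|k]; rewrite ?oner_neq0// mul1r addr0. Qed.

Section Surface.
Context {S : riemann_surface R}.
Implicit Types (c : chart R S) (p x : S) (nabla : meromorphic_connection S).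

Lemma centered_chart p (L : tangent_half_line p) : exists c theta,
  [/\ holomorphic_chart_at p c, c p = 0 & L c = half_line theta].
Proof.
have [c0 a0 d0] := surface_cover p.
have hc0 : holomorphic_chart_at p c0 by split => //; exact: atlas_holomorphic.
have hf : holomorphic_at (fun z : C => c0 p + z) 0.
  exact: (holomorphic_atD (holomorphic_at_cst (c0 p) 0) (holomorphic_at_id 0)).
have cf : cd (fun z : C => c0 p + z) 0 != 0.
  by rewrite (cder_cd (cderD (cder_cst (c0 p) 0) (cder_id 0))) add0r oner_neq0.
have [c [hc cp _ _]] := precompose_exists hc0 openT I hf (addr0 (c0 p)) cf.
by have [t Lt] := half_line_coordE L hc; exists c, t.
Qed.

(** Moves the data of an invariant to a normal chart: the given developing map, composed with the
    lift, develops the normal form with the same family, and now with the bounds of [has_values]. *)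
Lemma normal_data nabla p (L : tangent_half_line p) m (res : C) iota :
  (0 < m)%N -> has_residue nabla p res -> repelling_axis nabla m.+1 L ->
  asymptotic_invariant nabla m.+1 res L iota ->
  exists c r E phi s u,
   [/\ holomorphic_chart_at p c /\ c p = 0, 0 < r /\ disk r `<=` chart_cod c, L c = half_line 0,
       normal_form m res r E (nabla c) & [/\ developing_map (nabla c) r phi,
       has_values m res s phi u, family_space m.+1 res u & iota = family_class m.+1 res u]].
Proof.
move=> m0 hres hax [c [eps [phi [t0 [u [[hc cp e0 _ _] [dev Lc fam ->]]]]]]].
have [c' [r [kap [E [hc' _ cod' Lc' [hk kI nf Hk eqN]]]]]] :=
  normal_chart m0 hc cp Lc hres hax openT I e0.
have [r0 codr] := cod'.
have dev' : developing_map (nabla c') r (phi \o lift kap).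
  apply: (@developing_eq _ (pull (unlift kap) (nabla c))).
    by move=> z dz z0; rewrite eqN.
  apply: (developing_pull hk _ _ dev) => z dz _; first by have [] := Hk z dz.
  by have [] := Hk z dz.
have er : expR (ln r) <= r by rewrite lnK.
have [K K0 dphi] := developing_normal nf dev' er er.
have [s [u' [sr hv]]] := dev_values m0 (normal_form_hol0 r0 nf) dphi.
have uu : u = u'.
  apply: (family_transfer m0 r0 hk kI _ fam hv) => z dz _.
  by have [] := Hk z dz.
exists c', r, E, (phi \o lift kap), s, u; split => //; split => //.
- by rewrite uu.
- rewrite uu; apply: (values_family_space m0 hv (E := E) (K := K)) => w hw.
  by apply: dphi; exact: lt_le_trans sr.
Qed.

End Surface.

Lemma invariant_isomorphic (S1 S2 : riemann_surface R)
  (nabla1 : meromorphic_connection S1) (nabla2 : meromorphic_connection S2)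
  (p1 : S1) (p2 : S2) (L1 : tangent_half_line p1) (L2 : tangent_half_line p2) m (res : C) iota :
  (0 < m)%N -> is_pole nabla1 p1 m.+1 -> has_residue nabla1 p1 res -> has_residue nabla2 p2 res ->
  repelling_axis nabla1 m.+1 L1 -> repelling_axis nabla2 m.+1 L2 ->
  asymptotic_invariant nabla1 m.+1 res L1 iota -> asymptotic_invariant nabla2 m.+1 res L2 iota ->
  isomorphic_near_punctures nabla1 nabla2 L1 L2.
Proof.
move=> m0 pol res1 res2 ax1 ax2 inv1 inv2.
have [c1 [r1 [E1 [phi1 [s1 [u1 [[hc1 cp1] [r10 cod1] Lc1 nf1 [dev1 hv1 fam1 i1]]]]]]]] := normal_data m0 res1 ax1 inv1.
have [c2 [r2 [E2 [phi2 [s2 [u2 [[hc2 cp2] [r20 cod2] Lc2 nf2 [dev2 hv2 fam2 i2]]]]]]]] := normal_data m0 res2 ax2 inv2.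
have aff : affine_equiv u1 u2.
  have : family_class m.+1 res u2 u2 by split => //; exact: affine_equiv_refl.
  by rewrite -i2 i1 => -[].
pose r : R := Num.min r1 r2; have [rr1 rr2] : r <= r1 /\ r <= r2 by rewrite !ge_min !lexx orbT.
have r0 : 0 < r by rewrite lt_min r10.
pose s : R := Num.min s1 s2; have [ss1 ss2] : s <= s1 /\ s <= s2 by rewrite !ge_min !lexx orbT.
have nf1' := normal_form_le rr1 nf1; have nf2' := normal_form_le rr2 nf2.
have [r' [eta [r'0 rr heta eta0 H]]] := iso_germ m0 r0 r10 r20 nf1' nf2' dev1 dev2
  (has_values_le ss1 hv1) (has_values_le ss2 hv2) aff.
have d0 : disk r' 0 by rewrite /disk /= normc0.
have LL : L1 c1 = L2 c2 by rewrite Lc1 Lc2.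
have dle (a b : R) z : a <= b -> disk a z -> disk b z by rewrite /disk /= => h1 h2; exact: lt_le_trans h1.
apply: (glue hc1 hc2 cp1 cp2 pol LL r'0 rr _ _ _ _ _ _ _ H).
- by move=> z /(dle _ _ _ rr1) /cod1.
- by move=> z /(dle _ _ _ rr2) /cod2.
- by move=> z dz z0; exact: normal_form_holomorphic nf1' dz z0.
- by move=> z dz z0; exact: normal_form_holomorphic nf2' dz z0.
- by move=> z /heta de; exact: cder_derivable (cder_unlift de).
- exact: unlift0.
by rewrite (cder_cd (cder_unlift (heta _ d0))) mul0r addr0 mulr1 eta0 cexp0.
Qed.

Section Transport.
Context {S1 S2 : riemann_surface R} (U1 : set S1) (U2 : set S2) (f : S1 -> S2) (g : S2 -> S1).
Context (oU2 : open U2) (bi : biholomorphism U1 U2 f g).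
Context (c : chart R S1) (cU : chart_dom c `<=` U1).

Let dom : set S2 := [set y | U2 y /\ chart_dom c (g y)].

Let fg x : U1 x -> U2 (f x) /\ g (f x) = x. Proof. by have [h _ _ _] := bi; exact: h. Qed.
Let gf y : U2 y -> U1 (g y) /\ f (g y) = y. Proof. by have [_ h _ _] := bi; exact: h. Qed.
Let fcts x : U1 x -> {for x, continuous f}. Proof. by have [_ _ [h _] _] := bi; exact: h. Qed.
Let gcts y : U2 y -> {for y, continuous g}. Proof. by have [_ _ _ [h _]] := bi; exact: h. Qed.

Let dom_open : open dom.
Proof.
rewrite openE => y [y1 y2]; have n1 : nbhs y U2 by apply: open_nbhs_nbhs; split.
have n2 : \forall x \near y, chart_dom c (g x) by exact: (gcts y1 (nbhs_chart_dom y2)).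
by apply: filterS2 n1 n2.
Qed.

Let codE : (c \o g) @` dom = chart_cod c.
Proof.
apply/seteqP; split => [_ [y [y1 y2] <-]|_ [x x1 <-]]; first exact: chart_codP.
by have [q1 q2] := fg (cU x1); exists (f x); rewrite /dom /= q2.
Qed.

Let cod_open : open ((c \o g) @` dom).
Proof. by rewrite codE; exact: chart_cod_open. Qed.

Let funK y : dom y -> (f \o chart_inv c) ((c \o g) y) = y.
Proof. by move=> [y1 y2]; rewrite /= chart_funK//; have [] := gf y1. Qed.

Let fun_cts y : dom y -> {for y, continuous (c \o g)}.
Proof.
move=> [y1 y2]; apply: continuous_comp; first exact: gcts.
exact: chart_fun_cts.
Qed.

Let inv_cts z : ((c \o g) @` dom) z -> {for z, continuous (f \o chart_inv c)}.
Proof.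
rewrite codE => hz; apply: continuous_comp; first exact: chart_inv_cts.
by apply: fcts; apply: cU; have [] := chart_invP hz.
Qed.

(** Carries a chart of the first surface to the second one through the isomorphism; in this pair of
    charts the isomorphism is the identity. *)
Definition transport : chart R S2 := Chart dom_open cod_open funK fun_cts inv_cts.

Lemma transport_cod : chart_cod transport = chart_cod c. Proof. exact: codE. Qed.

Lemma transport_holomorphic : holomorphic_chart c -> holomorphic_chart transport.
Proof.
move=> hc c' a'; have hc' := atlas_holomorphic a'.
have [_ _ [_ hf] [_ hg]] := bi; split => z [y [y1 y2] yz].
  apply: (hf c c' hc hc' z); have [y3 y4] := y1; have [q1 q2] := gf y3.
  by exists (g y) => //; split; [split|rewrite /= q2].
apply: (hg c' c hc' hc z); have [y3 y4] := y2.
by exists y.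
Qed.

End Transport.

(** In a normal chart and its transport the two connections have the same symbol off the pole and
    the same axis, so one developing map and one family serve for both. *)
Lemma isomorphic_invariant (S1 S2 : riemann_surface R)
  (nabla1 : meromorphic_connection S1) (nabla2 : meromorphic_connection S2)
  (p1 : S1) (p2 : S2) (L1 : tangent_half_line p1) (L2 : tangent_half_line p2) m (res : C) :
  (0 < m)%N -> has_residue nabla1 p1 res ->
  repelling_axis nabla1 m.+1 L1 -> repelling_axis nabla2 m.+1 L2 ->
  isomorphic_near_punctures nabla1 nabla2 L1 L2 ->
  exists2 iota, invariant_space m.+1 res iota &
    asymptotic_invariant nabla1 m.+1 res L1 iota /\
    asymptotic_invariant nabla2 m.+1 res L2 iota.
Proof.
move=> m0 res1 ax1 ax2 [U1 [U2 [f [g [[[oU1 Up1] [oU2 Up2] bi] [fp con mat]]]]]].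
have [c0 [t0 [hc0 c0p Lc0]]] := centered_chart L1.
have [c [r0 [kap [E [[hc cp] cU [r00 cod0] Lc [_ _ nf0 _ _]]]]]] :=
  normal_chart m0 hc0 c0p Lc0 res1 ax1 oU1 Up1 ltr01.
pose c2 := transport oU2 bi cU.
have [hcc dp] := hc; have hcc2 : holomorphic_chart c2 := transport_holomorphic oU2 bi cU hcc.
have [gf1 gf2] : U2 (f p1) /\ g (f p1) = p1 by have [h _ _ _] := bi; exact: h.
have dp2 : chart_dom c2 p2 by rewrite -fp; split => //; rewrite gf2.
have c2p : c2 p2 = 0 by rewrite /= -fp gf2.
have hc2 : holomorphic_chart_at p2 c2 by split.
have mapE z : chart_cod c z -> map_in_charts_dom U1 f c c2 z /\ map_in_charts f c c2 z = z.
  move=> [x x1 <-]; have ux := cU _ x1; have [h1 h2] : U2 (f x) /\ g (f x) = x by have [h _ _ _] := bi; exact: h.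
  split; last by rewrite /map_in_charts /= chart_funK// h2.
  by exists x => //; split; [split|split => //; rewrite h2].
have cod00 : chart_cod c 0 by apply: cod0; rewrite /disk /= normc0.
have near_map z : chart_cod c z -> \forall w \near z, map_in_charts f c c2 w = w.
  by move=> hz; apply: filterS (nbhs_chart_cod hz) => w /mapE [].
have near_map' z : chart_cod c z -> \forall w \near z, w = map_in_charts f c c2 w.
  by move=> hz; apply: filterS (near_map z hz) => w ->.
have dmap z : chart_cod c z -> cd (map_in_charts f c c2) z = 1.
  move=> hz; rewrite -(near_eq_cd (near_map' z hz) (holomorphic_at_id z)).
  exact: cder_cd (cder_id z).
have pull_id z : pull (fun w => w) (nabla2 c2) z = nabla2 c2 z.
  rewrite /pull (cder_cd (cder_id z)).
  have -> : cd (cd (fun w : C => w)) z = 0.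
    apply: cder_cd; apply: near_eq_cder (cder_cst 1 z).
    by apply: nearCW => w; rewrite (cder_cd (cder_id w)).
  by rewrite mul1r mul0r addr0.
have n2 := near_pole_holomorphic ax2 hc2; rewrite c2p in n2.
have [r1 r10 Hr1] : exists2 r : R, 0 < r & forall z, disk r z -> z != 0 -> holomorphic_at (nabla2 c2) z.
  exact: near_disk n2.
pose r : R := Num.min r0 r1.
have [rr0 rr1] : r <= r0 /\ r <= r1 by rewrite !ge_min !lexx orbT.
have rp : 0 < r by rewrite lt_min r00.
have dle (a b : R) z : a <= b -> disk a z -> disk b z by rewrite /disk /= => h1 h2; exact: lt_le_trans h1.
have nf := normal_form_le rr0 nf0.
have codr z : disk r z -> chart_cod c z by move=> /(dle _ _ _ rr0) /cod0.
have hol1 z : disk r z -> z != 0 -> holomorphic_at (nabla1 c) z by exact: normal_form_holomorphic nf.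
have hol2 z : disk r z -> z != 0 -> holomorphic_at (nabla2 c2) z by move=> /(dle _ _ _ rr1); exact: Hr1.
have eqN z : disk r z -> z != 0 -> nabla1 c z = nabla2 c2 z.
  move=> dz z0; have [m1 m2] := mapE z (codr z dz).
  have h2 : holomorphic_at (nabla2 c2) (map_in_charts f c c2 z) by rewrite m2; exact: hol2.
  have := con c c2 hcc hcc2 z m1 (hol1 z dz z0) h2.
  rewrite -cdE -[RHS]/(pull (map_in_charts f c c2) (nabla2 c2) z) => ->.
  by rewrite -(near_eq_pull _ (near_map' z (codr z dz)) (holomorphic_at_id z)) pull_id.
have [phi [dphi dev]] := developing_exists rp nf.
have dphi' w : hp (ln r) w -> cder phi w (1 * dev_der m res E w) by rewrite mul1r; exact: dphi.
have [s [u [sr hv]]] := dev_values m0 (normal_form_hol0 rp nf) dphi'.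
have fam : family_space m.+1 res u.
  apply: (values_family_space m0 hv (E := E) (K := 1)) => w hw.
  by apply: dphi'; exact: lt_le_trans sr.
have Lc2 : L2 c2 = half_line 0.
  rewrite (mat c c2 hc hc2) cp Lc -cdE (dmap 0 cod00).
  by apply/seteqP; split => [_ [v hv' <-]|v hv']; [rewrite mul1r|exists v => //; rewrite mul1r].
exists (family_class m.+1 res u); first by exists u.
split.
  exists c, r, phi, 0, u; split; split => //; rewrite ?cdiskE//.
  exact: has_values_family hv.
exists c2, r, phi, 0, u; split; split => //; rewrite ?cdiskE//.
- by rewrite transport_cod.
- exact: (developing_eq eqN).
exact: has_values_family hv.
Qed.

End Complete.

(** * A divergent power series *)

Section Coefficients.
Context {R : realType}.
Local Notation C := (Cplx R).
Implicit Types (z w v : C) (f g F : C -> C) (G E H phi : C -> C) (r s : R) (u : int -> C).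

(** Cauchy's integral for the n-th Taylor coefficient at 0, where dt is d zeta / (2 i pi zeta). *)
Definition taylor_coef r F n : C := cint (fun t => F (circ r t) * (circ r t)^-1 ^+ n).

Section Fixed.
Context (rho r : R) (r0 : 0 < r) (rr : r < rho).

Let circ_disk (t : R) : disk rho (circ r t).
Proof. by rewrite /disk /= normc_circ ?ltW. Qed.

Let circ0 (t : R) : circ r t != 0.
Proof. by rewrite -normc_gt0 normc_circ ?ltW. Qed.

Let ctsI_inv n : ctsI (fun t => (circ r t)^-1 ^+ n).
Proof. by apply: ctsIX; apply: ctsIV (@ctsI_circ R r) _ => t _; exact: circ0. Qed.

Lemma ctsI_taylor F n : holomorphic_on (disk rho) F ->
  ctsI (fun t => F (circ r t) * (circ r t)^-1 ^+ n).
Proof. move=> hF; exact: ctsIM (ctsI_hol_circ (ltW r0) rr hF) (@ctsI_inv n). Qed.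

Let ctsI_taylor_der F n : holomorphic_on (disk rho) F ->
  ctsI (fun t => cd F (circ r t) * circ r t * (circ r t)^-1 ^+ n).
Proof.
move=> hF; apply: ctsIM (@ctsI_inv n).
exact: ctsIM (ctsI_hol_circ (ltW r0) rr (hol_cd hF)) (@ctsI_circ R r).
Qed.

Lemma taylor_coef0 F : holomorphic_on (disk rho) F -> taylor_coef r F 0 = F 0.
Proof.
move=> hF; have n0 : normc (0 : C) < r by rewrite normc0.
rewrite (cauchy hF rr n0); symmetry; apply: eq_cint.
  apply: ctsI_ker => //; apply: ctsIM; last exact: ctsI_circ.
  exact: ctsI_hol_circ (ltW r0) rr hF.
by move=> t _; rewrite subr0 expr1 expr0 mulr1 mulfK.
Qed.

(** The operator z d/dz multiplies the n-th coefficient by n: integrate the derivative of the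
    periodic function F(zeta) zeta^(-n). *)
Lemma taylor_coef_der F n : holomorphic_on (disk rho) F ->
  cint (fun t => cd F (circ r t) * circ r t * (circ r t)^-1 ^+ n) = n%:R * taylor_coef r F n.
Proof.
move=> hF.
have ct1 := @ctsI_taylor_der F n hF; have ct2 := @ctsI_taylor F n hF.
have ct3 : ctsI (fun t => - n%:R * (F (circ r t) * (circ r t)^-1 ^+ n)).
  exact: ctsIM (@ctsI_cst R (- n%:R)) ct2.
pose D (t : R) : C := cd F (circ r t) * circ r t * (circ r t)^-1 ^+ n + - n%:R * (F (circ r t) * (circ r t)^-1 ^+ n).
have ctD : ctsI D by exact: ctsID.
have dG (t : R) : 0 <= t <= 1 -> rder (fun t => F (circ r t) * (circ r t)^-1 ^+ n) t (tpi * D t).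
  move=> _; have c0 := circ0 t.
  have d1 := cderM (derivable_cd (hF _ (circ_disk t))) (cderX n (cderV (f := fun w => w) c0 (cder_id (circ r t)))).

  apply: (rder_eq (rder_comp (rder_circ r t) d1)); rewrite /D.
  have -> : n%:R * (circ r t)^-1 ^+ n.-1 * (- 1 / circ r t ^+ 2) = - n%:R * (circ r t)^-1 ^+ n * (circ r t)^-1.
    case: (n) => [|k]; first by rewrite !mul0r oppr0 !mul0r.
    by rewrite /= [(circ r t)^-1 ^+ k.+1]exprS; move: ((circ r t)^-1 ^+ k) => y; field.
  by field.
have /= := cint_circ_period dG.
rewrite /circ01 circ01 => /(_ erefl); rewrite cintZ// => /eqP.
rewrite mulf_eq0 (negbTE tpi_neq0) /= cintD// cintZ// mulNr subr_eq0 => /eqP.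
exact.
Qed.

Lemma taylor_coef_cst n : taylor_coef r (fun=> 1) n.+1 = 0.
Proof.
have h1 : holomorphic_on (disk rho) (fun=> 1 : C) by move=> z _; exact: cder_derivable (cder_cst 1 z).
have := taylor_coef_der n.+1 h1.
rewrite (_ : cint _ = 0); last first.
  have cz : ctsI (fun=> 0 : C) by exact: (@ctsI_cst R 0).
  rewrite -[RHS](mul0r (cint (fun=> 0 : C))) -cintZ//; apply: eq_cint.
    exact: ctsI_taylor_der h1.
  by move=> t _; rewrite (cder_cd (cder_cst 1 _)) !mul0r.
by move/esym/eqP; rewrite mulf_eq0 pnatr_eq0 /= => /eqP.
Qed.

Lemma taylor_coef_le F : holomorphic_on (disk rho) F ->
  exists2 M : R, 0 <= M & forall n, normc (taylor_coef r F n) <= M * r^-1 ^+ n.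
Proof.
move=> hF; have [M [M0 HM]] := ctsI_bounded (ctsI_hol_circ (ltW r0) rr hF).
exists M => // n; apply: cint_le; first exact: ctsI_taylor.
move=> t t01; rewrite normcM normcX normcV (normc_circ _ (ltW r0)).
by rewrite ler_wpM2r ?HM// exprn_ge0// invr_ge0 ltW.
Qed.

(* The recurrence makes the Taylor coefficients grow factorially. *)
Lemma no_holomorphic_solution m (mu : C) F : (0 < m)%N -> 0 < complex.Re mu ->
  holomorphic_on (disk rho) F ->
  (forall z, disk rho z -> m%:R * F z + z ^+ m * (mu * F z + z * cd F z) = 1) -> False.
Proof.
move=> m0 mu0 hF ode; have mn : m%:R != 0 :> C by rewrite pnatr_eq0 -lt0n.
have mp : 0 < m%:R :> R by rewrite ltr0n.
pose c n := taylor_coef r F n.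
have c0 : c 0%N = m%:R^-1.
  have d0 : disk rho 0 by rewrite /disk /= normc0; exact: lt_trans rr.
  have := ode 0 d0; rewrite expr0n gtn_eqF// mul0r addr0 /c taylor_coef0// => h.
  by apply: (mulfI mn); rewrite h divff.
(* The coefficient of z^(n + m) in the equation, where the constant right-hand side contributes
   nothing. *)
have rec n : m%:R * c (n + m)%N = - ((mu + n%:R) * c n).
  have ct1 := @ctsI_taylor F n hF; have ct2 := @ctsI_taylor F (n + m)%N hF.
  have ct3 := @ctsI_taylor_der F n hF.
  have h1 : holomorphic_on (disk rho) (fun=> 1 : C) by move=> z _; exact: cder_derivable (cder_cst 1 z).
  have ctZ k (g : R -> C) : ctsI g -> ctsI (fun t => k * g t).
    by move=> h; exact: ctsIM (@ctsI_cst R k) h.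
  have E : taylor_coef r (fun=> 1) (n + m) = m%:R * c (n + m)%N + (mu * c n + n%:R * c n).
    rewrite /c -taylor_coef_der// /taylor_coef -(cintZ _ ct1) -(cintZ _ ct2) -(cintD (ctZ mu _ ct1) ct3) -(cintD (ctZ m%:R _ ct2) (ctsID (ctZ mu _ ct1) ct3)).
    apply: eq_cint; first exact: (@ctsI_taylor (fun=> 1) (n + m)%N h1).
    move=> t _; rewrite -[X in X * _ = _](ode _ (circ_disk t)) exprD; have := circ0 t.
    move: (F (circ r t)) (cd F (circ r t)) => x1 x2; move: (circ r t) => x3 x30.
    have e : x3^-1 ^+ m * x3 ^+ m = 1 by rewrite -exprMn mulVf// expr1n.
    rewrite [LHS](_ : _ = m%:R * (x1 * (x3^-1 ^+ n * x3^-1 ^+ m)) +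
      (mu * (x1 * x3^-1 ^+ n) + x2 * x3 * x3^-1 ^+ n) * (x3^-1 ^+ m * x3 ^+ m)); last by ring.
    by rewrite e mulr1.
  move: E; have -> : (n + m = (n + m).-1.+1)%N by rewrite prednK// addn_gt0 m0 orbT.
  rewrite taylor_coef_cst => /esym/eqP; rewrite addr_eq0 => /eqP ->.
  by rewrite mulrDl.
have [M M0 HM] := taylor_coef_le hF.
(* By Cauchy's bound the coefficients of index j m, divided by A^j, stay bounded, whereas the
   recurrence multiplies them by factors that grow linearly in j. *)
pose A : R := r^-1 ^+ m; have A0 : 0 < A by rewrite exprn_gt0// invr_gt0.
pose x j : R := normc (c (j * m)%N) / A ^+ j.
have xM j : x j <= M.
  rewrite /x; have -> : A ^+ j = r^-1 ^+ (j * m) by rewrite mulnC exprM.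
  by rewrite ler_pdivrMr ?exprn_gt0 ?invr_gt0//; have := HM (j * m)%N; rewrite -/(c _) => h; apply: le_trans h _.
clearbody A.
have nmu j : complex.Re mu + (j * m)%:R <= normc (mu + (j * m)%:R).
  apply: le_trans (Re_le_normc _); apply: le_trans (ler_norm _).
  by rewrite cReD -realC_nat.
have xS j : (complex.Re mu / m%:R + j%:R) / A * x j <= x j.+1.
  rewrite /x mulSn addnC; have /(congr1 (@normc R)) := rec (j * m)%N.
  rewrite normcM normcN normcM normc_nat => h.
  have -> : normc (c (j * m + m)%N) = normc (mu + (j * m)%:R) * normc (c (j * m)%N) / m%:R.
    by rewrite -h mulrC mulKf// gt_eqF.
  rewrite exprS.
  have -> : (complex.Re mu / m%:R + j%:R) / A * (normc (c (j * m)%N) / A ^+ j) =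
     (complex.Re mu + (j * m)%:R) * normc (c (j * m)%N) / m%:R / (A * A ^+ j).
    have Aj : A ^+ j != 0 by rewrite gt_eqF ?exprn_gt0.
    have An : A != 0 by rewrite gt_eqF.
    have mR : m%:R != 0 :> R by rewrite gt_eqF.
    rewrite natrM; move: Aj An mR; move: (A ^+ j) (normc _) => y1 y3; move=> h1 h2 h3.
    by field; rewrite ?h1 ?h2 ?h3.
  have A1 : 0 <= (A * A ^+ j)^-1 by rewrite invr_ge0 mulr_ge0 ?exprn_ge0 ?ltW.
  have m1 : 0 <= m%:R^-1 :> R by rewrite invr_ge0.
  by apply: ler_wpM2r A1 _ _ _; apply: ler_wpM2r m1 _ _ _; apply: ler_wpM2r (nmu j); exact: normc_ge0.
have x0 j : 0 < x j.
  elim: j => [|j IH]; first by rewrite /x mul0n c0 expr0 divr1 normcV normc_nat invr_gt0.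
  apply: lt_le_trans (xS j); rewrite mulr_gt0// divr_gt0//.
  by rewrite ltr_wpDr// divr_gt0.
(* From index [J] on, each step at least doubles [x]. *)
pose J := Num.bound (2 * A).
have xJ i : x J * 2 ^+ i <= x (J + i)%N.
  elim: i => [|i IH]; first by rewrite expr0 mulr1 addn0.
  rewrite addnS; apply: le_trans (xS _); rewrite exprS mulrCA; apply: le_trans (_ : 2 * x (J + i)%N <= _).
    by rewrite ler_wpM2l.
  rewrite ler_wpM2r ?(ltW (x0 _))// ler_pdivlMr//.
  apply: le_trans (_ : (J + i)%:R <= _); last by rewrite lerDr divr_ge0 ?ltW.
  apply: le_trans (_ : J%:R <= _); last by rewrite ler_nat leq_addr.
  by apply: le_trans (ltW (archi_boundP _)); rewrite // mulr_ge0// ltW.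
have [i hi] := half_pow_small M0 (x0 J).
have := le_trans (xJ i) (xM _).
by rewrite -ler_pdivlMr ?exprn_gt0// leNgt hi.
Qed.

End Fixed.
End Coefficients.

(** * Realization of a family *)

Section Realization.
Context {R : realType}.
Local Notation C := (Cplx R).
Implicit Types (z w v : C) (f g F : C -> C) (G E H phi : C -> C) (r s : R) (u : int -> C).

(** Induction in both directions. The case M = 1 is used for families given by a one-step
    recurrence. *)
Lemma periodic_zero M (q : C) (x : int -> C) : (0 < M)%N -> q != 0 ->
  (forall n, x (n + M%:Z) = q * x n) -> (forall i, (i < M)%N -> x i%:Z = 0) -> forall n, x n = 0.
Proof.
move=> M0 q0 per x0.
have pos : forall k : nat, x k%:Z = 0.
  elim/ltn_ind => k IH; have [/x0//|Mk] := ltnP k M.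
  have -> : k%:Z = (k - M)%N%:Z + M%:Z by lia.
  by rewrite per IH ?mulr0//; lia.
have neg : forall k : nat, x (- k%:Z) = 0.
  elim/ltn_ind => k IH; apply: (mulfI q0); rewrite mulr0 -per.
  have [Mk|kM] := leqP k M.
    by have -> : - k%:Z + M%:Z = (M - k)%N%:Z by lia.
  have -> : - k%:Z + M%:Z = - (k - M)%N%:Z by lia.
  by apply: IH; lia.
by case=> k; [exact: pos|rewrite NegzE; exact: neg].
Qed.

(** Translation by [rot m] leads from one repelling axis to the next and fixes [Xm]; [rotq] is the
    factor it produces on the derivative with exponent [k]. *)
Definition rot m : C := 0 +i* (2 * pi / m%:R).
Definition rotq m (res : C) k : C := cexp ((1 - res + k%:R) * rot m).

Lemma mulrn_rot m : (0 < m)%N -> m%:R * rot m = tpi.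
Proof.
move=> m0; apply: complex_ext; rewrite ?RenM ?ImnM /= ?mulr0//.
by rewrite mulrC divfK// pnatr_eq0 -lt0n.
Qed.

Lemma Re_rot m w : complex.Re (w + rot m) = complex.Re w.
Proof. by rewrite cReD /= addr0. Qed.

Lemma Xm_rot m w : (0 < m)%N -> Xm m (w + rot m) = Xm m w.
Proof.
by move=> m0; rewrite !cexp_Xm -!cexpMn mulrDr mulrn_rot// cexpD /tpi cexp_2pi mulr1.
Qed.

Lemma Pm_rot m (res : C) w : (0 < m)%N ->
  Pm m res (w + rot m) = cexp ((1 - res) * rot m) * Pm m res w.
Proof.
by move=> m0; rewrite /Pm /Qm Xm_rot// -cexpD; congr cexp; ring.
Qed.

Definition mono_der m (res : C) k w : C := dev_der m res (fun z => z ^+ k) w.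

Lemma mono_der_rot m (res : C) k w : (0 < m)%N ->
  mono_der m res k (w + rot m) = rotq m res k * mono_der m res k w.
Proof.
move=> m0; rewrite /mono_der /dev_der Pm_rot// /rotq (mulrDl (1 - res) k%:R) (cexpD ((1 - res) * _)) cexpMn.
by rewrite (cexpD w) exprMn; ring.
Qed.

Lemma axis_rot m n (x : R) : (0 < m)%N -> axis m (n + 1) x = axis m n x + rot m.
Proof.
move=> m0; rewrite /axis; apply: complex_ext; rewrite ?cReD ?cImD /= ?addr0//.
by rewrite intrD; field; rewrite pnatr_eq0 -lt0n.
Qed.

Lemma values_rotate m (res : C) phi u (q b : C) s : (0 < m)%N ->
  has_values m res s phi u ->
  (forall w, hp s w -> phi (w + rot m) = q * phi w + b) ->
  forall k, u (k + 1) = q * u k + b.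
Proof.
move=> m0 [K K0 H] per k; apply/eqP; rewrite -subr_eq0; apply/eqP.
pose N := normc (cexp ((1 - res) * rot m)).
have N0 : 0 <= N by exact: normc_ge0.
apply: (@axis_limit0 R m res 0 (N * K + normc q * K) k _ (s - 1)) => //.
  by rewrite addr_ge0 ?mulr_ge0// normc_ge0.
move=> x xs; have sec n : `|m%:R * complex.Im (axis m n x) - 2 * pi * n%:~R| <= pi.
  by rewrite axis_sector// normr0 pi_ge0.
have xs' : complex.Re (axis m k x) <= s by rewrite /=; lra.
have xs1 : complex.Re (axis m (k + 1) x) <= s by rewrite /=; lra.
have h1 := H _ _ (sec k) xs'; have h2 := H _ _ (sec (k + 1)) xs1.
have Er : Em m res 0 (axis m k x + rot m) = N * Em m res 0 (axis m k x).
  by rewrite !EmE Pm_rot// normcM Re_rot mulrA.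
rewrite axis_rot// per ?Er in h2; last exact: hp_axis.
have := le_normc_dist (u (k + 1)) (q * phi (axis m k x) + b) (q * u k + b).
have -> : q * phi (axis m k x) + b - (q * u k + b) = q * (phi (axis m k x) - u k) by ring.
rewrite normcM (normcB (u (k + 1)) (q * phi _ + b)) => h3.
have h4 : normc q * normc (phi (axis m k x) - u k) <= normc q * (K * Em m res 0 (axis m k x)).
  by rewrite ler_wpM2l ?normc_ge0.
apply: le_trans h3 _; apply: le_trans (lerD h2 h4) _.
by rewrite mulrDl -!mulrA (mulrCA K).
Qed.

(** Rotation changes [phi] by the factor [rotq] and an additive constant; the constant drops out of
    differences of consecutive values, which form a geometric sequence. *)
Lemma mono_values m (res : C) k : (0 < m)%N -> exists phi s u,
  [/\ s <= 0, forall w, hp 0 w -> cder phi w (mono_der m res k w), has_values m res s phi u &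
    forall n, u (n + 1 + 1) - u (n + 1) = rotq m res k * (u (n + 1) - u n)].
Proof.
move=> m0; have hE : holomorphic_at (fun z : C => z ^+ k) 0 by exact: holomorphic_atX (holomorphic_at_id 0).
have hd : holomorphic_on (hp 0) (mono_der m res k).
  move=> w _; apply: cder_derivable.
  exact: (cderM (cder_Pm m res w) (cder_comp (cder_cexp w) (cderX k (cder_id _)))).
have [phi dphi] := primitive (@hp_convex R 0) (@hp_open R 0) hd.
have dphi1 w : hp 0 w -> cder phi w (1 * dev_der m res (fun z => z ^+ k) w).
  by rewrite mul1r; exact: dphi.
have [s [u [s0 hv]]] := dev_values m0 hE dphi1.
exists phi, s, u; split => // n.
pose b := phi ((-1)%:C + rot m) - rotq m res k * phi (-1)%:C.
have hm1 : hp 0 ((-1)%:C : C) by rewrite /hp /=; lra.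
have per w : hp s w -> phi (w + rot m) = rotq m res k * phi w + b.
  move=> hw; have hw0 : hp 0 w by exact: lt_le_trans s0.
  have d0 z : hp 0 z -> cder (fun v => phi (v + rot m) - rotq m res k * phi v) z 0.
    move=> hz; have d1 := cderD (cder_id z) (cder_cst (rot m) z).
    have hz1 : hp 0 (z + rot m) by rewrite /hp /= Re_rot.
    have d2 := cder_comp d1 (dphi _ hz1).
    apply: (cder_eq (cderB d2 (cderZ (rotq m res k) (dphi _ hz)))).
    by rewrite mono_der_rot//; ring.
  have := cder0_cst (@hp_convex R 0) d0 hw0 hm1 => /= h.
  by rewrite /b -h subrKC.
by rewrite !(values_rotate m0 hv per); ring.
Qed.

(** If all the values were equal, [phi - u 0] would be bounded by 4 |P0| on a half-plane, since [Em]
    with exponent [k] is |P0|. The quotient by [P0] would then descend to a holomorphic [F], and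
    differentiating F P0 gives the equation excluded by [no_holomorphic_solution]. *)
Lemma mono_nontrivial m (res : C) k phi s u : (0 < m)%N ->
  0 < complex.Re (1 - res + (k + m)%:R) -> s <= 0 ->
  (forall w, hp 0 w -> cder phi w (mono_der m res k w)) -> has_values m res s phi u ->
  (forall n, u (n + 1 + 1) - u (n + 1) = rotq m res k * (u (n + 1) - u n)) ->
  u 1 != u 0.
Proof.
move=> m0 mu0 s0 dphi hv per; apply/negP => /eqP u10.
have uE n : u n = u 0.
  have d0 n' : u (n' + 1) - u n' = 0.
    apply: (@periodic_zero 1 (rotq m res k) (fun n => u (n + 1) - u n)) => //; first exact: cexp_neq0.
    by case=> // _; rewrite add0r u10 subrr.
  apply/eqP; rewrite -subr_eq0; apply/eqP.
  apply: (@periodic_zero 1 1 (fun n => u n - u 0)) => //.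
    by move=> n'; rewrite mul1r; congr (_ - _); apply/eqP; rewrite -subr_eq0 d0.
  by case=> // _; rewrite subrr.
have H w : complex.Re w <= s - 1 -> cder phi w (mono_der m res k w) /\
    normc (mono_der m res k w) <= 1 * normc (Pm m res w) * expR (k%:R * complex.Re w).
  move=> ws; split; first by apply: dphi; rewrite /hp /=; lra.
  by rewrite mul1r /mono_der /dev_der normcM -cexpMn normc_cexp RenM.
have s1 : s - 1 <= s by lra.
have [s' ss' hs] := values_decay m0 (ler0n R k) ler01 H (has_values_le s1 hv).
have dphi1 w : hp 0 w -> cder phi w (1 * dev_der m res (fun z => z ^+ k) w).
  by rewrite mul1r; exact: dphi.
have [b bP] := dev_period dphi1.
have hp0 w : hp s' w -> hp 0 w by rewrite /hp /=; lra.
have bU : u 0 = mono res * u 0 + b.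
  have bP' w : hp s w -> phi (w + tpi) = mono res * phi w + b by move=> hw; apply: bP; exact: lt_le_trans s0.
  by have := values_period m0 hv bP' 0; rewrite uE.
pose P0 w : C := Pm m res w * cexp w ^+ (k + m).
have P00 w : P0 w != 0 by rewrite mulf_neq0 ?Pm_neq0 ?expf_neq0 ?cexp_neq0.
pose h w : C := (phi w - u 0) * (P0 w)^-1.
have dP0 w : cder P0 w ((1 - res + m%:R * Xm m w + (k + m)%:R) * P0 w).
  apply: (cder_eq (cderM (cder_Pm m res w) (cderX (k + m) (cder_cexp w)))); rewrite /P0.
  have -> : (k + m)%:R * cexp w ^+ (k + m).-1 * cexp w = (k + m)%:R * cexp w ^+ (k + m).
    by have -> : (k + m = (k + m).-1.+1)%N by [rewrite prednK// addn_gt0 m0 orbT]; rewrite /= exprS; ring.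
  by ring.
have h1 w : hp s' w -> derivable h w 1.
  move=> hw; apply: cder_derivable.
  exact: (cderM (cderB (dphi _ (hp0 w hw)) (cder_cst (u 0) w)) (cderV (P00 w) (dP0 w))).
have h2 w : hp s' w -> h (w + tpi) = h w.
  move=> hw; rewrite /h /P0 bP; last exact: hp0.
  rewrite Pm_tpi cexpD /tpi cexp_2pi mulr1.
  have mn : mono res != 0 by exact: cexp_neq0.
  have -> : mono res * phi w + b - u 0 = mono res * (phi w - u 0) by rewrite [in LHS]bU; ring.
  have := P00 w; rewrite /P0; move: (Pm m res w) (cexp w ^+ _) (mono res) mn => x1 x2 x3 x30.
  by rewrite mulf_eq0 negb_or => /andP[x10 x20]; field; rewrite ?x10 ?x20 ?x30.
have h3 w : hp s' w -> normc (h w) <= 4.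
  move=> hw; have [n hn] := sector_exists m w.
  have := hs n w hn (ltW hw); rewrite uE /h normcM normcV.
  have -> : Em m res k%:R w = normc (P0 w).
    by rewrite EmE /P0 normcM -cexpMn normc_cexp RenM natrD.
  by rewrite mulr1 ler_pdivrMr ?normc_gt0.
have es := expR_gt0 s'; pose r := expR s' / 2.
have r0 : 0 < r by rewrite divr_gt0.
have rs : r < expR s' by rewrite /r; lra.
have [F hF FE] := descend_bounded h1 h2 h3 r0 rs.
have ode z : disk r z -> z != 0 -> m%:R * F z + z ^+ m * ((1 - res + (k + m)%:R) * F z + z * cd F z) = 1.
  move=> dz z0; have [w wz] := cexp_surj z0.
  have hw : hp (ln r) w by apply/hp_expR; rewrite lnK// wz.
  have hw' : hp s' w by apply/hp_expR; rewrite wz; exact: lt_trans rs.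
  have dF : cder F (cexp w) (cd F (cexp w)) by apply: derivable_cd; apply: hF; rewrite wz.
  have e1 : \forall v \near w, P0 v * F (cexp v) = phi v - u 0.
    by apply: filterS (nbhs_hp hw) => v hv'; rewrite FE// /h mulrC divfK.
  have d1 := cderM (dP0 w) (cder_comp (cder_cexp w) dF).
  have d2 := cderB (dphi _ (hp0 w hw')) (cder_cst (u 0) w).
  have := cder_unique (near_eq_cder e1 d1) d2; rewrite /comp wz subr0 /mono_der /dev_der wz => e2.
  have Pk : Pm m res w * z ^+ k != 0 by rewrite mulf_neq0 ?Pm_neq0 ?expf_neq0.
  apply: (mulfI Pk); rewrite mulr1 -[RHS]e2 /P0 wz cexp_Xm wz exprD.
  have zm : z ^+ m != 0 by rewrite expf_neq0.
  move: zm; move: (Pm m res w) (z ^+ k) (z ^+ m) (F z) (cd F z) => x1 x2 x3 x4 x5 x30.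
  by field.
have d0 : disk r 0 by rewrite /disk /= normc0.
apply: (@no_holomorphic_solution R r (r / 2) _ _ m (1 - res + (k + m)%:R) F m0 mu0 hF) => [||z dz].
- by rewrite divr_gt0.
- by lra.
have [->|z0] := eqVneq z 0; last exact: ode.
have hF0 : holomorphic_at F 0 by apply: filterS (nbhs_disk d0) => y /hF.
pose T y : C := m%:R * F y + y ^+ m * ((1 - res + (k + m)%:R) * F y + y * cd F y).
have hT : holomorphic_at T 0.
  apply: (holomorphic_atD (holomorphic_atZ _ hF0)).
  apply: (holomorphic_atM (holomorphic_atX _ (holomorphic_at_id 0))).
  apply: (holomorphic_atD (holomorphic_atZ _ hF0)).
  exact: (holomorphic_atM (holomorphic_at_id 0) (holomorphic_at_cd hF0)).
apply: (@punctured_eq R T (fun=> 1) 0 (cder_cts (holomorphic_at_cder hT)) (cder_cts (cder_cst 1 0))).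
by apply/dnbhsCP; exists r => // y y0; rewrite subr0 => dy; exact: ode.
Qed.

(** The factors for k + i and k + j differ by e^(2 i pi (i - j) / m), and |i - j| < m. *)
Lemma rotq_inj m (res : C) k (i j : nat) : (i < m)%N -> (j < m)%N ->
  rotq m res (k + i) = rotq m res (k + j) -> i = j.
Proof.
move=> im jm; have m0 : (0 < m)%N by lia.
have mp : 0 < m%:R :> R by rewrite ltr0n.
rewrite /rotq => /cexp_eq [n] /(congr1 (@complex.Im R)).
rewrite cImD !cImM /rot /= !mulr0 !addr0 -!realC_nat !cReD /=.
rewrite !natrD => e; have p0 := pi_gt0 R.
have {}e : (i%:R - j%:R) * (2 * pi / m%:R) = n%:~R * m%:R * (2 * pi / m%:R) :> R.
  have -> : n%:~R * m%:R * (2 * pi / m%:R) = 2 * pi * n%:~R :> R by field; rewrite gt_eqF.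
  move: e; move: (1 + _) (2 * pi / m%:R) (2 * pi * n%:~R) => X P Q e.
  have -> : (i%:R - j%:R) * P = (X + (k%:R + i%:R)) * P - (X + (k%:R + j%:R)) * P by ring.
  by rewrite e addrC addKr.
have {}e : i%:R - j%:R = n%:~R * m%:R :> R.
  by move: e; apply: mulIf; rewrite gt_eqF// divr_gt0// mulr_gt0.
have : (i%:Z - j%:Z) = n * m%:Z.
  apply/eqP; rewrite -(eqr_int R); apply/eqP.
  by rewrite rmorphB rmorphM /= -!pmulrn.
have [n0|n0|->] := ltgtP n 0; nia.
Qed.

Lemma vandermonde_solve n (a y : nat -> C) :
  (forall i j, (i < n)%N -> (j < n)%N -> a i = a j -> i = j) ->
  exists t : nat -> C, forall k, (k < n)%N -> \sum_(j < n) t j * a j ^+ k = y k.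
Proof.
move=> inj; pose V : 'M[R[i]]_n := Vandermonde n (\row_(j < n) (a j : R[i])).
have uV : V \in unitmx.
  rewrite unitmxE det_Vandermonde unitfE prodf_seq_neq0; apply/allP => i _ /=.
  rewrite prodf_seq_neq0; apply/allP => j _ /=; apply/implyP => ij; rewrite !mxE subr_eq0.
  by apply: contraTN ij => /eqP e; rewrite -leqNgt (inj _ _ (ltn_ord j) (ltn_ord i) e).
pose Y : 'cV[R[i]]_n := \col_(i < n) (y i : R[i]).
pose T := invmx V *m Y.
pose t (j : nat) : C := if insub j is Some i then T i 0 else 0.
exists t => k kn; have /matrixP/(_ (Ordinal kn) 0) : V *m T = Y by rewrite mulKVmx.
rewrite !mxE => <-; apply: eq_bigr => j _.
by rewrite [V _ _]mxE mxE /t valK mulrC.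
Qed.

Lemma has_values_sum m (res : C) n (c : nat -> C) (phi : nat -> C -> C) (u : nat -> int -> C) (s : nat -> R) :
  (forall j, has_values m res (s j) (phi j) (u j)) -> exists2 s', s' <= 0 &
  has_values m res s' (fun w => \sum_(j < n) c j * phi j w) (fun k => \sum_(j < n) c j * u j k).
Proof.
move=> H; elim: n => [|n [s' s0 IH]].
  exists 0 => //; exists 0 => // k w _ _; rewrite !big_ord0 subrr normc0 mul0r //.
exists (Num.min s' (s n)); first by rewrite ge_min s0.
have l1 : Num.min s' (s n) <= s' by rewrite ge_min lexx.
have l2 : Num.min s' (s n) <= s n by rewrite ge_min lexx orbT.
have h1 := has_valuesD (has_values_le l1 IH) (has_values_affine (c n) 0 (has_values_le l2 (H n))).
have e1 : (fun w => \sum_(j < n.+1) c j * phi j w) = (fun w => \sum_(j < n) c j * phi j w + (c n * phi n w + 0)).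
  by apply/funext => w; rewrite big_ord_recr addr0.
have e2 : (fun k => \sum_(j < n.+1) c j * u j k) = (fun k => \sum_(j < n) c j * u j k + (c n * u n k + 0)).
  by apply/funext => w; rewrite big_ord_recr addr0.
by rewrite e1 e2.
Qed.

Lemma realize_family m (res : C) u : (0 < m)%N -> family_space m.+1 res u ->
  exists E phi s (be : C), [/\ forall z, derivable E z 1, E 0 = 1,
    s <= 0, forall w, hp 0 w -> cder phi w (dev_der m res E w) &
    has_values m res s phi (fun n => u n + be)].
Proof.
move=> m0 [b1 ub].
(* Beyond |1 - res|, so that every exponent used satisfies the positivity required by
   [mono_nontrivial]; the successor keeps all of them positive, so the corrections vanish at 0 and E
   0 = 1. *)
pose k0 := (Num.bound (normc (1 - res))).+1.
have mu0 k : 0 < complex.Re (1 - res + (k0 + k + m)%:R).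
  rewrite cReD -realC_nat /=.
  have h1 : normc (1 - res) < k0%:R.
    apply: lt_trans (archi_boundP (normc_ge0 _)) _; by rewrite ltr_nat.
  have h2 : k0%:R <= (k0 + k + m)%:R :> R by rewrite ler_nat -addnA leq_addr.
  have := Re_le_normc (1 - res); rewrite ler_norml => /andP[h3 _].
  by move: h1 h2 h3; clear; move: (k0%:R : R) ((k0 + k + m)%:R : R) => *; nlra.
(* The base map belongs to the constant term 1 of [E]; the [m] maps [phi j] below only correct its
   values. *)
have [phib [sb [vb [sb0 dphib hvb perb]]]] := mono_values res 0 m0.
have /choice [P HP] : forall j, exists p : (C -> C) * R * (int -> C),
   [/\ p.1.2 <= 0, forall w, hp 0 w -> cder p.1.1 w (mono_der m res (k0 + j) w),
     has_values m res p.1.2 p.1.1 p.2 &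
     forall n, p.2 (n + 1 + 1) - p.2 (n + 1) = rotq m res (k0 + j) * (p.2 (n + 1) - p.2 n)].
  by move=> j; have [phi [s [v H]]] := mono_values res (k0 + j) m0; exists (phi, s, v).
pose phi j := (P j).1.1; pose v j := (P j).2; pose s j := (P j).1.2.
pose q j := rotq m res (k0 + j); pose c j : C := v j 1 - v j 0.
have c0 j : c j != 0.
  rewrite subr_eq0; have [h1 h2 h3 h4] := HP j.
  exact: (mono_nontrivial m0 (mu0 j) h1 h2 h3 h4).
have dv j (n : nat) : v j (n%:Z + 1) - v j n%:Z = c j * q j ^+ n.
  elim: n => [|n IH]; first by rewrite expr0 mulr1 add0r.
  have [_ _ _ h4] := HP j.
  by rewrite -addn1 PoszD h4 -/(v j) IH /q addn1 exprS; ring.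
(* What remains of the prescribed differences once those of the base map are removed. The j-th
   correcting map contributes c j (q j)^n, and division by [c j] leads to a Vandermonde system. *)
pose y n : C := (u (n%:Z + 1) - u n%:Z) - (vb (n%:Z + 1) - vb n%:Z).
have [t Ht] := @vandermonde_solve m q y (fun i j im jm => @rotq_inj m res k0 i j im jm).
pose tau j : C := t j / c j.
pose E z : C := 1 + \sum_(j < m) tau j * z ^+ (k0 + j).
pose Phi w : C := phib w + \sum_(j < m) tau j * phi j w.
pose W k : C := vb k + \sum_(j < m) tau j * v j k.
have [s1 s10 hvs] := @has_values_sum m res m tau phi v s (fun j => let: And4 _ _ h _ := HP j in h).
pose s2 : R := Num.min sb s1.
have [s2b s21] : s2 <= sb /\ s2 <= s1 by rewrite !ge_min !lexx orbT.
have hW : has_values m res s2 Phi W := has_valuesD (has_values_le s2b hvb) (has_values_le s21 hvs).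
have s20 : s2 <= 0 by exact: le_trans s2b sb0.
have dPhi w : hp 0 w -> cder Phi w (dev_der m res E w).
  move=> hw.
  have dF j : cder (fun w => tau j * phi j w) w (tau j * mono_der m res (k0 + j) w).
    by apply: cderZ; have [_ h _ _] := HP j; exact: h.
  have d2 := @cder_sum R m (fun j w => tau j * phi j w) (fun j w => tau j * mono_der m res (k0 + j) w) w dF.
  apply: (cder_eq (cderD (dphib w hw) d2)).
  rewrite /mono_der /dev_der expr0 mulr1 /E mulrDr mulr1 big_distrr; congr (_ + _).
  by apply: eq_bigr => j _ /=; ring.
have dPhi1 w : hp s2 w -> cder Phi w (1 * dev_der m res E w).
  by move=> hw; rewrite mul1r; apply: dPhi; exact: lt_le_trans s20.
have [b2 Wb] := values_family_space m0 hW dPhi1.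
rewrite /= in ub Wb.
(* Both families have the same monodromy factor, so the defect of the differences is multiplied by
   it after [m] steps; the Vandermonde system makes it vanish on [m] consecutive indices. *)
pose x n : C := (u (n + 1) - u n) - (W (n + 1) - W n).
have x0 n : x n = 0.
  apply: (@periodic_zero m (mono res)) => //; first exact: cexp_neq0.
    move=> k; rewrite /x; have -> : k + m%:Z + 1 = k + 1 + m%:Z by rewrite addrAC.
    rewrite !ub !Wb /mono; move: (W (k + 1)) (W k) (u (k + 1)) (u k) (cexp _) => *; ring.
  move=> i im; rewrite /x.
  have -> : W (i%:Z + 1) - W i%:Z = (vb (i%:Z + 1) - vb i%:Z) + \sum_(j < m) t j * q j ^+ i.
    rewrite /W opprD addrACA -sumrB; congr (_ + _); apply: eq_bigr => j _.
    by rewrite -mulrBr dv /tau mulrA divfK.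
  by rewrite Ht// /y; ring.
pose be := W 0 - u 0.
have WE : W = (fun n => u n + be).
  apply/funext => n; apply/eqP; rewrite -subr_eq0; apply/eqP.
  apply: (@periodic_zero 1 1 (fun n => W n - (u n + be))) => //.
    move=> k; rewrite mul1r; have := x0 k; rewrite /x => h.
    have -> : W (k + 1) = W k + (u (k + 1) - u k) by move/eqP: h; rewrite subr_eq0 => /eqP ->; rewrite subrKC.
    by ring.
  by case=> // _; rewrite /be; ring.
exists E, Phi, s2, be; split => //.
- move=> z; have dF j : cder (fun z : C => tau j * z ^+ (k0 + j)) z (tau j * ((k0 + j)%:R * z ^+ (k0 + j).-1 * 1)).
    exact: (cderZ (tau j) (cderX (k0 + j) (cder_id z))).
  have d2 := @cder_sum R m (fun j (z : C) => tau j * z ^+ (k0 + j)) (fun j z => tau j * ((k0 + j)%:R * z ^+ (k0 + j).-1 * 1)) z dF.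
  exact: cder_derivable (cderD (cder_cst 1 z) d2).
- rewrite /E big1 ?addr0// => j _; by rewrite expr0n /= mulr0.
by rewrite -WE.
Qed.

End Realization.

(** * The connection on the disk *)

Section LaurentPull.
Context {R : realType}.
Local Notation C := (Cplx R).
Implicit Types (z w v : C) (f g F psi : C -> C) (G E H phi : C -> C) (r s : R) (u : int -> C).

Lemma cder_shift_negX n z0 w : w != z0 ->
  cder (fun y : C => (y - z0)^-1 ^+ n.+1) w (- (n.+1%:R / (w - z0) ^+ n.+2)).
Proof.
move=> wz; have w0 : w - z0 != 0 by rewrite subr_eq0.
have d := cder_comp (cderB (cder_id w) (cder_cst z0 w)) (cder_negX n w0).
by apply: (cder_eq d); rewrite subr0 mulr1.
Qed.

Lemma holomorphic_factor psi z0 : holomorphic_at psi z0 -> psi z0 = 0 ->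
  exists2 g, holomorphic_at g z0 /\ g z0 = cd psi z0 &
    \forall w \near z0, psi w = (w - z0) * g w.
Proof.
move=> hp p0; have [g hg E] := holomorphic_at_div hp.
have E' : \forall w \near z0, psi w = (w - z0) * g w by apply: filterS E => w ->; rewrite p0 add0r.
exists g => //; split => //; symmetry; apply: cder_cd.
have d := cderM (cderB (cder_id z0) (cder_cst z0 z0)) (holomorphic_at_cder hg).
apply: (cder_eq (near_eq_cder _ d)).
  by apply: filterS E' => w ->.
by rewrite subrr mul0r addr0 subr0 mul1r.
Qed.

(* The polar part of [psi' / psi ^ m.+1] is read off the Taylor expansion of
   [((w - z0) / psi) ^ m]. *)
Lemma neg_power_laurent m psi z0 : (0 < m)%N -> holomorphic_at psi z0 -> psi z0 = 0 -> cd psi z0 != 0 ->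
  exists (b : nat -> C) h, [/\ holomorphic_at h z0, b m.-1 = m%:R * (cd psi z0)^-1 ^+ m &
    \forall w \near z0^', cd psi w * (m%:R / psi w ^+ m.+1) =
      \sum_(i < m) b i / (w - z0) ^+ i.+2 + h w].
Proof.
move=> m0 hpsi p0 cp; have [g [hg g0] gE] := holomorphic_factor hpsi p0.
have gn0 : g z0 != 0 by rewrite g0.
pose q w : C := (g w)^-1 ^+ m.
have hq : holomorphic_at q z0 := holomorphic_atX m (holomorphic_atV hg gn0).
have [t [q2 [hq2 t0 qE]]] := holomorphic_at_taylor m hq.
(* Taylor coefficients in reverse order: the term of degree m - 1 - i, divided by (w - z0)^m, has a
   pole of order i + 1. *)
pose c i := t (m.-1 - i)%N.
exists (fun i => i.+1%:R * c i), (fun w => - cd q2 w); split.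
- exact: holomorphic_atN (holomorphic_at_cd hq2).
- rewrite (prednK m0) /c subnn (t0 m0) /q g0; exact: erefl.
have near_all : \forall w \near z0, [/\ \forall y \near w, psi y = (y - z0) * g y,
   \forall y \near w, q y = \sum_(j < m) t j * (y - z0) ^+ j + (y - z0) ^+ m * q2 y,
   \forall y \near w, g y != 0 & holomorphic_at psi w /\ holomorphic_at q2 w].
  have ng := near_neq0 (cder_cts (holomorphic_at_cder hg)) gn0.
  have n1 := near_join gE; have n2 := near_join qE; have n3 := near_join ng.
  have n4 := near_holomorphic_at hpsi; have n5 := near_holomorphic_at hq2.
  by apply: filterS2 (filterI n1 n2) (filterI n3 (filterI n4 n5)) => w [w1 w2] [w3 [w4 w5]]; split; [exact: w1|exact: w2|exact: w3|split; [exact: w4|exact: w5]].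
have /nbhsCP[e e0 He] := near_all.
apply/dnbhsCP; exists e => // w wz we.
have [n1 n2 n3 [hw hq2w]] := He w we.
have w0 : w - z0 != 0 by rewrite subr_eq0.
have pw : psi w = (w - z0) * g w := nbhs_singleton n1.
have gw : g w != 0 := nbhs_singleton n3.
have pw0 : psi w != 0 by rewrite pw mulf_neq0.
pose S y : C := \sum_(i < m) c i * (y - z0)^-1 ^+ i.+1 + q2 y.
have nz : \forall y \near w, y - z0 != 0.
  by apply: (near_neq0 (f := fun y => y - z0) (cder_cts (cderB (cder_id w) (cder_cst z0 w)))).
have SE : \forall y \near w, (psi y)^-1 ^+ m = S y.
  near=> y.
  have y1 : psi y = (y - z0) * g y by near: y.
  have y2 : q y = \sum_(j < m) t j * (y - z0) ^+ j + (y - z0) ^+ m * q2 y by near: y.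
  have y3 : g y != 0 by near: y.
  have y4 : y - z0 != 0 by near: y.
  have -> : (psi y)^-1 ^+ m = (y - z0)^-1 ^+ m * q y.
    by rewrite y1 /q -exprMn invfM.
  rewrite y2 mulrDr mulrA -exprMn mulVf// expr1n mul1r /S; congr (_ + _).
  rewrite (reindex_inj rev_ord_inj) big_distrr; apply: eq_bigr => i _ /=.
  have ei : (m - i.+1 = m.-1 - i)%N by rewrite -[m.-1]subn1 -subnDA add1n.
  rewrite ei.
  rewrite mulrCA; congr (_ * _).
  have -> : (y - z0)^-1 ^+ m = (y - z0)^-1 ^+ i.+1 * (y - z0)^-1 ^+ (m.-1 - i).
    by rewrite -exprD -ei (subnKC (ltn_ord i)).
  by rewrite -mulrA -exprMn mulVf// expr1n mulr1.
have dF i : cder (fun y => c i * (y - z0)^-1 ^+ i.+1) w (c i * - (i.+1%:R / (w - z0) ^+ i.+2)).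
  exact: (cderZ (c i) (cder_shift_negX i wz)).
have d2 := @cder_sum R m (fun i y => c i * (y - z0)^-1 ^+ i.+1) (fun i y => c i * - (i.+1%:R / (y - z0) ^+ i.+2)) w dF.
have d3 := cderD d2 (holomorphic_at_cder hq2w).
have d1 : cder (fun y => (psi y)^-1 ^+ m) w (- (m%:R / psi w ^+ m.+1) * cd psi w).
  have := cder_comp (holomorphic_at_cder hw) (cder_negX m.-1 pw0).
  by rewrite prednK.
have := cder_unique (near_eq_cder SE d1) d3.
rewrite mulNr => /(congr1 -%R); rewrite opprK mulrC => ->.
rewrite opprD -sumrN; congr (_ + _); apply: eq_bigr => i _.
by rewrite mulrN opprK mulrA [c i * _]mulrC.
Unshelve. all: by end_near.
Qed.

(** Writing psi = (w - z0) g, the term - res psi' / psi splits into - res / (w - z0) and the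
    holomorphic - res g' / g. The leading term contributes no simple pole by [neg_power_laurent], so
    the residue is unchanged. *)
Lemma laurent_pull m (res : C) r E G psi z0 : (0 < m)%N -> 0 < r -> normal_form m res r E G ->
  holomorphic_at psi z0 -> psi z0 = 0 -> cd psi z0 != 0 ->
  exists a, [/\ laurent_at (pull psi G) z0 m.+1 a, a 1%N = - res &
    a m.+1 = m%:R * (cd psi z0)^-1 ^+ m].
Proof.
move=> m0 r0 nf hpsi p0 cp; have [hE _ En GE] := nf.
have [g [hg g0] gE] := holomorphic_factor hpsi p0.
have gn0 : g z0 != 0 by rewrite g0.
have [b [h [hh bm bE]]] := neg_power_laurent m0 hpsi p0 cp.
have d0 : disk r 0 by rewrite /disk /= normc0.
have hE0 : holomorphic_at E (psi z0) by rewrite p0; exact: normal_form_hol0 nf.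
have hEp := holomorphic_at_comp hpsi hE0.
have hE'p := holomorphic_at_comp hpsi (holomorphic_at_cd hE0).
have En0 : E (psi z0) != 0 by rewrite p0; exact: En.
pose H w : C := h w + (cd psi w * (cd E (psi w) * (E (psi w))^-1) + (cd (cd psi) w * (cd psi w)^-1 + - res * (cd g w * (g w)^-1))).
exists (fun k => if k is j.+2 then b j else - res); split => //; last first.
  by case: (m) m0 bm => // n _ <-.
exists H.
  apply: (holomorphic_atD hh); apply: holomorphic_atD.
    exact: (holomorphic_atM (holomorphic_at_cd hpsi) (holomorphic_atM hE'p (holomorphic_atV hEp En0))).
  apply: holomorphic_atD.
    exact: (holomorphic_atM (holomorphic_at_cd (holomorphic_at_cd hpsi)) (holomorphic_atV (holomorphic_at_cd hpsi) cp)).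
  exact: (holomorphic_atZ _ (holomorphic_atM (holomorphic_at_cd hg) (holomorphic_atV hg gn0))).
have near_all : \forall w \near z0, [/\ \forall y \near w, psi y = (y - z0) * g y, g w != 0,
   holomorphic_at g w, disk r (psi w) & cd psi w != 0].
  have ng := near_neq0 (cder_cts (holomorphic_at_cder hg)) gn0.
  have n1 := near_join gE; have n4 := near_holomorphic_at hg.
  have n5 := near_cts (cder_cts (holomorphic_at_cder hpsi)) p0 (nbhs_disk d0).
  have n6 := near_neq0 (cder_cts (holomorphic_at_cder (holomorphic_at_cd hpsi))) cp.
  by near=> w; split; near: w.
have /nbhsCP[e e0 He] := near_all; have /dnbhsCP[e1 e10 He1] := bE.
apply/dnbhsCP; exists (Num.min e e1); first by rewrite lt_min e0.
move=> w wz; rewrite lt_min => /andP[we we1].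
have [n1 gw hgw dw cw] := He w we; have be := He1 w wz we1.
have w0 : w - z0 != 0 by rewrite subr_eq0.
have pw : psi w = (w - z0) * g w := nbhs_singleton n1.
have pw0 : psi w != 0 by rewrite pw mulf_neq0.
have dpsi : cd psi w = g w + (w - z0) * cd g w.
  apply: cder_cd; have d := cderM (cderB (cder_id w) (cder_cst z0 w)) (holomorphic_at_cder hgw).
  apply: (cder_eq (near_eq_cder _ d)); first by apply: filterS n1 => y ->.
  by rewrite subr0 mul1r.
rewrite /pull GE// !mulrDr be /H.
rewrite big_add1 /= big_mkord big_ord_recl /= expr1.
have -> : cd psi w * - (res / psi w) = - res / (w - z0) + - res * (cd g w / g w).
  rewrite pw dpsi; move: (cd g w) (g w) gw (w - z0) w0 => x1 x2 x20 x3 x30.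
  by field; rewrite x20 x30.
have -> : \sum_(i < m) (if bump 0 i is j.+1 then b j else - res) / (w - z0) ^+ (bump 0 i).+1 =
   \sum_(i < m) b i / (w - z0) ^+ i.+2 by apply: eq_bigr.
move: (\sum_(i < m) _) (h w) (cd psi w * (cd E _ / _)) (cd (cd psi) w / _) (- res * (cd g w / g w)) (- res / _).
by move=> x1 x2 x3 x4 x5 x6; ring.
Unshelve. all: by end_near.
Qed.

End LaurentPull.

(** * Extension of a normal form to all charts of the disk *)

Section DiskConnection.
Context {R : realType}.
Local Notation C := (Cplx R).
Context (m : nat) (m0 : (0 < m)%N) (res : C) (r : R) (r0 : 0 < r) (E G : C -> C).
Context (nf : normal_form m res r E G).
Local Notation D := (disk_surface r0).
Local Notation dc := (disk_chart r0 : chart R D).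
Local Notation p0 := (disk_center r0 : D).
Implicit Types (z w v : C) (c : chart R D).

Lemma disk_chart_holomorphic : holomorphic_chart dc.
Proof. exact: (@atlas_holomorphic R D dc erefl). Qed.

Lemma disk_chart_disk (x : D) : disk r (dc x).
Proof. rewrite -cdiskE; exact: set_valP. Qed.

Lemma disk_transition c z : chart_cod c z -> transition_dom c dc z /\ disk r (transition c dc z).
Proof. by move=> hz; split; [apply/transition_domP|exact: disk_chart_disk]. Qed.

Lemma disk_transition_facts c z : holomorphic_chart c -> chart_cod c z ->
  [/\ holomorphic_at (transition c dc) z, cd (transition c dc) z != 0 & disk r (transition c dc z)].
Proof.
move=> hc hz; have [h1 h2] := disk_transition hz; have hd := disk_chart_holomorphic.
by split => //; [exact: transition_holomorphic|exact: transition_cd_neq0].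
Qed.

(** Pulling [G] back along the transition to the disk chart reduces the transition law between
    arbitrary charts to [pull_comp]. *)
Definition disk_christoffel c : C -> C := pull (transition c dc) G.

Lemma holomorphic_at_pull psi z : holomorphic_at psi z -> cd psi z != 0 ->
  holomorphic_at G (psi z) -> holomorphic_at (pull psi G) z.
Proof.
move=> h1 h2 h3; apply: holomorphic_atD.
  exact: (holomorphic_atM (holomorphic_at_cd h1) (holomorphic_at_comp h1 h3)).
exact: (holomorphic_atM (holomorphic_at_cd (holomorphic_at_cd h1)) (holomorphic_atV (holomorphic_at_cd h1) h2)).
Qed.

Lemma disk_christoffel_holomorphic c z : holomorphic_chart c -> chart_cod c z ->
  transition c dc z != 0 -> holomorphic_at (disk_christoffel c) z.
Proof.
move=> hc hz z0; have [h1 h2 h3] := disk_transition_facts hc hz.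
exact: (holomorphic_at_pull h1 h2 (normal_form_holomorphic nf h3 z0)).
Qed.

Lemma disk_christoffel_laurent c z : holomorphic_chart c -> chart_cod c z ->
  transition c dc z = 0 -> exists a, [/\ laurent_at (disk_christoffel c) z m.+1 a, a 1%N = - res &
    a m.+1 = m%:R * (cd (transition c dc) z)^-1 ^+ m].
Proof.
by move=> hc hz z0; have [h1 h2 h3] := disk_transition_facts hc hz; exact: laurent_pull nf h1 z0 h2.
Qed.

Lemma disk_christoffel_pole c z : holomorphic_chart c -> chart_cod c z ->
  transition c dc z = 0 -> pole_order (disk_christoffel c) z m.+1.
Proof.
move=> hc hz z0; have [a [la _ am]] := disk_christoffel_laurent hc hz z0.
have [_ h2 _] := disk_transition_facts hc hz.
split => //; exists a => //; rewrite am mulf_neq0 ?pnatr_eq0 -?lt0n//.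
by rewrite expf_neq0// invr_eq0.
Qed.

Lemma disk_christoffel_meromorphic c : holomorphic_chart c ->
  meromorphic_on (chart_cod c) (disk_christoffel c).
Proof.
move=> hc z hz; have [z0|z0] := eqVneq (transition c dc z) 0.
  by right; exists m.+1; exact: disk_christoffel_pole.
by left; exact: disk_christoffel_holomorphic.
Qed.

Lemma disk_christoffel_transition c1 c2 : holomorphic_chart c1 -> holomorphic_chart c2 ->
  christoffel_law (transition_dom c1 c2) (transition c1 c2) (disk_christoffel c1) (disk_christoffel c2).
Proof.
move=> h1 h2 z hz _ _.
rewrite -cdE -[RHS]/(pull (transition c1 c2) (disk_christoffel c2) z).
have [z1 z2] := (transition_domP _ _ _).1 (transition_swap hz).
have ht := transition_holomorphic h1 h2 hz.
have [k1 k2 k3] := disk_transition_facts h2 z1.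
have ct := transition_cd_neq0 h1 h2 hz.
rewrite /disk_christoffel -(pull_comp G ht k1 ct k2).
have [c1z _] := (transition_domP _ _ _).1 hz.
have [k4 _ _] := disk_transition_facts h1 c1z.
apply: near_eq_pull k4; apply: filterS (nbhs_transition_dom hz) => w [x [x1 x2] <-].
by rewrite /transition /= !chart_funK.
Qed.

Definition disk_connection : meromorphic_connection D :=
  MeromorphicConnection disk_christoffel_meromorphic disk_christoffel_transition.

Lemma disk_center_dom : chart_dom dc p0. Proof. by []. Qed.

Lemma disk_out c : transition dc c 0 = c p0.
Proof. exact: (congr1 c (chart_funK disk_center_dom)). Qed.

Lemma disk_transition_dom0 c : chart_dom c p0 -> transition_dom dc c 0.
Proof. by move=> h; exists p0. Qed.

Lemma transition_center c : chart_dom c p0 -> transition c dc (c p0) = 0.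
Proof. by move=> h; rewrite /transition /= chart_funK. Qed.

(** The positive real direction of the disk, read in the chart [c]. *)
Let coord c : set C := [set cd (transition dc c) 0 * v | v in half_line 0].

Lemma disk_dc_center : holomorphic_chart_at p0 dc.
Proof. by split => //; exact: disk_chart_holomorphic. Qed.

Lemma disk_transition_out c : holomorphic_chart_at p0 c ->
  exists k : C, [/\ cd (transition dc c) 0 = cexp k, cd (transition c dc) (c p0) = cexp (- k) &
    coord c = half_line (complex.Im k)].
Proof.
move=> [hc dp]; have hd := disk_chart_holomorphic.
have t0 := disk_transition_dom0 dp.
have [k kE] := cexp_surj (transition_cd_neq0 hd hc t0).
have E0 := disk_out c.
exists k; split => //.
  have := transition_cd_mul hd hc t0; rewrite E0 -kE cexpN => h.
  by apply: (mulIf (cexp_neq0 k)); rewrite h mulVf// cexp_neq0.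
by rewrite /coord -kE half_line_scale add0r.
Qed.

Lemma coord_half_line c : holomorphic_chart_at p0 c -> exists theta, coord c = half_line theta.
Proof. by move=> /disk_transition_out [k [_ _ ->]]; exists (complex.Im k). Qed.

Lemma coord_transition c1 c2 : holomorphic_chart_at p0 c1 -> holomorphic_chart_at p0 c2 ->
  coord c2 = [set derive1 (transition c1 c2) (c1 p0) * v | v in coord c1].
Proof.
move=> [h1 d1] [h2 d2]; have hd := disk_chart_holomorphic.
have t1 := disk_transition_dom0 d1.
have t2 := disk_transition_dom0 d2.
have t3 : transition_dom c1 c2 (transition dc c1 0).
  by rewrite disk_out; exact: transition_domI.
have E0 := disk_out c1.
have e1 := derivable_cd (transition_derivable hd h1 t1).
have e3 := derivable_cd (transition_derivable h1 h2 t3).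
have e2 := derivable_cd (transition_derivable hd h2 t2).
have n : \forall w \near (0 : C), (transition c1 c2 \o transition dc c1) w = transition dc c2 w.
  apply: filterS (nbhs_transition_dom t1) => w [x [x1 x2] <-].
  have e : chart_inv dc (dc x) = x := chart_funK x1.
  by rewrite /transition /comp e chart_funK.
have := cder_unique (near_eq_cder n (cder_comp e1 e3)) e2; rewrite E0 => h.
rewrite /coord -cdE -h; apply/seteqP; split=> [_ [v hv <-]|_ [_ [v hv <-] <-]].
  by exists (cd (transition dc c1) 0 * v); [exists v|rewrite mulrA].
by exists v => //; rewrite mulrA.
Qed.

Definition disk_axis : tangent_half_line p0 := TangentHalfLine coord_half_line coord_transition.

Lemma disk_connection_regular (q : D) : q <> p0 -> regular_point disk_connection q.
Proof.
move=> qp c [hc dq]; apply: disk_christoffel_holomorphic => //; first exact: chart_codP.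
rewrite /transition /= chart_funK//; apply/eqP => q0; apply: qp.
by apply: val_inj; rewrite /= -[RHS]q0.
Qed.

Lemma disk_connection_pole : is_pole disk_connection p0 m.+1.
Proof.
move=> c [hc dp]; apply: disk_christoffel_pole => //; first exact: chart_codP.
exact: transition_center.
Qed.

Lemma disk_connection_residue : has_residue disk_connection p0 res.
Proof.
move=> c [hc dp]; have [a [la a1 _]] := disk_christoffel_laurent hc (chart_codP dp) (transition_center dp).
by exists m.+1, (fun k => - a k); split => //; [exact: laurentN|rewrite a1 opprK].
Qed.

(** In the chart the leading coefficient is m e^(m k), and the factor e^(- i m Im k) turns it into a
    positive real number. *)
Lemma disk_connection_axis : repelling_axis disk_connection m.+1 disk_axis.
Proof.
move=> c hcp; have [hc dp] := hcp.
have [k [_ k2 k3]] := disk_transition_out hcp.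
have [a [la _ am]] := disk_christoffel_laurent hc (chart_codP dp) (transition_center dp).
exists (complex.Im k), a; split => //.
rewrite am k2 -cexpN opprK -cexpMn mulNr -mulrA -cexpD /=.
have -> : m%:R * k + 0 +i* (- (m%:R * complex.Im k)) = (m%:R * complex.Re k)%:C :> C.
  by apply: complex_ext; rewrite ?cReD ?cImD ?RenM ?ImnM /=; ring.
rewrite cexp_real -realC_nat -realCM -realCN -realC0 ltcR oppr_lt0.
by rewrite mulr_gt0 ?expR_gt0 ?ltr0n.
Qed.

Lemma disk_connectionE z : disk r z -> disk_connection dc z = G z.
Proof.
move=> dz; have cz : chart_cod dc z by rewrite /chart_cod disk_cod cdiskE.
have nE w : disk r w -> w = transition dc dc w.
  move=> dw; have cw : chart_cod dc w by rewrite /chart_cod disk_cod cdiskE.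
  by have [_] := chart_invP cw.
have n : \forall w \near z, w = transition dc dc w.
  by apply: filterS (nbhs_disk dz) => w; exact: nE.
rewrite /= /disk_christoffel -(near_eq_pull _ n (holomorphic_at_id z)).
rewrite /pull (cder_cd (cder_id z)).
have -> : cd (cd (fun w : C => w)) z = 0.
  apply: cder_cd; apply: near_eq_cder (cder_cst 1 z).
  by apply: nearCW => w; rewrite (cder_cd (cder_id w)).
by rewrite mul1r mul0r addr0.
Qed.

Lemma disk_connection_invariant phi s u : family_space m.+1 res u ->
  (forall w, covering_space r w -> cder phi w (dev_der m res E w)) ->
  has_values m res s phi u ->
  asymptotic_invariant disk_connection m.+1 res disk_axis (family_class m.+1 res u).
Proof.
move=> fam dphi hv; exists dc, r, phi, 0, u; split; split => //.
- exact: disk_dc_center.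
- by rewrite /chart_cod disk_cod.
- move=> z; rewrite cdiskE => dz z0; apply: near_eq_holomorphic_at (normal_form_holomorphic nf dz z0).
  by apply: filterS (nbhs_disk dz) => w dw; rewrite disk_connectionE.
- apply: (@developing_eq _ G) => [z dz _|]; first by rewrite disk_connectionE.
  apply: (@cder_developing _ _ _ (fun w => dev_der m res E w / cexp w)) => w cw.
  + by apply: (cder_eq (dphi _ cw)); rewrite mulrC divfK// cexp_neq0.
  + by rewrite mulf_neq0 ?invr_eq0 ?cexp_neq0// (dev_der_neq0 nf).
  exact: cder_dev_der nf cw.
- have [k [k1 _ k3]] := disk_transition_out disk_dc_center; rewrite /= k3.
  have n : \forall w \near (0 : C), w = transition dc dc w.
    have d0 : disk r 0 by rewrite /disk /= normc0.
    apply: filterS (nbhs_disk d0) => w dw.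
    have cw : chart_cod dc w by rewrite /chart_cod disk_cod cdiskE.
    by have [_] := chart_invP cw.
  move: k1; rewrite -(near_eq_cd n (holomorphic_at_id 0)) (cder_cd (cder_id 0)) => k1.
  rewrite -[complex.Im k]add0r -half_line_scale -k1.
  by apply/seteqP; split => [_ [v hv' <-]|v hv']; [rewrite mul1r|exists v => //; rewrite mul1r].
exact: has_values_family hv.
Qed.

End DiskConnection.

(** * Realization of an invariant and conclusion *)

Lemma realize_invariant (R : realType) m (res : Cplx R) iota : (0 < m)%N ->
  invariant_space m.+1 res iota ->
  exists (r : R) (r0 : 0 < r)
       (nabla : meromorphic_connection (disk_surface r0))
       (L : tangent_half_line (disk_center r0 : disk_surface r0)),
       [/\ forall q : disk_surface r0, q <> disk_center r0 ->
             regular_point nabla q,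
           is_pole nabla (disk_center r0 : disk_surface r0) m.+1,
           has_residue nabla (disk_center r0 : disk_surface r0) res,
           repelling_axis nabla m.+1 L &
           asymptotic_invariant nabla m.+1 res L iota].
Proof.
move=> m0 [u fam <-].
have [E [phi [s [be [dE E0 s0 dphi hv]]]]] := realize_family m0 fam.
have [dl dl0 En0] : exists2 dl : R, 0 < dl & forall w : Cplx R, normc w < dl -> E w != 0.
  have En : E 0 != 0 by rewrite E0 oner_neq0.
  have /nbhsCP[dl dl0 H] := near_neq0 (cder_cts (derivable_cd (dE 0))) En.
  by exists dl => // w wd; apply: H; rewrite subr0.
(* Radius at most 1 places the covering space in Re w < 0, where the derivative of [phi] is known;
   radius at most [dl] keeps [E] from vanishing. *)
pose r : R := Num.min 1 dl.
have r0 : 0 < r by rewrite lt_min ltr01.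
pose G (z : Cplx R) : Cplx R := m%:R / z ^+ m.+1 - res / z + cd E z / E z.
have nf : normal_form m res r E G.
  split; [by move=> z _; exact: dE|exact: E0| |by []].
  by move=> z; rewrite /disk /= lt_min => /andP[_ zd]; exact: En0.
exists r, r0, (disk_connection m0 r0 nf), (disk_axis r0).
split.
- exact: disk_connection_regular.
- exact: disk_connection_pole.
- exact: disk_connection_residue.
- exact: disk_connection_axis.
have hcov w : covering_space r w -> hp 0 w.
  move=> cw; apply: lt_le_trans (covering_hp r0 cw) _.
  by rewrite -[leRHS]ln1 ler_ln ?posrE ?ge_min ?lexx.
(* The family was realized up to the constant [be]; subtracting it from the developing map gives
   exactly [u]. *)
have h1 w : covering_space r w -> cder (fun w => 1 * phi w + - be) w (dev_der m res E w).
  move=> cw; apply: (cder_eq (cderD (cderZ 1 (dphi _ (hcov _ cw))) (cder_cst (- be) w))).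
  by rewrite mul1r addr0.
have h2 := has_values_affine 1 (- be) hv.
have uE : (fun n => 1 * (u n + be) + - be) = u by apply/funext => n; rewrite mul1r addrK.
rewrite uE in h2.
exact: (disk_connection_invariant m0 r0 nf fam h1 h2).
Qed.

Theorem theorem1p3 (R : realType) :
  (forall (d : nat) (res : Cplx R) (S1 S2 : riemann_surface R)
     (nabla1 : meromorphic_connection S1) (nabla2 : meromorphic_connection S2)
     (p1 : S1) (p2 : S2)
     (L1 : tangent_half_line p1) (L2 : tangent_half_line p2),
     (2 <= d)%N ->
     is_pole nabla1 p1 d -> is_pole nabla2 p2 d ->
     has_residue nabla1 p1 res -> has_residue nabla2 p2 res ->
     repelling_axis nabla1 d L1 -> repelling_axis nabla2 d L2 ->
     ((exists2 iota, invariant_space d res iota &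
         asymptotic_invariant nabla1 d res L1 iota /\
         asymptotic_invariant nabla2 d res L2 iota)
      <-> isomorphic_near_punctures nabla1 nabla2 L1 L2)) /\
  (forall (d : nat) (res : Cplx R) (iota : set (int -> Cplx R)),
     (2 <= d)%N -> invariant_space d res iota ->
     exists (r : R) (r0 : 0 < r)
       (nabla : meromorphic_connection (disk_surface r0))
       (L : tangent_half_line (disk_center r0 : disk_surface r0)),
       [/\ forall q : disk_surface r0, q <> disk_center r0 ->
             regular_point nabla q,
           is_pole nabla (disk_center r0 : disk_surface r0) d,
           has_residue nabla (disk_center r0 : disk_surface r0) res,
           repelling_axis nabla d L &
           asymptotic_invariant nabla d res L iota]).
Proof.
split=> [[|[|m]] res S1 S2 nabla1 nabla2 p1 p2 L1 L2 // _ pol1 _ res1 res2 ax1 ax2|[|[|m]] res iota // _ h].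
  split=> [[iota _ [inv1 inv2]]|iso]; last exact: isomorphic_invariant res1 ax1 ax2 iso.
  exact: invariant_isomorphic pol1 res1 res2 ax1 ax2 inv1 inv2.
exact: realize_invariant.
Qed.
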